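(* Let $(\theta_n)_{n\ge0}$ be the sequence produced by the P-BOEM algorithm. Let $\bar p>2$, $p\in(2,\bar p)$ and $\Delta p:=2\bar p p/(\bar p-p)$. Assume: (1) the exponential-family assumption: (a) there are continuous $\phi:\Theta\to\mathbb R$, $\psi:\Theta\to\mathbb R^d$, $S:\mathbb X\times\mathbb X\times\mathbb Y\to\mathbb R^d$ with $\log m_\theta(x,x')+\log g_\theta(x',y)=\phi(\theta)+\langle S(x,x',y),\psi(\theta)\rangle$; (b) there is an open set $\mathcal S\subseteq\mathbb R^d$ containing the convex hull of $S(\mathbb X\times\mathbb X\times\mathbb Y)$; (c) there is a continuous $\bar\theta:\mathcal S\to\Theta$ with $\bar\theta(s)=\mathrm{argmax}_{\theta\in\Theta}\{\phi(\theta)+\langle s,\psi(\theta)\rangle\}$ for all $s\in\mathcal S$; (2) there exist $\sigma_-,\sigma_+$ such that $0<\sigma_-\le m_\theta(x,x')\le\sigma_+$ for all $(x,x')\in\mathbb X^2$ and all $\theta\in\Theta$; (3) $\big\|\sup_{x,x'\in\mathbb X}|S(x,x',\mathbf Y_0)|\big\|_{\bar p}<\infty$; (4) $\mathbf Y$ is stationary, there exist $C_0\in[0,1)$ and $\beta\in(0,1)$ with $\beta^{\mathbf Y}(n)\le C_0\beta^n$ for all $n\ge0$, and $\mathbb E\big[|\log b_-(\mathbf Y_0)|+|\log b_+(\mathbf Y_0)|\big]<\infty$; (5) there exist $c>0$ and $a>1$ such that $\tau_n=\lfloor cn^a\rfloor$ for all $n\ge1$; (6) $\sup_{t,n}\sup_{x\in\mathbb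 X}|\upsilon_{t,n}(x)|<\infty$; (7) $\big\|\omega_+(\mathbf Y_0)/b_-(\mathbf Y_0)\big\|_{\Delta p}<\infty$; (8) there exist $c'>0$ and $d'\ge(a+1)/(2a)$ such that $N_n=\lfloor c'\tau_n^{d'}\rfloor$ for all $n\ge1$; (9) $\mathrm W(\mathcal L)$ has an empty interior, where $\mathcal L=\{\theta\in\Theta:\mathrm R(\theta)=\theta\}$ is the set of fixed points of the limiting EM map $\mathrm R$ and $\mathrm W=\exp(\ell)$ is its Lyapunov function. Then there exists a (possibly random) $w_\star$ such that, almost surely, $\mathrm W(\theta_n)\to w_\star$ and $(\theta_n)_{n\ge0}$ converges to the set $\{\theta\in\mathcal L:\mathrm W(\theta)=w_\star\}$ (i.e. the distance from $\theta_n$ to this set tends to $0$).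
   Context: Notation: $x_{r:t}=(x_r,\dots,x_t)$; $\|Z\|_p=(\mathbb E|Z|^p)^{1/p}$. Model. $\Theta\subseteq\mathbb R^{d_\theta}$ is compact; $(\mathbb X,\mathcal X)$ and $(\mathbb Y,\mathcal Y)$ are general spaces with countably generated $\sigma$-fields; $\lambda$ is a finite measure on $\mathbb X$ and $\nu$ a measure on $\mathbb Y$. For $\theta\in\Theta$, $m_\theta(x,x')\,\lambda(dx')$ is a Markov transition kernel on $\mathbb X\times\mathcal X$ and $g_\theta(x,y)\,\nu(dy)$ is a Markov transition kernel on $\mathbb X\times\mathcal Y$. $\chi$ is a fixed known initial probability distribution on $\mathbb X$. $\mathbf Y=(\mathbf Y_t)_{t\in\mathbb Z}$ is a $\mathbb Y$-valued observation process (not assumed to follow the model). The functions $S$, $\bar\theta$ and the set $\mathcal S$ are those of the exponential-family assumption in the claim. Exact block statistic. For integers $\tau>0$, $T\ge0$, $$\bar S^T_\tau(\theta,\mathbf Y)=\frac1\tau\sum_{t=T+1}^{T+\tau}\frac{\int\chi(dx_T)\prod_{i=T}^{T+\tau-1}m_\theta(x_i,x_{i+1})g_\theta(x_{i+1},\mathbf Y_{i+1})\,S(x_{t-1},x_t,\mathbf Y_t)\,d\lambda(x_{T+1:T+\tau})}{\int\chi(dx_T)\prod_{i=T}^{T+\tau-1}m_\theta(x_i,x_{i+1})g_\theta(x_{i+1},\mathbf Y_{i+1})\,d\lambda(x_{T+1:T+\tau})}.$$ Limiting EM. Under the assumptions, for every $\theta$ and every $T>0$, $\bar S^T_\tau(\theta,\mathbf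 Y)$ converges almost surely as $\tau\to\infty$ to a deterministic limit $\bar{\mathrm S}(\theta)$ not depending on $T$, and $\bar{\mathrm S}$ is continuous on $\Theta$ (known). The limiting EM map is $\mathrm R(\theta)=\bar\theta(\bar{\mathrm S}(\theta))$. The contrast function $\ell(\theta)$ is the deterministic almost sure limit, as $T\to\infty$, of the normalized log-likelihood $\frac1T\log\int\chi(dx_0)\prod_{t=1}^Tm_\theta(x_{t-1},x_t)g_\theta(x_t,\mathbf Y_t)\,d\lambda(x_{1:T})$, and $\mathrm W(\theta)=\exp(\ell(\theta))$. It is known that $\mathrm W$ is a positive continuous Lyapunov function for $\mathrm R$ with respect to $\mathcal L$: $\mathrm W\circ\mathrm R\ge\mathrm W$ on $\Theta$ and $\inf_{\theta\in\mathcal K}\{\mathrm W(\mathrm R(\theta))-\mathrm W(\theta)\}>0$ for every compact $\mathcal K\subset\Theta\setminus\mathcal L$. P-BOEM algorithm. Let $(\tau_n)_{n\ge1}$ (block sizes) and $(N_n)_{n\ge1}$ (numbers of particles) be positive integers, $T_0=0$, $T_n=\sum_{k=1}^n\tau_k$, $\theta_0\in\Theta$. For block $n\ge0$ let $\upsilon_{t,n}$ be positive functions on $\mathbb X$ (adjustment multipliers) and $q_{t,n}(x,x')$ Markov transition densities with respect to $\lambda$ (instrumental kernels), $t\le\tau_{n+1}$. Given $\theta_n$, put $\tau=\tau_{n+1}$, $N=N_{n+1}$ and: sample $\xi_0^1,\dots,\xi_0^N$ i.i.d. from $\chi$, set $\omega_0^\ell=1/N$, $R_0^\ell=0$. For $t=1,\dots,\tau$,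 conditionally on $\theta_n$, the observations $\mathbf Y_{T_n+1:T_n+t}$ and the previous particles, draw independently for $\ell=1,\dots,N$ pairs $(J_t^\ell,\xi_t^\ell)\in\{1,\dots,N\}\times\mathbb X$ from the distribution proportional to $\omega_{t-1}^i\upsilon_{t,n}(\xi_{t-1}^i)q_{t,n}(\xi_{t-1}^i,x)\lambda(dx)$ (in $(i,x)$), and set $$\omega_t^\ell=\frac{m_{\theta_n}(\xi_{t-1}^{J_t^\ell},\xi_t^\ell)g_{\theta_n}(\xi_t^\ell,\mathbf Y_{T_n+t})}{\upsilon_{t,n}(\xi_{t-1}^{J_t^\ell})q_{t,n}(\xi_{t-1}^{J_t^\ell},\xi_t^\ell)},\qquad R_t^\ell=\frac1t\sum_{j=1}^N\frac{\omega_{t-1}^jm_{\theta_n}(\xi_{t-1}^j,\xi_t^\ell)\big[S(\xi_{t-1}^j,\xi_t^\ell,\mathbf Y_{T_n+t})+(t-1)R_{t-1}^j\big]}{\sum_{k=1}^N\omega_{t-1}^km_{\theta_n}(\xi_{t-1}^k,\xi_t^\ell)}.$$ Then $\widetilde S_n(\theta_n,\mathbf Y)=\sum_{\ell=1}^N\omega_\tau^\ell R_\tau^\ell\big/\sum_{\ell=1}^N\omega_\tau^\ell$ and $\theta_{n+1}=\bar\theta\big(\widetilde S_n(\theta_n,\mathbf Y)\big)$. Other definitions. $b_-(y)=\inf_{\theta\in\Theta}\int g_\theta(x,y)\lambda(dx)$, $b_+(y)=\sup_{\theta\in\Theta}\int g_\theta(x,y)\lambda(dx)$, and $$\omega_+(y)=\sup_{\theta\in\Theta}\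 \sup_{(x,x')\in\mathbb X^2,\,t\ge0,\,n\ge0}\frac{m_\theta(x,x')g_\theta(x',y)}{\upsilon_{t,n}(x)q_{t,n}(x,x')}.$$ Mixing coefficients: $\mathcal F_k=\sigma(\mathbf Y_u,u\le k)$, $\mathcal G_k=\sigma(\mathbf Y_u,u\ge k)$ and $\beta^{\mathbf Y}(n)=\sup_{u\in\mathbb Z}\sup_{B\in\mathcal G_{u+n}}|\mathbb P(B\mid\mathcal F_u)-\mathbb P(B)|$ (bounds on it are understood almost surely). *)

(* Defs.v *)
From HB Require Import structures.
From mathcomp Require Import all_boot all_order all_algebra.
From mathcomp Require Import all_classical all_reals all_analysis measurable_realfun.
From mathcomp Require Import ess_sup_inf.

Set Implicit Arguments.
Unset Strict Implicit.
Unset Printing Implicit Defensive.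

Import Order.TTheory GRing.Theory Num.Theory.
Import numFieldNormedType.Exports.

Local Open Scope classical_set_scope.
Local Open Scope ring_scope.

(* The topology is only there to make sense of the continuity of S; it is not
   required to be compatible with the sigma-field. *)
#[short(type="topMeasurableType")]
HB.structure Definition TopMeasurable d := {T of Measurable d T & Topological T}.

Definition countably_generated d (T : measurableType d) : Prop :=
  exists2 G : set (set T), countable G & @measurable d T = <<s G >>.

Section euclidean.
Context {R : realType} {d : nat}.
Implicit Types u v : 'rV[R]_d.

Definition dotp u v : R := (u *m v^T) 0 0.

Definition enorm u : R := Num.sqrt (dotp u u).

Definition convex_hull (A : set 'rV[R]_d) : set 'rV[R]_d :=
  smallest (@convex_set R 'rV[R]_d) A.

End euclidean.

Definition argmax_on {R : realType} {T : Type} (A : set T) (f : T -> R) :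
    set T :=
  [set t | A t /\ forall u, A u -> f u <= f t].

Definition markov_density {R : realType} {d1 d2} {T1 : measurableType d1}
    {T2 : measurableType d2} (mu : {measure set T2 -> \bar R})
    (k : T1 -> T2 -> R) : Prop :=
  [/\ measurable_fun setT (fun z : T1 * T2 => k z.1 z.2),
      forall x y, 0 <= k x y
    & forall x, (\int[mu]_y (k x y)%:E = 1)%E].

Section process.
Context {R : realType} {dO : measure_display} {Omega : measurableType dO}.
Variable P : probability Omega R.

Definition finite_Lp_norm {d} {T : measurableType d} (p : R) (f : T -> \bar R)
    (Z : Omega -> T) : Prop :=
  measurable_fun setT f /\ (Lnorm P p%:E (f \o Z) < +oo)%E.

Section stationarity_and_mixing.
Context {dY : measure_display} {Y : measurableType dY}.
Variable Yt : int -> Omega -> Y.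

Definition stationary : Prop :=
  forall (n : nat) (t : n.-tuple int) (k : int) (A : set (n.-tuple Y)),
    measurable A ->
    P [set w | A [tuple Yt (tnth t i + k) w | i < n]] =
    P [set w | A [tuple Yt (tnth t i) w | i < n]].

Definition sigma_process (D : set int) : set (set Omega) :=
  <<s [set A | exists2 u, D u & exists2 B, measurable B & A = Yt u @^-1` B] >>.

Definition sigma_past (k : int) := sigma_process [set u | u <= k].

Definition sigma_future (k : int) := sigma_process [set u | k <= u].

Definition cond_probability (F : set (set Omega)) (B : set Omega)
    (Z : Omega -> R) : Prop :=
  [/\ forall C : set R, measurable C -> F (Z @^-1` C),
      P.-integrable setT (EFin \o Z)
    & forall A, F A -> (\int[P]_(w in A) (Z w)%:E = P (A `&` B))%E].

(* Versions of P(B | F_u) agree almost surely, hence the essential supremum. *)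
Definition mixing_coef (n : nat) : \bar R :=
  ereal_sup [set e | exists u B Z,
    [/\ sigma_future (u + n%:Z) B, cond_probability (sigma_past u) B Z
      & e = ess_sup P (fun w => `|(Z w)%:E - P B|%E)]].

End stationarity_and_mixing.

(* Conditionally on the sub-sigma-field H, the variables Z 0, ..., Z (N - 1)
   are independent with common (random) distribution kappa. *)
Definition cond_iid {d} {E : measurableType d} (H : set (set Omega)) (N : nat)
    (Z : nat -> Omega -> E) (kappa : Omega -> set E -> \bar R) : Prop :=
  forall (A : set Omega) (B : nat -> set E),
    H A -> (forall l, measurable (B l)) ->
    P (A `&` [set w | forall l, (l < N)%N -> B l (Z l w)]) =
    (\int[P]_(w in A) \prod_(l < N) kappa w (B l))%E.

End process.

Section hmm.
Context {R : realType} {dX dY : measure_display}.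
Context {X : measurableType dX} {Y : measurableType dY} {Par : Type} {d : nat}.
Variable lambda : {finite_measure set X -> \bar R}.
Variable chi : probability X R.
Variables (m : Par -> X -> X -> R) (g : Par -> X -> Y -> R).
Variable S : X -> X -> Y -> 'rV[R]_d.

Fixpoint iterated_integral (n : nat) (F : seq X -> R) : R :=
  if n is n'.+1 then
    \int[lambda]_x iterated_integral n' (fun s => F (x :: s))
  else F [::].

(* int chi(dx_T) prod_i m(x_i, x_{i+1}) g(x_{i+1}, y_{i+1}) F(x_{T:T+tau})
   lambda(dx_{T+1:T+tau}); the i-th entry of the path handed to F is x_{T+i}. *)
Definition block_integral (th : Par) (T tau : nat) (y : nat -> Y)
    (F : (nat -> X) -> R) : R :=
  \int[chi]_x0 iterated_integral tau (fun s =>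
    let x := nth x0 (x0 :: s) in
    (\prod_(i < tau) (m th (x i) (x i.+1) * g th (x i.+1) (y (T + i.+1)%N)))
    * F x).

Definition likelihood th T tau y : R := block_integral th T tau y (fun=> 1).

Definition block_stat (th : Par) (T tau : nat) (y : nat -> Y) : 'rV[R]_d :=
  tau%:R^-1 *: \sum_(1 <= t < tau.+1)
    \row_k (block_integral th T tau y
              (fun x => S (x t.-1) (x t) (y (T + t)%N) 0 k)
            / likelihood th T tau y).

Variable Theta : set Par.

Definition b_minus (y : Y) : \bar R :=
  ereal_inf [set (\int[lambda]_x (g th x y)%:E)%E | th in Theta].

Definition b_plus (y : Y) : \bar R :=
  ereal_sup [set (\int[lambda]_x (g th x y)%:E)%E | th in Theta].

Definition sup_S (y : Y) : \bar R :=
  ereal_sup [set (enorm (S z.1 z.2 y))%:E | z in [set: X * X]].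

(* The quotient is taken in \bar R, so it is +oo where q vanishes. *)
Definition omega_plus (ups : nat -> nat -> X -> R)
    (q : nat -> nat -> X -> X -> R) (y : Y) : \bar R :=
  ereal_sup [set e | exists th x x' t n, Theta th /\
    e = ((m th x x' * g th x' y)%:E / (ups t n x * q t n x x')%:E)%E].

(* One block with N particles, for realized values of the parameter th, of the
   particles x t l, of the ancestor indices j t l (t >= 1) and of the
   observations y t (t >= 1). Particle indices range over 0, ..., N - 1. *)
Section block.
Variables (N : nat) (th : Par) (x : nat -> nat -> X) (j : nat -> nat -> nat).
Variables (y : nat -> Y) (ups : nat -> X -> R) (q : nat -> X -> X -> R).

Definition weight (t l : nat) : R :=
  if t is t'.+1 then
    m th (x t' (j t l)) (x t l) * g th (x t l) (y t)
    / (ups t (x t' (j t l)) * q t (x t' (j t l)) (x t l))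
  else N%:R^-1.

Fixpoint smoothed_stat (t l : nat) : 'rV[R]_d :=
  if t is t'.+1 then
    t%:R^-1 *: \sum_(i < N)
      (weight t' i * m th (x t' i) (x t l)
       / \sum_(k < N) weight t' k * m th (x t' k) (x t l))
      *: (S (x t' i) (x t l) (y t) + t'%:R *: smoothed_stat t' i)
  else 0.

Definition particle_stat (tau : nat) : 'rV[R]_d :=
  (\sum_(l < N) weight tau l)^-1 *:
    \sum_(l < N) weight tau l *: smoothed_stat tau l.

Local Open Scope ereal_scope.

(* Mass of B under omega_{t-1}^i ups_t(xi_{t-1}^i) q_t(xi_{t-1}^i, z) lambda(dz),
   a finite measure in the pair (i, z); proposal_law is its normalization, the
   law of each pair (J_t, xi_t), t >= 1, given the particles at time t - 1. *)
Definition proposal_mass (t : nat) (B : set (nat * X)) : \bar R :=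
  \sum_(i < N) (weight t.-1 i * ups t (x t.-1 i))%:E
    * \int[lambda]_(z in [set z | B (i : nat, z)]) (q t (x t.-1 i) z)%:E.

Definition proposal_law (t : nat) (B : set (nat * X)) : \bar R :=
  proposal_mass t B / proposal_mass t setT.

End block.
End hmm.

Definition block_end (tau : nat -> nat) (n : nat) : nat :=
  (\sum_(1 <= k < n.+1) tau k)%N.

Section pboem.
Context {R : realType} {dO dX dY : measure_display}.
Context {Omega : measurableType dO} {X : measurableType dX}.
Context {Y : measurableType dY} {Par : Type} {d : nat}.
Variable P : probability Omega R.
Variable lambda : {finite_measure set X -> \bar R}.
Variable chi : probability X R.
Variables (m : Par -> X -> X -> R) (g : Par -> X -> Y -> R).
Variable S : X -> X -> Y -> 'rV[R]_d.
Variable thbar : 'rV[R]_d -> Par.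
Variables (tau N : nat -> nat).
Variable ups : nat -> nat -> X -> R.
Variable q : nat -> nat -> X -> X -> R.
Variable Yt : int -> Omega -> Y.
Variable th0 : Par.
(* xi n t l and J n t l are the particle xi_t^l and the index J_t^l of the
   block number n. *)
Variables (xi : nat -> nat -> nat -> Omega -> X).
Variables (J : nat -> nat -> nat -> Omega -> nat).
Variable theta : nat -> Omega -> Par.

Definition block_obs (n : nat) (w : Omega) (t : nat) : Y :=
  Yt (block_end tau n + t)%N w.

(* (k, s) is a time of block k that precedes the time t of block n. *)
Definition before (k s n t : nat) : bool :=
  ((k < n) && (s <= tau k.+1))%N || ((k == n) && (s < t))%N.

(* All randomness available when the particles of block n at time t are drawn;
   the whole observation process is included, so that the random draws of the
   algorithm carry no information on future observations. *)
Definition history (n t : nat) : set (set Omega) :=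
  <<s [set A | exists u B, measurable B /\ A = Yt u @^-1` B] `|`
      [set A | exists k s l B, [/\ before k s n t, (l < N k.+1)%N,
                 measurable B & A = xi k s l @^-1` B]] `|`
      [set A | exists k s l B, [/\ before k s.+1 n t, (l < N k.+1)%N,
                 measurable B & A = J k s.+1 l @^-1` B]] >>.

Record pboem : Prop := {
  pboem_xi_measurable : forall n t l, (t <= tau n.+1)%N -> (l < N n.+1)%N ->
    measurable_fun setT (xi n t l) ;
  pboem_J_measurable : forall n t l, (0 < t <= tau n.+1)%N -> (l < N n.+1)%N ->
    measurable_fun setT (J n t l) ;
  pboem_theta0 : forall w, theta 0 w = th0 ;
  pboem_initial : forall n,
    cond_iid P (history n 0) (N n.+1) (xi n 0) (fun=> chi) ;
  pboem_step : forall n t, (0 < t <= tau n.+1)%N ->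
    cond_iid P (history n t) (N n.+1) (fun l w => (J n t l w, xi n t l w))
      (fun w => proposal_law lambda m g (N n.+1) (theta n w)
        (fun s l => xi n s l w) (fun s l => J n s l w) (block_obs n w)
        (ups^~ n) (q^~ n) t) ;
  pboem_update : forall n w, theta n.+1 w =
    thbar (particle_stat m g S (N n.+1) (theta n w)
      (fun s l => xi n s l w) (fun s l => J n s l w) (block_obs n w)
      (ups^~ n) (q^~ n) (tau n.+1)) }.

End pboem.

(* Main.v *)
(* On a mixing process with C0 < 1 at lag 0, an integrable function of one
   observation is essentially bounded, so after clipping the observations the
   kernels m g = exp (phi + <S, psi>) lie between two positive constants.
   Exponential tilting turns the smoothed additive functional into a nearly
   additive function of disjoint windows of observations, whence a law of large
   numbers along blocks, uniform in theta by equicontinuity. The particle error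
   over a block is a sum of martingale-like increments with mean square of order
   1/N. Since sum 1/tau_n and sum 1/N_n converge, theta_(n+1) - R(theta_n) tends
   to 0 almost surely, and the deterministic Lyapunov argument applies once
   Sbar(theta) is known to lie in the convex hull of the range of S; there a
   supporting hyperplane would, by minorization of the two-step transitions,
   contain S almost everywhere. *)

Require Import Defs.
From HB Require Import structures.
From mathcomp Require Import all_boot all_order all_algebra.
From mathcomp Require Import all_classical all_reals all_analysis measurable_realfun.
From mathcomp Require Import ess_sup_inf.
From mathcomp Require Import ring lra.

Set Implicit Arguments.
Unset Strict Implicit.
Unset Printing Implicit Defensive.

Import Order.TTheory GRing.Theory Num.Theory.
Import numFieldNormedType.Exports.

Local Open Scope classical_set_scope.
Local Open Scope ring_scope.

(** Two obstacles shape the proof: a smoothed mean is not additive in time, and the parameter used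
    in a block is a function of earlier data. For the first, log masses of paths are additive across
    a cut up to [ln (k2 / k1)], whatever the lengths, and the mean of u S falls below the log mass
    ratio of the u-tilted kernel by at most O(n u^2). Dividing by u leaves an error O(u) per step
    and O(1/u) per window, so u is fixed before the window length. For the second, the estimates
    hold for arbitrary starts of the blocks, by stationarity, and simultaneously on finite nets of
    parameters. Exact smoothing continued from a particle cloud interpolates between the exact block
    statistic and the particle one; each new generation changes it by a self-normalized sampling
    error. Bounds and measurability are wanted at every sample point, so the run is replaced by an
    almost surely equal one with clipped observations and ancestor indices. Ascent of the contrast
    is Jensen's inequality in the limit, and equality forces a fixed point because the maximizer is
    unique. The hull argument serves because [thbar] is controlled on [Sset] only. *)

(** * Bounded measurable functions and integrals over finite measures *)

Section bounded_measurable.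
Context {R : realType} {d : measure_display} {T : measurableType d}.
Implicit Types f g : T -> R.

(** Bounded everywhere, not almost everywhere: the class is then stable under products and
    composition, and each member is integrable for every finite measure, whatever its null sets. *)
Definition bounded_measurable f : Prop :=
  measurable_fun setT f /\ exists M, forall x, `|f x| <= M.

Lemma bmeas_cst (c : R) : bounded_measurable (fun=> c).
Proof. by split; [exact: measurable_cst|exists `|c|]. Qed.

Lemma bmeasD f g : bounded_measurable f -> bounded_measurable g ->
  bounded_measurable (fun x => f x + g x).
Proof.
move=> [mf [M fM]] [mg [M' gM]]; split; first exact: measurable_funD.
by exists (M + M') => x; rewrite (le_trans (ler_normD _ _))// lerD.
Qed.

Lemma bmeasM f g : bounded_measurable f -> bounded_measurable g ->
  bounded_measurable (fun x => f x * g x).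
Proof.
move=> [mf [M fM]] [mg [M' gM]]; split; first exact: measurable_funM.
by exists (M * M') => x; rewrite normrM ler_pM.
Qed.

Lemma bmeasZ (c : R) f : bounded_measurable f ->
  bounded_measurable (fun x => c * f x).
Proof. by move=> ?; apply: bmeasM => //; exact: bmeas_cst. Qed.

Lemma bmeasN f : bounded_measurable f -> bounded_measurable (fun x => - f x).
Proof.
move=> [mf [M fM]]; split; first exact: measurableT_comp.
by exists M => x; rewrite normrN.
Qed.

Lemma bmeasB f g : bounded_measurable f -> bounded_measurable g ->
  bounded_measurable (fun x => f x - g x).
Proof. by move=> bf bg; apply: bmeasD => //; exact: bmeasN. Qed.

Lemma bmeas_sum (I : Type) (s : seq I) (F : I -> T -> R) :
  (forall i, bounded_measurable (F i)) ->
  bounded_measurable (fun x => \sum_(i <- s) F i x).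
Proof.
move=> bF; elim: s => [|i s IH].
  by under eq_fun do rewrite big_nil; exact: bmeas_cst.
by under eq_fun do rewrite big_cons; exact: bmeasD.
Qed.

Lemma bmeas_indic (A : set T) : measurable A ->
  bounded_measurable (\1_A : T -> R).
Proof.
move=> mA; split; first exact: measurable_indic.
by exists 1 => x; rewrite indicE; case: (_ \in _); rewrite ?normr1 ?normr0.
Qed.

Lemma bmeas_between f (a b : R) : measurable_fun setT f ->
  (forall x, a <= f x <= b) -> bounded_measurable f.
Proof.
move=> mf fab; split=> //; exists (`|a| + `|b|) => x.
have /andP[ax xb] := fab x; rewrite ler_norml; apply/andP; split.
  rewrite (le_trans _ ax)// opprD (le_trans (y := - `|a|))//.
    by rewrite gerDl oppr_le0.
  by rewrite lerNl -normrN ler_norm.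
by rewrite (le_trans xb)// (le_trans (ler_norm b))// lerDr.
Qed.

Lemma bmeas_expR f : bounded_measurable f ->
  bounded_measurable (fun x => expR (f x)).
Proof.
move=> [mf [M fM]]; apply: (@bmeas_between _ 0 (expR M)).
  exact: measurableT_comp.
by move=> x; rewrite expR_ge0 ler_expR (le_trans (ler_norm _)).
Qed.

End bounded_measurable.

Lemma bmeas_comp {R : realType} {d d'} {T : measurableType d}
    {T' : measurableType d'} (f : T' -> R) (h : T -> T') :
  bounded_measurable f -> measurable_fun setT h ->
  bounded_measurable (fun x => f (h x)).
Proof.
by move=> [mf [M fM]] mh; split; [exact: measurableT_comp|exists M => x].
Qed.

Section bounded_integral.
Context {R : realType} {d : measure_display} {T : measurableType d}.
Variable mu : {finite_measure set T -> \bar R}.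
Implicit Types f g : T -> R.

Lemma bmeas_integrable f : bounded_measurable f ->
  mu.-integrable setT (EFin \o f).
Proof.
move=> [mf [M fM]]; apply: measurable_bounded_integrable => //.
  exact: fin_num_fun_lty.
by exists M; split=> // [|N MN x _]; [exact: num_real|exact: (le_trans (fM x) (ltW MN))].
Qed.

Lemma bintegral_EFin f : bounded_measurable f ->
  (\int[mu]_x (f x)%:E = (\int[mu]_x f x)%:E)%E.
Proof.
move=> bf; rewrite /Rintegral fineK//.
by apply: integrable_fin_num => //; exact: bmeas_integrable.
Qed.

Lemma bintegralD f g : bounded_measurable f -> bounded_measurable g ->
  \int[mu]_x (f x + g x) = \int[mu]_x f x + \int[mu]_x g x.
Proof. by move=> bf bg; rewrite RintegralD//; exact: bmeas_integrable. Qed.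

Lemma bintegralB f g : bounded_measurable f -> bounded_measurable g ->
  \int[mu]_x (f x - g x) = \int[mu]_x f x - \int[mu]_x g x.
Proof. by move=> bf bg; rewrite RintegralB//; exact: bmeas_integrable. Qed.

Lemma bintegralZl f (c : R) : bounded_measurable f ->
  \int[mu]_x (c * f x) = c * \int[mu]_x f x.
Proof. by move=> bf; rewrite RintegralZl//; exact: bmeas_integrable. Qed.

Lemma bintegralZr f (c : R) : bounded_measurable f ->
  \int[mu]_x (f x * c) = \int[mu]_x f x * c.
Proof. by move=> bf; rewrite RintegralZr//; exact: bmeas_integrable. Qed.

Lemma bintegral_sum (I : Type) (s : seq I) (F : I -> T -> R) :
  (forall i, bounded_measurable (F i)) ->
  \int[mu]_x (\sum_(i <- s) F i x) = \sum_(i <- s) \int[mu]_x F i x.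
Proof.
move=> bF; elim: s => [|i s IH].
  under eq_Rintegral do rewrite big_nil.
  by rewrite big_nil Rintegral_cst// mul0r.
under eq_Rintegral do rewrite big_cons.
by rewrite big_cons bintegralD// ?IH//; exact: bmeas_sum.
Qed.

Lemma le_bintegral f g : bounded_measurable f -> bounded_measurable g ->
  (forall x, f x <= g x) -> \int[mu]_x f x <= \int[mu]_x g x.
Proof. by move=> bf bg fg; apply: le_Rintegral => //; exact: bmeas_integrable. Qed.

Lemma bintegral_cst (c : R) : \int[mu]_(x in setT) c = c * fine (mu setT).
Proof. by rewrite Rintegral_cst. Qed.

End bounded_integral.

Lemma eq_Rint {R : realType} {d} {T : measurableType d}
    (mu : {measure set T -> \bar R}) (f g : T -> R) : f =1 g ->
  \int[mu]_x f x = \int[mu]_x g x.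
Proof. by move=> fg; apply: eq_Rintegral => x _; exact: fg. Qed.

Section bounded_convergence.
Context {R : realType} {d : measure_display} {T : measurableType d}.
Variable mu : {finite_measure set T -> \bar R}.

Lemma bounded_cvg_Rintegral (f : nat -> T -> R) (g : T -> R) (M : R) :
  (forall n, measurable_fun setT (f n)) -> (forall n x, `|f n x| <= M) ->
  (forall x, f n x @[n --> \oo] --> g x) ->
  \int[mu]_x f n x @[n --> \oo] --> \int[mu]_x g x.
Proof.
move=> mf fM fg; apply: fine_cvg; rewrite fineK; last first.
  apply: integrable_fin_num => //; apply: bmeas_integrable; split.
    exact: (measurable_fun_cvg (h := f)).
  exists M => x; have /(@cvg_norm _ R) /cvg_lim <- // := fg x.
  apply: limr_le; first by apply: is_cvg_norm; apply/cvg_ex; exists (g x).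
  by apply: nearW => n.
apply: (@dominated_cvg _ _ _ mu _ _ _ _ (fun=> M%:E)) => //.
- by move=> n; apply/measurable_EFinP.
- by move=> x _; apply: cvg_EFin; [exact: nearW|exact: fg].
- by apply: (@bmeas_integrable _ _ _ mu (fun=> M)); exact: bmeas_cst.
- by move=> n x _; rewrite lee_fin.
Qed.

End bounded_convergence.

Section parameter_integral.
Context {R : realType} {d d' : measure_display}.
Context {T : measurableType d} {X : measurableType d'}.
Variable mu : {finite_measure set X -> \bar R}.

Lemma measurable_Rintegral_param (f : T -> X -> R) :
  measurable_fun setT (fun z : T * X => f z.1 z.2) ->
  measurable_fun setT (fun t => \int[mu]_x f t x).
Proof.
move=> mf; apply: measurableT_comp; first exact: fine_measurable.
pose F := fun z : T * X => (f z.1 z.2)%:E.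
have mF : measurable_fun setT F by exact/measurable_EFinP.
(* Tonelli yields measurability in the parameter for nonnegative integrands, hence the split into
   positive and negative parts. *)
rewrite (_ : (fun t => _) = (fun t => (\int[mu]_x F^\+ (t, x))
    - (\int[mu]_x F^\- (t, x)))%E); last first.
  by apply/funext => t; rewrite integralE; congr (_ - _)%E; apply: eq_integral => x _; rewrite ?funeposE ?funenegE.
apply: emeasurable_funB.
  by apply: (measurable_fun_fubini_tonelli_F (m2 := mu) (F^\+)%E) => //; exact: measurable_funepos.
by apply: (measurable_fun_fubini_tonelli_F (m2 := mu) (F^\-)%E) => //; exact: measurable_funeneg.
Qed.

Lemma bmeas_Rintegral_param (f : T -> X -> R) :
  bounded_measurable (fun z : T * X => f z.1 z.2) ->
  bounded_measurable (fun t => \int[mu]_x f t x).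
Proof.
move=> [mf [M fM]]; split; first exact: measurable_Rintegral_param.
exists (M * fine (mu setT)) => t.
have bf : bounded_measurable (f t).
  split; last by exists M => x; exact: (fM (t, x)).
  by apply: (measurableT_comp mf (g := pair t)); exact: measurable_pair1.
apply: (le_trans (le_normr_Rintegral _ (bmeas_integrable mu bf))) => //.
rewrite -bintegral_cst; apply: le_bintegral; last by move=> x; exact: (fM (t, x)).
  by case: bf => mft _; split; [exact: measurableT_comp|
    exists M => x; rewrite normr_id; exact: (fM (t, x))].
exact: bmeas_cst.
Qed.

End parameter_integral.

Lemma measurable_funV {R : realType} {d} {T : measurableType d} (D : set T)
    (f : T -> R) : measurable_fun D f -> measurable_fun D (fun x => (f x)^-1).
Proof.
move=> mf.
(* 1 / y = y exp (- ln y^2) is built from measurable maps, and both sides are 0 at y = 0. *)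
rewrite (_ : (fun x => _) = (fun x => f x * expR (- ln (f x ^+ 2)))).
  apply: measurable_funM => //; apply: measurableT_comp => //.
  apply: measurableT_comp => //; apply: measurableT_comp; first exact: measurable_ln.
  exact: measurable_funX.
apply/funext => x; have [->|fx0] := eqVneq (f x) 0; first by rewrite invr0 mul0r.
have f2 : 0 < f x ^+ 2 by rewrite lt0r sqrf_eq0 fx0 sqr_ge0.
by rewrite expRN lnK ?posrE// expr2 invfM mulrA divff// mul1r.
Qed.

(** * Weighted means: Jensen's inequality, a converse, and Doeblin domination *)

Section weighted_mean.
Context {R : realType} {d : measure_display} {T : measurableType d}.
Variable mu : {finite_measure set T -> \bar R}.
Hypothesis mu_gt0 : 0 < fine (mu setT).
Implicit Types w Z : T -> R.

Definition wmean w Z : R := (\int[mu]_x (w x * Z x)) / \int[mu]_x w x.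

Definition positive_weight w : Prop :=
  bounded_measurable w /\ exists2 a, 0 < a & forall x, a <= w x.

Lemma weight_ge0 w x : positive_weight w -> 0 <= w x.
Proof. by move=> [_ [a a0 aw]]; rewrite (le_trans (ltW a0)). Qed.

Lemma weight_gt0 w x : positive_weight w -> 0 < w x.
Proof. by move=> [_ [a a0 aw]]; rewrite (lt_le_trans a0). Qed.

Lemma weight_integral_gt0 w : positive_weight w -> 0 < \int[mu]_x w x.
Proof.
move=> [bw [a a0 aw]]; apply: (@lt_le_trans _ _ (a * fine (mu setT))).
  exact: mulr_gt0.
by rewrite -bintegral_cst; apply: le_bintegral => //; exact: bmeas_cst.
Qed.

Lemma wmeanE w Z : positive_weight w ->
  \int[mu]_x (w x * Z x) = wmean w Z * \int[mu]_x w x.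
Proof. by move=> pw; rewrite /wmean divfK// gt_eqF// weight_integral_gt0. Qed.

Lemma wmean_le w Z Z' : positive_weight w -> bounded_measurable Z ->
  bounded_measurable Z' -> (forall x, Z x <= Z' x) -> wmean w Z <= wmean w Z'.
Proof.
move=> pw bZ bZ' ZZ'; rewrite /wmean ler_pM2r ?invr_gt0 ?weight_integral_gt0//.
have [bw _] := pw; apply: le_bintegral; [exact: bmeasM|exact: bmeasM|].
by move=> x; rewrite ler_wpM2l// weight_ge0.
Qed.

Lemma wmean_cst w (c : R) : positive_weight w -> wmean w (fun=> c) = c.
Proof.
move=> pw; have [bw _] := pw.
by rewrite /wmean bintegralZr// mulrAC divff ?mul1r// gt_eqF// weight_integral_gt0.
Qed.

Lemma wmeanD w Z Z' : positive_weight w -> bounded_measurable Z ->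
  bounded_measurable Z' ->
  wmean w (fun x => Z x + Z' x) = wmean w Z + wmean w Z'.
Proof.
move=> [bw _] bZ bZ'; rewrite /wmean -mulrDl -bintegralD; [|exact: bmeasM|exact: bmeasM].
by under eq_Rint do rewrite mulrDr.
Qed.

Lemma wmeanZ w Z (c : R) : positive_weight w -> bounded_measurable Z ->
  wmean w (fun x => c * Z x) = c * wmean w Z.
Proof.
move=> [bw _] bZ; rewrite /wmean mulrA -bintegralZl; last exact: bmeasM.
by under eq_Rint do rewrite mulrCA.
Qed.

Lemma wmean_bounds w Z (lo hi : R) : positive_weight w -> measurable_fun setT Z ->
  (forall x, lo <= Z x <= hi) -> lo <= wmean w Z <= hi.
Proof.
move=> pw mZ Zb; have bZ := bmeas_between mZ Zb.
by rewrite -{1}(wmean_cst lo pw) -{1}(wmean_cst hi pw) !wmean_le//;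
  try exact: bmeas_cst; move=> x; have /andP[] := Zb x.
Qed.

Lemma wmean_norm w Z (M : R) : positive_weight w -> measurable_fun setT Z ->
  (forall x, `|Z x| <= M) -> `|wmean w Z| <= M.
Proof.
by move=> pw mZ Zb; rewrite ler_norml; apply: wmean_bounds => // x; rewrite -ler_norml.
Qed.

(** The tangent of the exponential at the mean m, exp z >= exp m (1 + z - m), is averaged; its
    linear term vanishes. *)
Lemma jensen_expR w Z : positive_weight w -> bounded_measurable Z ->
  expR (wmean w Z) <= wmean w (fun x => expR (Z x)).
Proof.
move=> pw bZ; set m := wmean w Z.
have -> : expR m = wmean w (fun x => expR m * (1 + (Z x - m))).
  have b1 : bounded_measurable (fun x => Z x - m) by apply: bmeasB => //; exact: bmeas_cst.
  rewrite wmeanZ//; last by apply: bmeasD => //; exact: bmeas_cst.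
  rewrite wmeanD//; last exact: bmeas_cst.
  rewrite wmean_cst// wmeanD//; last exact: bmeas_cst.
  by rewrite wmean_cst// addrN addr0 mulr1.
apply: wmean_le => //.
- apply: bmeasZ; apply: bmeasD; first exact: bmeas_cst.
  by apply: bmeasB => //; exact: bmeas_cst.
- exact: bmeas_expR.
- move=> x; rewrite (_ : expR (Z x) = expR m * expR (Z x - m)) ?ler_wpM2l ?expR_ge0//; last first.
    by rewrite -expRD addrC subrK.
  exact: expR_ge1Dx.
Qed.

Lemma expR_le_sqr (x : R) : `|x| <= 1 -> expR x <= 1 + x + 2 * x ^+ 2.
Proof.
move=> x1; have [x0|x0] := eqVneq x 0.
  by rewrite x0 expR0 expr0n/= mulr0 !addr0.
(* The inverse of 1 - y <= exp (- y). It is used at x / 2 and then squared, because 1 / (1 - x)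
   blows up near x = 1. *)
have h (y : R) : y < 1 -> expR y <= (1 - y)^-1.
  move=> y1; rewrite -[leLHS]invrK -expRN lef_pV2 ?posrE ?expR_gt0 ?subr_gt0//.
  by rewrite expR_ge1Dx.
have /andP[xm xM] : -1 <= x <= 1 by rewrite -ler_norml.
have h2 : expR (x / 2) <= (1 - x / 2)^-1 by apply: h; rewrite ltr_pdivrMr// (le_lt_trans xM)// mul1r ltr1n.
have -> : expR x = expR (x / 2) ^+ 2 by rewrite -expRM_natl; congr expR; lra.
have p : 0 < 1 - x / 2 by lra.
apply: (@le_trans _ _ ((1 - x / 2)^-1 ^+ 2)).
  by rewrite lerXn2r// nnegrE ?expR_ge0// invr_ge0 ltW.
rewrite exprVn -[leLHS]mul1r ler_pdivrMr ?exprn_gt0// -subr_ge0.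
have -> : (1 + x + 2 * x ^+ 2) * (1 - x / 2) ^+ 2 - 1 =
    x ^+ 2 / 4 * ((5 - 2 * x) * (1 - x)) by field.
apply: mulr_ge0; first by rewrite divr_ge0// sqr_ge0.
by apply: mulr_ge0; lra.
Qed.

(** A converse of Jensen's inequality to second order: with fluctuations of size c around the mean,
    the linear term cancels and only 2 c^2 survives. It makes the tilting bounds two-sided. *)
Lemma wmean_expR_le w Z (c : R) : positive_weight w -> bounded_measurable Z ->
  (forall x, `|Z x - wmean w Z| <= c) -> c <= 1 ->
  wmean w (fun x => expR (Z x)) <= expR (wmean w Z + 2 * c ^+ 2).
Proof.
move=> pw bZ Zc c1; set m := wmean w Z.
have b1 : bounded_measurable (fun x => Z x - m) by apply: bmeasB => //; exact: bmeas_cst.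
have bc e : @bounded_measurable R _ T (fun=> e) by exact: bmeas_cst.
apply: (@le_trans _ _ (wmean w (fun x => expR m * ((1 + 2 * c ^+ 2) + (Z x - m))))).
  apply: wmean_le => //; first exact: bmeas_expR.
    by apply: bmeasZ; apply: bmeasD.
  move=> x; rewrite (_ : expR (Z x) = expR m * expR (Z x - m)) ?ler_wpM2l ?expR_ge0//; last first.
    by rewrite -expRD addrC subrK.
  rewrite (le_trans (expR_le_sqr _))// ?(le_trans (Zc x))// addrAC lerD2r lerD2l ler_pM2l//.
  by rewrite -(ger0_norm (sqr_ge0 _)) normrX lerXn2r// nnegrE ?normr_ge0// (le_trans _ (Zc x)).
rewrite wmeanZ//; last exact: bmeasD.
rewrite wmeanD// wmean_cst// wmeanD// wmean_cst// addrN addr0 expRD ler_wpM2l ?expR_ge0//.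
exact: expR_ge1Dx.
Qed.

(* If w is comparable to g with ratio in [k1, k2], the normalization of w
   dominates k1 / k2 times that of g. *)
Lemma wmean_doeblin w g Z (k1 k2 lo hi : R) : positive_weight w ->
  positive_weight g -> measurable_fun setT Z -> 0 < k1 -> 0 < k2 ->
  (forall x, k1 * g x <= w x <= k2 * g x) -> (forall x, lo <= Z x <= hi) ->
  (k1 / k2) * wmean g Z + (1 - k1 / k2) * lo <= wmean w Z <=
  (k1 / k2) * wmean g Z + (1 - k1 / k2) * hi.
Proof.
move=> pw pg mZ k10 k20 wg Zb; set rho := k1 / k2; have bZ := bmeas_between mZ Zb.
have [[bw _] [bg _]] := (pw, pg).
have Iw := weight_integral_gt0 pw; have Ig := weight_integral_gt0 pg.
have bc e : @bounded_measurable R _ T (fun=> e) by exact: bmeas_cst.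
have Iwg : \int[mu]_x w x <= k2 * \int[mu]_x g x.
  rewrite -bintegralZl//; apply: le_bintegral => //; first exact: bmeasZ.
  by move=> x; have /andP[] := wg x.
(* For nonnegative functions the domination of the normalized weights is direct; the two bounds
   follow by applying it to Z - lo and hi - Z. *)
have key (Z' : T -> R) : bounded_measurable Z' -> (forall x, 0 <= Z' x) ->
    rho * wmean g Z' <= wmean w Z'.
  move=> bZ' Z'0; rewrite {2}/wmean ler_pdivlMr//.
  have m0 : 0 <= wmean g Z'.
    by rewrite -(wmean_cst 0 pg); apply: wmean_le.
  apply: (@le_trans _ _ (k1 * \int[mu]_x (g x * Z' x))).
    rewrite wmeanE//; apply: (@le_trans _ _ (rho * wmean g Z' * (k2 * \int[mu]_x g x))).
      by rewrite ler_wpM2l// mulr_ge0// divr_ge0// ltW.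
    rewrite le_eqVlt; apply/orP; left; apply/eqP; rewrite /rho; field.
    by rewrite gt_eqF.
  rewrite -bintegralZl; last exact: bmeasM.
  apply: le_bintegral; [by apply: bmeasZ; exact: bmeasM|exact: bmeasM|].
  by move=> x; rewrite mulrA ler_wpM2r//; have /andP[] := wg x.
apply/andP; split.
  have := key (fun x => Z x - lo).
  rewrite !wmeanD// ?wmean_cst//; first last.
  move=> /(_ (bmeasB bZ (bc lo))) H.
  have : rho * (wmean g Z - lo) <= wmean w Z - lo.
    by apply: H => x; rewrite subr_ge0; have /andP[] := Zb x.
  by lra.
have bN : bounded_measurable (fun x => -1 * Z x) by exact: bmeasZ.
have := key (fun x => hi + -1 * Z x).
rewrite !wmeanD// ?wmean_cst// !wmeanZ//.
move=> /(_ (bmeasD (bc hi) bN)) H.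
have : rho * (hi + -1 * wmean g Z) <= hi + -1 * wmean w Z.
  by apply: H => x; rewrite mulN1r subr_ge0; have /andP[] := Zb x.
by lra.
Qed.

End weighted_mean.

(** * Feynman-Kac recursions for kernels between two positive constants *)

Definition shift {A : Type} (m : nat) (u : nat -> A) : nat -> A :=
  fun i => u (m + i)%N.

Section feynman_kac.
Context {R : realType} {dX : measure_display} {X : measurableType dX}.
Variable lambda : {finite_measure set X -> \bar R}.
Implicit Types (K s : nat -> X -> X -> R).

(** The backward likelihood: the mass of n-step paths started at x with unnormalized density the
    product of the K i. The recursion peels off the first step, so time is advanced by [shift 1]. *)
Fixpoint fk_mass n K (x : X) : R :=
  if n is n'.+1 then \int[lambda]_z (K 0 x z * fk_mass n' (shift 1 K) z)
  else 1.

(** The integral of s 0 + ... + s (n - 1) against the same unnormalized path measure: the first cost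
    is paid with the mass of the remaining steps. *)
Fixpoint fk_sum n K s (x : X) : R :=
  if n is n'.+1 then
    \int[lambda]_z (K 0 x z * (s 0 x z * fk_mass n' (shift 1 K) z
                               + fk_sum n' (shift 1 K) (shift 1 s) z))
  else 0.

Definition fk_mean n K s x : R := fk_sum n K s x / fk_mass n K x.

Definition kernel_between (k1 k2 : R) K : Prop := forall i,
  measurable_fun setT (fun z : X * X => K i z.1 z.2) /\
  forall x z, k1 <= K i x z <= k2.

Definition cost_bounded (M : R) s : Prop := forall i,
  measurable_fun setT (fun z : X * X => s i z.1 z.2) /\
  forall x z, `|s i x z| <= M.

(** The mass of the kernel tilted by u s has logarithmic derivative [fk_mean] at u = 0, which is how
    means are later read off masses. *)
Definition tilt s K : nat -> X -> X -> R :=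
  fun i x z => K i x z * expR (s i x z).

Section measurability.
Context {dT : measure_display} {T : measurableType dT}.

(** The kernels depend on an extra point of T. It later stands for a window of observations or for a
    sample point under a sub-sigma-field, and gives joint measurability in the randomness and the
    start. *)
Lemma measurable_fk_mass n (K : T -> nat -> X -> X -> R) :
  (forall i, measurable_fun setT (fun z : T * X * X => K z.1.1 i z.1.2 z.2)) ->
  measurable_fun setT (fun z : T * X => fk_mass n (K z.1) z.2).
Proof.
elim: n K => [|n IH] K mK /=; first exact: measurable_cst.
apply: (measurable_Rintegral_param (T := (T * X)%type) lambda
  (f := fun t x => K t.1 0 t.2 x * fk_mass n (shift 1 (K t.1)) x)).
apply: measurable_funM; first exact: mK.
have h := IH (fun t => shift 1 (K t)) (fun i => mK i.+1).
apply: (measurableT_comp h (g := fun z : T * X * X => (z.1.1, z.2))).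
apply: measurable_fun_pair; last exact: measurable_snd.
exact: measurableT_comp measurable_fst measurable_fst.
Qed.

Lemma measurable_fk_sum n (K s : T -> nat -> X -> X -> R) :
  (forall i, measurable_fun setT (fun z : T * X * X => K z.1.1 i z.1.2 z.2)) ->
  (forall i, measurable_fun setT (fun z : T * X * X => s z.1.1 i z.1.2 z.2)) ->
  measurable_fun setT (fun z : T * X => fk_sum n (K z.1) (s z.1) z.2).
Proof.
have mp : measurable_fun setT (fun z : T * X * X => (z.1.1, z.2)).
  apply: measurable_fun_pair; last exact: measurable_snd.
  exact: measurableT_comp measurable_fst measurable_fst.
elim: n K s => [|n IH] K s mK ms /=; first exact: measurable_cst.
apply: (measurable_Rintegral_param (T := (T * X)%type) lambda
  (f := fun t x => K t.1 0 t.2 x * (s t.1 0 t.2 x * fk_mass n (shift 1 (K t.1)) x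
    + fk_sum n (shift 1 (K t.1)) (shift 1 (s t.1)) x))).
apply: measurable_funM; first exact: mK.
apply: measurable_funD; first apply: measurable_funM; first exact: ms.
  have h := measurable_fk_mass n (K := fun t => shift 1 (K t)) (fun i => mK i.+1).
  exact: (measurableT_comp h mp).
have h := IH (fun t => shift 1 (K t)) (fun t => shift 1 (s t))
  (fun i => mK i.+1) (fun i => ms i.+1).
exact: (measurableT_comp h mp).
Qed.

End measurability.

Hypothesis lambda_gt0 : 0 < fine (lambda setT).
Variables (k1 k2 : R).
Hypothesis k1_gt0 : 0 < k1.
Hypothesis k12 : k1 <= k2.

Let k2_gt0 : 0 < k2. Proof. exact: lt_le_trans k12. Qed.
Let rho := k1 / k2.
Let rho_gt0 : 0 < rho. Proof. by rewrite divr_gt0. Qed.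
Let rho_le1 : rho <= 1. Proof. by rewrite ler_pdivrMr// mul1r. Qed.

Lemma kernel_shift m K : kernel_between k1 k2 K -> kernel_between k1 k2 (shift m K).
Proof. by move=> hK i; exact: hK. Qed.

Lemma cost_shift m s M : cost_bounded M s -> cost_bounded M (shift m s).
Proof. by move=> hs i; exact: hs. Qed.

Lemma measurable_fk_mass1 n K : kernel_between k1 k2 K ->
  measurable_fun setT (fk_mass n K).
Proof.
move=> hK; have := @measurable_fk_mass _ X n (fun=> K).
move=> /(_ _) h; apply: (measurableT_comp (h _) (g := fun x => (x, x))).
  move=> i; apply: (measurableT_comp (hK i).1 (g := fun z : X * X * X => (z.1.2, z.2))).
  apply: measurable_fun_pair; last exact: measurable_snd.
  exact: measurableT_comp measurable_snd measurable_fst.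
by apply: measurable_fun_pair; exact: measurable_id.
Qed.

Lemma measurable_fk_sum1 n K s M : kernel_between k1 k2 K -> cost_bounded M s ->
  measurable_fun setT (fk_sum n K s).
Proof.
move=> hK hs; have := @measurable_fk_sum _ X n (fun=> K) (fun=> s).
have mp : measurable_fun setT (fun z : X * X * X => (z.1.2, z.2)).
  apply: measurable_fun_pair; last exact: measurable_snd.
  exact: measurableT_comp measurable_snd measurable_fst.
move=> /(_ _ _) h; apply: (measurableT_comp (h _ _) (g := fun x => (x, x))).
- by move=> i; exact: (measurableT_comp (hK i).1 mp).
- by move=> i; exact: (measurableT_comp (hs i).1 mp).
- by apply: measurable_fun_pair; exact: measurable_id.
Qed.

Lemma kernel_weight K i x : kernel_between k1 k2 K -> positive_weight (K i x).
Proof.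
move=> hK; have [mK bK] := hK i; split; last by exists k1 => // z; have /andP[] := bK x z.
apply: (@bmeas_between _ _ _ _ k1 k2) => //.
exact: (measurableT_comp mK (measurable_pair1 x)).
Qed.

Lemma cost_bmeas s M i x : cost_bounded M s -> bounded_measurable (s i x).
Proof.
move=> hs; have [ms bs] := hs i; split; last by exists M.
exact: (measurableT_comp ms (measurable_pair1 x)).
Qed.

Lemma weightM (w g : X -> R) : positive_weight w -> positive_weight g ->
  positive_weight (fun x => w x * g x).
Proof.
move=> [bw [a a0 aw]] [bg [b b0 bge]]; split; first exact: bmeasM.
exists (a * b) => [|x]; first exact: mulr_gt0.
by rewrite ler_pM// ltW.
Qed.

Lemma fk_mass_weight n K : kernel_between k1 k2 K -> positive_weight (fk_mass n K).
Proof.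
elim: n K => [|n IH] K hK.
  by split; [exact: bmeas_cst|exists 1].
have pw := IH _ (kernel_shift 1 hK); have [bw [a a0 aw]] := pw.
have mm := measurable_fk_mass1 n.+1 hK.
have I0 := weight_integral_gt0 lambda_gt0 pw.
have bnd x : k1 * \int[lambda]_z fk_mass n (shift 1 K) z <= fk_mass n.+1 K x
    <= k2 * \int[lambda]_z fk_mass n (shift 1 K) z.
  rewrite -!bintegralZl//=; have bK := (kernel_weight 0 x hK).1.
  apply/andP; split; (apply: le_bintegral; [by [exact: bmeasM|exact: bmeasZ]..|]) => z;
    by rewrite ler_wpM2r ?(weight_ge0 _ pw)//; have /andP[] := (hK 0%N).2 x z.
split; first exact: bmeas_between bnd.
exists (k1 * \int[lambda]_z fk_mass n (shift 1 K) z); first exact: mulr_gt0.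
by move=> x; have /andP[] := bnd x.
Qed.

Lemma fk_mass_gt0 n K x : kernel_between k1 k2 K -> 0 < fk_mass n K x.
Proof. by move=> hK; apply: weight_gt0; exact: fk_mass_weight. Qed.

Lemma step_weight n K x : kernel_between k1 k2 K ->
  positive_weight (fun z => K 0 x z * fk_mass n (shift 1 K) z).
Proof.
move=> hK; apply: weightM; first exact: kernel_weight.
exact: fk_mass_weight (kernel_shift 1 hK).
Qed.

(** Only the first kernel sees the start, and two of its values have ratio at least k1 / k2. The
    bound is therefore the same for all n, and every estimate uniform in the block length rests on
    it. *)
Lemma fk_mass_ratio n K x y : kernel_between k1 k2 K ->
  rho * fk_mass n K x <= fk_mass n K y.
Proof.
case: n => [|n] hK; first by rewrite mulr1.
have pw := fk_mass_weight n (kernel_shift 1 hK); have [bw _] := pw.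
have [b1 _] := step_weight n x hK; have [b2 _] := step_weight n y hK.
rewrite /= -bintegralZl//; apply: le_bintegral => //; first exact: bmeasZ.
move=> z; rewrite mulrA ler_wpM2r ?(weight_ge0 _ pw)//.
have /andP[_ h1] := (hK 0%N).2 x z; have /andP[h2 _] := (hK 0%N).2 y z.
rewrite (le_trans _ h2)// /rho mulrAC ler_pdivrMr// ler_wpM2l//.
exact: ltW.
Qed.

Lemma fk_sum_bound n K s M x : kernel_between k1 k2 K -> cost_bounded M s ->
  `|fk_sum n K s x| <= n%:R * M * fk_mass n K x.
Proof.
elim: n K s x => [|n IH] K s x hK hs /=.
  by rewrite normr0 !mul0r.
have hK' := kernel_shift 1 hK; have hs' := cost_shift 1 hs.
have bK := (kernel_weight 0 x hK).1; have bs := cost_bmeas 0 x hs.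
have bm := (fk_mass_weight n hK').1.
have bS : bounded_measurable (fk_sum n (shift 1 K) (shift 1 s)).
  split; first exact: measurable_fk_sum1 hK' hs'.
  have [_ [B hB]] := bm; exists (n%:R * M * B) => z.
  rewrite (le_trans (IH _ _ z hK' hs'))// ler_wpM2l//.
    by rewrite mulr_ge0// (le_trans _ ((hs 0%N).2 x x)).
  by rewrite (le_trans (ler_norm _)).
have bT : bounded_measurable (fun z => K 0 x z * (s 0 x z * fk_mass n (shift 1 K) z
    + fk_sum n (shift 1 K) (shift 1 s) z)).
  by apply: bmeasM => //; apply: bmeasD => //; exact: bmeasM.
apply: (le_trans (le_normr_Rintegral _ (bmeas_integrable lambda bT))) => //.
rewrite -bintegralZl; last exact: bmeasM.
apply: le_bintegral.
- case: bT => mT [B hB]; split; first exact: measurableT_comp.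
  by exists B => z; rewrite normr_id.
- by apply: bmeasZ; exact: bmeasM.
move=> z; rewrite normrM mulrCA ger0_norm; last first.
  by apply: weight_ge0; exact: kernel_weight.
rewrite ler_wpM2l//; first by apply: weight_ge0; exact: kernel_weight.
rewrite (le_trans (ler_normD _ _))// -natr1 mulrDl mul1r mulrDl addrC.
have m0 := ltW (fk_mass_gt0 n z hK').
by rewrite lerD ?IH// normrM (ger0_norm m0) ler_wpM2r// (hs 0%N).2.
Qed.

Lemma bmeas_fk_sum n K s M : kernel_between k1 k2 K -> cost_bounded M s ->
  bounded_measurable (fk_sum n K s).
Proof.
move=> hK hs; split; first exact: measurable_fk_sum1 hK hs.
have [[_ [B hB]] _] := fk_mass_weight n hK; exists (n%:R * M * B) => z.
rewrite (le_trans (fk_sum_bound n z hK hs))// ler_wpM2l//.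
  by rewrite mulr_ge0// (le_trans _ ((hs 0%N).2 z z)).
by rewrite (le_trans (ler_norm _)).
Qed.

Lemma fk_mean_bound n K s M x : kernel_between k1 k2 K -> cost_bounded M s ->
  `|fk_mean n K s x| <= n%:R * M.
Proof.
move=> hK hs; have m0 := fk_mass_gt0 n x hK.
by rewrite /fk_mean normrM normfV (gtr0_norm m0) ler_pdivrMr// fk_sum_bound.
Qed.

Lemma bmeas_fk_mean n K s M : kernel_between k1 k2 K -> cost_bounded M s ->
  bounded_measurable (fk_mean n K s).
Proof.
move=> hK hs; split; last by exists (n%:R * M) => x; exact: fk_mean_bound.
apply: measurable_funM; first exact: measurable_fk_sum1 hK hs.
exact: measurable_funV (measurable_fk_mass1 n hK).
Qed.

Lemma fk_meanK n K s x : kernel_between k1 k2 K ->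
  fk_mass n K x * fk_mean n K s x = fk_sum n K s x.
Proof.
by move=> hK; rewrite /fk_mean mulrCA divff ?mulr1// gt_eqF// fk_mass_gt0.
Qed.

(** Given the start, the first step of the smoothed chain has density proportional to the first
    kernel times the remaining mass; means propagate as averages under this law. *)
Lemma fk_meanS n K s x : kernel_between k1 k2 K ->
  fk_mean n.+1 K s x =
  wmean lambda (fun z => K 0 x z * fk_mass n (shift 1 K) z)
    (fun z => s 0 x z + fk_mean n (shift 1 K) (shift 1 s) z).
Proof.
move=> hK; rewrite {1}/fk_mean /wmean /=; congr (_ / _); apply: eq_Rint => z.
rewrite -(fk_meanK n (shift 1 s) z (kernel_shift 1 hK)).
by rewrite -!mulrA (mulrC (s _ _ _)) -mulrDr.
Qed.

(** A step adds at most 2 M to the oscillation, and the common part of the first-step laws contracts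
    the oscillation of the remainder by 1 - rho. The bound 2 M / rho is the fixed point of o = 2 M +
    (1 - rho) o, hence free of n. *)
Lemma fk_mean_osc n K s M : kernel_between k1 k2 K -> cost_bounded M s ->
  exists lo, forall x, lo <= fk_mean n K s x <= lo + 2 * M / rho.
Proof.
elim: n K s => [|n IH] K s hK hs.
  exists 0 => x; rewrite /fk_mean /= mul0r lexx add0r /= -mulrA mulr_ge0//.
  rewrite mulr_ge0 ?invr_ge0 ?(ltW rho_gt0)//.
  by rewrite (le_trans _ ((hs 0%N).2 x x)).
have hK' := kernel_shift 1 hK; have hs' := cost_shift 1 hs.
have [lo hlo] := IH _ _ hK' hs'.
pose F := fk_mean n (shift 1 K) (shift 1 s).
pose g := fk_mass n (shift 1 K).
have bF : bounded_measurable F := bmeas_fk_mean n hK' hs'.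
have pg : positive_weight g := fk_mass_weight n hK'.
exists (- M + (rho * wmean lambda g F + (1 - rho) * lo)) => x.
rewrite fk_meanS// wmeanD//; [|exact: step_weight|exact: cost_bmeas hs].
have pw := step_weight n x hK.
have /andP[s1 s2] : - M <= wmean lambda (fun z => K 0 x z * g z) (s 0 x) <= M.
  rewrite -ler_norml; apply: wmean_norm => //; first by have [] := cost_bmeas 0 x hs.
  by move=> z; exact: (hs 0%N).2.
have wg z : k1 * g z <= K 0 x z * g z <= k2 * g z.
  by have /andP[a b] := (hK 0%N).2 x z; rewrite !ler_wpM2r// (weight_ge0 _ pg).
have /andP[f1 f2] := wmean_doeblin lambda_gt0 pw pg bF.1 k1_gt0 k2_gt0 wg hlo.
apply/andP; split; first exact: lerD.
apply: (le_trans (lerD s2 f2)); rewrite le_eqVlt; apply/orP; left; apply/eqP.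
rewrite -/rho; field; exact/lt0r_neq0.
Qed.

End feynman_kac.

(** * Initial law, near-additivity of log masses, exponential tilting *)

Section feynman_kac_tilt.
Context {R : realType} {dX : measure_display} {X : measurableType dX}.
Variable lambda : {finite_measure set X -> \bar R}.
Variable chi : probability X R.
Implicit Types (K s : nat -> X -> X -> R).

Definition fk_total n K : R := \int[chi]_x fk_mass lambda n K x.
Definition fk_expect n K s : R :=
  (\int[chi]_x fk_sum lambda n K s x) / fk_total n K.

Hypothesis lambda_gt0 : 0 < fine (lambda setT).

Lemma chi_gt0 : 0 < fine (chi setT).
Proof. by rewrite probability_setT. Qed.

Lemma tilt_between k1 k2 M K s : 0 < k1 -> k1 <= k2 ->
  kernel_between k1 k2 K -> cost_bounded M s ->
  kernel_between (k1 * expR (- M)) (k2 * expR M) (tilt s K).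
Proof.
move=> k10 k12 hK hs i; have [mK bK] := hK i; have [ms bs] := hs i; split.
  by apply: measurable_funM => //; exact: measurableT_comp.
move=> x z; have /andP[a b] := bK x z.
have /andP[c e] : - M <= s i x z <= M by rewrite -ler_norml.
rewrite /tilt; apply/andP; split; apply: ler_pM; rewrite ?expR_ge0 ?ler_expR//.
  exact: ltW.
exact: le_trans (ltW k10) a.
Qed.

Lemma tilt_ratio_gt0 k M : 0 < k -> 0 < k * expR M :> R.
Proof. by move=> k0; rewrite mulr_gt0// expR_gt0. Qed.

Lemma tilt_le k1 k2 M K s : 0 < k1 -> k1 <= k2 -> cost_bounded M s ->
  X -> k1 * expR (- M) <= k2 * expR M.
Proof.
move=> k10 k12 hs x; have M0 : 0 <= M by rewrite (le_trans _ ((hs 0%N).2 x x)).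
apply: ler_pM; rewrite ?expR_ge0 ?(ltW k10)//.
by rewrite ler_expR (le_trans _ M0)// oppr_le0.
Qed.

Section bounds.
Variables (k1 k2 : R).
Hypothesis k1_gt0 : 0 < k1.
Hypothesis k12 : k1 <= k2.

Let k2_gt0 : 0 < k2. Proof. exact: lt_le_trans k12. Qed.

Lemma fk_total_gt0 n K : kernel_between k1 k2 K -> 0 < fk_total n K.
Proof.
by move=> hK; apply: (weight_integral_gt0 chi_gt0); exact: (fk_mass_weight lambda_gt0 k1_gt0 n hK).
Qed.

Lemma fk_expectE n K s : kernel_between k1 k2 K ->
  fk_expect n K s = wmean chi (fk_mass lambda n K) (fk_mean lambda n K s).
Proof.
move=> hK; rewrite /fk_expect /wmean; congr (_ / _); apply: eq_Rint => x.
by rewrite (fk_meanK lambda_gt0 k1_gt0 _ _ _ hK).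
Qed.

Lemma fk_expect_bound n K s M : kernel_between k1 k2 K -> cost_bounded M s ->
  `|fk_expect n K s| <= n%:R * M.
Proof.
move=> hK hs; rewrite fk_expectE//; apply: (wmean_norm chi_gt0).
- exact: (fk_mass_weight lambda_gt0 k1_gt0 n hK).
- by have [] := bmeas_fk_mean lambda_gt0 k1_gt0 n hK hs.
- by move=> x; exact: (fk_mean_bound lambda_gt0 k1_gt0).
Qed.

Lemma le_fk_mass n K K' k1' k2' delta x : 0 < k1' ->
  kernel_between k1 k2 K -> kernel_between k1' k2' K' ->
  (forall i y z, K i y z <= expR delta * K' i y z) ->
  fk_mass lambda n K x <= expR (n%:R * delta) * fk_mass lambda n K' x.
Proof.
move=> k10'; elim: n K K' x => [|n IH] K K' x hK hK' KK'.
  by rewrite mul0r expR0 mul1r.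
have [b1 _] := step_weight lambda_gt0 k1_gt0 n x hK.
have [b2 _] := step_weight lambda_gt0 k10' n x hK'.
rewrite /= -bintegralZl//; apply: le_bintegral => //; first exact: bmeasZ.
move=> z; rewrite -natr1 mulrDl mul1r expRD.
have m0 := ltW (fk_mass_gt0 lambda_gt0 k1_gt0 n z (kernel_shift 1 hK)).
rewrite [leRHS](_ : _ = (expR delta * K' 0 x z) *
    (expR (n%:R * delta) * fk_mass lambda n (shift 1 K') z)); last by ring.
apply: ler_pM => //; first by have /andP[a _] := (hK 0%N).2 x z; exact: le_trans (ltW k1_gt0) a.
by apply: IH => [||i y z']; [exact: kernel_shift|exact: kernel_shift|exact: KK'].
Qed.

Lemma fk_mass_add n m K a b x : kernel_between k1 k2 K ->
  (forall z, a <= fk_mass lambda m (shift n K) z <= b) ->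
  a * fk_mass lambda n K x <= fk_mass lambda (n + m) K x
    <= b * fk_mass lambda n K x.
Proof.
elim: n K x => [|n IH] K x hK ab; first by rewrite !mulr1.
have [b1 _] := step_weight lambda_gt0 k1_gt0 n x hK.
have [b2 _] := step_weight lambda_gt0 k1_gt0 (n + m) x hK.
have h z := IH _ z (kernel_shift 1 hK) ab.
rewrite addSn /= -!bintegralZl//; apply/andP; split;
  (apply: le_bintegral; [by [|exact: bmeasZ]..|]) => z;
  rewrite mulrCA ler_wpM2l//; (try by have /andP[] := h z);
  by have /andP[c _] := (hK 0%N).2 x z; exact: le_trans (ltW k1_gt0) c.
Qed.

Lemma fk_total_ratio n K x : kernel_between k1 k2 K ->
  (k1 / k2) * fk_total n K <= fk_mass lambda n K x <= (k1 / k2)^-1 * fk_total n K.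
Proof.
move=> hK; have [bm _] := fk_mass_weight lambda_gt0 k1_gt0 n hK.
have r0 : 0 < k1 / k2 by rewrite divr_gt0.
have chi1 : fine (chi setT) = 1 by rewrite probability_setT.
have E : \int[chi]_(y in setT) fk_mass lambda n K x = fk_mass lambda n K x.
  by rewrite bintegral_cst chi1 mulr1.
apply/andP; split.
  rewrite -[leRHS]E -bintegralZl//; apply: le_bintegral; [exact: bmeasZ|exact: bmeas_cst|].
  by move=> y; exact: (fk_mass_ratio lambda_gt0 k1_gt0 k12).
rewrite mulrC ler_pdivlMr// mulrC -E -bintegralZl; last exact: bmeas_cst.
apply: le_bintegral => //; first exact: bmeas_cst.
by move=> y; exact: (fk_mass_ratio lambda_gt0 k1_gt0 k12).
Qed.

(** The mass of the last m steps depends on the state at the cut by a factor at most k2 / k1, so it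
    may be replaced by its average under [chi]. The error depends on neither length, which makes
    this a substitute for additivity. *)
Lemma fk_total_add n m K : kernel_between k1 k2 K ->
  `|ln (fk_total (n + m) K) - ln (fk_total n K) - ln (fk_total m (shift n K))|
    <= ln (k2 / k1).
Proof.
move=> hK; have hK' := kernel_shift n hK.
have t1 := fk_total_gt0 n hK; have t2 := fk_total_gt0 m hK'.
have t3 := fk_total_gt0 (n + m) hK.
have r0 : 0 < k2 / k1 by rewrite divr_gt0.
have h x := fk_mass_add x hK (fun z => fk_total_ratio m z hK').
have b n' := (fk_mass_weight lambda_gt0 k1_gt0 n' hK).1.
have h1 : (k1 / k2) * fk_total m (shift n K) * fk_total n K <= fk_total (n + m) K.
  rewrite /fk_total -bintegralZl//; apply: le_bintegral => //; first exact: bmeasZ.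
  by move=> x; have /andP[] := h x.
have h2 : fk_total (n + m) K <= (k1 / k2)^-1 * fk_total m (shift n K) * fk_total n K.
  rewrite /fk_total -bintegralZl//; apply: le_bintegral => //; first exact: bmeasZ.
  by move=> x; have /andP[] := h x.
move: h1 h2 r0; rewrite invf_div -[k1 / k2]invf_div.
move: (k2 / k1) => r h1 h2 r0.
rewrite -ler_ln ?posrE ?mulr_gt0 ?invr_gt0// in h1.
rewrite -ler_ln ?posrE ?mulr_gt0// in h2.
rewrite !lnM ?posrE ?mulr_gt0 ?invr_gt0// lnV ?posrE// in h1.
rewrite !lnM ?posrE ?mulr_gt0// in h2.
by rewrite ler_norml; apply/andP; split; lra.
Qed.

(** Jensen's inequality is applied once per step, under the first-step law of the untilted chain. *)
Lemma fk_mass_tilt_ge n K s M x : kernel_between k1 k2 K -> cost_bounded M s ->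
  fk_mass lambda n K x * expR (fk_mean lambda n K s x)
    <= fk_mass lambda n (tilt s K) x.
Proof.
elim: n K s x => [|n IH] K s x hK hs.
  by rewrite /fk_mean/= mul0r expR0 mulr1.
have hK' := kernel_shift 1 hK; have hs' := cost_shift 1 hs.
have hT := tilt_between k1_gt0 k12 hK hs.
have pw := step_weight lambda_gt0 k1_gt0 n x hK.
have bF := bmeas_fk_mean lambda_gt0 k1_gt0 n hK' hs'.
have bsF : bounded_measurable (fun z => s 0 x z + fk_mean lambda n (shift 1 K) (shift 1 s) z).
  by apply: bmeasD => //; exact: cost_bmeas hs.
have [bT _] := step_weight lambda_gt0 (tilt_ratio_gt0 (- M) k1_gt0) n x hT.
rewrite (fk_meanS lambda_gt0 k1_gt0 _ _ _ hK).
apply: (le_trans (ler_wpM2l (ltW (fk_mass_gt0 lambda_gt0 k1_gt0 n.+1 x hK))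
  (jensen_expR lambda_gt0 pw bsF))).
rewrite /= mulrC -wmeanE//; apply: le_bintegral => //.
  by have [bw _] := pw; apply: bmeasM => //; exact: bmeas_expR.
move=> z; rewrite expRD {1}/tilt -!mulrA ler_wpM2l//.
  by have /andP[a _] := (hK 0%N).2 x z; exact: le_trans (ltW k1_gt0) a.
by rewrite mulrCA ler_wpM2l ?expR_ge0//; exact: IH.
Qed.

Lemma fk_mass_tilt_le n K s M x : kernel_between k1 k2 K -> cost_bounded M s ->
  4 * M / (k1 / k2) <= 1 ->
  fk_mass lambda n (tilt s K) x <= fk_mass lambda n K x *
    expR (fk_mean lambda n K s x + n%:R * (2 * (4 * M / (k1 / k2)) ^+ 2)).
Proof.
move=> hK0 hs0; set c := 4 * M / _ => c1.
elim: n K s x hK0 hs0 => [|n IH] K s x hK hs.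
  by rewrite /fk_mean/= mul0r mul0r addr0 expR0 mulr1.
have hK' := kernel_shift 1 hK; have hs' := cost_shift 1 hs.
have hT := tilt_between k1_gt0 k12 hK hs.
have pw := step_weight lambda_gt0 k1_gt0 n x hK.
have bF := bmeas_fk_mean lambda_gt0 k1_gt0 n hK' hs'.
pose Z z := s 0 x z + fk_mean lambda n (shift 1 K) (shift 1 s) z.
have bZ : bounded_measurable Z.
  by apply: bmeasD => //; exact: cost_bmeas hs.
have [bT _] := step_weight lambda_gt0 (tilt_ratio_gt0 (- M) k1_gt0) n x hT.
have M0 : 0 <= M by rewrite (le_trans _ ((hs 0%N).2 x x)).
have r0 : 0 < k1 / k2 by rewrite divr_gt0.
have r1 : k1 / k2 <= 1 by rewrite ler_pdivrMr// mul1r.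
have [lo hlo] := fk_mean_osc lambda_gt0 k1_gt0 k12 n hK' hs'.
have Zlo z : lo - M <= Z z <= lo + 2 * M / (k1 / k2) + M.
  have /andP[a b] := hlo z; have : `|s 0 x z| <= M := (hs 0%N).2 x z.
  by rewrite ler_norml => /andP[e f]; rewrite /Z; apply/andP; split; lra.
have /andP[m1 m2] := wmean_bounds lambda_gt0 pw bZ.1 Zlo.
(* The first cost oscillates by 2 M and the remaining mean by 2 M / rho with rho = k1 / k2 <= 1;
   together at most c = 4 M / rho, the deviation fed to the converse of Jensen's inequality. *)
have Zc z : `|Z z - wmean lambda (fun z => K 0 x z * fk_mass lambda n (shift 1 K) z) Z| <= c.
  have Mr : M <= M / (k1 / k2) by rewrite ler_pdivlMr// ler_piMr.
  have cE : c = 4 * (M / (k1 / k2)) by rewrite /c mulrA.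
  have /andP[z1 z2] := Zlo z.
  rewrite -mulrA in m2 z2.
  by rewrite ler_norml cE; apply/andP; split; lra.
have := wmean_expR_le lambda_gt0 pw bZ Zc c1.
rewrite (fk_meanS lambda_gt0 k1_gt0 _ _ _ hK) -/Z => H.
have m0 := ltW (fk_mass_gt0 lambda_gt0 k1_gt0 n.+1 x hK).
rewrite -natr1 mulrDl mul1r (addrC (_ * _) (2 * _)) addrA expRD.
apply: le_trans (_ : _ <= fk_mass lambda n.+1 K x * (wmean lambda (fun z => K 0 x z *
  fk_mass lambda n (shift 1 K) z) (fun z => expR (Z z)) * expR (n%:R * (2 * c ^+ 2)))) _;
  last by rewrite ler_wpM2l// ler_wpM2r// expR_ge0.
rewrite mulrA [X in X * _]mulrC /= -wmeanE// mulrC -bintegralZl; last first.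
  by have [bw _] := pw; apply: bmeasM => //; exact: bmeas_expR.
apply: le_bintegral => //.
  by have [bw _] := pw; apply: bmeasZ; apply: bmeasM => //; exact: bmeas_expR.
move=> z; have K0 : 0 <= K 0 x z.
  by have /andP[a _] := (hK 0%N).2 x z; exact: le_trans (ltW k1_gt0) a.
rewrite [leRHS](_ : _ = K 0 x z * expR (s 0 x z) * (fk_mass lambda n (shift 1 K) z *
  expR (fk_mean lambda n (shift 1 K) (shift 1 s) z + n%:R * (2 * c ^+ 2)))); last first.
  by rewrite /Z !expRD; ring.
by rewrite ler_wpM2l ?mulr_ge0 ?expR_ge0//; exact: IH.
Qed.

(** This moves the question from means, which involve the whole block, to log masses, which
    [fk_total_add] splits into windows. *)
Lemma fk_expect_tilt n K s M : kernel_between k1 k2 K -> cost_bounded M s ->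
  fk_expect n K s <= ln (fk_total n (tilt s K)) - ln (fk_total n K).
Proof.
move=> hK hs; have /=x0 : X := point.
have hT := tilt_between k1_gt0 k12 hK hs.
have T0 : 0 < fk_total n (tilt s K).
  apply: (weight_integral_gt0 chi_gt0).
  exact: (fk_mass_weight lambda_gt0 (tilt_ratio_gt0 (- M) k1_gt0)).
have t0 := fk_total_gt0 n hK.
have pw := fk_mass_weight lambda_gt0 k1_gt0 n hK.
have bF := bmeas_fk_mean lambda_gt0 k1_gt0 n hK hs.
rewrite -ln_div ?posrE// -[leLHS]expRK ler_ln ?posrE ?expR_gt0 ?divr_gt0//.
rewrite fk_expectE//; apply: (le_trans (jensen_expR chi_gt0 pw bF)).
rewrite /wmean ler_wpM2r ?invr_ge0 ?(ltW t0)//; apply: le_bintegral.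
- by have [bw _] := pw; apply: bmeasM => //; exact: bmeas_expR.
- by have [] := fk_mass_weight lambda_gt0 (tilt_ratio_gt0 (- M) k1_gt0) n hT.
- by move=> x; exact: fk_mass_tilt_ge hK hs.
Qed.

(** One second-order term per step and one more for the average over the initial law, hence the
    factor n + 1. *)
Lemma fk_tilt_expect n K s M : kernel_between k1 k2 K -> cost_bounded M s ->
  4 * M / (k1 / k2) <= 1 ->
  ln (fk_total n (tilt s K)) - ln (fk_total n K) <=
    fk_expect n K s + n.+1%:R * (2 * (4 * M / (k1 / k2)) ^+ 2).
Proof.
move=> hK hs; set c := 4 * M / _ => c1; have /=x0 : X := point.
have hT := tilt_between k1_gt0 k12 hK hs.
have pT := fk_mass_weight lambda_gt0 (tilt_ratio_gt0 (- M) k1_gt0) n hT.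
have T0 : 0 < fk_total n (tilt s K) by exact: (weight_integral_gt0 chi_gt0).
have t0 := fk_total_gt0 n hK.
have pw := fk_mass_weight lambda_gt0 k1_gt0 n hK.
have bF := bmeas_fk_mean lambda_gt0 k1_gt0 n hK hs.
have [lo hlo] := fk_mean_osc lambda_gt0 k1_gt0 k12 n hK hs.
have M0 : 0 <= M by rewrite (le_trans _ ((hs 0%N).2 x0 x0)).
have r0 : 0 < k1 / k2 by rewrite divr_gt0.
have Fc z : `|fk_mean lambda n K s z - fk_expect n K s| <= c.
  have /andP[m1 m2] := wmean_bounds chi_gt0 pw bF.1 hlo.
  rewrite -fk_expectE// in m1 m2; have /andP[z1 z2] := hlo z.
  have Mr0 : 0 <= M / (k1 / k2) by rewrite divr_ge0// ltW.
  have cE : c = 4 * (M / (k1 / k2)) by rewrite /c mulrA.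
  rewrite -mulrA in m2 z2.
  by rewrite ler_norml cE; apply/andP; split; lra.
rewrite -ln_div ?posrE// -[leRHS]expRK ler_ln ?posrE ?expR_gt0 ?divr_gt0//.
rewrite -natr1 mulrDl mul1r (addrC (_ * _) (2 * _)) addrA expRD.
have := wmean_expR_le chi_gt0 pw bF.
rewrite -fk_expectE// => /(_ c Fc c1) H.
apply: le_trans (_ : wmean chi (fk_mass lambda n K) (fun x => expR (fk_mean lambda n K s x))
   * expR (n%:R * (2 * c ^+ 2)) <= _); last by rewrite ler_wpM2r// expR_ge0.
rewrite /wmean mulrAC ler_wpM2r ?invr_ge0 ?(ltW t0)// mulrC -bintegralZl; last first.
  by have [bw _] := pw; apply: bmeasM => //; exact: bmeas_expR.
apply: le_bintegral; first by case: pT.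
  by have [bw _] := pw; apply: bmeasZ; apply: bmeasM => //; exact: bmeas_expR.
move=> x; apply: (le_trans (fk_mass_tilt_le n x hK hs c1)).
by rewrite expRD -/c le_eqVlt; apply/orP; left; apply/eqP; ring.
Qed.

End bounds.
End feynman_kac_tilt.

(** * Linearity in the cost and the exact block statistic as a Feynman-Kac mean *)

Section feynman_kac_linear.
Context {R : realType} {dX : measure_display} {X : measurableType dX}.
Variable lambda : {finite_measure set X -> \bar R}.
Variable chi : probability X R.
Implicit Types (K s : nat -> X -> X -> R).
Hypothesis lambda_gt0 : 0 < fine (lambda setT).
Variables (k1 k2 : R).
Hypothesis k1_gt0 : 0 < k1.
Hypothesis k12 : k1 <= k2.

Lemma cost_lin (a : R) s s' M M' : cost_bounded M s -> cost_bounded M' s' ->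
  cost_bounded (`|a| * M + M') (fun i x z => a * s i x z + s' i x z).
Proof.
move=> hs hs' i; have [ms bs] := hs i; have [ms' bs'] := hs' i; split.
  by apply: measurable_funD => //; apply: measurable_funM.
move=> x z; rewrite (le_trans (ler_normD _ _))// lerD// normrM ler_wpM2l//.
Qed.

Lemma bmeas_step n K s M x : kernel_between k1 k2 K -> cost_bounded M s ->
  bounded_measurable (fun z => K 0 x z * (s 0 x z * fk_mass lambda n (shift 1 K) z
    + fk_sum lambda n (shift 1 K) (shift 1 s) z)).
Proof.
move=> hK hs; apply: bmeasM; first by have [] := kernel_weight k1_gt0 0 x hK.
apply: bmeasD; last exact: (bmeas_fk_sum lambda_gt0 k1_gt0 n (kernel_shift 1 hK) (cost_shift 1 hs)).
apply: bmeasM; first exact: cost_bmeas hs.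
by have [] := fk_mass_weight lambda_gt0 k1_gt0 n (kernel_shift 1 hK).
Qed.

Lemma fk_sum_lin n K (a : R) s s' M M' x : kernel_between k1 k2 K ->
  cost_bounded M s -> cost_bounded M' s' ->
  fk_sum lambda n K (fun i x z => a * s i x z + s' i x z) x =
  a * fk_sum lambda n K s x + fk_sum lambda n K s' x.
Proof.
elim: n K s s' x => [|n IH] K s s' x hK hs hs' /=; first by rewrite mulr0 addr0.
have b1 := bmeas_step n x hK hs; have b2 := bmeas_step n x hK hs'.
rewrite -bintegralZl// -bintegralD//; last exact: bmeasZ.
apply: eq_Rint => z.
rewrite [X in _ * (_ + X)](IH _ (shift 1 s) (shift 1 s') z (kernel_shift 1 hK)
  (cost_shift 1 hs) (cost_shift 1 hs')).
ring.
Qed.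

Lemma fk_sum0 n K x : fk_sum lambda n K (fun _ _ _ => 0) x = 0.
Proof.
elim: n K x => [//|n IH] K x /=.
under eq_Rint => z.
  have := IH (shift 1 K) z; rewrite mul0r add0r => E.
  rewrite [X in _ * X]E mulr0; over.
by rewrite Rintegral_cst// mul0r.
Qed.

Lemma fk_expect_lin n K (a : R) s s' M M' : kernel_between k1 k2 K ->
  cost_bounded M s -> cost_bounded M' s' ->
  fk_expect lambda chi n K (fun i x z => a * s i x z + s' i x z) =
  a * fk_expect lambda chi n K s + fk_expect lambda chi n K s'.
Proof.
move=> hK hs hs'; rewrite /fk_expect mulrA -mulrDl; congr (_ / _).
have b s0 M0 := bmeas_fk_sum lambda_gt0 k1_gt0 (s := s0) (M := M0) n hK.
rewrite -bintegralZl; last exact: b hs.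
rewrite -bintegralD; [|by apply: bmeasZ; exact: b hs|exact: b hs'].
by apply: eq_Rint => x; exact: fk_sum_lin hK hs hs'.
Qed.

Lemma fk_expect0 n K : fk_expect lambda chi n K (fun _ _ _ => 0) = 0.
Proof.
rewrite /fk_expect; under eq_Rint do rewrite fk_sum0.
by rewrite Rintegral_cst// !mul0r.
Qed.

Lemma fk_expectZ n K (a : R) s M : kernel_between k1 k2 K -> cost_bounded M s ->
  fk_expect lambda chi n K (fun i x z => a * s i x z) =
  a * fk_expect lambda chi n K s.
Proof.
move=> hK hs.
have h0 : @cost_bounded R _ X 0 (fun _ _ _ => 0).
  by move=> i; split; [exact: measurable_cst|move=> x z; rewrite normr0].
rewrite -[RHS]addr0 -(fk_expect0 n K) -(fk_expect_lin n a hK hs h0).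
by congr fk_expect; do 3 apply/funext => ?; rewrite addr0.
Qed.

(** Isolates the cost of one step, because the exact block statistic is a sum of separate integrals,
    one for each time. *)
Definition only (t : nat) s : nat -> X -> X -> R :=
  fun i x z => if i == t then s i x z else 0.

Lemma only_bounded t s M : X -> cost_bounded M s -> cost_bounded M (only t s).
Proof.
move=> x0 hs i; have [ms bs] := hs i; rewrite /only; case: eqP => // _; split.
  exact: measurable_cst.
by move=> x z; rewrite normr0 (le_trans _ (bs x z)).
Qed.

Lemma fk_sum_only n K s M x : kernel_between k1 k2 K -> cost_bounded M s ->
  fk_sum lambda n K s x = \sum_(t < n) fk_sum lambda n K (only t s) x.
Proof.
elim: n K s x => [|n IH] K s x hK hs; first by rewrite big_ord0.
have hK' := kernel_shift 1 hK; have hs' := cost_shift 1 hs.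
have bK := (kernel_weight k1_gt0 0 x hK).1.
have b2 s0 M0 (hs0 : cost_bounded M0 s0) :
    bounded_measurable (fun z => K 0 x z * fk_sum lambda n (shift 1 K) s0 z).
  by apply: bmeasM => //; exact: (bmeas_fk_sum lambda_gt0 k1_gt0 n hK' hs0).
have b1 : bounded_measurable (fun z => K 0 x z * (s 0 x z * fk_mass lambda n (shift 1 K) z)).
  apply: bmeasM => //; apply: bmeasM; first exact: cost_bmeas hs.
  by have [] := fk_mass_weight lambda_gt0 k1_gt0 n hK'.
rewrite big_ord_recl/=.
under eq_Rint do rewrite mulrDr.
rewrite bintegralD//; last exact: b2 hs'.
congr (_ + _).
  by apply: eq_Rint => z; rewrite (_ : shift 1 (only 0 s) = fun _ _ _ => 0)// fk_sum0 addr0.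
under eq_Rint => z do rewrite (IH _ _ z hK' hs') mulr_sumr.
rewrite bintegral_sum; last by move=> i; exact: b2 (only_bounded i x hs').
apply: eq_bigr => i _; apply: eq_Rint => z.
by rewrite mul0r add0r.
Qed.

(** The factor c collects the kernels of the steps already integrated; the induction needs it, since
    the integrand is a function of the whole path. *)
Lemma iterated_mass n K (c : R) (dflt x : X) : kernel_between k1 k2 K ->
  iterated_integral lambda n (fun p => c * \prod_(i < n)
    K i (nth dflt (x :: p) i) (nth dflt (x :: p) i.+1))
  = c * fk_mass lambda n K x.
Proof.
elim: n K c x => [|n IH] K c x hK /=; first by rewrite big_ord0.
rewrite -bintegralZl; last by have [] := step_weight lambda_gt0 k1_gt0 n x hK.
apply: eq_Rint => z.
under [X in iterated_integral _ _ X]eq_fun do rewrite big_ord_recl/= mulrA.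
by rewrite (IH (shift 1 K) (c * K 0 x z) z (kernel_shift 1 hK)) mulrA.
Qed.

Lemma iterated_only n K s M t (c : R) (dflt x : X) : (t < n)%N ->
  kernel_between k1 k2 K -> cost_bounded M s ->
  iterated_integral lambda n (fun p => c * (\prod_(i < n)
    K i (nth dflt (x :: p) i) (nth dflt (x :: p) i.+1)
    * s t (nth dflt (x :: p) t) (nth dflt (x :: p) t.+1)))
  = c * fk_sum lambda n K (only t s) x.
Proof.
elim: n K s t c x => [|n IH] K s t c x // tn hK hs /=.
rewrite -bintegralZl; last exact: bmeas_step hK (only_bounded t x hs).
apply: eq_Rint => z; case: t tn => [|t] tn.
  rewrite (_ : shift 1 (only 0 s) = fun _ _ _ => 0)// fk_sum0 addr0.
  under [X in iterated_integral _ _ X]eq_fun do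
    rewrite big_ord_recl/= mulrAC mulrA.
  by rewrite (iterated_mass (K := shift 1 K) n (c * (K 0 x z * s 0 x z)) dflt z
    (kernel_shift 1 hK)) !mulrA.
under [X in iterated_integral _ _ X]eq_fun do
  rewrite big_ord_recl/= -mulrA mulrA.
rewrite (IH (shift 1 K) (shift 1 s) t (c * K 0 x z) z tn (kernel_shift 1 hK)
  (cost_shift 1 hs)) mul0r add0r mulrA.
by congr (_ * fk_sum _ _ _ _ _).
Qed.

End feynman_kac_linear.

Section block_stat_fk.
Context {R : realType} {dX dY : measure_display}.
Context {X : measurableType dX} {Y : measurableType dY} {Par : Type} {d : nat}.
Variable lambda : {finite_measure set X -> \bar R}.
Variable chi : probability X R.
Variables (m : Par -> X -> X -> R) (g : Par -> X -> Y -> R).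
Variable S : X -> X -> Y -> 'rV[R]_d.
Hypothesis lambda_gt0 : 0 < fine (lambda setT).
Variables (k1 k2 M : R).
Hypothesis k1_gt0 : 0 < k1.
Variables (th : Par) (T : nat) (y : nat -> Y).

Let K i x z := m th x z * g th z (y (T + i.+1)%N).
Let s k i x z := S x z (y (T + i.+1)%N) 0 k.
Hypothesis hK : kernel_between k1 k2 K.
Hypothesis hs : forall k, cost_bounded M (s k).

Lemma likelihood_fk n :
  likelihood lambda chi m g th T n y = fk_total lambda chi n K.
Proof.
rewrite /likelihood /block_integral /fk_total; apply: eq_Rint => x.
rewrite -[RHS]mul1r -(iterated_mass lambda_gt0 k1_gt0 n 1 x x hK).
congr iterated_integral; apply/funext => p; rewrite mulr1 mul1r.
by apply: eq_bigr.
Qed.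

(** All the ratios in the block statistic share the likelihood as denominator, so their numerators,
    each with a cost at a single time, add up to one additive functional. *)
Lemma block_stat_fk n k :
  block_stat lambda chi m g S th T n y 0 k =
  n%:R^-1 * fk_expect lambda chi n K (s k).
Proof.
rewrite /block_stat mxE; congr (_ * _).
rewrite big_add1 big_mkord summxE /fk_expect.
under eq_bigr do rewrite mxE likelihood_fk.
rewrite -mulr_suml; congr (_ / _).
have bo i (x0 : X) : bounded_measurable (fk_sum lambda n K (only i (s k))).
  exact: (bmeas_fk_sum lambda_gt0 k1_gt0 n hK (only_bounded i x0 (hs k))).
have /=x0 : X := point.
under [RHS]eq_Rint do rewrite (fk_sum_only lambda_gt0 k1_gt0 n _ hK (hs k)).
rewrite bintegral_sum; last by move=> i; exact: bo.
apply: eq_bigr => i _; rewrite /block_integral; apply: eq_Rint => x.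
rewrite -[RHS]mul1r.
rewrite -(iterated_only lambda_gt0 k1_gt0 1 x x (ltn_ord i) hK (hs k)).
congr iterated_integral; apply/funext => p; rewrite mul1r.
by congr (_ * _); apply: eq_bigr.
Qed.

End block_stat_fk.

(** * From rectangles to bounded measurable functions *)

Section monotone_class.
Context {R : realType}.

Lemma bmeas_quantize {d} {T : measurableType d} (f : T -> R) (e : R) :
  bounded_measurable f -> 0 < e ->
  exists (n : nat) (c : nat -> R) (D : nat -> set T),
    (forall k, measurable (D k)) /\
    forall x, `|f x - \sum_(k < n) c k * \1_(D k) x| <= e.
Proof.
move=> [mf [M fM]] e0.
have fM0 x : 0 <= f x + M by have := fM x; rewrite ler_norml => /andP[]; lra.
(* Slices of height e of f + M, which lies in [0, 2 M]; this gives the number of slices and the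
   values e k - M. *)
pose D k := [set x | k%:R <= (f x + M) / e < k.+1%:R].
exists (Num.truncn (2 * M / e)).+1, (fun k => e * k%:R - M), D; split.
  move=> k; rewrite (_ : D k = (fun x => (f x + M) / e) @^-1` `[k%:R, k.+1%:R[%classic).
    rewrite -[X in measurable X]setTI.
    by apply: measurable_funM => //; apply: measurable_funD.
  by apply/seteqP; split=> x; rewrite /D /= in_itv.
move=> x; set q := (f x + M) / e.
have q0 : 0 <= q by rewrite divr_ge0// ltW.
have [k1 k2] := andP (truncn_itv q0).
have tn : (Num.truncn q < (Num.truncn (2 * M / e)).+1)%N.
  rewrite ltnS; apply: le_truncn; rewrite ler_pM2r ?invr_gt0//.
  by have := fM x; rewrite ler_norml => /andP[]; lra.
rewrite (bigD1 (Ordinal tn))//= big1 ?addr0.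
  rewrite indicE mem_set ?mulr1; last by rewrite /D/= k1 k2.
  have -> : f x - (e * (Num.truncn q)%:R - M) = e * (q - (Num.truncn q)%:R).
    by rewrite mulrBr /q mulrCA divff ?gt_eqF// mulr1; ring.
  have h : q <= (Num.truncn q)%:R + 1 by rewrite natr1 ltW.
  have h1 : 0 <= q - (Num.truncn q)%:R by lra.
  have h2 : q - (Num.truncn q)%:R <= 1 by lra.
  by rewrite ger0_norm ?mulr_ge0 ?(ltW e0)// ler_piMr// ltW.
move=> i; rewrite -val_eqE/= => ni; rewrite indicE memNset ?mulr0//.
rewrite /D/= -/q => /andP[i1 i2]; move/eqP: ni; apply.
by apply/eqP; rewrite eq_sym; apply/eqP/truncn_def; rewrite i1 i2.
Qed.

Context {d1 d2 : measure_display} {T1 : measurableType d1} {T2 : measurableType d2}.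

(** The functional form of the pi-lambda theorem. It turns the product rule of [cond_iid], stated
    for events, into identities between integrals of functions of the conditioning variable and one
    draw. *)
Lemma rectangle_functional (Phi : (T1 * T2 -> R) -> R) :
  (forall f g, bounded_measurable f -> bounded_measurable g ->
    Phi (fun z => f z + g z) = Phi f + Phi g) ->
  (forall c f, bounded_measurable f -> Phi (fun z => c * f z) = c * Phi f) ->
  (forall (f : nat -> T1 * T2 -> R) g (M : R), (forall n, bounded_measurable (f n)) ->
    bounded_measurable g -> (forall n z, `|f n z| <= M) ->
    (forall z, f n z @[n --> \oo] --> g z) ->
    Phi (f n) @[n --> \oo] --> Phi g) ->
  (forall A B, measurable A -> measurable B ->
    Phi (fun z => \1_A z.1 * \1_B z.2) = 0) ->
  forall f, bounded_measurable f -> Phi f = 0.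
Proof.
move=> PhiD PhiZ Phicvg PhiR.
have R1 : forall A B, measurable A -> measurable B -> Phi (\1_(A `*` B)) = 0.
  move=> A B mA mB; rewrite -(PhiR A B mA mB); congr Phi; apply/funext => z.
  by rewrite !indicE in_setX; case: (_ \in _); case: (_ \in _); rewrite /= ?(mulr0, mul0r, mulr1).
have PT : Phi (fun=> 1) = 0.
  rewrite -(R1 setT setT)//; congr Phi; apply/funext => z.
  by rewrite setXTT indicE in_setT.
have P0 : Phi (fun=> 0) = 0.
  rewrite -[RHS](mul0r (Phi (fun=> 0))) -PhiZ; last exact: bmeas_cst.
  by congr Phi; apply/funext => z; rewrite mul0r.
have Psum n (F : nat -> T1 * T2 -> R) : (forall k, bounded_measurable (F k)) ->
    Phi (fun z => \sum_(k < n) F k z) = \sum_(k < n) Phi (F k).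
  move=> bF; elim: n => [|n IH].
    by rewrite big_ord0 -[RHS]P0; congr Phi; apply/funext => z; rewrite big_ord0.
  rewrite big_ord_recr/= -IH -PhiD//; last exact: bmeas_sum.
  by congr Phi; apply/funext => z; rewrite big_ord_recr.
(* The sets whose indicator is killed by [Phi] form a Dynkin system: complements by linearity,
   disjoint unions by bounded convergence of the partial sums of indicators. *)
have PI D : measurable D -> Phi (\1_D) = 0.
  move=> mD; move: D mD; rewrite measurable_prod_measurableType.
  apply: dynkin_induction => /=.
  - by rewrite measurable_prod_measurableType.
  - move=> _ _ [A1 mA1 [A2 mA2 <-]] [B1 mB1 [B2 mB2 <-]].
    exists (A1 `&` B1); first exact: measurableI.
    exists (A2 `&` B2); first exact: measurableI.
    by rewrite setXI.
  - by rewrite -[RHS]PT; congr Phi; apply/funext => z; rewrite indicE in_setT.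
  - by move=> _ [A mA [B mB <-]]; exact: R1.
  - move=> S mS PS.
    have : Phi (fun z => 1 + -1 * \1_S z) = 0.
      rewrite PhiD ?PhiZ ?PT ?PS ?mulr0 ?addr0//.
      + exact: bmeas_indic.
      + exact: bmeas_cst.
      + by apply: bmeasZ; exact: bmeas_indic.
    move=> <-; congr Phi; apply/funext => z.
    by rewrite !indicE in_setC; case: (_ \in _) => /=; rewrite ?mulr1 ?mulr0 ?subrr ?addr0.
  - move=> F mF tF PF.
    have : Phi (fun z => \sum_(k < n) \1_(F k) z) @[n --> \oo] --> Phi (\1_(\bigcup_k F k)).
      have cvgF z : \sum_(k < n) \1_(F k) z @[n --> \oo] --> (\1_(\bigcup_k F k) z : R).
        have [[k _ Fk]|nF] := pselect ((\bigcup_k F k) z).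
          rewrite indicE mem_set; last by exists k.
          apply: cvg_near_cst; exists k.+1 => // n /= kn.
          rewrite (bigD1 (Ordinal kn))//= indicE mem_set// big1 ?addr0// => i.
          rewrite -val_eqE/= => ik; rewrite indicE memNset// => Fi.
          move/eqP: ik; apply.
          by apply: (tF i k I I); exists z.
        rewrite indicE memNset//; apply: cvg_near_cst; exists 0%N => // n _.
        by rewrite big1// => i _; rewrite indicE memNset// => Fi; apply: nF; exists i.
      have le1 n z : `|\sum_(k < n) \1_(F k) z| <= (1 : R).
        have [[k [kn Fk]]|nF] := pselect (exists k, (k < n)%N /\ F k z).
          rewrite (bigD1 (Ordinal kn))//= indicE mem_set// big1 ?addr0 ?normr1// => i.
          rewrite -val_eqE/= => ik; rewrite indicE memNset// => Fi.
          move/eqP: ik; apply.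
          by apply: (tF i k I I); exists z.
        rewrite big1 ?normr0// => i _; rewrite indicE memNset// => Fi.
        by apply: nF; exists i; split.
      apply: (Phicvg (fun n z => \sum_(k < n) \1_(F k) z) _ 1) => //.
        by move=> n; apply: bmeas_sum => k; exact: bmeas_indic.
      by apply: bmeas_indic; exact: bigcup_measurable.
    move=> /cvg_lim <- //; rewrite (_ : (fun n => _) = fun=> 0); first exact: lim_cst.
    apply/funext => n; rewrite (Psum n (fun k => \1_(F k))); last by move=> k; exact: bmeas_indic.
    by rewrite big1.
move=> f bf.
have He n : (0 : R) < n.+1%:R^-1 by rewrite invr_gt0.
have /choice[nn /choice[cc /choice[DD H]]] := fun n => bmeas_quantize bf (He n).
pose fn n z := \sum_(k < nn n) cc n k * \1_(DD n k) z.
have bfn n : bounded_measurable (fn n).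
  by apply: bmeas_sum => k; apply: bmeasZ; apply: bmeas_indic; exact: (H n).1.
have fn0 n : Phi (fn n) = 0.
  rewrite /fn (Psum (nn n) (fun k z => cc n k * \1_(DD n k) z)); last first.
    by move=> k; apply: bmeasZ; apply: bmeas_indic; exact: (H n).1.
  rewrite big1// => k _; rewrite PhiZ ?PI ?mulr0//; first exact: (H n).1.
  by apply: bmeas_indic; exact: (H n).1.
have [mf [M fM]] := bf.
have : Phi (fn n) @[n --> \oo] --> Phi f.
  apply: (Phicvg _ _ (M + 1)) => //.
    move=> n z; have := (H n).2 z; rewrite distrC => h.
    rewrite -[fn n z](subrK (f z)) (le_trans (ler_normD _ _))// addrC lerD//.
    by rewrite (le_trans h)// invf_le1// ler1n.
  move=> z; apply/cvgrPdist_le => e e0.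
  have h := near_infty_natSinv_lt (PosNum e0).
  near=> n; apply: (le_trans ((H n).2 z)); apply: ltW; near: n; exact: h.
under eq_fun do rewrite fn0.
by move=> /cvg_lim <- //; exact: lim_cst.
Unshelve. all: by end_near.
Qed.

End monotone_class.

(** * Second moments of conditionally independent draws *)

Section conditional_second_moment.
Context {R : realType} {dO dT dE dX : measure_display}.
Context {Omega : measurableType dO} {T : measurableType dT}.
Context {E : measurableType dE} {X : measurableType dX}.
Variable P : probability Omega R.
Variable mu : {finite_measure set X -> \bar R}.
Variables (V : Omega -> T) (N : nat) (Z : nat -> Omega -> E).
Hypothesis mV : measurable_fun setT V.
Hypothesis mZ : forall l, (l < N)%N -> measurable_fun setT (Z l).
Variables (n : nat) (e : nat -> X -> E) (p : T -> nat -> X -> R).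
Hypothesis me : forall i, measurable_fun setT (e i).
Hypothesis p_ge0 : forall v i x, 0 <= p v i x.
Hypothesis mp : forall i, measurable_fun setT (fun z : T * X => p z.1 i z.2).
Hypothesis p_total : forall v, (\sum_(i < n) \int[mu]_x (p v i x)%:E = 1)%E.

(* The law with density p v i with respect to mu on the i-th branch e i. *)
Definition mixture (v : T) (f : E -> R) : R :=
  \sum_(i < n) \int[mu]_x (p v i x * f (e i x)).

Hypothesis iidZ : forall (A : set T) (B : nat -> set E), measurable A ->
  (forall l, measurable (B l)) ->
  P (V @^-1` A `&` [set w | forall l, (l < N)%N -> B l (Z l w)]) =
  (\int[P]_(w in V @^-1` A) \prod_(l < N) (mixture (V w) \1_(B l))%:E)%E.

Let mpv v i : measurable_fun setT (p v i).
Proof. exact: (measurableT_comp (mp i) (measurable_pair1 v)). Qed.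

Let p_le1 v (i : 'I_n) : (\int[mu]_x (p v i x)%:E <= 1)%E.
Proof.
rewrite -(p_total v) (bigD1 i)//= leeDl// sume_ge0// => j _.
by apply: integral_ge0 => x _; rewrite lee_fin.
Qed.

Let p_int v (i : 'I_n) : mu.-integrable setT (EFin \o p v i).
Proof.
apply/integrableP; split; first exact/measurable_EFinP.
apply: le_lt_trans (ltry 1); apply: le_trans (p_le1 v i).
by under eq_integral do rewrite /= ger0_norm//.
Qed.

Let pf_int v (i : 'I_n) (f : E -> R) : bounded_measurable f ->
  mu.-integrable setT (EFin \o (fun x => p v i x * f (e i x))).
Proof.
move=> [mf [M fM]].
apply: (@le_integrable _ _ _ mu _ measurableT _ (fun x => (M * p v i x)%:E)) => //.
- apply/measurable_EFinP; apply: measurable_funM; first exact: mpv.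
  exact: measurableT_comp mf (me i).
- move=> x _ /=; rewrite lee_fin normrM normrM (ger0_norm (p_ge0 _ _ _)) mulrC.
  by rewrite ler_wpM2r// (le_trans (fM _))// ler_norm.
- under eq_fun do rewrite EFinM; exact: integrableZl (p_int v i).
Qed.

Lemma mixtureD v f g : bounded_measurable f -> bounded_measurable g ->
  mixture v (fun z => f z + g z) = mixture v f + mixture v g.
Proof.
move=> bf bg; rewrite /mixture -big_split/=; apply: eq_bigr => i _.
rewrite -RintegralD//; [|exact: pf_int|exact: pf_int].
by apply: eq_Rint => x; rewrite mulrDr.
Qed.

Lemma mixtureZ v (c : R) f : bounded_measurable f ->
  mixture v (fun z => c * f z) = c * mixture v f.
Proof.
move=> bf; rewrite /mixture mulr_sumr; apply: eq_bigr => i _.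
rewrite -RintegralZl//; last exact: pf_int.
by apply: eq_Rint => x; rewrite mulrCA.
Qed.

Lemma mixture1 v : mixture v (fun=> 1) = 1.
Proof.
rewrite /mixture; under eq_bigr do under eq_Rint do rewrite mulr1.
have -> : \sum_(i < n) \int[mu]_x p v i x = fine (\sum_(i < n) \int[mu]_x (p v i x)%:E)%E.
  rewrite sum_fine//= => i _.
  exact: integrable_fin_num (p_int v i).
by rewrite p_total.
Qed.

Lemma mixture_bound v (f : E -> R) (M : R) : measurable_fun setT f -> (forall z, `|f z| <= M) ->
  `|mixture v f| <= M.
Proof.
move=> mf fM; have bf : bounded_measurable f by split=> //; exists M.
rewrite -[leRHS]mulr1 -(mixture1 v) /mixture mulr_sumr.
apply: (le_trans (ler_norm_sum _ _ _)); apply: ler_sum => i _.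
apply: (le_trans (le_normr_Rintegral _ (pf_int v i bf))) => //.
have p1 : mu.-integrable setT (EFin \o (fun x => p v i x * 1)).
  exact: (pf_int v i (f := fun=> 1) (bmeas_cst 1)).
rewrite -RintegralZl//; apply: le_Rintegral => //.
- by have := integrable_norm (pf_int v i bf).
- by have := integrableZl measurableT M p1; apply: eq_integrable.
- by move=> x _; rewrite normrM ger0_norm// mulr1 mulrC ler_wpM2r.
Qed.

Lemma bmeas_mixture (f : T * E -> R) : bounded_measurable f ->
  bounded_measurable (fun v => mixture v (fun z => f (v, z))).
Proof.
move=> [mf [M fM]]; split; last first.
  exists M => v; apply: mixture_bound => [|z]; last exact: fM.
  exact: (measurableT_comp mf (measurable_pair1 v)).
rewrite /mixture; apply: measurable_sum => i.
apply: (measurable_Rintegral_param mu (f := fun v x => p v i x * f (v, e i x))).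
apply: measurable_funM; first exact: mp.
apply: (measurableT_comp mf (g := fun z : T * X => (z.1, e i z.2))).
apply: measurable_fun_pair; first exact: measurable_fst.
exact: measurableT_comp (me i) measurable_snd.
Qed.

Let mixture_cvg v (f : nat -> E -> R) g (M : R) :
  (forall n, bounded_measurable (f n)) -> bounded_measurable g ->
  (forall n z, `|f n z| <= M) -> (forall z, f n z @[n --> \oo] --> g z) ->
  mixture v (f n) @[n --> \oo] --> mixture v g.
Proof.
move=> bf bg fM fg; rewrite /mixture.
apply: cvg_big => [|i _]; first by move=> x; exact: add_continuous.
apply: fine_cvg; rewrite fineK; last first.
  exact: integrable_fin_num (pf_int v i bg).
apply: (@dominated_cvg _ _ _ mu _ _ _ _ (fun x => (M * p v i x)%:E)) => //.
- move=> k; apply/measurable_EFinP; apply: measurable_funM; first exact: mpv.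
  exact: measurableT_comp (bf k).1 (me i).
- move=> x _; apply: cvg_EFin; first exact: nearW.
  exact: cvgMr.
- under eq_fun do rewrite EFinM; exact: integrableZl (p_int v i).
- move=> k x _; rewrite lee_fin normrM (ger0_norm (p_ge0 _ _ _)) mulrC.
  by rewrite ler_wpM2r.
Qed.

Let mixture_indic01 v B : measurable B -> 0 <= mixture v \1_B.
Proof.
move=> mB; apply: sumr_ge0 => i _; apply: Rintegral_ge0 => x _.
by rewrite mulr_ge0// indicE.
Qed.

Let bVZ (f : T * E -> R) l : (l < N)%N -> bounded_measurable f ->
  bounded_measurable (fun w => f (V w, Z l w)).
Proof.
move=> lN bf; apply: (bmeas_comp (h := fun w => (V w, Z l w)) bf).
by apply: measurable_fun_pair => //; exact: mZ.
Qed.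

Let bZ (B : set E) l : (l < N)%N -> measurable B ->
  bounded_measurable (fun w => \1_B (Z l w) : R).
Proof.
by move=> lN mB; apply: (bmeas_comp (bmeas_indic mB)); exact: mZ.
Qed.

Let bmix (f : T * E -> R) : bounded_measurable f ->
  bounded_measurable (fun w => mixture (V w) (fun z => f (V w, z))).
Proof. by move=> bf; exact: (bmeas_comp (bmeas_mixture bf) mV). Qed.

Let bf_snd (f : T * E -> R) v : bounded_measurable f ->
  bounded_measurable (fun z => f (v, z)).
Proof. by move=> bf; exact: (bmeas_comp bf (measurable_pair1 v)). Qed.

Let bmixB (B : set E) : measurable B ->
  bounded_measurable (fun w => mixture (V w) \1_B).
Proof.
move=> mB; apply: (bmix (f := fun z => \1_B z.2)).
exact: (bmeas_comp (bmeas_indic mB) measurable_snd).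
Qed.

(** Half of the extension from events to functions: draw l is tested by a function that may also
    depend on V, draw k still by an event. *)
Lemma conditional_pair l k (B : set E) (f : T * E -> R) :
  (l < N)%N -> (k < N)%N -> l != k -> measurable B -> bounded_measurable f ->
  \int[P]_w (f (V w, Z l w) * \1_B (Z k w)) =
  \int[P]_w (mixture (V w) \1_B * mixture (V w) (fun z => f (V w, z))).
Proof.
move=> lN kN lk mB bf; apply/eqP; rewrite -subr_eq0; apply/eqP.
pose Phi (f : T * E -> R) := \int[P]_w (f (V w, Z l w) * \1_B (Z k w)) -
  \int[P]_w (mixture (V w) \1_B * mixture (V w) (fun z => f (V w, z))).
have b1 (g : T * E -> R) : bounded_measurable g ->
    bounded_measurable (fun w => g (V w, Z l w) * \1_B (Z k w)).
  by move=> bg; apply: bmeasM; [exact: (bVZ lN bg)|exact: bZ].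
have b2 (g : T * E -> R) : bounded_measurable g -> bounded_measurable
    (fun w => mixture (V w) \1_B * mixture (V w) (fun z => g (V w, z))).
  by move=> bg; apply: bmeasM; [exact: bmixB|exact: (bmix bg)].
apply: (rectangle_functional (Phi := Phi)) bf => {f}.
- move=> f g bf bg; rewrite /Phi addrACA -opprD -bintegralD//; [|exact: b1|exact: b1].
  rewrite -bintegralD; [|exact: b2|exact: b2].
  congr (_ - _); apply: eq_Rint => w; first by rewrite mulrDl.
  by rewrite mixtureD ?mulrDr//; by [exact: bf_snd|exact: (bf_snd _ bf)|exact: (bf_snd _ bg)].
- move=> c f bf; rewrite /Phi mulrBr -!bintegralZl; [|exact: b2|exact: b1].
  congr (_ - _); apply: eq_Rint => w; first by rewrite mulrA.
  by rewrite mixtureZ 1?mulrCA//; by [exact: bf_snd|exact: (bf_snd _ bf)|exact: (bf_snd _ bg)].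
- move=> f g M bf bg fM fg; rewrite /Phi; apply: cvgB.
    apply: (bounded_cvg_Rintegral (M := M * 1)).
    + by move=> j; have [] := b1 _ (bf j).
    + move=> j w; rewrite normrM ler_pM// indicE.
      by case: (_ \in _); rewrite ?normr1 ?normr0.
    + by move=> w; apply: cvgMl; exact: fg.
  apply: (bounded_cvg_Rintegral (M := 1 * M)).
  + by move=> j; have [] := b2 _ (bf j).
  + move=> j w; rewrite normrM ler_pM//.
      apply: mixture_bound; first by have [] := bmeas_indic (R := R) mB.
      by move=> z; rewrite indicE; case: (_ \in _); rewrite ?normr1 ?normr0.
    apply: mixture_bound; first by have [] := bf_snd (V w) (bf j).
    by move=> z; exact: fM.
  + move=> w; apply: cvgMr; apply: (mixture_cvg (M := M)) => //.
    * by move=> j; by [exact: bf_snd|exact: (bf_snd _ bf)|exact: (bf_snd _ bg)].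
    * by [exact: bf_snd|exact: (bf_snd _ bf)|exact: (bf_snd _ bg)].
- move=> A C mA mC; rewrite /Phi; apply/eqP; rewrite subr_eq0; apply/eqP.
  (* The other draws are left unconstrained, so their factors are the total mass 1 of the
     mixture. *)
  pose D j := if j == l then C else if j == k then B else setT.
  have mD j : measurable (D j) by rewrite /D; case: ifP => // _; case: ifP.
  have lhsE : V @^-1` A `&` [set w | forall j, (j < N)%N -> D j (Z j w)] =
      (fun w => (V w, Z l w)) @^-1` (A `*` C) `&` Z k @^-1` B.
    apply/seteqP; split=> w /=.
      move=> [Aw Dw]; have := Dw _ lN; have := Dw _ kN.
      by rewrite /D eqxx eq_sym (negbTE lk) eqxx.
    move=> [[Aw Cw] Bw]; split=> // j jN; rewrite /D.
    by case: eqP => [->//|_]; case: eqP => [->//|].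
  have prodE w : (\prod_(j < N) (mixture (V w) \1_(D j))%:E =
      (mixture (V w) \1_B * mixture (V w) \1_C)%:E)%E.
    rewrite prodEFin; congr EFin.
    rewrite (bigD1 (Ordinal kN))//= (bigD1 (Ordinal lN))/=; last first.
      by rewrite -val_eqE.
    rewrite /D eqxx (eq_sym k) (negbTE lk) eqxx big1 ?mulr1// => j /andP[jk jl].
    have {}jk : (j == k :> nat) = false by exact: negbTE jk.
    have {}jl : (j == l :> nat) = false by exact: negbTE jl.
    rewrite jl jk -[RHS](mixture1 (V w)).
    by congr mixture; apply/funext => z; rewrite indicE in_setT.
  have := iidZ mA mD; rewrite lhsE.
  under eq_integral do rewrite prodE.
  move=> H.
  have mVZ : measurable ((fun w => (V w, Z l w)) @^-1` (A `*` C) `&` Z k @^-1` B).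
    apply: measurableI; last by rewrite -[X in measurable X]setTI; exact: mZ.
    rewrite -[X in measurable X]setTI.
    apply: (measurable_fun_pair mV (mZ lN)) => //.
    exact: measurableX.
  have mVA : measurable (V @^-1` A) by rewrite -[X in measurable X]setTI; exact: mV.
  transitivity (fine (P ((fun w => (V w, Z l w)) @^-1` (A `*` C) `&` Z k @^-1` B))).
    rewrite -[in RHS](setIT (_ `&` _)) -integral_indic// /Rintegral; congr fine.
    apply: eq_integral => w _; rewrite !indicE; congr EFin; rewrite in_setI.
    have -> : (w \in (fun w => (V w, Z l w)) @^-1` (A `*` C)) = (V w \in A) && (Z l w \in C).
      apply/idP/idP => [/set_mem[a b]|/andP[/set_mem a /set_mem b]].
        by rewrite !mem_set.
      exact/mem_set.
    have -> : (w \in Z k @^-1` B) = (Z k w \in B).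
      by apply/idP/idP => /set_mem h; exact/mem_set.
    by case: (_ \in _); case: (_ \in _); case: (_ \in _); rewrite /= ?(mulr0, mul0r, mulr1).
  rewrite H integral_mkcond /Rintegral; congr fine; apply: eq_integral => w _.
  rewrite patchE; case: ifPn => [|/negP]; rewrite inE/= => Aw.
    congr EFin; congr (_ * _); congr mixture; apply/funext => z.
    by rewrite [\1_A _]indicE mem_set// mul1r.
  rewrite [X in _ * X](_ : _ = 0); first by rewrite mulr0; reflexivity.
  rewrite /mixture big1// => i _; under eq_Rint do rewrite [\1_A _]indicE memNset//= mul0r mulr0.
  by rewrite Rintegral_cst// mul0r.
Qed.

(** The other half of the extension: the test of draw k is reduced to a rectangle, its event on V is
    moved into the factor of draw l, and the centring of f then annihilates the integral. *)
Lemma conditional_uncorrelated l k (f : T * E -> R) :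
  (l < N)%N -> (k < N)%N -> l != k -> bounded_measurable f ->
  (forall v, mixture v (fun z => f (v, z)) = 0) ->
  \int[P]_w (f (V w, Z l w) * f (V w, Z k w)) = 0.
Proof.
move=> lN kN lk bf f0.
pose Phi (h : T * E -> R) := \int[P]_w (f (V w, Z l w) * h (V w, Z k w)).
have b1 (g : T * E -> R) : bounded_measurable g ->
    bounded_measurable (fun w => f (V w, Z l w) * g (V w, Z k w)).
  by move=> bg; apply: bmeasM; [exact: (bVZ lN bf)|exact: (bVZ kN bg)].
apply: (rectangle_functional (Phi := Phi)) => //.
- move=> g h bg bh; rewrite /Phi -bintegralD//; [|exact: b1|exact: b1].
  by apply: eq_Rint => w; rewrite mulrDr.
- move=> c g bg; rewrite /Phi -!bintegralZl; last exact: b1.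
  by apply: eq_Rint => w; rewrite mulrCA.
- move=> g h M bg bh gM gh; rewrite /Phi.
  have [_ [M' fM']] := bf.
  apply: (bounded_cvg_Rintegral (M := M' * M)).
  + by move=> j; have [] := b1 _ (bg j).
  + by move=> j w; rewrite normrM ler_pM.
  + by move=> w; apply: cvgMr; exact: gh.
- move=> A C mA mC; rewrite /Phi.
  pose fA (z : T * E) := \1_A z.1 * f z.
  have bA : bounded_measurable (fun z : T * E => \1_A z.1 : R).
    exact: (bmeas_comp (bmeas_indic mA) measurable_fst).
  have bfA : bounded_measurable fA by apply: bmeasM.
  transitivity (\int[P]_w (fA (V w, Z l w) * \1_C (Z k w))).
    by apply: eq_Rint => w; rewrite /fA/= mulrCA mulrA.
  rewrite (conditional_pair lN kN lk mC bfA).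
  under eq_Rint => w.
    rewrite (_ : mixture (V w) (fun z => fA _) = 0); last first.
      by rewrite /fA/= mixtureZ ?f0 ?mulr0//; by [exact: bf_snd|exact: (bf_snd _ bf)|exact: (bf_snd _ bg)].
    rewrite mulr0; over.
  by rewrite Rintegral_cst// mul0r.
Qed.

Lemma conditional_second_moment (f : T * E -> R) (c : R) :
  measurable_fun setT f -> (forall z, `|f z| <= c) ->
  (forall v, mixture v (fun z => f (v, z)) = 0) ->
  \int[P]_w ((\sum_(l < N) f (V w, Z l w)) ^+ 2) <= N%:R * c ^+ 2.
Proof.
move=> mf fc f0; have bf : bounded_measurable f by split=> //; exists c.
have b1 (l k : 'I_N) : bounded_measurable (fun w => f (V w, Z l w) * f (V w, Z k w)).
  by apply: bmeasM; [exact: (bVZ (ltn_ord l) bf)|exact: (bVZ (ltn_ord k) bf)].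
under eq_Rint do rewrite expr2 mulr_suml; under eq_Rint do under eq_bigr do rewrite mulr_sumr.
rewrite bintegral_sum; last by move=> l; apply: bmeas_sum.
rewrite -[N in leRHS]card_ord -sum1_card natr_sum mulr_suml; apply: ler_sum => l _.
rewrite bintegral_sum// (bigD1 l)//= big1 ?addr0; last first.
  by move=> k kl; rewrite conditional_uncorrelated// eq_sym.
rewrite mul1r -[leRHS]mulr1 (_ : 1 = fine (P setT)); last by rewrite probability_setT.
rewrite -bintegral_cst; apply: le_bintegral => //; first exact: bmeas_cst.
move=> w; rewrite -expr2 -(ger0_norm (sqr_ge0 _)) normrX lerXn2r// nnegrE//.
exact: le_trans (fc (V w, Z l w)).
Qed.

End conditional_second_moment.

(** * Self-normalized importance sampling *)

Section self_normalized.
Context {R : realType} {dO dT dE dX : measure_display}.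
Context {Omega : measurableType dO} {T : measurableType dT}.
Context {E : measurableType dE} {X : measurableType dX}.
Variable P : probability Omega R.
Variable mu : {finite_measure set X -> \bar R}.
Variables (V : Omega -> T) (N : nat) (Z : nat -> Omega -> E).
Hypothesis mV : measurable_fun setT V.
Hypothesis mZ : forall l, (l < N)%N -> measurable_fun setT (Z l).
Variables (n : nat) (e : nat -> X -> E) (p : T -> nat -> X -> R).
Hypothesis me : forall i, measurable_fun setT (e i).
Hypothesis p_ge0 : forall v i x, 0 <= p v i x.
Hypothesis mp : forall i, measurable_fun setT (fun z : T * X => p z.1 i z.2).
Hypothesis p_total : forall v, (\sum_(i < n) \int[mu]_x (p v i x)%:E = 1)%E.
Hypothesis iidZ : forall (A : set T) (B : nat -> set E), measurable A ->
  (forall l, measurable (B l)) ->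
  P (V @^-1` A `&` [set w | forall l, (l < N)%N -> B l (Z l w)]) =
  (\int[P]_(w in V @^-1` A) \prod_(l < N) (mixture mu n e p (V w) \1_(B l))%:E)%E.

Variables (W H : T * E -> R) (psi : T -> R) (b C mu0 : R) (lo : T -> R).
Hypothesis mW : measurable_fun setT W.
Hypothesis mH : measurable_fun setT H.
Hypothesis mpsi : measurable_fun setT psi.
Hypothesis W_bound : forall z, 0 <= W z <= b.
Hypothesis H_bound : forall v z, lo v <= H (v, z) <= lo v + C.
Hypothesis mu0_gt0 : 0 < mu0.
Hypothesis W_mean : forall v, mu0 <= mixture mu n e p v (fun z => W (v, z)).
Hypothesis WH_mean : forall v, mixture mu n e p v (fun z => W (v, z) * H (v, z)) =
  psi v * mixture mu n e p v (fun z => W (v, z)).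
Hypothesis W_gt0 : forall w, 0 < \sum_(l < N) W (V w, Z l w).

Let mix := mixture mu n e p.
Let bW : bounded_measurable W. Proof. exact: bmeas_between W_bound. Qed.
Let bs (f : T * E -> R) v : bounded_measurable f ->
  bounded_measurable (fun z => f (v, z)).
Proof. by move=> bf; exact: (bmeas_comp bf (measurable_pair1 v)). Qed.
Let bWs v : bounded_measurable (fun z => W (v, z)). Proof. exact: (bs v bW). Qed.
Let bHs v : bounded_measurable (fun z => H (v, z)).
Proof.
apply: bmeas_between (H_bound v); exact: (measurableT_comp mH (measurable_pair1 v)).
Qed.

Let mixD v f g : bounded_measurable f -> bounded_measurable g ->
  mix v (fun z => f z + g z) = mix v f + mix v g.
Proof. by move=> bf bg; exact: (mixtureD me p_ge0 mp p_total). Qed.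

Let mixZ v (c : R) f : bounded_measurable f -> mix v (fun z => c * f z) = c * mix v f.
Proof. by move=> bf; exact: (mixtureZ me p_ge0 mp p_total). Qed.

Let mix_ge0 v f : (forall z, 0 <= f z) -> 0 <= mix v f.
Proof.
move=> f0; apply: sumr_ge0 => i _; apply: Rintegral_ge0 => x _.
by rewrite mulr_ge0.
Qed.

Let psi_bound v : lo v <= psi v <= lo v + C.
Proof.
have mW0 : 0 < mix v (fun z => W (v, z)) := lt_le_trans mu0_gt0 (W_mean v).
have W0 z : 0 <= W z by have /andP[] := W_bound z.
(* The weighted mean of an affine function of H is the same affine function of psi; with c = 1 and c
   = -1 the slacks of both bounds become weighted means of nonnegative functions. *)
have key c (a : R) : mix v (fun z => W (v, z) * (c * H (v, z) + a)) =
    (c * psi v + a) * mix v (fun z => W (v, z)).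
  have bWH : bounded_measurable (fun z => W (v, z) * H (v, z)).
    by apply: bmeasM; [exact: bWs|exact: bHs].
  rewrite (_ : (fun z => _) = (fun z => c * (W (v, z) * H (v, z)) + a * W (v, z))).
    rewrite mixD; [|exact: bmeasZ|exact: bmeasZ].
    by rewrite (mixZ v c bWH) (mixZ v a (bWs v)) /mix WH_mean mulrA -mulrDl.
  by apply/funext => z; ring.
rewrite -subr_ge0 -[X in _ && X]subr_ge0 -(pmulr_lge0 _ mW0) -[X in _ && X](pmulr_lge0 _ mW0).
rewrite -[psi v]mul1r -(key 1) (_ : lo v + C - 1 * psi v = -1 * psi v + (lo v + C)); last by ring.
rewrite -key; apply/andP; split; apply: mix_ge0 => z; rewrite mulr_ge0//;
  have /andP[] := H_bound v z; lra.
Qed.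

Let C_ge0 (v : T) : 0 <= C.
Proof. by have /andP[h1 h2] := psi_bound v; have := le_trans h1 h2; lra. Qed.

Let b_ge0 (z : T * E) : 0 <= b.
Proof. by have /andP[h1 h2] := W_bound z; exact: le_trans h2. Qed.

(* Off the event that the empirical mass is at least half its mean, the error
   is only bounded by C, and that event is controlled by the fluctuation of
   the mass itself. *)
Lemma self_normalized_second_moment : (0 < N)%N ->
  \int[P]_w (((\sum_(l < N) W (V w, Z l w) * H (V w, Z l w))
    / (\sum_(l < N) W (V w, Z l w)) - psi (V w)) ^+ 2)
  <= 8 * (b * C) ^+ 2 / mu0 ^+ 2 / N%:R.
Proof.
move=> N0; have N0' : (0 : R) < N%:R by rewrite ltr0n.
pose f (z : T * E) := W z * (H z - psi z.1).
pose f2 (z : T * E) := W z - mix z.1 (fun x => W (z.1, x)).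
have mmW : bounded_measurable (fun v => mix v (fun x => W (v, x))).
  exact: (bmeas_mixture me p_ge0 mp p_total bW).
have mf : measurable_fun setT f.
  apply: measurable_funM => //; apply: measurable_funB => //.
  exact: measurableT_comp mpsi measurable_fst.
have mf2 : measurable_fun setT f2.
  by apply: measurable_funB => //; exact: (measurableT_comp mmW.1 measurable_fst).
have Hpsi z : `|H z - psi z.1| <= C.
  have := H_bound z.1 z.2; rewrite -surjective_pairing => /andP[h1 h2].
  have /andP[h3 h4] := psi_bound z.1.
  by rewrite ler_norml; apply/andP; split; lra.
have W0 z : 0 <= W z by have /andP[] := W_bound z.
have Wb z : W z <= b by have /andP[] := W_bound z.
have fc z : `|f z| <= b * C.
  by rewrite /f normrM ger0_norm// ler_pM.
have mixWb v : 0 <= mix v (fun x => W (v, x)) <= b.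
  rewrite mix_ge0//=; apply: (le_trans (ler_norm _)).
  apply: (mixture_bound me p_ge0 mp p_total); first by have [] := bWs v.
  by move=> z; rewrite ger0_norm.
have f2c z : `|f2 z| <= b.
  have /andP[m1 m2] := mixWb z.1; have := W0 z; have := Wb z.
  by rewrite ler_norml /f2 => w1 w2; apply/andP; split; lra.
have f0 v : mix v (fun z => f (v, z)) = 0.
  rewrite (_ : (fun z => _) = (fun z => W (v, z) * H (v, z) + (- psi v) * W (v, z))).
    rewrite mixD; [|exact: bmeasM|exact: bmeasZ].
    by rewrite mixZ// /mix WH_mean mulNr subrr.
  by apply/funext => z; rewrite /f/=; ring.
have f20 v : mix v (fun z => f2 (v, z)) = 0.
  rewrite (_ : (fun z => _) = (fun z => W (v, z) + (- mix v (fun x => W (v, x))) * 1)).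
    rewrite mixD//; last by apply: bmeasZ; exact: bmeas_cst.
    rewrite mixZ; last exact: bmeas_cst.
    by rewrite (_ : mix v (fun=> 1) = 1) ?mulr1 ?subrr//; exact: mixture1.
  by apply/funext => z; rewrite mulr1.
have M1 := conditional_second_moment mV mZ me p_ge0 mp p_total iidZ mf fc f0.
have M2 := conditional_second_moment mV mZ me p_ge0 mp p_total iidZ mf2 f2c f20.
have mVZ l : (l < N)%N -> measurable_fun setT (fun w => (V w, Z l w)).
  by move=> lN; apply: measurable_fun_pair => //; exact: mZ.
have bsq (h : T * E -> R) c : measurable_fun setT h -> (forall z, `|h z| <= c) ->
    bounded_measurable (fun w => (\sum_(l < N) h (V w, Z l w)) ^+ 2).
  move=> mh hc; have b1 : bounded_measurable (fun w => \sum_(l < N) h (V w, Z l w)).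
    apply: bmeas_sum => l; apply: (bmeas_comp (h := fun w => (V w, Z l w))).
      by split=> //; exists c.
    exact: mVZ.
  by under eq_fun do rewrite expr2; exact: bmeasM.
pose err w := ((\sum_(l < N) W (V w, Z l w) * H (V w, Z l w))
    / (\sum_(l < N) W (V w, Z l w)) - psi (V w)) ^+ 2.
rewrite (eq_Rint P (g := err))//.
have errE w : err w = ((\sum_(l < N) f (V w, Z l w)) / (\sum_(l < N) W (V w, Z l w))) ^+ 2.
  rewrite /err; congr (_ ^+ 2).
  rewrite -[psi (V w)](mulfK (lt0r_neq0 (W_gt0 w))).
  rewrite -mulrBl; congr (_ / _).
  rewrite mulr_sumr -sumrB; apply: eq_bigr => l _; rewrite /f/=; ring.
have pt w : err w <= 4 / mu0 ^+ 2 / N%:R ^+ 2 * ((\sum_(l < N) f (V w, Z l w)) ^+ 2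
    + C ^+ 2 * (\sum_(l < N) f2 (V w, Z l w)) ^+ 2).
  rewrite errE; set A := \sum_(l < N) f _; set D := \sum_(l < N) W _.
  set D2 := \sum_(l < N) f2 _; have D0 : 0 < D := W_gt0 w.
  have m0 := W_mean (V w); set m1 := mixture _ _ _ _ _ _ in m0.
  have D2E : D2 = D - N%:R * m1.
    by rewrite /D2 /f2 sumrB/= sumr_const card_ord -[_ *+ N]mulr_natl.
  have AD : `|A| <= C * D.
    rewrite (le_trans (ler_norm_sum _ _ _))// mulr_sumr; apply: ler_sum => l _.
    by rewrite /f normrM ger0_norm// mulrC ler_wpM2r//; exact: (Hpsi (V w, Z l w)).
  have C0 := C_ge0 (V w).
  have c0 : 0 < 4 / mu0 ^+ 2 / N%:R ^+ 2 by rewrite !divr_gt0// exprn_gt0.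
  have mN0 : 0 < mu0 * N%:R by rewrite mulr_gt0.
  have cE : 4 / mu0 ^+ 2 / N%:R ^+ 2 = 4 / (mu0 * N%:R) ^+ 2.
    by field; rewrite !gt_eqF.
  have mm : mu0 * N%:R <= N%:R * m1 by rewrite mulrC ler_pM2l.
  rewrite cE exprMn exprVn.
  have [hD|hD] := leP (mu0 * N%:R) (2 * D).
    apply: (@le_trans _ _ (4 / (mu0 * N%:R) ^+ 2 * A ^+ 2)); last first.
      rewrite ler_wpM2l ?divr_ge0 ?sqr_ge0// lerDl mulr_ge0 ?sqr_ge0//.
    rewrite mulrC ler_wpM2r ?sqr_ge0// -[leLHS]mul1r ler_pdivrMr ?exprn_gt0//.
    rewrite mulrAC ler_pdivlMr ?exprn_gt0// mul1r.
    have -> : 4 * D ^+ 2 = (2 * D) ^+ 2 by ring.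
    by rewrite lerXn2r// nnegrE ltW// mulr_gt0.
  apply: (@le_trans _ _ (C ^+ 2)).
    rewrite ler_pdivrMr ?exprn_gt0// -exprMn -(ger0_norm (sqr_ge0 A)) normrX.
    by rewrite lerXn2r// nnegrE// mulr_ge0// ltW.
  apply: (@le_trans _ _ (4 / (mu0 * N%:R) ^+ 2 * (C ^+ 2 * D2 ^+ 2))); last first.
    rewrite ler_wpM2l ?divr_ge0 ?sqr_ge0// lerDr sqr_ge0//.
  rewrite mulrCA -[leLHS]mulr1 ler_wpM2l ?sqr_ge0// mulrAC ler_pdivlMr ?exprn_gt0//.
  rewrite mul1r.
  have -> : 4 * D2 ^+ 2 = (2 * (N%:R * m1 - D)) ^+ 2 by rewrite D2E; ring.
  rewrite lerXn2r// ?nnegrE; lra.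
have berr : bounded_measurable err.
  split; last first.
    exists (C ^+ 2) => w; rewrite errE normrX lerXn2r// ?nnegrE// ?(C_ge0 (V w))//.
    rewrite normrM normfV (gtr0_norm (W_gt0 w)) ler_pdivrMr//.
    rewrite (le_trans (ler_norm_sum _ _ _))// mulr_sumr; apply: ler_sum => l _.
    by rewrite /f normrM ger0_norm// mulrC ler_wpM2r//; exact: (Hpsi (V w, Z l w)).
  rewrite (_ : err = fun w => ((\sum_(l < N) f (V w, Z l w)) *
     (\sum_(l < N) W (V w, Z l w))^-1) ^+ 2); last by apply/funext => w; rewrite errE.
  apply: measurable_funX; apply: measurable_funM.
    by apply: measurable_sum => l; exact: (measurableT_comp mf (mVZ _ (ltn_ord l))).
  apply: measurable_funV; apply: measurable_sum => l.
  exact: (measurableT_comp mW (mVZ _ (ltn_ord l))).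
have b1 := bsq f _ mf fc; have b2 := bsq f2 _ mf2 f2c.
apply: (le_trans (le_bintegral P berr _ pt)).
  by apply: bmeasZ; apply: bmeasD => //; exact: bmeasZ.
rewrite bintegralZl; last by apply: bmeasD => //; exact: bmeasZ.
rewrite bintegralD//; last exact: bmeasZ.
rewrite bintegralZl//.
(* Both second moments contribute N (b C)^2, whence the constant 8 and a single power of 1 / N. *)
apply: (@le_trans _ _ (4 / mu0 ^+ 2 / N%:R ^+ 2 *
   (N%:R * (b * C) ^+ 2 + C ^+ 2 * (N%:R * b ^+ 2)))).
  apply: ler_wpM2l; first by rewrite !divr_ge0 ?sqr_ge0.
  by rewrite lerD// ler_wpM2l ?sqr_ge0.
rewrite le_eqVlt; apply/orP; left; apply/eqP; field.
by rewrite !gt_eqF.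
Qed.

End self_normalized.

(** * Particle recursion and exact look-ahead *)

Lemma sum_doeblin (R : realFieldType) (n : nat) (a b Z : 'I_n -> R)
    (k1 k2 lo hi : R) : 0 < k1 -> 0 < k2 ->
  (forall i, 0 <= b i) -> 0 < \sum_i b i -> 0 < \sum_i a i ->
  (forall i, k1 * b i <= a i <= k2 * b i) -> (forall i, lo <= Z i <= hi) ->
  let m := (\sum_i b i * Z i) / \sum_i b i in
  (k1 / k2 * m + (1 - k1 / k2) * lo <= (\sum_i a i * Z i) / \sum_i a i) /\
  ((\sum_i a i * Z i) / \sum_i a i <= k1 / k2 * m + (1 - k1 / k2) * hi).
Proof.
move=> k10 k20 b0 B0 A0 ab Zb m.
have AB : \sum_i a i <= k2 * \sum_i b i.
  by rewrite mulr_sumr; apply: ler_sum => i _; have /andP[] := ab i.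
have key (Z' : 'I_n -> R) : (forall i, 0 <= Z' i) ->
    k1 / k2 * ((\sum_i b i * Z' i) / \sum_i b i) <= (\sum_i a i * Z' i) / \sum_i a i.
  move=> Z0; have m0 : 0 <= (\sum_i b i * Z' i) / \sum_i b i.
    by rewrite divr_ge0 ?(ltW B0)// sumr_ge0// => i _; rewrite mulr_ge0.
  rewrite ler_pdivlMr//; apply: (@le_trans _ _
    (k1 / k2 * ((\sum_i b i * Z' i) / \sum_i b i) * (k2 * \sum_i b i))).
    by rewrite ler_wpM2l// mulr_ge0// divr_ge0// ltW.
  rewrite (_ : _ * (k2 * _) = k1 * \sum_i b i * Z' i); last first.
    by field; rewrite !gt_eqF.
  rewrite mulr_sumr; apply: ler_sum => i _; rewrite mulrA ler_wpM2r//.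
  by have /andP[] := ab i.
have lin (w : 'I_n -> R) c e : 0 < \sum_i w i ->
    (\sum_i w i * (c * Z i + e)) / \sum_i w i = c * ((\sum_i w i * Z i) / \sum_i w i) + e.
  move=> w0; rewrite (eq_bigr (fun i => c * (w i * Z i) + e * w i)); last by move=> i _; ring.
  by rewrite big_split/= -!mulr_sumr mulrDl -mulrA mulfK// gt_eqF.
split.
  have := key (fun i => 1 * Z i + - lo); rewrite !lin// -/m => H.
  have : k1 / k2 * (1 * m + - lo) <= 1 * ((\sum_i a i * Z i) / \sum_i a i) + - lo.
    by apply: H => i; have /andP[] := Zb i; lra.
  lra.
have := key (fun i => -1 * Z i + hi); rewrite !lin// -/m => H.
have : k1 / k2 * (-1 * m + hi) <= -1 * ((\sum_i a i * Z i) / \sum_i a i) + hi.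
  by apply: H => i; have /andP[] := Zb i; lra.
lra.
Qed.

Section particle_recursion.
Context {R : realType} {dX : measure_display} {X : measurableType dX}.
Variable lambda : {finite_measure set X -> \bar R}.
Hypothesis lambda_gt0 : 0 < fine (lambda setT).
Variables (k1 k2 M : R).
Hypothesis k1_gt0 : 0 < k1.
Hypothesis k12 : k1 <= k2.
Variables (N : nat) (K s : nat -> X -> X -> R).
Variables (u : nat -> X -> R) (q : nat -> X -> X -> R).
Variables (x : nat -> nat -> X) (j : nat -> nat -> nat).
Hypothesis N_gt0 : (0 < N)%N.
Hypothesis hK : kernel_between k1 k2 K.
Hypothesis hs : cost_bounded M s.
Hypothesis u_gt0 : forall t z, 0 < u t z.
Hypothesis q_gt0 : forall t z z', 0 < q t.+1 z z'.

(** The algorithm written for the product K of transition and observation densities, with parameter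
    and observations already substituted: K t leads from time t to time t + 1. *)
Definition pweight (t l : nat) : R :=
  if t is t'.+1 then
    K t' (x t' (j t l)) (x t l) / (u t (x t' (j t l)) * q t (x t' (j t l)) (x t l))
  else N%:R^-1.

(** This is t times the statistic R_t of the algorithm, an additive quantity. The observation
    density may sit in K because it cancels in the ratio. *)
Fixpoint psum (t l : nat) : R :=
  if t is t'.+1 then
    (\sum_(i < N) pweight t' i * K t' (x t' i) (x t l)
       * (s t' (x t' i) (x t l) + psum t' i))
    / (\sum_(i < N) pweight t' i * K t' (x t' i) (x t l))
  else 0.

(** The statistic carried by a particle that lands at z at time t + 1. The drawn ancestor does not
    enter, since ancestors are averaged out. *)
Definition pnext (t : nat) (z : X) : R :=
  (\sum_(i < N) pweight t i * K t (x t i) z * (s t (x t i) z + psum t i))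
  / (\sum_(i < N) pweight t i * K t (x t i) z).

(** The estimate obtained when the particles are stopped at time t and exact smoothing takes over.
    At t = tau it is the output of the algorithm, and at t = 0 only the sampling of the initial law
    separates it from the exact value; the error of a block telescopes along t. *)
Definition hybrid (tau t : nat) : R :=
  (\sum_(l < N) pweight t l *
     (fk_mass lambda (tau - t) (shift t K) (x t l) * psum t l
      + fk_sum lambda (tau - t) (shift t K) (shift t s) (x t l)))
  / (\sum_(l < N) pweight t l * fk_mass lambda (tau - t) (shift t K) (x t l)).

Let k2_gt0 : 0 < k2. Proof. exact: lt_le_trans k12. Qed.

Let K_gt0 i z z' : 0 < K i z z'.
Proof. by have /andP[a _] := (hK i).2 z z'; exact: lt_le_trans a. Qed.

Lemma pweight_gt0 t l : 0 < pweight t l.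
Proof.
case: t => [|t]; first by rewrite invr_gt0 ltr0n.
by rewrite divr_gt0// mulr_gt0.
Qed.

Lemma sum_gt0 (F : 'I_N -> R) : (forall i, 0 < F i) -> 0 < \sum_(i < N) F i.
Proof.
move=> F0; rewrite (bigD1 (Ordinal N_gt0))//= ltr_pwDl// sumr_ge0// => i _.
exact: ltW.
Qed.

Let M_ge0 : 0 <= M.
Proof. by rewrite (le_trans _ ((hs 0%N).2 (x 0%N 0%N) (x 0%N 0%N))). Qed.

Lemma pnext_den_gt0 t z : 0 < \sum_(i < N) pweight t i * K t (x t i) z.
Proof. by apply: sum_gt0 => i; rewrite mulr_gt0// pweight_gt0. Qed.

Let average_bound t z (F : 'I_N -> R) (lo hi : R) : (forall i, lo <= F i <= hi) ->
  lo <= (\sum_(i < N) pweight t i * K t (x t i) z * F i)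
     / (\sum_(i < N) pweight t i * K t (x t i) z) <= hi.
Proof.
move=> Fb; have D0 := pnext_den_gt0 t z.
have w0 i : 0 <= pweight t i * K t (x t i) z.
  by rewrite mulr_ge0 ?(ltW (pweight_gt0 _ _)) ?(ltW (K_gt0 _ _ _)).
rewrite ler_pdivlMr// ler_pdivrMr// !mulr_sumr; apply/andP.
split; apply: ler_sum => i _; have /andP[a b] := Fb i.
  by rewrite [leLHS]mulrC ler_wpM2l.
by rewrite [leRHS]mulrC ler_wpM2l.
Qed.

Lemma psum_bound t l : `|psum t l| <= t%:R * M.
Proof.
elim: t l => [|t IH] l /=; first by rewrite normr0 mul0r.
rewrite ler_norml; apply: average_bound => i; rewrite -ler_norml.
rewrite (le_trans (ler_normD _ _))// -natr1 mulrDl mul1r addrC lerD//.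
exact: (hs t).2.
Qed.

Lemma pnext_bound t z : `|pnext t z| <= t.+1%:R * M.
Proof.
rewrite ler_norml; apply: average_bound => i; rewrite -ler_norml.
rewrite (le_trans (ler_normD _ _))// -natr1 mulrDl mul1r addrC lerD ?psum_bound//.
exact: (hs t).2.
Qed.

(** The contraction behind [fk_mean_osc], for particle averages: the weights seen from any z are
    comparable to the same weights [pweight], so the oscillation stays below 2 M / rho whatever t
    and N. *)
Let pnext_osc_of t lo : (forall l, lo <= psum t l <= lo + 2 * M / (k1 / k2)) ->
  exists lo', forall z, lo' <= pnext t z <= lo' + 2 * M / (k1 / k2).
Proof.
move=> hlo; have r0 : 0 < k1 / k2 by rewrite divr_gt0.
pose m := (\sum_(i < N) pweight t i * psum t i) / \sum_(i < N) pweight t i.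
exists (- M + (k1 / k2 * m + (1 - k1 / k2) * lo)) => z.
have D0 := pnext_den_gt0 t z.
have -> : pnext t z = (\sum_(i < N) pweight t i * K t (x t i) z * s t (x t i) z)
     / (\sum_(i < N) pweight t i * K t (x t i) z)
   + (\sum_(i < N) pweight t i * K t (x t i) z * psum t i)
     / (\sum_(i < N) pweight t i * K t (x t i) z).
  rewrite -mulrDl -big_split/=; congr (_ / _).
  by apply: eq_bigr => i _; rewrite mulrDr.
have /andP[s1 s2] := average_bound t z (F := fun i => s t (x t i) z)
   (lo := - M) (hi := M) (fun i => ltac:(rewrite -ler_norml; exact: (hs t).2)).
have [] := @sum_doeblin R N (fun i => pweight t i * K t (x t i) z)
  (fun i => pweight t i) (fun i => psum t i) k1 k2 lo (lo + 2 * M / (k1 / k2)) k1_gt0 k2_gt0.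
- by move=> i; apply/ltW/pweight_gt0.
- by apply: sum_gt0 => i; exact: pweight_gt0.
- exact: D0.
- move=> i; have /andP[a b] := (hK t).2 (x t i) z.
  by rewrite ![_ * pweight _ _]mulrC !ler_wpM2l// ltW// pweight_gt0.
- by move=> i; exact: hlo.
rewrite -/m => f1 f2; apply/andP; split; first exact: lerD.
apply: (le_trans (lerD s2 f2)); rewrite le_eqVlt; apply/orP; left; apply/eqP.
by field; rewrite !gt_eqF.
Qed.

Lemma psum_osc t : exists lo, forall l, lo <= psum t l <= lo + 2 * M / (k1 / k2).
Proof.
elim: t => [|t [lo /pnext_osc_of[lo' hlo']]]; last first.
  by exists lo' => l; exact: (hlo' (x t.+1 l)).
exists 0 => l /=; rewrite lexx add0r /= -mulrA mulr_ge0// mulr_ge0 ?invr_ge0//.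
by rewrite divr_ge0// ltW.
Qed.

Lemma pnext_osc t : exists lo, forall z, lo <= pnext t z <= lo + 2 * M / (k1 / k2).
Proof. by have [lo /pnext_osc_of] := psum_osc t. Qed.

Lemma hybrid_end tau : hybrid tau tau =
  (\sum_(l < N) pweight tau l * psum tau l) / \sum_(l < N) pweight tau l.
Proof.
rewrite /hybrid subnn /=; congr (_ / _); apply: eq_bigr => l _.
  by rewrite mul1r addr0.
by rewrite mulr1.
Qed.

Lemma shift_shift1 (A : Type) t (f : nat -> A) : shift 1 (shift t f) = shift t.+1 f.
Proof. by apply/funext => i; rewrite /shift addnCA addnA. Qed.

(* The exact look-ahead from time t + 1, averaged over one more step of the
   dynamics, is the exact look-ahead from time t. *)
Lemma hybrid_step tau t : (t < tau)%N ->
  let g := fk_mass lambda (tau - t.+1) (shift t.+1 K) in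
  (\sum_(i < N) pweight t i * \int[lambda]_z (K t (x t i) z * g z)
     = \sum_(l < N) pweight t l * fk_mass lambda (tau - t) (shift t K) (x t l)) /\
  (\sum_(i < N) pweight t i * \int[lambda]_z (K t (x t i) z * g z *
      (pnext t z + fk_mean lambda (tau - t.+1) (shift t.+1 K) (shift t.+1 s) z))
   = \sum_(l < N) pweight t l *
     (fk_mass lambda (tau - t) (shift t K) (x t l) * psum t l
      + fk_sum lambda (tau - t) (shift t K) (shift t s) (x t l))).
Proof.
move=> ttau g.
have E : (tau - t)%N = (tau - t.+1).+1 by rewrite subnSK.
have hK1 := kernel_shift t.+1 hK; have hs1 := cost_shift t.+1 hs.
have massE l : fk_mass lambda (tau - t) (shift t K) (x t l) =
    \int[lambda]_z (K t (x t l) z * g z).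
  by rewrite E /= shift_shift1 /shift addn0.
split; first by apply: eq_bigr => i _; rewrite massE.
have sumE l : fk_sum lambda (tau - t) (shift t K) (shift t s) (x t l) =
    \int[lambda]_z (K t (x t l) z * (s t (x t l) z * g z +
      fk_sum lambda (tau - t.+1) (shift t.+1 K) (shift t.+1 s) z)).
  by rewrite E /= !shift_shift1 /shift !addn0.
have bg : bounded_measurable g by have [] := fk_mass_weight lambda_gt0 k1_gt0 (tau - t.+1) hK1.
have bA : bounded_measurable (fk_sum lambda (tau - t.+1) (shift t.+1 K) (shift t.+1 s)).
  exact: (bmeas_fk_sum lambda_gt0 k1_gt0).
have bK i : bounded_measurable (K t (x t i)).
  by have [] := kernel_weight k1_gt0 t (x t i) hK.
have bS i : bounded_measurable (s t (x t i)) by exact: (cost_bmeas _ _ hs).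
have bL i : bounded_measurable (fun z => K t (x t i) z * g z *
    (pnext t z + fk_mean lambda (tau - t.+1) (shift t.+1 K) (shift t.+1 s) z)).
  apply: bmeasM; first exact: bmeasM.
  apply: bmeasD; last exact: (bmeas_fk_mean lambda_gt0 k1_gt0 _ hK1 hs1).
  split; last by exists (t.+1%:R * M) => z; exact: pnext_bound.
  apply: measurable_funM.
    apply: measurable_sum => k; apply: measurable_funM.
      by apply: measurable_funM => //; exact: (bK k).1.
    by apply: measurable_funD => //; exact: (bS k).1.
  apply: measurable_funV; apply: measurable_sum => k.
  by apply: measurable_funM => //; exact: (bK k).1.
have bR i : bounded_measurable (fun z => K t (x t i) z * (s t (x t i) z * g z +
      fk_sum lambda (tau - t.+1) (shift t.+1 K) (shift t.+1 s) z)).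
  by apply: bmeasM => //; apply: bmeasD => //; exact: bmeasM.
have bM i : bounded_measurable (fun z => psum t i * (K t (x t i) z * g z)).
  by apply: bmeasZ; exact: bmeasM.
transitivity (\int[lambda]_z (\sum_(i < N) pweight t i * (K t (x t i) z * g z *
    (pnext t z + fk_mean lambda (tau - t.+1) (shift t.+1 K) (shift t.+1 s) z)))).
  rewrite bintegral_sum; last by move=> i; apply: bmeasZ; exact: bL.
  by apply: eq_bigr => i _; rewrite bintegralZl.
transitivity (\int[lambda]_z (\sum_(i < N) pweight t i *
   (psum t i * (K t (x t i) z * g z) + K t (x t i) z * (s t (x t i) z * g z +
      fk_sum lambda (tau - t.+1) (shift t.+1 K) (shift t.+1 s) z)))).
  apply: eq_Rint => z.
  rewrite -(fk_meanK lambda_gt0 k1_gt0 _ _ _ hK1) -/g.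
  set F := fk_mean _ _ _ _ _.
  have D0 := pnext_den_gt0 t z.
  (* For fixed z the sum over the particles rebuilds the denominator of [pnext] and leaves its
     numerator, which is linear in the costs and in the carried statistics. *)
  rewrite (eq_bigr (fun i : 'I_N => (g z * (pnext t z + F)) * (pweight t i * K t (x t i) z))); last first.
    by move=> i _; ring.
  rewrite -mulr_sumr mulrDr mulrDl -[X in X + _]mulrA {1}/pnext divfK ?gt_eqF//.
  rewrite !mulr_sumr -big_split/=; apply: eq_bigr => i _; ring.
rewrite bintegral_sum; last first.
  by move=> i; apply: bmeasZ; apply: bmeasD; [exact: bM|exact: bR].
apply: eq_bigr => i _; rewrite massE sumE.
rewrite bintegralZl; last by apply: bmeasD; [exact: bM|exact: bR].
rewrite bintegralD; [|exact: bM|exact: bR].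
rewrite bintegralZl; last exact: bmeasM.
by rewrite [psum t i * _]mulrC.
Qed.

End particle_recursion.

(** * Sub-sigma-fields and the mean square particle error of one block *)

Definition sub_measurable {dO d'} {Omega : measurableType dO} {U : measurableType d'}
    (G : set (set Omega)) (f : Omega -> U) : Prop :=
  measurable_fun (setT : set (g_sigma_algebraType G)) (f : g_sigma_algebraType G -> U).

Section sub_measurable.
Context {dO : measure_display} {Omega : measurableType dO}.
Implicit Types G : set (set Omega).

Lemma sub_sigma_measurable G : G `<=` measurable -> <<s G >> `<=` measurable.
Proof. by move=> Gm; apply: smallest_sub => //; exact: sigma_algebra_measurable. Qed.

Lemma measurable_fun_id_sub G : G `<=` measurable ->
  measurable_fun setT (id : Omega -> g_sigma_algebraType G).
Proof. by move=> Gm _ B mB; rewrite setTI; exact: sub_sigma_measurable mB. Qed.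

Lemma measurable_fun_id_sub2 G G' : G `<=` G' ->
  measurable_fun setT (id : g_sigma_algebraType G' -> g_sigma_algebraType G).
Proof. by move=> GG _ B mB; rewrite setTI; exact: (sub_sigma_algebra2 GG). Qed.

Lemma sub_measurableT G {d'} {U : measurableType d'} (f : Omega -> U) :
  G `<=` measurable -> sub_measurable G f -> measurable_fun setT f.
Proof.
by move=> Gm mf; exact: (measurableT_comp mf (measurable_fun_id_sub Gm)).
Qed.

Lemma sub_measurableW G G' {d'} {U : measurableType d'} (f : Omega -> U) :
  G `<=` G' -> sub_measurable G f -> sub_measurable G' f.
Proof.
by move=> GG mf; exact: (measurableT_comp mf (measurable_fun_id_sub2 GG)).
Qed.

End sub_measurable.

(** Cauchy-Schwarz, read off from the nonnegative sum of the (n a_i - S)^2. *)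
Lemma sqr_sum_le (R : realFieldType) (n : nat) (a : 'I_n -> R) :
  (\sum_(i < n) a i) ^+ 2 <= n%:R * \sum_(i < n) a i ^+ 2.
Proof.
case: n a => [|n] a; first by rewrite !big_ord0 expr0n/= mul0r.
set m := n.+1; have m0 : (0 : R) < m%:R by rewrite ltr0n.
set S := \sum_(i < m) a i.
have : 0 <= \sum_(i < m) (m%:R * a i - S) ^+ 2 by apply: sumr_ge0 => i _; exact: sqr_ge0.
rewrite (eq_bigr (fun i => m%:R ^+ 2 * a i ^+ 2 + (- (2 * m%:R * S) * a i + S ^+ 2))); last first.
  by move=> i _; ring.
have -> : \sum_(i < m) (m%:R ^+ 2 * a i ^+ 2 + (- (2 * m%:R * S) * a i + S ^+ 2)) =
    m%:R ^+ 2 * \sum_(i < m) a i ^+ 2 + (- (2 * m%:R * S) * S + m%:R * S ^+ 2).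
  rewrite big_split/= -mulr_sumr big_split/= -mulr_sumr; congr (_ + (_ + _)).
  by rewrite sumr_const card_ord mulr_natl.
move=> H.
rewrite -(ler_pM2l m0) -subr_ge0; apply: le_trans H _.
by rewrite le_eqVlt; apply/orP; left; apply/eqP; ring.
Qed.

Section particle_block.
Context {R : realType} {dO dX : measure_display}.
Context {Omega : measurableType dO} {X : measurableType dX}.
Variable P : probability Omega R.
Variable lambda : {finite_measure set X -> \bar R}.
Variable chi : probability X R.
Hypothesis lambda_gt0 : 0 < fine (lambda setT).
Variables (k1 k2 M U B : R).
Hypothesis k1_gt0 : 0 < k1.
Hypothesis k12 : k1 <= k2.
Variables (tau N : nat) (G : nat -> set (set Omega)).
Variables (K s : Omega -> nat -> X -> X -> R).
Variables (u : nat -> X -> R) (q : nat -> X -> X -> R).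
Variables (xi : nat -> nat -> Omega -> X) (J : nat -> nat -> Omega -> nat).
Hypothesis N_gt0 : (0 < N)%N.
Hypothesis G_measurable : forall t, (t <= tau.+1)%N -> G t `<=` measurable.
Hypothesis G_mono : forall t t', (t <= t')%N -> G t `<=` G t'.
Hypothesis mK : forall i, measurable_fun setT
  (fun z : g_sigma_algebraType (G 0) * X * X => K z.1.1 i z.1.2 z.2).
Hypothesis ms : forall i, measurable_fun setT
  (fun z : g_sigma_algebraType (G 0) * X * X => s z.1.1 i z.1.2 z.2).
Hypothesis K_bound : forall w i x z, k1 <= K w i x z <= k2.
Hypothesis s_bound : forall w i x z, `|s w i x z| <= M.
Hypothesis mu : forall t, measurable_fun setT (u t).
Hypothesis u_bound : forall t x, 0 < u t x <= U.
Hypothesis mq : forall t, measurable_fun setT (fun z : X * X => q t z.1 z.2).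
Hypothesis q_gt0 : forall t x z, 0 < q t.+1 x z.
Hypothesis q_total : forall t x, (\int[lambda]_z (q t x z)%:E = 1)%E.
Hypothesis weight_bound : forall w i x z,
  K w i x z / (u i.+1 x * q i.+1 x z) <= B.
Hypothesis mxi : forall t l, (t <= tau)%N -> (l < N)%N ->
  sub_measurable (G t.+1) (xi t l).
Hypothesis mxiT : forall t l, (t <= tau)%N -> (l < N)%N ->
  measurable_fun setT (xi t l).
Hypothesis mJ : forall t l, (t.+1 <= tau)%N -> (l < N)%N ->
  sub_measurable (G t.+2) (J t.+1 l).
Hypothesis mJT : forall t l, (t.+1 <= tau)%N -> (l < N)%N ->
  measurable_fun setT (J t.+1 l).
Hypothesis J_lt : forall t l w, (J t l w < N)%N.

Let x_ (w : Omega) t l := xi t l w.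
Let j_ (w : Omega) t l := J t l w.
Let wt w t l := pweight N (K w) u q (x_ w) (j_ w) t l.
Let ps w t l := psum N (K w) (s w) u q (x_ w) (j_ w) t l.
Let pn w t z := pnext N (K w) (s w) u q (x_ w) (j_ w) t z.
Let hyb w t := hybrid lambda N (K w) (s w) u q (x_ w) (j_ w) tau t.

(** The normalized proposal density on the branch of ancestor i; it makes the law of a pair of
    ancestor and particle an instance of [mixture] with branch maps [pair]. *)
Definition proposal_density (w : Omega) (t i : nat) (z : X) : R :=
  if (i < N)%N then
    pweight N (K w) u q (fun t l => xi t l w) (fun t l => J t l w) t i
    * u t.+1 (xi t i w) * q t.+1 (xi t i w) z
    / \sum_(k < N) pweight N (K w) u q (fun t l => xi t l w) (fun t l => J t l w) t k
        * u t.+1 (xi t k w)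
  else 0.

Hypothesis iid0 : cond_iid P <<s G 0>> N (xi 0) (fun=> chi).
Hypothesis iidS : forall t, (t < tau)%N ->
  cond_iid P <<s G t.+1>> N (fun l w => (J t.+1 l w, xi t.+1 l w))
    (fun w D => (mixture lambda N pair (fun w => proposal_density w t) w \1_D)%:E).

Let k2_gt0 : 0 < k2. Proof. exact: lt_le_trans k12. Qed.
Let rho_gt0 : 0 < k1 / k2. Proof. by rewrite divr_gt0. Qed.

Let hK w : kernel_between k1 k2 (K w).
Proof.
move=> i; split; last exact: K_bound.
apply: (measurableT_comp (mK i) (g := fun z : X * X => ((w : g_sigma_algebraType (G 0), z.1), z.2))).
apply: measurable_fun_pair; last exact: measurable_snd.
by apply: measurable_fun_pair; [exact: measurable_cst|exact: measurable_fst].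
Qed.

Let hs w : cost_bounded M (s w).
Proof.
move=> i; split; last exact: s_bound.
apply: (measurableT_comp (ms i) (g := fun z : X * X => ((w : g_sigma_algebraType (G 0), z.1), z.2))).
apply: measurable_fun_pair; last exact: measurable_snd.
by apply: measurable_fun_pair; [exact: measurable_cst|exact: measurable_fst].
Qed.

Let u_gt0 t z : 0 < u t z. Proof. by have /andP[] := u_bound t z. Qed.

Let wt_gt0 w t l : 0 < wt w t l.
Proof. exact: (pweight_gt0 k1_gt0 (x_ w) (j_ w) N_gt0 (hK w) u_gt0 q_gt0). Qed.

Section at_time.
Context {dT : measure_display} {T : measurableType dT}.

Lemma measurable_K_comp i (a : T -> g_sigma_algebraType (G 0)) (b c : T -> X) :
  measurable_fun setT a -> measurable_fun setT b -> measurable_fun setT c ->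
  measurable_fun setT (fun z => K (a z) i (b z) (c z)).
Proof.
move=> ma mb mc; apply: (measurableT_comp (mK i) (g := fun z => ((a z, b z), c z))).
by apply: measurable_fun_pair => //; exact: measurable_fun_pair.
Qed.

Lemma measurable_s_comp i (a : T -> g_sigma_algebraType (G 0)) (b c : T -> X) :
  measurable_fun setT a -> measurable_fun setT b -> measurable_fun setT c ->
  measurable_fun setT (fun z => s (a z) i (b z) (c z)).
Proof.
move=> ma mb mc; apply: (measurableT_comp (ms i) (g := fun z => ((a z, b z), c z))).
by apply: measurable_fun_pair => //; exact: measurable_fun_pair.
Qed.

Lemma measurable_q_comp t (b c : T -> X) :
  measurable_fun setT b -> measurable_fun setT c ->
  measurable_fun setT (fun z => q t (b z) (c z)).
Proof.
move=> mb mc; apply: (measurableT_comp (mq t) (g := fun z => (b z, c z))).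
exact: measurable_fun_pair.
Qed.

End at_time.

Let HG t := g_sigma_algebraType (G t).

Let mid t : measurable_fun setT (id : HG t -> HG 0).
Proof. by apply: measurable_fun_id_sub2; exact: G_mono. Qed.

Let mxi' t t' l : (t' <= t)%N -> (t <= tau)%N -> (l < N)%N ->
  measurable_fun setT (xi t' l : HG t.+1 -> X).
Proof.
move=> t't tt lN; apply: (sub_measurableW (G := G t'.+1)); first exact: G_mono.
by apply: mxi => //; exact: leq_trans tt.
Qed.

Let mwt t t' l : (t' <= t)%N -> (t <= tau)%N -> (l < N)%N ->
  measurable_fun setT ((fun w => wt w t' l) : HG t.+1 -> R).
Proof.
case: t' => [|t'] t't tt lN; first exact: measurable_cst.
(* A quantity indexed by a random ancestor becomes a finite sum over the possible ancestors of
   indicators times measurable terms. *)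
rewrite (_ : (fun w => _) = (fun w : HG t.+1 => \sum_(i < N) \1_[set (i : nat)] (J t'.+1 l w) *
   (K w t' (xi t' i w) (xi t'.+1 l w) /
    (u t'.+1 (xi t' i w) * q t'.+1 (xi t' i w) (xi t'.+1 l w))))); last first.
  apply/funext => w; rewrite (bigD1 (Ordinal (J_lt t'.+1 l w)))//= indicE mem_set// mul1r.
  rewrite big1 ?addr0// => i iJ; rewrite indicE memNset ?mul0r//= => Ji.
  by move/eqP: iJ; apply; apply/val_inj; rewrite /= Ji.
apply: measurable_sum => i; apply: measurable_funM.
  apply: (measurableT_comp (measurable_indic _)) => //.
  apply: (sub_measurableW (G := G t'.+2)); first exact: G_mono.
  by apply: mJ => //; exact: leq_trans t't tt.
have h1 := mxi' (ltnW t't) tt (ltn_ord i); have h2 := mxi' t't tt lN.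
apply: measurable_funM; first exact: (measurable_K_comp _ (@mid t.+1) h1 h2).
apply: measurable_funV; apply: measurable_funM; last exact: (measurable_q_comp _ h1 h2).
exact: measurableT_comp (mu _) h1.
Qed.

Let mps t t' l : (t' <= t)%N -> (t <= tau)%N -> (l < N)%N ->
  measurable_fun setT ((fun w => ps w t' l) : HG t.+1 -> R).
Proof.
elim: t' l => [|t' IH] l t't tt lN; first exact: measurable_cst.
have h1 i := mxi' (ltnW t't) tt (ltn_ord i); have h2 := mxi' t't tt lN.
have h3 i := mwt (ltnW t't) tt (ltn_ord i).
apply: measurable_funM.
  apply: measurable_sum => i; apply: measurable_funM.
    by apply: measurable_funM; [exact: h3|exact: (measurable_K_comp _ (@mid t.+1) (h1 i) h2)].
  apply: measurable_funD; first exact: (measurable_s_comp _ (@mid t.+1) (h1 i) h2).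
  by apply: IH => //; exact: ltnW.
apply: measurable_funV; apply: measurable_sum => i.
by apply: measurable_funM; [exact: h3|exact: (measurable_K_comp _ (@mid t.+1) (h1 i) h2)].
Qed.

Let fstX {dT} {T : measurableType dT} {dV} {V : measurableType dV} (f : T -> V) :
  measurable_fun setT f -> measurable_fun setT (fun z : T * X => f z.1).
Proof. by move=> mf; exact: measurableT_comp mf measurable_fst. Qed.

Let mpn t : (t <= tau)%N ->
  measurable_fun setT (fun z : HG t.+1 * X => pn z.1 t z.2).
Proof.
move=> tt; have h1 i := fstX (mxi' (leqnn t) tt (ltn_ord i)).
have h3 i := fstX (mwt (leqnn t) tt (ltn_ord i)).
have h4 i := fstX (mps (leqnn t) tt (ltn_ord i)).
have h5 := fstX (@mid t.+1).
have m2 : measurable_fun setT (snd : HG t.+1 * X -> X) by exact: measurable_snd.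
apply: measurable_funM.
  apply: measurable_sum => i; apply: measurable_funM.
    by apply: measurable_funM; [exact: h3|exact: (measurable_K_comp _ h5 (h1 i) m2)].
  apply: measurable_funD; first exact: (measurable_s_comp _ h5 (h1 i) m2).
  exact: h4.
apply: measurable_funV; apply: measurable_sum => i.
by apply: measurable_funM; [exact: h3|exact: (measurable_K_comp _ h5 (h1 i) m2)].
Qed.

Let mmass n t r : measurable_fun setT
  (fun z : HG r * X => fk_mass lambda n (shift t (K z.1)) z.2).
Proof.
apply: (measurable_fk_mass lambda n (K := fun w : HG r => shift t (K w))) => i.
apply: measurable_K_comp; last exact: measurable_snd.
  exact: (measurableT_comp (@mid r) (measurableT_comp measurable_fst measurable_fst)).
exact: measurableT_comp measurable_snd measurable_fst.
Qed.

Let mfsum n t r : measurable_fun setT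
  (fun z : HG r * X => fk_sum lambda n (shift t (K z.1)) (shift t (s z.1)) z.2).
Proof.
apply: (measurable_fk_sum lambda n (K := fun w : HG r => shift t (K w))
  (s := fun w : HG r => shift t (s w))) => i.
  apply: measurable_K_comp; last exact: measurable_snd.
    exact: (measurableT_comp (@mid r) (measurableT_comp measurable_fst measurable_fst)).
  exact: measurableT_comp measurable_snd measurable_fst.
apply: measurable_s_comp; last exact: measurable_snd.
  exact: (measurableT_comp (@mid r) (measurableT_comp measurable_fst measurable_fst)).
exact: measurableT_comp measurable_snd measurable_fst.
Qed.

Let mpairX r (f : HG r -> X) : measurable_fun setT f ->
  measurable_fun setT (fun w : HG r => (w, f w)).
Proof. by move=> mf; apply: measurable_fun_pair. Qed.

Let mhyb t : (t <= tau)%N -> measurable_fun setT ((fun w => hyb w t) : HG t.+1 -> R).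
Proof.
move=> tt; have h1 i := mxi' (leqnn t) tt (ltn_ord i).
have h3 i := mwt (leqnn t) tt (ltn_ord i); have h4 i := mps (leqnn t) tt (ltn_ord i).
have h5 i := measurableT_comp (@mmass (tau - t) t t.+1) (mpairX (h1 i)).
have h6 i := measurableT_comp (@mfsum (tau - t) t t.+1) (mpairX (h1 i)).
apply: measurable_funM.
  apply: measurable_sum => i; apply: measurable_funM; first exact: h3.
  apply: measurable_funD; last exact: h6.
  by apply: measurable_funM; [exact: h5|exact: h4].
apply: measurable_funV; apply: measurable_sum => i.
by apply: measurable_funM; [exact: h3|exact: h5].
Qed.

(** Twice 2 M / rho: once for the statistic already carried by the particles, once for the exact
    mean of the remaining steps. *)
Let C := 4 * M / (k1 / k2).

Lemma particle_initial_error :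
  \int[P]_w ((hyb w 0 - fk_expect lambda chi tau (K w) (s w)) ^+ 2)
    <= 8 * ((k1 / k2)^-1 * C) ^+ 2 / (k1 / k2) ^+ 2 / N%:R.
Proof.
have chi1 : fine (chi setT) = 1 by rewrite probability_setT.
have /= x0 : X := point.
have M0 : 0 <= M by rewrite (le_trans _ (s_bound point 0 x0 x0)).
have MC : 2 * M / (k1 / k2) <= C.
  by rewrite /C ler_wpM2r ?invr_ge0 ?(ltW rho_gt0)// ler_wpM2r// ler_nat.
pose g w := fk_mass lambda tau (K w).
have g0 w z : 0 < g w z by exact: (fk_mass_gt0 lambda_gt0 k1_gt0 _ _ (hK w)).
(* Look-ahead masses may grow or decay geometrically with the number of steps. Divided by their
   value at a reference point they stay between rho and 1 / rho, and self-normalized ratios do not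
   change. *)
pose W (z : HG 0 * X) := g z.1 z.2 / g z.1 x0.
pose H (z : HG 0 * X) := fk_mean lambda tau (K z.1) (s z.1) z.2.
have shift0 (A : Type) (f : nat -> A) : shift 0 f = f by [].
have mg : measurable_fun setT (fun z : HG 0 * X => g z.1 z.2) by exact: (@mmass tau 0 0).
have mg0 : measurable_fun setT (fun z : HG 0 * X => g z.1 x0).
  apply: (measurableT_comp mg (g := fun z : HG 0 * X => (z.1, x0))).
  by apply: measurable_fun_pair; [exact: measurable_fst|exact: measurable_cst].
have mW : measurable_fun setT W.
  by apply: measurable_funM => //; exact: measurable_funV.
have mH : measurable_fun setT H.
  by apply: measurable_funM; [exact: (@mfsum tau 0 0)|exact: measurable_funV].
have Wb z : k1 / k2 <= W z <= (k1 / k2)^-1.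
  rewrite /W ler_pdivlMr// ler_pdivrMr// (fk_mass_ratio lambda_gt0 k1_gt0 k12 _ _ _ (hK _))/=.
  by rewrite mulrC ler_pdivlMr// mulrC (fk_mass_ratio lambda_gt0 k1_gt0 k12 _ _ _ (hK _)).
have W0 z : 0 < W z by have /andP[h _] := Wb z; exact: lt_le_trans h.
have /choice[lo Hlo] v := fk_mean_osc lambda_gt0 k1_gt0 k12 tau (hK v) (hs v).
have mixE (v : HG 0) (f : X -> R) : mixture chi 1 (fun=> id) (fun _ _ _ => 1) v f = \int[chi]_x f x.
  by rewrite /mixture big_ord1; apply: eq_Rint => x; rewrite mul1r.
have bg v : bounded_measurable (g v).
  by have [] := fk_mass_weight lambda_gt0 k1_gt0 tau (hK v).
have mpsi : measurable_fun setT ((fun w => fk_expect lambda chi tau (K w) (s w)) : HG 0 -> R).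
  apply: measurable_funM.
    exact: (measurable_Rintegral_param chi (f := fun w : HG 0 => fk_sum lambda tau (K w) (s w)) (@mfsum tau 0 0)).
  apply: measurable_funV.
  exact: (measurable_Rintegral_param chi (f := fun w : HG 0 => fk_mass lambda tau (K w)) (@mmass tau 0 0)).
have intW v : \int[chi]_x W (v, x) = fk_total lambda chi tau (K v) / g v x0.
  by rewrite /W /= bintegralZr.
have t0 v : 0 < fk_total lambda chi tau (K v).
  by apply: (fk_total_gt0 _ lambda_gt0 k1_gt0 _ (hK v)).
have ratioZ (c : R) (a b : 'I_N -> R) : c != 0 ->
    (\sum_i c * a i) / (\sum_i c * b i) = (\sum_i a i) / (\sum_i b i).
  by move=> c0; rewrite -!mulr_sumr -mulf_div divff// mul1r.
have E1 w : hyb w 0 = (\sum_(l < N) W (w, xi 0 l w) * H (w, xi 0 l w))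
    / (\sum_(l < N) W (w, xi 0 l w)).
  rewrite /hyb /hybrid subn0 !shift0 /=.
  rewrite ratioZ; last by rewrite invr_eq0 pnatr_eq0 -lt0n.
  rewrite -[LHS](ratioZ (g w x0)^-1); last by rewrite invr_eq0 gt_eqF.
  congr (_ / _); apply: eq_bigr => l _; last by rewrite mulrC.
  rewrite /W /H /= mulr0 add0r -(fk_meanK lambda_gt0 k1_gt0 _ _ _ (hK w)).
  by rewrite -/(g w) mulrA [_^-1 * _]mulrC.
rewrite (eq_Rint P (g := fun w => ((\sum_(l < N) W (w, xi 0 l w) * H (w, xi 0 l w))
    / (\sum_(l < N) W (w, xi 0 l w)) - fk_expect lambda chi tau (K w) (s w)) ^+ 2)); last first.
  by move=> w; rewrite E1.
apply: (@self_normalized_second_moment R _ _ _ _ Omega (HG 0) X X P chi id N (xi 0)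
  (measurable_fun_id_sub (G_measurable (leq0n _))) (fun l lN => mxiT (leq0n _) lN)
  1 (fun=> id) (fun _ _ _ => 1) _ _ _ _ _ W H
  (fun w => fk_expect lambda chi tau (K w) (s w)) (k1 / k2)^-1 C (k1 / k2) lo
  mW mH mpsi).
- by move=> i; exact: measurable_id.
- by move=> *; exact: ler01.
- by move=> i; exact: measurable_cst.
- by move=> v; rewrite big_ord1 integral_cst//= [X in (_ * X)%E]probability_setT mule1.
- move=> A D mA mD; rewrite /= preimage_id iid0//.
  apply: eq_integral => w _; apply: eq_bigr => l _; rewrite mixE.
  rewrite /Rintegral integral_indic// setIT fineK//.
  exact: fin_num_measure.
- by move=> z; have /andP[_ ->] := Wb z; rewrite ltW.
- by move=> v z; have /andP[h1 h2] := Hlo v z; rewrite h1/= (le_trans h2)// lerD2l.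
- exact: rho_gt0.
- move=> v; rewrite mixE (_ : k1 / k2 = \int[chi]_(x in setT) (k1 / k2)); last first.
    by rewrite bintegral_cst chi1 mulr1.
  apply: le_bintegral; first exact: bmeas_cst.
    exact: (bmeasM (bg v) (bmeas_cst (g v x0)^-1)).
  by move=> x; have /andP[] := Wb (v, x).
- move=> v; rewrite !mixE intW /fk_expect mulrA divfK ?gt_eqF//.
  rewrite -bintegralZr; last exact: (bmeas_fk_sum lambda_gt0 k1_gt0 _ (hK v) (hs v)).
  apply: eq_Rint => x; rewrite /W /H /= -(fk_meanK lambda_gt0 k1_gt0 _ _ _ (hK v)).
  by rewrite mulrAC.
- by move=> w; apply: (sum_gt0 N_gt0) => l; exact: W0.
- exact: N_gt0.
Qed.

Let Lam := fine (lambda setT).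

(** Given the particles at time t, the next generation is importance sampling: by [hybrid_step] its
    target mean is [hybrid] at time t, and its self-normalized estimate is [hybrid] at time t +
    1. *)
Lemma particle_step_error t : (t < tau)%N ->
  \int[P]_w ((hyb w t.+1 - hyb w t) ^+ 2)
    <= 8 * (B / (k1 / k2) * C) ^+ 2 / (k1 * (k1 / k2) * Lam / U) ^+ 2 / N%:R.
Proof.
move=> tt; have tt' := ltnW tt.
have /= x0 : X := point.
have M0 : 0 <= M by rewrite (le_trans _ (s_bound point 0 x0 x0)).
have U0 : 0 < U by have /andP[h1 h2] := u_bound 0 x0; exact: lt_le_trans h2.
have B0 : 0 < B.
  apply: lt_le_trans (weight_bound point 0 x0 x0); apply: divr_gt0.
    by have /andP[h _] := K_bound point 0 x0 x0; exact: lt_le_trans h.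
  exact: mulr_gt0.
pose g w := fk_mass lambda (tau - t.+1) (shift t.+1 (K w)).
have hK1 w := kernel_shift t.+1 (hK w); have hs1 w := cost_shift t.+1 (hs w).
have pg w : positive_weight (g w) by exact: (fk_mass_weight lambda_gt0 k1_gt0 _ (hK1 w)).
have bg w : bounded_measurable (g w) by have [] := pg w.
have g0 w z : 0 < g w z by exact: weight_gt0.
(* Importance weight times normalized look-ahead mass. The indicators select the ancestor measurably
   and make W vanish for indices from N on, which the mixture never draws. *)
pose W (z : HG t.+1 * (nat * X)) := (\sum_(i < N) \1_[set (i : nat)] z.2.1 *
   (K z.1 t (xi t i z.1) z.2.2 / (u t.+1 (xi t i z.1) * q t.+1 (xi t i z.1) z.2.2)))
   * (g z.1 z.2.2 / g z.1 x0).
pose F w := fk_mean lambda (tau - t.+1) (shift t.+1 (K w)) (shift t.+1 (s w)).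
pose H (z : HG t.+1 * (nat * X)) := pn z.1 t z.2.2 + F z.1 z.2.2.
have WE v i z : (i < N)%N -> W (v, (i, z)) =
    K v t (xi t i v) z / (u t.+1 (xi t i v) * q t.+1 (xi t i v) z) * (g v z / g v x0).
  move=> iN; rewrite /W/= (bigD1 (Ordinal iN))//= indicE mem_set// mul1r.
  rewrite big1 ?addr0// => k ki; rewrite indicE memNset ?mul0r//= => ik.
  by move/eqP: ki; apply; apply/val_inj; rewrite /= ik.
have WN v i z : (N <= i)%N -> W (v, (i, z)) = 0.
  move=> Ni; rewrite /W/= big1 ?mul0r// => k _; rewrite indicE memNset ?mul0r//= => ik.
  by move: Ni; rewrite ik leqNgt ltn_ord.
have m1 : measurable_fun setT (fst : HG t.+1 * (nat * X) -> HG t.+1) by exact: measurable_fst.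
have m2 : measurable_fun setT (fun z : HG t.+1 * (nat * X) => z.2.1).
  exact: measurableT_comp measurable_fst measurable_snd.
have m3 : measurable_fun setT (fun z : HG t.+1 * (nat * X) => z.2.2).
  exact: measurableT_comp measurable_snd measurable_snd.
have m13 : measurable_fun setT (fun z : HG t.+1 * (nat * X) => (z.1, z.2.2)).
  exact: measurable_fun_pair.
have mxi1 (i : 'I_N) : measurable_fun setT (fun z : HG t.+1 * (nat * X) => xi t i z.1).
  exact: measurableT_comp (mxi' (leqnn t) tt' (ltn_ord i)) m1.
have mg : measurable_fun setT (fun z : HG t.+1 * X => g z.1 z.2).
  exact: (@mmass (tau - t.+1) t.+1 t.+1).
have mW : measurable_fun setT W.
  apply: measurable_funM; last apply: measurable_funM.
  - apply: measurable_sum => i; apply: measurable_funM.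
      exact: (measurableT_comp (measurable_indic _) m2).
    have mid1 := measurableT_comp (@mid t.+1) m1.
    apply: measurable_funM; first exact: (measurable_K_comp _ mid1 (mxi1 i) m3).
    apply: measurable_funV; apply: measurable_funM.
      exact: measurableT_comp (mu _) (mxi1 i).
    exact: (measurable_q_comp _ (mxi1 i) m3).
  - exact: (measurableT_comp mg m13).
  - apply: measurable_funV.
    apply: (measurableT_comp mg (g := fun z : HG t.+1 * (nat * X) => (z.1, x0))).
    by apply: measurable_fun_pair => //; exact: measurable_cst.
have mF : measurable_fun setT (fun z : HG t.+1 * X => F z.1 z.2).
  apply: measurable_funM; first exact: (@mfsum (tau - t.+1) t.+1 t.+1).
  exact: measurable_funV.
have mH : measurable_fun setT H.
  apply: measurable_funD; last exact: (measurableT_comp mF m13).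
  exact: (measurableT_comp (mpn tt') m13).
have gr v z : k1 / k2 <= g v z / g v x0 <= (k1 / k2)^-1.
  rewrite ler_pdivlMr// ler_pdivrMr// (fk_mass_ratio lambda_gt0 k1_gt0 k12 _ _ _ (hK1 _))/=.
  by rewrite mulrC ler_pdivlMr// mulrC (fk_mass_ratio lambda_gt0 k1_gt0 k12 _ _ _ (hK1 _)).
have W0 v i z : (i < N)%N -> 0 < W (v, (i, z)).
  move=> iN; rewrite WE// mulr_gt0//; last exact: divr_gt0.
  by rewrite divr_gt0 ?mulr_gt0//; have /andP[h _] := K_bound v t (xi t i v) z; exact: lt_le_trans h.
have Wb z : 0 <= W z <= B / (k1 / k2).
  case: z => v [i z]; have [iN|Ni] := ltnP i N; last first.
    by rewrite WN// lexx divr_ge0// ltW.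
  rewrite (ltW (W0 _ _ _ iN))/= WE//; apply: ler_pM.
  - rewrite divr_ge0 ?mulr_ge0 ?(ltW (u_gt0 _ _)) ?(ltW (q_gt0 _ _ _))//.
    by have /andP[h _] := K_bound v t (xi t i v) z; exact: le_trans (ltW k1_gt0) h.
  - by rewrite divr_ge0// ltW.
  - exact: weight_bound.
  - by have /andP[] := gr v z.
have /choice[lo Hlo] (v : HG t.+1) : exists lo, forall z, lo <= H (v, z) <= lo + C.
  have [l1 h1] := fk_mean_osc lambda_gt0 k1_gt0 k12 (tau - t.+1) (hK1 v) (hs1 v).
  have [l2 h2] := pnext_osc k1_gt0 k12 (x_ v) (j_ v) N_gt0 (hK v) (hs v) u_gt0 q_gt0 t.
  exists (l2 + l1) => -[i z]; have /andP[a1 b1] := h1 z; have /andP[a2 b2] := h2 z.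
  rewrite /H /= lerD//= (le_trans (lerD b2 b1))// le_eqVlt; apply/orP; left; apply/eqP.
  by rewrite /C; field; rewrite !gt_eqF.
pose tot v := \sum_(k < N) wt v t k * u t.+1 (xi t k v).
have tot0 v : 0 < tot v.
  by apply: (sum_gt0 N_gt0) => k; rewrite mulr_gt0.
have pE v i z : (i < N)%N -> proposal_density v t i z =
    (wt v t i * u t.+1 (xi t i v) / tot v) * q t.+1 (xi t i v) z.
  by move=> iN; rewrite /proposal_density iN -/(tot v) mulrAC.
have bK v i : bounded_measurable (K v t (xi t i v)).
  by have [] := kernel_weight k1_gt0 t (xi t i v) (hK v).
have mixE v f : bounded_measurable f ->
    mixture lambda N pair (fun w => proposal_density w t) v (fun z => W (v, z) * f z.2) =
    (tot v)^-1 / g v x0 * \sum_(i < N) wt v t i * \int[lambda]_z (K v t (xi t i v) z * g v z * f z).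
  move=> bf; rewrite /mixture mulr_sumr; apply: eq_bigr => i _.
  rewrite -!bintegralZl; last first.
  - by apply: bmeasM => //; exact: bmeasM.
  - by apply: bmeasZ; apply: bmeasM => //; exact: bmeasM.
  apply: eq_Rint => z /=; rewrite WE// pE//; field.
  by rewrite !gt_eqF// ?u_gt0 ?q_gt0.
have mixE1 v : mixture lambda N pair (fun w => proposal_density w t) v (fun z => W (v, z)) =
    (tot v)^-1 / g v x0 * \sum_(i < N) wt v t i * \int[lambda]_z (K v t (xi t i v) z * g v z).
  rewrite (_ : (fun z => W (v, z)) = (fun z => W (v, z) * 1)); last first.
    by apply/funext => z; rewrite mulr1.
  rewrite (mixE v (fun=> 1) (bmeas_cst 1)); congr (_ * _); apply: eq_bigr => i _.
  by congr (_ * _); apply: eq_Rint => z; rewrite mulr1.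
have step v := hybrid_step lambda_gt0 k1_gt0 (x_ v) (j_ v) N_gt0 (hK v) (hs v) u_gt0 q_gt0 tt.
have ratioZ (c : R) (a b : 'I_N -> R) : c != 0 ->
    (\sum_i c * a i) / (\sum_i c * b i) = (\sum_i a i) / (\sum_i b i).
  by move=> c0; rewrite -!mulr_sumr -mulf_div divff// mul1r.
pose Z l w := (J t.+1 l w, xi t.+1 l w).
have E1 w : hyb w t.+1 = (\sum_(l < N) W (w, Z l w) * H (w, Z l w))
    / (\sum_(l < N) W (w, Z l w)).
  rewrite /hyb /hybrid -[LHS](ratioZ (g w x0)^-1); last by rewrite invr_eq0 gt_eqF.
  congr (_ / _); apply: eq_bigr => l _; last first.
    by rewrite /Z WE// -/(g w) mulrCA [(g w x0)^-1 * _]mulrC.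
  rewrite /Z WE// /H /= -(fk_meanK lambda_gt0 k1_gt0 _ _ _ (hK1 w)) -/(g w) -/(F w _).
  rewrite -/(pnext _ _ _ _ _ _ _ _ _) -/(x_ w) -/(j_ w) -[x_ w t.+1 l]/(xi t.+1 l w).
  rewrite -mulrDr !mulrA; congr (_ * _); ring.
rewrite (eq_Rint P (g := fun w => ((\sum_(l < N) W (w, Z l w) * H (w, Z l w))
    / (\sum_(l < N) W (w, Z l w)) - hyb w t) ^+ 2)); last first.
  by move=> w; rewrite E1.
apply: (@self_normalized_second_moment R _ _ _ _ Omega (HG t.+1) (nat * X)%type X P lambda id N Z
  (measurable_fun_id_sub (G_measurable (leqW tt))) _
  N pair (fun w => proposal_density w t) _ _ _ _ _ W H
  (fun w => hyb w t) (B / (k1 / k2)) C (k1 * (k1 / k2) * Lam / U) lo mW mH (mhyb tt')).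
- by move=> l lN; apply: measurable_fun_pair; [exact: mJT|exact: mxiT].
- by move=> i; exact: measurable_pair1.
- move=> v i z; have [iN|Ni] := ltnP i N.
    by rewrite pE// mulr_ge0 ?(ltW (q_gt0 _ _ _))// divr_ge0 ?(ltW (tot0 v))// mulr_ge0// ltW.
  by rewrite /proposal_density ltnNge Ni.
- move=> i; have [iN|Ni] := ltnP i N; last first.
    rewrite (_ : (fun z => _) = fun=> 0); first exact: measurable_cst.
    by apply/funext => z; rewrite /proposal_density ltnNge Ni.
  rewrite (_ : (fun z => _) = (fun z : HG t.+1 * X =>
    (wt z.1 t i * u t.+1 (xi t i z.1) / tot z.1) * q t.+1 (xi t i z.1) z.2)); last first.
    by apply/funext => z; rewrite pE.
  have h1 k (kN : (k < N)%N) := fstX (mxi' (leqnn t) tt' kN).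
  have h3 k (kN : (k < N)%N) := fstX (mwt (leqnn t) tt' kN).
  have h4 k kN := measurableT_comp (mu t.+1) (h1 k kN).
  apply: measurable_funM; last exact: (measurable_q_comp _ (h1 i iN) measurable_snd).
  apply: measurable_funM; first by apply: measurable_funM; [exact: h3|exact: h4].
  apply: measurable_funV; apply: measurable_sum => k.
  by apply: measurable_funM; [exact: h3|exact: h4].
- move=> v; under eq_bigr => i _.
    under eq_integral => z _ do rewrite pE// EFinM.
    rewrite ge0_integralZl//; first last.
    + by rewrite lee_fin divr_ge0 ?(ltW (tot0 v))// mulr_ge0// ltW.
    + by move=> z _; rewrite lee_fin ltW.
    + by apply/measurable_EFinP; exact: (measurableT_comp (mq t.+1) (measurable_pair1 _)).
    rewrite q_total mule1; over.
  by rewrite sumEFin -mulr_suml -/(tot v) divff// gt_eqF.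
- by move=> A D mA mD; rewrite preimage_id (iidS tt mA mD).
- exact: Wb.
- exact: Hlo.
- by rewrite divr_gt0// mulr_gt0// mulr_gt0.
(* Origin of the lower bound on the mean weight: after division by the reference mass each integral
   is at least k1 rho Lam, and the normalization of the proposal is at most U times the sum of the
   weights. *)
- move=> v; apply: le_trans (_ : _ <= (tot v)^-1 / g v x0 *
    \sum_(i < N) wt v t i * \int[lambda]_z (K v t (xi t i v) z * g v z)) _; last first.
    by rewrite -mixE1.
  have h i : k1 * (k1 / k2) * Lam * g v x0 <= \int[lambda]_z (K v t (xi t i v) z * g v z).
    rewrite mulrAC -bintegral_cst; apply: le_bintegral; [exact: bmeas_cst|exact: bmeasM|].
    move=> z; rewrite -mulrA; have /andP[a _] := K_bound v t (xi t i v) z.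
    apply: ler_pM => //; first exact: ltW.
      by rewrite mulr_ge0 ?ltW.
    by have /andP[] := gr v z; rewrite ler_pdivlMr.
  have totU : tot v <= U * \sum_(i < N) wt v t i.
    rewrite mulr_sumr; apply: ler_sum => i _; rewrite mulrC ler_wpM2r ?(ltW (wt_gt0 _ _ _))//.
    by have /andP[] := u_bound t.+1 (xi t i v).
  have kL : 0 <= k1 * (k1 / k2) * Lam by rewrite ltW// mulr_gt0// mulr_gt0.
  move: h kL; move: (k1 * (k1 / k2) * Lam) => a h kL.
  have h2 : a * g v x0 * \sum_(i < N) wt v t i <=
     \sum_(i < N) wt v t i * \int[lambda]_z (K v t (xi t i v) z * g v z).
    by rewrite mulr_sumr; apply: ler_sum => i _; rewrite mulrC ler_wpM2l// ltW.
  move: h2; set S := \sum_(i < N) _ * \int[_]_z _ => h2.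
  rewrite ler_pdivrMr// (_ : _ * U = S * U / (tot v * g v x0)); last first.
    by field; rewrite !gt_eqF.
  rewrite ler_pdivlMr ?mulr_gt0//; apply: (@le_trans _ _ (a * g v x0 * (U * \sum_(i < N) wt v t i))).
    by rewrite (mulrC (tot v)) [leLHS]mulrA ler_wpM2l// mulr_ge0// ltW.
  by rewrite mulrCA mulrC ler_wpM2r// ltW.
- move=> v; have bpF : bounded_measurable (fun z => pn v t z + F v z).
    apply: bmeasD; last exact: (bmeas_fk_mean lambda_gt0 k1_gt0 _ (hK1 v) (hs1 v)).
    split; first exact: (measurableT_comp (mpn tt') (measurable_pair1 (v : HG t.+1))).
    exists (t.+1%:R * M) => z.
    exact: (pnext_bound k1_gt0 (x_ v) (j_ v) N_gt0 (hK v) (hs v) u_gt0 q_gt0 t z).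
  transitivity ((tot v)^-1 / g v x0 * \sum_(i < N) wt v t i *
     \int[lambda]_z (K v t (xi t i v) z * g v z * (pn v t z + F v z))).
    by rewrite -(mixE v _ bpF).
  transitivity (hyb v t * ((tot v)^-1 / g v x0 *
    \sum_(i < N) wt v t i * \int[lambda]_z (K v t (xi t i v) z * g v z))); last first.
    by rewrite -mixE1.
  have [e1 e2] := step v.
  rewrite [X in _ * X = _]e2 [X in _ = _ * (_ * X)]e1 /hyb /hybrid.
  set num := \sum_(l < N) _ * (_ + _); set den := \sum_(l < N) _.
  have den0 : den != 0.
    rewrite gt_eqF//; apply: (sum_gt0 N_gt0) => l; rewrite mulr_gt0//; first exact: wt_gt0.
    exact: (fk_mass_gt0 lambda_gt0 k1_gt0 _ _ (kernel_shift t (hK v))).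
  by rewrite mulrCA divfK.
- by move=> w; apply: (sum_gt0 N_gt0) => l; exact: W0.
- exact: N_gt0.
Qed.

Let hyb_bound w t : (t <= tau)%N -> `|hyb w t| <= tau%:R * M.
Proof.
move=> tt; have /= x0 : X := point.
have M0 : 0 <= M by rewrite (le_trans _ (s_bound point 0 x0 x0)).
have hK1 := kernel_shift t (hK w); have hs1 := cost_shift t (hs w).
have m0 l : 0 < fk_mass lambda (tau - t) (shift t (K w)) (x_ w t l).
  exact: (fk_mass_gt0 lambda_gt0 k1_gt0 _ _ hK1).
have D0 : 0 < \sum_(l < N) wt w t l * fk_mass lambda (tau - t) (shift t (K w)) (x_ w t l).
  by apply: (sum_gt0 N_gt0) => l; rewrite mulr_gt0.
rewrite /hyb /hybrid normrM normfV (gtr0_norm D0) ler_pdivrMr//.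
rewrite (le_trans (ler_norm_sum _ _ _))// mulr_sumr; apply: ler_sum => l _.
rewrite normrM (gtr0_norm (wt_gt0 w t l)) mulrCA ler_wpM2l ?(ltW (wt_gt0 _ _ _))//.
have E : tau%:R = (tau - t)%:R + t%:R :> R by rewrite -natrD subnK.
rewrite (le_trans (ler_normD _ _))// E addrC !mulrDl lerD//.
  exact: (fk_sum_bound lambda_gt0 k1_gt0).
rewrite normrM (gtr0_norm (m0 l)) mulrC ler_wpM2r ?(ltW (m0 l))//.
exact: (psum_bound k1_gt0 (x_ w) (j_ w) N_gt0 (hK w) (hs w) u_gt0 q_gt0).
Qed.

Let bhyb t : (t <= tau)%N -> bounded_measurable (fun w => hyb w t).
Proof.
move=> tt; split; last by exists (tau%:R * M) => w; exact: hyb_bound.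
exact: (measurableT_comp (mhyb tt) (measurable_fun_id_sub (G_measurable (tt : (t < tau.+1)%N)))).
Qed.

Let bmeas_block_expect :
  bounded_measurable (fun w => fk_expect lambda chi tau (K w) (s w)).
Proof.
split; last by exists (tau%:R * M) => w; exact: (fk_expect_bound chi lambda_gt0 k1_gt0).
have mid0 := measurable_fun_id_sub (G_measurable (leq0n _)).
apply: measurable_funM.
  apply: (measurableT_comp (measurable_Rintegral_param chi
    (f := fun w : HG 0 => fk_sum lambda tau (K w) (s w)) (@mfsum tau 0 0)) mid0).
apply: measurable_funV.
exact: (measurableT_comp (measurable_Rintegral_param chi
  (f := fun w : HG 0 => fk_mass lambda tau (K w)) (@mmass tau 0 0)) mid0).
Qed.

Lemma measurable_particle_ratio : sub_measurable (G tau.+1)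
  (fun w => (\sum_(l < N) wt w tau l * ps w tau l) / (\sum_(l < N) wt w tau l)).
Proof.
rewrite (_ : (fun _ => _) = (fun w => hyb w tau)); first exact: mhyb.
by apply/funext => w; rewrite /hyb hybrid_end.
Qed.

Lemma bmeas_particle_error : bounded_measurable
  (fun w => (\sum_(l < N) wt w tau l * ps w tau l) / (\sum_(l < N) wt w tau l)
    - fk_expect lambda chi tau (K w) (s w)).
Proof.
apply: bmeasB => //; rewrite (_ : (fun _ => _) = (fun w => hyb w tau)); first exact: bhyb.
by apply/funext => w; rewrite /hyb hybrid_end.
Qed.

(** The tau + 1 increments are combined by Cauchy-Schwarz. The factor (tau + 1)^2 is harmless
    because the block statistic is this ratio divided by tau, so a constant over N is what
    remains. *)
Lemma particle_block_error :
  \int[P]_w (((\sum_(l < N) wt w tau l * ps w tau l) / (\sum_(l < N) wt w tau l)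
    - fk_expect lambda chi tau (K w) (s w)) ^+ 2)
  <= tau.+1%:R ^+ 2 * (8 * ((k1 / k2)^-1 * C) ^+ 2 / (k1 / k2) ^+ 2 +
     8 * (B / (k1 / k2) * C) ^+ 2 / (k1 * (k1 / k2) * Lam / U) ^+ 2) / N%:R.
Proof.
set c0 := 8 * _ / (k1 / k2) ^+ 2; set c1 := 8 * _ / _.
have N0 : (0 : R) < N%:R by rewrite ltr0n.
have c00 : 0 <= c0 by apply: divr_ge0; rewrite ?sqr_ge0// mulr_ge0// sqr_ge0.
have c10 : 0 <= c1 by apply: divr_ge0; rewrite ?sqr_ge0// mulr_ge0// sqr_ge0.
pose E w := fk_expect lambda chi tau (K w) (s w).
have bE : bounded_measurable E by exact: bmeas_block_expect.
(* The increment of index 0 is the error made in sampling the initial law. *)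
pose a w (t : 'I_tau.+1) := if t == 0 :> nat then hyb w 0 - E w else hyb w t - hyb w t.-1.
have ba t : bounded_measurable (fun w => a w t).
  rewrite /a; case: eqP => [_|t0]; apply: bmeasB => //; apply: bhyb => //.
    by rewrite -ltnS.
  by rewrite (leq_trans (leq_pred _))// -ltnS.
have telE w : hyb w tau - E w = \sum_(t < tau.+1) a w t.
  rewrite big_ord_recl /a/=.
  have -> : \sum_(i < tau) (hyb w (bump 0 i) - hyb w (bump 0 i).-1) = hyb w tau - hyb w 0.
    rewrite -(big_mkord xpredT (fun i => hyb w (bump 0 i) - hyb w (bump 0 i).-1)).
    by rewrite -(telescope_sumr _ (leq0n tau)); apply: eq_bigr => i _; rewrite /bump add1n.
  by rewrite addrC; ring.
have bsq (f : Omega -> R) : bounded_measurable f -> bounded_measurable (fun w => f w ^+ 2).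
  by move=> bf; under eq_fun do rewrite expr2; exact: bmeasM.
rewrite (eq_Rint P (g := fun w => (hyb w tau - E w) ^+ 2)); last first.
  by move=> w; rewrite /hyb hybrid_end.
apply: (@le_trans _ _ (\int[P]_w (tau.+1%:R * \sum_(t < tau.+1) a w t ^+ 2))).
  apply: le_bintegral.
  - by apply: bsq; apply: bmeasB => //; exact: bhyb.
  - by apply: bmeasZ; apply: bmeas_sum => t; exact: bsq.
  - by move=> w; rewrite telE; exact: sqr_sum_le.
rewrite bintegralZl; last by apply: bmeas_sum => t; exact: bsq.
rewrite bintegral_sum; last by move=> t; exact: bsq.
rewrite expr2 -!mulrA ler_wpM2l//.
apply: (@le_trans _ _ (\sum_(t < tau.+1) ((c0 + c1) / N%:R))); last first.
  by rewrite sumr_const card_ord mulr_natl.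
apply: ler_sum => t _; rewrite mulrDl /a; case: (unliftP 0 t) => [i|] ->.
  rewrite /= /bump/= add1n/=; apply: (le_trans (particle_step_error (ltn_ord i))).
  by rewrite lerDr divr_ge0// ltW.
rewrite /=; apply: (le_trans particle_initial_error).
by rewrite lerDl divr_ge0// ltW.
Qed.

End particle_block.

(** * Perturbed iterations of a map with a Lyapunov function *)

Definition continuous_on {R : realType} {V V' : normedModType R} (A : set V)
    (f : V -> V') : Prop :=
  forall x, A x -> forall e : R, 0 < e -> exists2 d : R, 0 < d &
    forall y, A y -> `|x - y| < d -> `|f x - f y| < e.

Lemma within_continuous_on {R : realType} {V V' : normedModType R} (A : set V)
    (f : V -> V') : {within A, continuous f} -> continuous_on A f.
Proof.
move=> /subspace_continuousP cf x Ax e e0.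
have := cf x Ax => /cvgrPdist_lt /(_ e e0); rewrite near_withinE => /nbhs_normP[d /= d0 h].
by exists d => // y Ay xy; apply: h.
Qed.

(** The sequence is pushed along the filter of large indices in S, so the cluster point comes with
    times of S and no subsequence has to be extracted. *)
Lemma infinitely_often_cluster {R : realType} {V : normedModType R}
    (A : set V) (u : nat -> V) (S : set nat) :
  compact A -> (forall n, A (u n)) -> (forall N, exists2 n, (N <= n)%N & S n) ->
  exists2 x, A x & forall (e : R) N, 0 < e ->
    exists n, [/\ (N <= n)%N, S n & `|x - u n| < e].
Proof.
move=> cA Au Sinf.
pose F := fmap u (within S eventually).
have FF : ProperFilter F.
  apply: fmap_proper_filter; split; last exact: within_filter.
  move=> [N _ h]; have [n Nn Sn] := Sinf N; exact: (h n Nn).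
have FA : F A by exists 0%N => // n _ _; exact: Au.
have [x [Ax clx]] := cA F FF FA.
exists x => // e N e0.
have FN : F [set u n | n in [set n | (N <= n)%N /\ S n]].
  by exists N => // n Nn Sn; exists n.
have := clx _ _ FN (nbhsx_ballx x e e0) => -[_ [[n [Nn Sn] <-]]].
by rewrite -ball_normE /= => h; exists n.
Qed.

Section perturbed_iteration.
Context {R : realType} {V : normedModType R}.
Variables (Theta : set V) (W : V -> R) (Rm : V -> V) (th : nat -> V).
Hypothesis compact_Theta : compact Theta.
Hypothesis W_cont : continuous_on Theta (W : V -> R^o).
Hypothesis R_cont : continuous_on Theta Rm.
Hypothesis R_Theta : forall x, Theta x -> Theta (Rm x).
Hypothesis W_le : forall x, Theta x -> W x <= W (Rm x).
Hypothesis W_fix : forall x, Theta x -> W (Rm x) <= W x -> Rm x = x.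
Hypothesis th_Theta : forall n, Theta (th n).
Hypothesis th_close : forall e : R, 0 < e ->
  exists N, forall n, (N <= n)%N -> `|th n.+1 - Rm (th n)| < e.

Let L := [set x | Theta x /\ Rm x = x].
Hypothesis WL_interior : (W @` L)° = set0.

(** If the value dropped by e below that of the image infinitely often, a cluster point of the
    images would contradict continuity of W there. Compactness thus replaces uniform continuity. *)
Let W_next e : 0 < e -> exists N, forall n, (N <= n)%N ->
  W (Rm (th n)) - e < W (th n.+1).
Proof.
move=> e0; apply: contrapT => nh.
pose S := [set n | W (th n.+1) <= W (Rm (th n)) - e].
have Sinf N : exists2 n, (N <= n)%N & S n.
  apply: contrapT => h; apply: nh; exists N => n Nn; rewrite ltNge.
  by apply/negP => Sn; apply: h; exists n.
have e2 : 0 < e / 2 by rewrite divr_gt0.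
have [x Tx clx] := @infinitely_often_cluster R V Theta (fun n => Rm (th n)) S
  compact_Theta (fun n => R_Theta (th_Theta n)) Sinf.
have [d d0 hd] := W_cont Tx e2.
have [N hN] := th_close (divr_gt0 d0 (ltr0Sn _ 1)).
have [n [Nn Sn xn]] := clx (d / 2) N (divr_gt0 d0 (ltr0Sn _ 1)).
have h1 : `|W x - W (Rm (th n))| < e / 2.
  by apply: hd; [exact: R_Theta|rewrite (lt_le_trans xn)// ler_pdivrMr// ler_pMr// ler1n].
have h2 : `|W x - W (th n.+1)| < e / 2.
  apply: hd => //; rewrite -(subrKA (Rm (th n))) (le_lt_trans (ler_normD _ _))//.
  by rewrite [X in _ < X](splitr d) ltrD// distrC; exact: hN.
have : S n := Sn; rewrite /S/= leNgt => /negP; apply.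
rewrite ltr_norml in h1; rewrite ltr_norml in h2.
by move: h1 h2 => /andP[? ?] /andP[? ?]; lra.
Qed.

(** At a cluster point of times when W is asymptotically at least w, and at most w one step later,
    continuity gives W (Rm x) <= w <= W x. Monotonicity of W along [Rm] turns these into equalities,
    so x is a fixed point at level w. *)
Let cluster_fix x S (w : R) : Theta x ->
  (forall e N, 0 < e -> exists n, [/\ (N <= n)%N, S n & `|x - th n| < e]) ->
  (forall e, 0 < e -> exists N, forall n, (N <= n)%N -> S n ->
     w - e < W (th n) /\ W (th n.+1) < w + e) -> L x /\ W x = w.
Proof.
move=> Tx clx Sw.
have Wx : w <= W x.
  rewrite leNgt; apply/negP => xw; have e0 : 0 < (w - W x) / 2 by lra.
  have [d d0 hd] := W_cont Tx e0; have [N hN] := Sw _ e0.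
  have [n [Nn Sn xn]] := clx d N d0.
  have := hd _ (th_Theta n) xn; have [h1 _] := hN n Nn Sn.
  by rewrite ltr_norml => /andP[? ?]; lra.
have WRx : W (Rm x) <= w.
  rewrite leNgt; apply/negP => xw; have e0 : 0 < (W (Rm x) - w) / 3 by lra.
  have [d d0 hd] := W_cont (R_Theta Tx) e0.
  have [d' d'0 hd'] := R_cont Tx d0.
  have [N1 hN1] := Sw _ e0; have [N2 hN2] := W_next e0.
  have [n [Nn Sn xn]] := clx d' (maxn N1 N2) d'0.
  have [_ h1] := hN1 n (leq_trans (leq_maxl _ _) Nn) Sn.
  have h2 := hN2 n (leq_trans (leq_maxr _ _) Nn).
  have := hd _ (R_Theta (th_Theta n)) (hd' _ (th_Theta n) xn).
  by rewrite ltr_norml => /andP[? ?]; lra.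
have le1 := W_le Tx; split; last by apply: le_anti; rewrite Wx andbT (le_trans le1).
by split=> //; apply: W_fix => //; exact: le_trans WRx Wx.
Qed.

(** Otherwise w would be crossed downwards infinitely often, and the crossing times would produce a
    fixed point at level w. *)
Let one_side (w : R) : ~ (W @` L) w ->
  (exists N, forall n, (N <= n)%N -> w <= W (th n)) \/
  (exists N, forall n, (N <= n)%N -> W (th n) < w).
Proof.
move=> wL; apply: contrapT => /not_orP[n1 n2].
pose S := [set n | w <= W (th n) /\ W (th n.+1) < w].
have inf1 N : exists2 n, (N <= n)%N & W (th n) < w.
  apply: contrapT => h; apply: n1; exists N => n Nn; rewrite leNgt; apply/negP => hw.
  by apply: h; exists n.
have inf2 N : exists2 n, (N <= n)%N & w <= W (th n).
  apply: contrapT => h; apply: n2; exists N => n Nn; rewrite ltNge; apply/negP => hw.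
  by apply: h; exists n.
have Sinf N : exists2 n, (N <= n)%N & S n.
  have [n Nn hn] := inf2 N; have [k nk hk] := inf1 n.
  apply: contrapT => nS.
  have up i : w <= W (th (n + i)%N).
    elim: i => [|i IH]; first by rewrite addn0.
    rewrite leNgt; apply/negP => hi; apply: nS; exists (n + i)%N.
      by rewrite (leq_trans Nn)// leq_addr.
    by split=> //; rewrite -addnS.
  by have := up (k - n)%N; rewrite subnKC// leNgt hk.
have [x Tx clx] := infinitely_often_cluster compact_Theta th_Theta Sinf.
apply: wL; have [Lx <-] : L x /\ W x = w; last by exists x.
apply: (cluster_fix (S := S)) => // e e0; exists 0%N => n _ [h1 h2]; split; lra.
Qed.

Let W_bounded : exists B, forall n, `|W (th n)| <= B.
Proof.
apply: contrapT => nb.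
have big N : exists n, N%:R < `|W (th n)|.
  apply: contrapT => h; apply: nb; exists N%:R => n; rewrite leNgt; apply/negP => hn.
  by apply: h; exists n.
have /choice[f hf] := big.
have [x Tx clx] := @infinitely_often_cluster R V Theta (fun n => th (f n)) setT
  compact_Theta (fun n => th_Theta (f n)) (fun N => ex_intro2 _ _ N (leqnn N) I).
have [d d0 hd] := W_cont Tx (@ltr01 R).
have [n [Nn _ xn]] := clx d (Num.truncn (`|W x| + 1)).+1 d0.
have := hd _ (th_Theta (f n)) xn; have := hf n.
have h0 : 0 <= `|W x| + 1 by rewrite addr_ge0.
have [_ h1] := andP (truncn_itv h0).
have h2 : `|W x| + 1 < n%:R by rewrite (lt_le_trans h1)// ler_nat.
move=> h3 h4; have : `|W (th (f n))| < `|W x| + 1.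
  rewrite -(subrKC (W x) (W (th (f n)))) (le_lt_trans (ler_normD _ _))//.
  by rewrite ltrD2l distrC.
by lra.
Qed.

Lemma perturbed_iteration_cvg : exists wstar : R,
  W (th n) @[n --> \oo] --> wstar /\
  edist_inf [set x | L x /\ W x = wstar] (th n) @[n --> \oo] --> 0%E.
Proof.
have [B hB] := W_bounded.
(* The eventual lower bounds of W along the sequence; their supremum is the lower limit. Since the
   values on L have empty interior, some level just above it is not such a value; the sequence
   eventually stays below that level, so the lower limit is the limit. *)
pose A := [set w : R | exists N, forall n, (N <= n)%N -> w <= W (th n)].
have A0 : A !=set0.
  by exists (- B), 0%N => n _; have := hB n; rewrite ler_norml => /andP[].
have Aub : has_ubound A.
  exists B => w [N hN]; apply: (le_trans (hN N (leqnn N))).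
  by rewrite (le_trans (ler_norm _)).
pose ws := sup A; have supA : has_sup A by [].
have lower e : 0 < e -> exists N, forall n, (N <= n)%N -> ws - e < W (th n).
  move=> e0; have [w [N hN] hw] := sup_adherent e0 supA.
  by exists N => n Nn; apply: (lt_le_trans hw); exact: hN.
have upper e : 0 < e -> exists N, forall n, (N <= n)%N -> W (th n) < ws + e.
  move=> e0; have [w /andP[w1 w2] wL] : exists2 w, ws < w < ws + e & ~ (W @` L) w.
    apply: contrapT => h.
    have : (W @` L)° (ws + e / 2).
      have e2 : 0 < e / 2 by rewrite divr_gt0.
      apply/nbhs_ballP; exists (e / 2) => // w; rewrite -ball_normE /= ltr_norml => /andP[w1 w2].
      apply: contrapT => hw; apply: h; exists w => //; apply/andP; split; lra.
    by rewrite WL_interior.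
  case: (one_side wL) => [Aw|[N hN]].
    by have := ub_le_sup Aub Aw; rewrite leNgt w1.
  by exists N => n Nn; exact: lt_trans (hN n Nn) w2.
exists ws; split.
  apply/cvgrPdist_lt => e e0; have [N1 h1] := lower e e0; have [N2 h2] := upper e e0.
  exists (maxn N1 N2) => // n /= Nn.
  have := h1 n (leq_trans (leq_maxl _ _) Nn); have := h2 n (leq_trans (leq_maxr _ _) Nn).
  by move=> ? ?; rewrite ltr_norml; apply/andP; split; lra.
have near_L (e : R) : 0 < e -> exists N, forall n, (N <= n)%N ->
    exists2 y, L y /\ W y = ws & `|th n - y| < e.
  move=> e0; apply: contrapT => nh.
  pose S := [set n | ~ exists2 y, L y /\ W y = ws & `|th n - y| < e].
  have Sinf N : exists2 n, (N <= n)%N & S n.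
    apply: contrapT => h; apply: nh; exists N => n Nn; apply: contrapT => hn.
    by apply: h; exists n.
  have [x Tx clx] := infinitely_often_cluster compact_Theta th_Theta Sinf.
  have Lx : L x /\ W x = ws.
    apply: (cluster_fix (S := S)) => // e' e'0.
    have [N1 h1] := lower e' e'0; have [N2 h2] := upper e' e'0.
    exists (maxn N1 N2) => n Nn _; split.
      exact: h1 (leq_trans (leq_maxl _ _) Nn).
    by apply: h2; rewrite (leq_trans (leq_trans (leq_maxr _ _) Nn)).
  have [n [_ Sn xn]] := clx e 0%N e0.
  by apply: Sn; exists x => //; rewrite distrC.
apply/fine_cvgP; split.
  have [N hN] := near_L 1 ltr01; exists N => // n /= Nn.
  have [y Ly yn] := hN n Nn.
  rewrite ge0_fin_numE ?edist_inf_ge0//; apply: (@le_lt_trans _ _ 1%:E); last exact: ltry.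
  apply: (@le_trans _ _ (edist (th n, y))); first by apply: ereal_inf_lbound; exists y.
  by apply: edist_fin => //=; rewrite -ball_normE.
apply/cvgrPdist_le => e e0; have [N hN] := near_L e e0; exists N => // n /= Nn.
have [y Ly yn] := hN n Nn.
have le1 : (edist_inf [set x | L x /\ W x = ws] (th n) <= e%:E)%E.
  apply: (@le_trans _ _ (edist (th n, y))); first by apply: ereal_inf_lbound; exists y.
  by apply: edist_fin => //=; rewrite -ball_normE.
have ge0 : (0 <= edist_inf [set x | L x /\ W x = ws] (th n))%E by exact: edist_inf_ge0.
rewrite sub0r normrN ger0_norm ?fine_ge0//.
by rewrite -lee_fin fineK// ge0_fin_numE// (le_lt_trans le1)// ltry.
Qed.

End perturbed_iteration.

(** * Proper separation of convex sets in finite dimension *)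

Section separation.
Context {R : realType}.

Lemma dotpE d (u v : 'rV[R]_d) : dotp u v = \sum_i u 0 i * v 0 i.
Proof. by rewrite /dotp mxE; apply: eq_bigr => i _; rewrite mxE. Qed.

Lemma dotpDl d (u u' v : 'rV[R]_d) : dotp (u + u') v = dotp u v + dotp u' v.
Proof. by rewrite /dotp mulmxDl mxE. Qed.

Lemma dotpZl d a (u v : 'rV[R]_d) : dotp (a *: u) v = a * dotp u v.
Proof. by rewrite /dotp -scalemxAl mxE. Qed.

Lemma dotpC d (u v : 'rV[R]_d) : dotp u v = dotp v u.
Proof. by rewrite !dotpE; apply: eq_bigr => i _; rewrite mulrC. Qed.

Lemma dotpBl d (u u' v : 'rV[R]_d) : dotp (u - u') v = dotp u v - dotp u' v.
Proof. by rewrite -scaleN1r dotpDl dotpZl mulN1r. Qed.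

Lemma coord_lt d (x y : 'rV[R]_d) e i : `|x - y| < e -> `|x 0 i - y 0 i| < e.
Proof.
move=> h; have : ball x e y by rewrite mx_norm_ball.
by move=> [_ /(_ 0 i)].
Qed.

Lemma coord_le d (x : 'rV[R]_d) i : `|x 0 i| <= `|x|.
Proof.
apply/ler_addgt0Pr => e e0; apply/ltW.
have := @coord_lt d x 0 (`|x| + e) i; rewrite subr0 mxE subr0; apply.
by rewrite ltrDl.
Qed.

Lemma norm_lt_coord d (x y : 'rV[R]_d) e : 0 < e ->
  (forall i, `|x 0 i - y 0 i| < e) -> `|x - y| < e.
Proof.
move=> e0 h; have : ball x e y by split=> // i j; rewrite ord1; exact: h.
by rewrite mx_norm_ball.
Qed.

(* A near-minimizer a of the sum of the squares of the positive parts of a + e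
   provides the weights. *)
Let approximate_weights r (C : set 'rV[R]_r) (e : R) : (0 < r)%N ->
  (forall a b t, 0 <= t <= 1 -> C a -> C b -> C (t *: b + (1 - t) *: a)) ->
  C !=set0 -> (forall a i, C a -> `|a 0 i| <= 1) ->
  (forall a, C a -> exists i, 0 <= a 0 i) -> 0 < e <= 1 ->
  exists v : 'rV[R]_r, [/\ forall i, 0 <= v 0 i, \sum_i v 0 i = 1 &
    forall b, C b -> - (2 * e) <= dotp v b].
Proof.
move=> r0 Cconv [c0 Cc0] Cbox Cpos /andP[e0 e1].
pose pp (x : R) := Num.max x 0.
pose f (a : 'rV[R]_r) := \sum_i pp (a 0 i + e) ^+ 2.
have f0 a : 0 <= f a by apply: sumr_ge0 => i _; exact: sqr_ge0.
have rR : (0 : R) < r%:R by rewrite ltr0n.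
(* Step length towards b: the quadratic remainder 4 r t^2 then equals e^2 t, the defect allowed in
   the near-minimization. *)
pose t := e ^+ 2 / (4 * r%:R).
have t0 : 0 < t by rewrite divr_gt0 ?exprn_gt0// mulr_gt0.
have t1 : t <= 1.
  rewrite ler_pdivrMr ?mulr_gt0// mul1r (le_trans (y := 1))//; first by rewrite expr_le1// ltW.
  by rewrite -natrM ler1n muln_gt0.
have [a Ca fa] : exists2 a, C a & f a < inf (f @` C) + e ^+ 2 * t.
  have hi : has_inf (f @` C) by split; [exists (f c0), c0|exists 0 => _ [a _ <-]].
  have [_ [a Ca <-] h] := inf_adherent (mulr_gt0 (exprn_gt0 2 e0) t0) hi.
  by exists a.
have infle b : C b -> inf (f @` C) <= f b.
  by move=> Cb; apply: ge_inf; [exists 0 => _ [? _ <-]|exists b].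
pose g i := pp (a 0 i + e).
have g0 i : 0 <= g i by rewrite /g /pp le_max lexx orbT.
(* First-order expansion of the squared positive part, with remainder at most y^2. *)
have sq (x y : R) : pp (x + y) ^+ 2 <= pp x ^+ 2 + 2 * pp x * y + y ^+ 2.
  have -> : pp x ^+ 2 + 2 * pp x * y + y ^+ 2 = (pp x + y) ^+ 2 by ring.
  have [h|h] := leP 0 (x + y).
    have px : x <= pp x by rewrite /pp le_max lexx.
    rewrite {1}/pp max_l// lerXn2r ?nnegrE ?lerD2r//.
    by rewrite (le_trans h)// lerD2r.
  rewrite {1}/pp max_r; last exact: ltW.
  by rewrite [leLHS]expr2 mul0r sqr_ge0.
have D b : C b -> - e ^+ 2 <= \sum_i g i * (b 0 i - a 0 i).
  move=> Cb; set DD := \sum_i _.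
  have := infle _ (Cconv a b t _ Ca Cb); rewrite (ltW t0) t1 => /(_ isT) h.
  have h2 : f (t *: b + (1 - t) *: a) <= f a + 2 * t * DD + r%:R * (4 * t ^+ 2).
    rewrite (_ : r%:R * _ = \sum_(i < r) (4 * t ^+ 2)); last first.
      by rewrite sumr_const card_ord mulr_natl.
    rewrite /f /DD mulr_sumr -!big_split/=; apply: ler_sum => i _.
    rewrite !mxE (_ : _ + e = (a 0 i + e) + t * (b 0 i - a 0 i)); last by ring.
    apply: (le_trans (sq _ _)); rewrite -/(g i).
    have -> : 2 * g i * (t * (b 0 i - a 0 i)) = 2 * t * (g i * (b 0 i - a 0 i)) by ring.
    rewrite lerD2l exprMn mulrC ler_wpM2r ?sqr_ge0//.
    have -> : (4 : R) = 2 ^+ 2 by ring.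
    rewrite -(ger0_norm (sqr_ge0 (b 0 i - a 0 i))) normrX lerXn2r// ?nnegrE//.
    rewrite (le_trans (ler_normB _ _))//.
    by have := Cbox b i Cb; have := Cbox a i Ca; lra.
  have rt : r%:R * (4 * t ^+ 2) = e ^+ 2 * t.
    by rewrite /t; field; rewrite gt_eqF.
  rewrite rt in h2.
  have h3 : - (2 * (e ^+ 2 * t)) <= 2 * t * DD by lra.
  have : 0 <= t * (DD + e ^+ 2) by nra.
  by rewrite pmulr_rge0// => ?; lra.
pose G := \sum_i g i.
(* The shift by e serves here: some coordinate of a is nonnegative, so the sum of the positive parts
   is at least e and can be used for normalization. *)
have Ge : e <= G.
  have [i ai] := Cpos a Ca; rewrite /G (bigD1 i)//= -[leLHS]addr0 lerD ?sumr_ge0//.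
  by rewrite /g /pp le_max; apply/orP; left; rewrite lerDr.
have G0 : 0 < G by exact: lt_le_trans Ge.
have ga : - (e * G) <= \sum_i g i * a 0 i.
  rewrite -mulNr mulr_sumr; apply: ler_sum => i _; rewrite mulrC.
  have [h|h] := leP (- e) (a 0 i); first by rewrite ler_wpM2l.
  by rewrite /g /pp max_r ?mul0r//; lra.
exists (\row_i (g i / G)); split.
- by move=> i; rewrite mxE divr_ge0// ltW.
- by under eq_bigr do rewrite mxE; rewrite -mulr_suml divff// gt_eqF.
- move=> b Cb; rewrite dotpE.
  under eq_bigr do rewrite mxE mulrAC.
  rewrite -mulr_suml ler_pdivlMr//.
  have := D b Cb; rewrite (eq_bigr (fun i => g i * b 0 i - g i * a 0 i)); last first.
    by move=> i _; rewrite mulrBr.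
  rewrite sumrB => h.
  have : e ^+ 2 <= e * G by rewrite expr2 ler_wpM2l// ltW.
  by lra.
Qed.

(** A theorem of the alternative for cones that may fail to be closed: approximate weights for the
    part of the cone in the unit box, with e = 1 / (n + 1), then a cluster point in a compact cube.
    Homogeneity carries the inequality from the box to the cone. *)
Lemma cone_weights r (C : set 'rV[R]_r) : (0 < r)%N ->
  (forall a b, C a -> C b -> C (a + b)) ->
  (forall a t, 0 < t -> C a -> C (t *: a)) -> C !=set0 ->
  (forall a, C a -> exists i, 0 <= a 0 i) ->
  exists v : 'rV[R]_r, [/\ forall i, 0 <= v 0 i, \sum_i v 0 i = 1 &
    forall b, C b -> 0 <= dotp v b].
Proof.
move=> r0 CD CZ [c Cc] Cpos.
pose Q := [set a | C a /\ forall i, `|a 0 i| <= 1].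
have scale b : C b -> exists2 t, 0 < t & Q (t *: b).
  move=> Cb; exists (`|b| + 1)^-1; first by rewrite invr_gt0 ltr_wpDl.
  have b0 : 0 < `|b| + 1 by rewrite ltr_wpDl.
  split; first by apply: CZ => //; rewrite invr_gt0.
  move=> i; rewrite mxE normrM normfV (gtr0_norm b0) mulrC ler_pdivrMr// mul1r.
  by rewrite (le_trans (coord_le _ _))// lerDl.
have e01 n : 0 < (n.+1%:R^-1 : R) <= 1 by rewrite invr_gt0 ltr0n/= invf_le1// ler1n.
have Qconv a b t : 0 <= t <= 1 -> Q a -> Q b -> Q (t *: b + (1 - t) *: a).
  move=> /andP[t0 t1] [Ca a1] [Cb b1]; split.
    have [->|tn0] := eqVneq t 0; first by rewrite scale0r add0r subr0 scale1r.
    have [->|tn1] := eqVneq t 1; first by rewrite subrr scale0r addr0 scale1r.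
    apply: CD; apply: CZ => //; first by rewrite lt0r tn0.
    by rewrite subr_gt0 lt_neqAle tn1.
  move=> i; rewrite !mxE (le_trans (ler_normD _ _))// !normrM (ger0_norm t0).
  have t1' : 0 <= 1 - t by rewrite subr_ge0.
  rewrite (ger0_norm t1').
  apply: (@le_trans _ _ (t * 1 + (1 - t) * 1)); last by lra.
  by apply: lerD; rewrite ler_wpM2l.
have [t tt0 Qc] := scale c Cc.
have /choice[v Hv] n := @approximate_weights r Q n.+1%:R^-1 r0 Qconv
  (ex_intro _ _ Qc) (fun a i Qa => Qa.2 i) (fun a Qa => Cpos a Qa.1) (e01 n).
have cb : compact [set x : 'rV[R]_r | forall i, `[0 : R, 1]%classic (x 0 i)].
  exact: (@rV_compact R r (fun=> `[0 : R, 1]%classic) (fun=> @segment_compact R 0 1)).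
have vb n : [set x : 'rV[R]_r | forall i, `[0 : R, 1]%classic (x 0 i)] (v n).
  move=> i /=; rewrite in_itv/=; have [h1 h2 _] := Hv n.
  by rewrite h1/= -h2 (bigD1 i)//= lerDl sumr_ge0.
have [w bw clw] := @infinitely_often_cluster R _ _ v setT cb vb
  (fun N => ex_intro2 _ _ N (leqnn N) I).
have near_dotp b (e : R) N : 0 < e -> exists n, (N <= n)%N /\ `|dotp w b - dotp (v n) b| <= e * \sum_i `|b 0 i|.
  move=> e0; have [n [Nn _ wn]] := clw e N e0; exists n; split=> //.
  rewrite -dotpBl dotpE (le_trans (ler_norm_sum _ _ _))// mulr_sumr; apply: ler_sum => i _.
  by rewrite normrM ler_wpM2r// !mxE ltW//; exact: coord_lt.
have sumE (x : 'rV[R]_r) : dotp x (const_mx 1) = \sum_i x 0 i.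
  by rewrite dotpE; apply: eq_bigr => i _; rewrite mxE mulr1.
exists w; split.
- by move=> i; have := bw i; rewrite /= in_itv/= => /andP[].
- apply/eqP; rewrite -subr_eq0 -normr_le0; apply/ler_addgt0Pr => e e0; rewrite add0r.
  have rp : 0 < (r%:R + 1 : R) by rewrite ltr_wpDl.
  have [n [_ h]] := near_dotp (const_mx 1) (e / (r%:R + 1)) 0%N (divr_gt0 e0 rp).
  have [_ h1 _] := Hv n; rewrite !sumE h1 in h; apply: (le_trans h).
  under eq_bigr do rewrite mxE normr1; rewrite sumr_const card_ord.
  by rewrite mulrAC ler_pdivrMr// ler_wpM2l ?lerDl// ltW.
- move=> b /scale[s s0 Qb]; rewrite -(pmulr_rge0 _ s0) dotpC -dotpZl dotpC.
  move: (s *: b) Qb => {}b Qb; apply/ler_addgt0Pr => e e0.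
  set B := \sum_i `|b 0 i|; have B0 : 0 <= B by apply: sumr_ge0.
  have Bp : 0 < B + 1 by rewrite ltr_wpDl.
  have e2 : 0 < e / 2 by rewrite divr_gt0.
  have [n [Nn h]] := near_dotp b (e / 2 / (B + 1)) (Num.truncn (4 / e)) (divr_gt0 e2 Bp).
  have h' : `|dotp w b - dotp (v n) b| <= e / 2.
    apply: (le_trans h); rewrite -/B mulrAC ler_pdivrMr// ler_wpM2l ?lerDl//.
    exact: ltW.
  have [_ _ h1] := Hv n; have {}h1 := h1 b Qb.
  have h2 : 4 / e < n.+1%:R.
    have [_ h3] := andP (truncn_itv (ltW (divr_gt0 (ltr0Sn R 3) e0))).
    by rewrite (lt_le_trans h3)// ler_nat.
  have h4 : 2 * n.+1%:R^-1 <= e / 2.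
    have n0 : (0 : R) < n.+1%:R by rewrite ltr0n.
    rewrite ltr_pdivrMr// in h2; rewrite ler_pdivrMr// mulrAC ler_pdivlMr//.
    by move: h2; lra.
  move: h'; rewrite ler_norml => /andP[h5 h6].
  move: (2 * _) (dotp (v n) b) h1 h4 h5 => x y h1 h4 h5.
  by lra.
Qed.

(** An independent family of maximal size whose vectors all come from A; the size is at most d.
    Membership in A later puts these vectors in a cone, or among the directions that vanish almost
    everywhere. *)
Lemma row_basis d (A : set 'rV[R]_d) : exists r (B : 'M[R]_(r, d)),
  [/\ forall i, A (row i B), row_free B & forall a, A a -> (a <= B)%MS].
Proof.
pose Pr r := exists B : 'M[R]_(r, d), (forall i, A (row i B)) /\ row_free B.
have P0 : exists r, `[< Pr r >].
  exists 0%N; apply/asboolP; exists 0; split; first by case.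
  by rewrite /row_free mxrank0.
have Pub r : `[< Pr r >] -> (r <= d)%N.
  by move=> /asboolP[B [_ /eqP <-]]; exact: rank_leq_col.
have [r /asboolP[B [AB fB]] rmax] := ex_maxnP P0 Pub.
exists r, B; split=> // a Aa; apply: contrapT => /negP aB.
have : (r + 1 <= r)%N; last by rewrite addn1 ltnn.
apply: rmax; apply/asboolP; exists (col_mx B a); split.
  move=> i; case: (split_ordP i) => j ->.
    by rewrite rowKu.
  by rewrite rowKd ord1 row_id.
have rB : \rank B = r by exact/eqP.
have h : (r < \rank (col_mx B a))%N.
  rewrite -{1}rB -addsmxE; apply: rank_ltmx.
  rewrite ltmxE addsmxSl /=.
  by apply: contra aB => /(submx_trans _); apply; exact: addsmxSr.
rewrite /row_free eqn_leq rank_leq_row /=; apply: leq_trans h.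
by rewrite addn1.
Qed.

(** K may be neither closed nor of full dimension, so strict separation can fail. In a basis drawn
    from K the generated cone misses the open negative orthant; weights that sum to 1 are positive
    on some basis vector, and there the inequality is strict. *)
Lemma proper_separation d (K : set 'rV[R]_d) :
  (forall a b t, 0 <= t <= 1 -> K a -> K b -> K (t *: b + (1 - t) *: a)) ->
  K !=set0 -> ~ K 0 ->
  exists v, (forall k, K k -> 0 <= dotp v k) /\ exists2 k, K k & 0 < dotp v k.
Proof.
move=> Kconv [k0 Kk0] K0; have [r [B [KB fB spanB]]] := row_basis K.
have r0 : (0 < r)%N.
  case: r B KB fB spanB => // B _ _ /(_ _ Kk0).
  by move=> /submxP[D]; rewrite (flatmx0 B) mulmx0 => k00; rewrite k00 in Kk0.
pose cone := [set x : 'rV[R]_d | exists t k, [/\ 0 < t, K k & x = t *: k]].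
have coneD x y : cone x -> cone y -> cone (x + y).
  move=> [t [k [t0 Kk ->]]] [s [l [s0 Kl ->]]]; exists (t + s), ((t / (t + s)) *: k + (1 - t / (t + s)) *: l).
  have ts : 0 < t + s by rewrite addr_gt0.
  split=> //; first by apply: Kconv => //; rewrite divr_ge0 ?(ltW ts) ?(ltW t0)//= ler_pdivrMr// mul1r lerDl ltW.
  rewrite scalerDr !scalerA mulrBr mulr1 mulrC divfK ?gt_eqF//.
  by rewrite [t + s]addrC addrK.
have coneZ x t : 0 < t -> cone x -> cone (t *: x).
  by move=> t0 [s [k [s0 Kk ->]]]; exists (t * s), k; rewrite scalerA mulr_gt0.
have cone0 : ~ cone 0.
  move=> [t [k [t0 Kk]]] /esym/eqP; rewrite scaler_eq0 gt_eqF//= => /eqP k00.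
  by rewrite k00 in Kk.
have coneK k : K k -> cone k by move=> Kk; exists 1, k; rewrite scale1r.
pose C := [set a : 'rV[R]_r | cone (a *m B)].
have rowE i : delta_mx 0 i *m B = row i B by rewrite rowE.
have [v [v0 v1 vC]] : exists v : 'rV[R]_r, [/\ forall i, 0 <= v 0 i, \sum_i v 0 i = 1 &
    forall b, C b -> 0 <= dotp v b].
  apply: cone_weights => //.
  - by move=> a b Ca Cb; rewrite /C /= mulmxDl; exact: coneD.
  - by move=> a t t0 Ca; rewrite /C /= -scalemxAl; exact: coneZ.
  - by exists (delta_mx 0 (Ordinal r0)); rewrite /C /= rowE; exact: coneK.
  (* If all coordinates of a were negative, adding the multiples - a_i > 0 of the basis vectors, all
     in the cone, would bring 0 into the cone. *)
  - move=> a Ca; apply: contrapT => neg; apply: cone0.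
    have an i : a 0 i < 0 by rewrite ltNge; apply/negP => ai; apply: neg; exists i.
    have -> : 0 = a *m B + (\sum_i (- a 0 i) *: row i B).
      rewrite mulmx_sum_row -big_split/= big1// => i _.
      by rewrite scaleNr subrr.
    elim: (index_enum _) => [|i s IH]; first by rewrite big_nil addr0.
    rewrite big_cons addrCA; apply: coneD => //; apply: coneZ; last exact: coneK.
    by rewrite oppr_gt0.
(* A right inverse of B transports the weights from coordinates to a vector of the ambient space
   with the same pairing. *)
have [D BV] : exists D, B *m D = 1%:M by exists (pinvmx B); rewrite mulmxVp.
have BVT : D^T *m B^T = 1%:M by rewrite -trmx_mul BV trmx1.
have dotB x : dotp (v *m D^T) (x *m B) = dotp v x.
  by rewrite /dotp trmx_mul mulmxA -(mulmxA v) BVT mulmx1.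
exists (v *m D^T); split.
  move=> k Kk; have /submxP[x kE] := spanB k Kk; rewrite kE dotB; apply: vC.
  by rewrite /C /= -kE; exact: coneK.
apply: contrapT => neg.
have vz i : v 0 i = 0.
  apply/eqP; rewrite eq_le v0 andbT leNgt; apply/negP => vi; apply: neg.
  exists (row i B) => //; rewrite -rowE dotB dotpE (bigD1 i)//= big1 ?addr0.
    by rewrite mxE !eqxx mulr1.
  by move=> j ji; rewrite mxE eqxx (negbTE ji) mulr0.
by move: v1; rewrite big1 => [/eqP|i _]; [rewrite eq_sym oner_eq0|exact: vz].
Qed.

End separation.

(** * Conditional probabilities and mixing inequalities *)

Section sub_measure.
Context {R : realType} {dO : measure_display} {Omega : measurableType dO}.
Variables (Q : {finite_measure set Omega -> \bar R}) (G : set (set Omega)).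

Definition sub_measure (Gm : G `<=` measurable) :
  set (g_sigma_algebraType G) -> \bar R := Q.

Variable Gm : G `<=` measurable.

Let sub_measure0 : sub_measure Gm set0 = 0%E. Proof. exact: measure0. Qed.

Let sub_measure_ge0 A : (0 <= sub_measure Gm A)%E. Proof. exact: measure_ge0. Qed.

Let sub_measure_sigma_additive : semi_sigma_additive (sub_measure Gm).
Proof.
move=> F mF tF mUF; apply: (@measure_semi_sigma_additive _ _ _ Q) => //.
  by move=> n; exact: (sub_sigma_measurable Gm (mF n)).
exact: (sub_sigma_measurable Gm mUF).
Qed.

HB.instance Definition _ := isMeasure.Build _ _ _ (sub_measure Gm)
  sub_measure0 sub_measure_ge0 sub_measure_sigma_additive.

Let sub_measure_finite : fin_num_fun (sub_measure Gm).
Proof. by move=> A mA; apply: fin_num_measure; exact: (sub_sigma_measurable Gm mA). Qed.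

HB.instance Definition _ := Measure_isFinite.Build _ _ _ (sub_measure Gm)
  sub_measure_finite.

Lemma ge0_integral_sub_measure (A : set (g_sigma_algebraType G))
    (f : g_sigma_algebraType G -> \bar R) :
  measurable A -> measurable_fun setT f -> (forall x, 0 <= f x)%E ->
  (\int[sub_measure Gm]_(x in A) f x = \int[Q]_(x in A) f x)%E.
Proof.
move=> mA mf f0.
have := @ge0_integral_pushforward _ _ Omega (g_sigma_algebraType G) R id
  (measurable_fun_id_sub Gm) Q A f mA (measurable_funTS mf) (fun x _ => f0 x).
by rewrite preimage_id.
Qed.

End sub_measure.

(** The Radon-Nikodym derivative, on the sub-sigma-field, of P restricted to B. A version must exist
    for the supremum in [mixing_coef] to constrain the event B at all. *)
Lemma cond_probability_exists {R : realType} {dO} {Omega : measurableType dO}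
    (P : probability Omega R) (G : set (set Omega)) (B : set Omega) :
  G `<=` measurable -> measurable B ->
  exists Z, cond_probability P <<s G >> B Z.
Proof.
move=> Gm mB.
pose mu : {finite_measure set (g_sigma_algebraType G) -> \bar R} := sub_measure P Gm.
pose nu : {finite_measure set (g_sigma_algebraType G) -> \bar R} :=
  sub_measure (mrestr P mB) Gm.
have numu : nu `<< mu.
  apply/null_content_dominatesP => A mA muA.
  apply/eqP; rewrite eq_le measure_ge0 andbT -[X in (_ <= X)%E]muA.
  apply: le_measure; rewrite ?inE//; last exact: (sub_sigma_measurable Gm mA).
  by apply: measurableI => //; exact: (sub_sigma_measurable Gm mA).
have [f [f0 fint fE]] := radon_nikodym_finite numu.
have [mf flty] := integrableP _ _ _ fint.
have mfP : measurable_fun setT (f : Omega -> \bar R).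
  exact: (measurableT_comp mf (measurable_fun_id_sub Gm)).
have intP : P.-integrable setT (f : Omega -> \bar R).
  apply/integrableP; split=> //; move: flty.
  by rewrite /mu ge0_integral_sub_measure//; exact: measurableT_comp.
have ffin : {ae P, forall x, f x \is a fin_num}.
  by have := integrable_ae measurableT intP; apply: filterS => x /(_ I).
have mfin : measurable_fun setT (fine \o f : Omega -> R).
  exact: (measurableT_comp (fine_measurable measurableT) mfP).
exists (fine \o f); split.
- move=> C mC; rewrite -[X in <<s G >> X]setTI.
  exact: (measurableT_comp (fine_measurable measurableT) mf).
- apply/integrableP; split.
    exact/measurable_EFinP.
  have [_] := integrableP _ _ _ intP; apply: le_lt_trans.
  apply: ge0_le_integral => //.
  + by apply: measurableT_comp => //; exact/measurable_EFinP.
  + exact: measurableT_comp.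
  + by move=> x _ /=; case: (f x) => [r| |] /=; rewrite ?normr0 ?leey ?lexx.
- move=> A GA; have mA := sub_sigma_measurable Gm GA.
  have nuE : nu A = P (A `&` B) by [].
  rewrite -nuE fE// /mu ge0_integral_sub_measure//.
  apply: ae_eq_integral => //.
  + by apply: measurable_funTS; exact/measurable_EFinP.
  + exact: measurable_funTS.
  + case: ffin => D [mD D0 Dsub]; exists D; split=> // x nx; apply: Dsub => /= fx.
    by apply: nx => _ /=; rewrite fineK.
Qed.

Section mixing.
Context {R : realType} {dO dY : measure_display}.
Context {Omega : measurableType dO} {Y : measurableType dY}.
Variables (P : probability Omega R) (Yt : int -> Omega -> Y).
Hypothesis mY : forall t, measurable_fun setT (Yt t).

Lemma sigma_process_measurable D : sigma_process Yt D `<=` measurable.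
Proof.
apply: smallest_sub; first exact: sigma_algebra_measurable.
by move=> _ [u _ [B mB ->]]; rewrite -[X in measurable X]setTI; exact: mY.
Qed.

(** The essential bound on P(B | F_u) - P(B) is integrated over A only, which keeps the factor P(A)
    on the right; the dichotomy for events at lag 0 depends on it. *)
Lemma mixing_events (n : nat) (r : R) (u : int) (A B : set Omega) :
  0 <= r -> (mixing_coef P Yt n <= r%:E)%E -> sigma_past Yt u A ->
  sigma_future Yt (u + n%:Z) B ->
  `|fine (P (A `&` B)) - fine (P A) * fine (P B)| <= r * fine (P A).
Proof.
move=> r0 mix pA fB.
have mA := sigma_process_measurable pA; have mB := sigma_process_measurable fB.
have Gm : [set A | exists2 v, [set v | v <= u] v &
    exists2 C, measurable C & A = Yt v @^-1` C] `<=` (measurable : set (set Omega)).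
  by move=> _ [v _ [C mC ->]]; rewrite -[X in measurable X]setTI; exact: mY.
have [Z [ZG Zint ZE]] := cond_probability_exists P Gm mB.
have supZ : (ess_sup P (fun w => `|(Z w)%:E - P B|) <= r%:E)%E.
  apply: le_trans mix; apply: ereal_sup_ubound; exists u, B, Z; split=> //.
have aeZ : {ae P, forall w, (`|(Z w)%:E - P B| <= r%:E)%E} by apply/ess_supP.
have PBE : P B = (fine (P B))%:E by rewrite fineK// fin_num_measure.
have PAE : P A = (fine (P A))%:E by rewrite fineK// fin_num_measure.
have PABE : P (A `&` B) = (fine (P (A `&` B)))%:E.
  by rewrite fineK// fin_num_measure//; exact: measurableI.
have intZ : P.-integrable A (EFin \o Z) by exact: integrableS Zint.
have intc (c : R) : P.-integrable A (EFin \o cst c).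
  by apply: integrableS (bmeas_integrable P (bmeas_cst c)).
have mZ : measurable_fun setT Z.
  by apply/measurable_EFinP; have [] := integrableP _ _ _ Zint.
have E : (\int[P]_(w in A) ((Z w)%:E - (fine (P B))%:E) =
   (fine (P (A `&` B)) - fine (P A) * fine (P B))%:E)%E.
  rewrite integralB//; last exact: intc.
  by rewrite ZE// integral_cst// EFinB EFinM -PABE -PAE [in RHS]muleC.
rewrite -lee_fin -abse_EFin -E.
apply: (le_trans (le_abse_integral _ mA _)).
  apply: measurable_funTS; apply: emeasurable_funB; first exact/measurable_EFinP.
  exact: measurable_cst.
rewrite EFinM -PAE -(integral_cst P mA); apply: ae_ge0_le_integral => //.
- apply: measurable_funTS; apply: measurableT_comp => //; apply: emeasurable_funB.
    exact/measurable_EFinP.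
  exact: measurable_cst.
- by move: aeZ; apply: filterS => w; rewrite PBE.
Qed.

End mixing.

(** * Second moments and laws of large numbers along windows *)

Lemma ae_cvg0_of_summable {R : realType} {d} {T : measurableType d}
    (mu : {finite_measure set T -> \bar R}) (f : nat -> T -> R) (a : nat -> R) :
  (forall n, bounded_measurable (f n)) -> (forall n x, 0 <= f n x) ->
  (forall n, \int[mu]_x f n x <= a n) -> cvgn (series a) ->
  {ae mu, forall x, f n x @[n --> \oo] --> 0}.
Proof.
move=> bf f0 fa ca.
have a0 n : 0 <= a n by apply: le_trans (fa n); apply: Rintegral_ge0 => x _.
have nda : nondecreasing_seq (series a).
  by apply/nondecreasing_seqP => n; rewrite -subr_ge0 seriesSB.
(* The sum has finite integral by monotone convergence, so it is finite almost surely and its terms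
   tend to 0. *)
pose F x := (\sum_(n <oo) (f n x)%:E)%E.
have mfn n : measurable_fun setT (fun x => (f n x)%:E).
  by apply/measurable_EFinP; have [] := bf n.
have F0 x : (0 <= F x)%E by apply: nneseries_ge0 => n _ _; rewrite lee_fin.
have mF : measurable_fun setT F.
  by apply: ge0_emeasurable_sum => [n x _ _|n _]; [rewrite lee_fin|exact: mfn].
have Flty : (\int[mu]_x F x < +oo)%E.
  rewrite integral_nneseries//; last by move=> n x _; rewrite lee_fin.
  apply: (@le_lt_trans _ _ (limn (series a))%:E); last exact: ltry.
  apply: lime_le.
    by apply: is_cvg_nneseries => n _ _; apply: integral_ge0 => x _; rewrite lee_fin.
  near=> n; apply: (@le_trans _ _ (series a n)%:E).
    rewrite /series/= -sumEFin; apply: lee_sum => i _.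
    by rewrite bintegral_EFin// lee_fin.
  by rewrite lee_fin; exact: nondecreasing_cvgn_le.
have intF : mu.-integrable setT F.
  apply/integrableP; split=> //.
  by under eq_integral do rewrite gee0_abs//.
have [D [mD D0 Dsub]] := integrable_ae measurableT intF.
exists D; split=> // x nx; apply: Dsub => /= Ffin; apply: nx.
have {}Ffin := Ffin I.
apply: cvg_series_cvg_0; apply: nondecreasing_is_cvgn.
  by apply/nondecreasing_seqP => n; rewrite -subr_ge0 seriesSB.
exists (fine (F x)) => _ [n _ <-].
rewrite -lee_fin fineK// /series/= -sumEFin.
by apply: nneseries_lim_ge => i _ _; rewrite lee_fin.
Unshelve. all: by end_near. Qed.

(** By induction, each new term adds its own variance, at most 1, and twice covariances that sum to
    at most b / (1 - b); 2 / (1 - b) = 2 b / (1 - b) + 2 absorbs both. *)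
Lemma variance_of_decorrelated {R : realType} {d} {T : measurableType d}
    (mu : {finite_measure set T -> \bar R}) (Z : nat -> T -> R) (b : R) :
  0 < b < 1 -> (forall j, bounded_measurable (Z j)) ->
  (forall j, \int[mu]_x (Z j x ^+ 2) <= 1) ->
  (forall i j, (i < j)%N -> `|\int[mu]_x (Z i x * Z j x)| <= b ^+ (j - i)) ->
  forall q, \int[mu]_x ((\sum_(j < q) Z j x) ^+ 2) <= q%:R * (2 / (1 - b)).
Proof.
move=> /andP[b0 b1] bZ Z1 Zij; elim=> [|q IH].
  under eq_Rintegral do rewrite big_ord0 expr0n/=.
  by rewrite Rintegral_cst// !mul0r.
have bZ2 j : bounded_measurable (fun x => Z j x ^+ 2).
  by under eq_fun do rewrite expr2; exact: bmeasM.
have bS : bounded_measurable (fun x => \sum_(j < q) Z j x) by exact: bmeas_sum.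
have bS2 : bounded_measurable (fun x => (\sum_(j < q) Z j x) ^+ 2).
  by under eq_fun do rewrite expr2; exact: bmeasM.
have bSZ : bounded_measurable (fun x => \sum_(j < q) Z j x * Z q x).
  by apply: bmeas_sum => j; exact: bmeasM.
have -> : \int[mu]_x ((\sum_(j < q.+1) Z j x) ^+ 2) =
    \int[mu]_x ((\sum_(j < q) Z j x) ^+ 2) + (2 * \sum_(j < q) \int[mu]_x (Z j x * Z q x)
      + \int[mu]_x (Z q x ^+ 2)).
  rewrite -bintegral_sum; last by move=> j; exact: bmeasM.
  rewrite -bintegralZl// -bintegralD//; last exact: bmeasZ.
  rewrite -bintegralD//; last by apply: bmeasD => //; exact: bmeasZ.
  apply: eq_Rint => x; rewrite big_ord_recr/= -mulr_suml; ring.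
have geo : \sum_(j < q) b ^+ (q - j) <= b / (1 - b).
  rewrite ler_pdivlMr ?subr_gt0//.
  suff -> : (\sum_(j < q) b ^+ (q - j)) * (1 - b) = b - b ^+ q.+1.
    by rewrite gerBl exprn_ge0// ltW.
  elim: q {IH bS bS2 bSZ} => [|q IH]; first by rewrite big_ord0 mul0r expr1 subrr.
  rewrite big_ord_recl/= subn0 mulrDl.
  under eq_bigr do rewrite /bump/= add1n subSS.
  by rewrite IH !exprS; ring.
have S1 : \sum_(j < q) \int[mu]_x (Z j x * Z q x) <= b / (1 - b).
  apply: le_trans geo; apply: ler_sum => j _.
  by apply: le_trans (ler_norm _) _; exact: Zij.
have Zq := Z1 q.
have e : 2 / (1 - b) = 2 * (b / (1 - b)) + 2.
  by field; rewrite subr_eq0 eq_sym lt_eqF.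
rewrite -natr1 mulrDl mul1r; lra.
Qed.

Section windows.
Context {R : realType} {dO dY : measure_display}.
Context {Omega : measurableType dO} {Y : measurableType dY}.
Variables (P : probability Omega R) (Yt : int -> Omega -> Y).
Hypothesis mY : forall t, measurable_fun setT (Yt t).
Hypothesis Y_stationary : stationary P Yt.
Variables (C0 b : R).
Hypothesis C0_ge0 : 0 <= C0.
Hypothesis C0_lt1 : C0 < 1.
Hypothesis b01 : 0 < b < 1.
Hypothesis Y_mixing : forall n, (mixing_coef P Yt n <= (C0 * b ^+ n)%:E)%E.

Definition window (n : nat) (k : int) (w : Omega) : n.-tuple Y :=
  [tuple Yt ((i : nat)%:Z + k) w | i < n].

Lemma measurable_window n k : measurable_fun setT (window n k).
Proof.
apply/measurable_fun_tnthP => i; rewrite (_ : _ \o _ = Yt ((i : nat)%:Z + k))//.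
by apply/funext => w /=; rewrite /window tnth_mktuple.
Qed.

Lemma window_law n k (D : set (n.-tuple Y)) : measurable D ->
  P (window n k @^-1` D) = P (window n 0 @^-1` D).
Proof.
move=> mD.
have := Y_stationary [tuple (i : nat)%:Z | i < n] k mD.
have E k' : [set w | D [tuple Yt (tnth [tuple (i : nat)%:Z | i < n] i + k') w | i < n]] =
    window n k' @^-1` D.
  apply/funext => w /=; rewrite /window; congr (D _).
  by apply: eq_mktuple => i; rewrite tnth_mktuple.
rewrite E => ->; rewrite -E; congr (P _); apply/funext => w /=; congr (D _).
by apply: eq_mktuple => i; rewrite addr0.
Qed.

Lemma window_sigma n k (A : set int) (D : set (n.-tuple Y)) : measurable D ->
  (forall i, (i < n)%N -> A (i%:Z + k)) ->
  sigma_process Yt A (window n k @^-1` D).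
Proof.
move=> mD Ak.
suff H : sub_measurable [set B | exists2 u, A u & exists2 C, measurable C & B = Yt u @^-1` C]
   (window n k).
  by have := H measurableT _ mD; rewrite setTI.
apply/measurable_fun_tnthP => i /= _ C mC; rewrite setTI; apply: sub_sigma_algebra.
exists ((i : nat)%:Z + k); first exact: Ak.
by exists C => //; apply/seteqP; split=> w /=; rewrite /window tnth_mktuple.
Qed.

Lemma window_frequency_variance n k (D : set (n.-tuple Y)) q : (0 < n)%N ->
  measurable D ->
  \int[P]_w ((\sum_(j < q) (\1_D (window n (k + (j * n)%N%:Z) w)
     - fine (P (window n 0 @^-1` D)))) ^+ 2) <= q%:R * (2 / (1 - b)).
Proof.
move=> n0 mD; set p := fine _.
have fin A : measurable A -> P A = (fine (P A))%:E by move=> mA; rewrite fineK// fin_num_measure.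
pose E (j : nat) : set Omega := window n (k + (j * n)%N%:Z) @^-1` D.
have mE j : measurable (E j).
  by rewrite /E -[X in measurable X]setTI; exact: measurable_window.
have PE j : fine (P (E j)) = p by rewrite /p /E window_law.
have P1 : fine (P setT) = 1 by rewrite probability_setT.
have p01 : 0 <= p <= 1.
  by rewrite -(PE 0%N) fine_ge0//= -lee_fin -fin//; exact: probability_le1.
have bI j : bounded_measurable (\1_(E j) : Omega -> R) by exact: bmeas_indic.
have iE A : measurable A -> \int[P]_x (\1_A x : R) = fine (P A).
  by move=> mA; rewrite /Rintegral integral_indic// setIT.
have prodE i j : \int[P]_w ((\1_(E i) w - p) * (\1_(E j) w - p)) =
    fine (P (E i `&` E j)) - p * p.
  have -> : \int[P]_w ((\1_(E i) w - p) * (\1_(E j) w - p)) =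
     \int[P]_w ((\1_(E i `&` E j) w : R) + ((- p) * \1_(E i) w + ((- p) * \1_(E j) w + p * p))).
    by apply: eq_Rint => w; rewrite indicI/=; ring.
  have mEE : measurable (E i `&` E j) by exact: measurableI.
  have bIZ l : bounded_measurable (fun w => (- p) * (\1_(E l) w : R)) by exact: bmeasZ.
  have bp := bmeas_cst (T := Omega) (p * p).
  rewrite bintegralD; [|exact: bmeas_indic|by apply: bmeasD => //; exact: bmeasD].
  rewrite bintegralD//; last exact: bmeasD.
  rewrite bintegralD// !bintegralZl//.
  rewrite !iE// !PE (bintegral_cst P p) P1.
    by ring.
  exact: bmeas_cst.
have := @variance_of_decorrelated _ _ _ P (fun j w => \1_(E j) w - p) b b01; apply.
- by move=> j; apply: bmeasB => //; exact: bmeas_cst.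
- move=> j; under eq_Rint do rewrite expr2.
  by rewrite prodE setIid PE; nra.
- move=> i j ij; rewrite prodE -{1}(PE i) -(PE j).
  (* The lag between the last observation of window i and the first of window j. It is at least j -
     i because n >= 1, so covariances decay geometrically in j - i whatever the window length. *)
  set gap := ((j - i) * n - n.-1)%N.
  have gapE : (k + (i * n)%N%:Z + n.-1%:Z + gap%:Z = k + (j * n)%N%:Z).
    rewrite -!addrA -!PoszD; congr (k + _%:Z); rewrite /gap.
    have : (n <= (j - i) * n)%N by rewrite leq_pmull// subn_gt0.
    rewrite mulnBl -[X in (X <= _)%N](prednK n0) ltn_subRL => /ltnW h.
    by rewrite -subnDA addnA subnKC.
  have := @mixing_events R _ _ _ _ P Yt mY gap (C0 * b ^+ gap)
    (k + (i * n)%N%:Z + n.-1%:Z) (E i) (E j).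
  move=> /(_ _ (Y_mixing gap)) H; apply: le_trans (H _ _ _) _.
  + by rewrite mulr_ge0// exprn_ge0// ltW//; case/andP: b01.
  + apply: window_sigma => // l ln /=.
    rewrite addrC lerD2l lez_nat; by case: (n) ln n0.
  + rewrite gapE; apply: window_sigma => // l ln /=; by rewrite lerDr.
  + have /andP[p0 p1] := p01; have /andP[b0 b1] := b01; rewrite PE.
    have bg : b ^+ gap <= b ^+ (j - i).
      apply: ler_wiXn2l; rewrite ?ltW// /gap.
      case: (n) n0 => // n' _ /=; rewrite mulnS -addnBA; first exact: leq_addr.
      by rewrite leq_pmull// subn_gt0.
    have g0 : 0 <= b ^+ gap by rewrite exprn_ge0// ltW.
    apply: le_trans bg; apply: (@le_trans _ _ (C0 * b ^+ gap)).
      by rewrite ler_piMr// mulr_ge0.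
    by rewrite ler_piMl// ltW.
Qed.

(** Each i has its own starting time k i, so this is a law for an array and not along one
    trajectory. Stationarity makes the mean independent of k i, and the variances of the averages,
    of order 1 / q i, are summable. *)
Lemma ae_window_average_cvg n (f : n.-tuple Y -> R) (k : nat -> int) (q : nat -> nat) :
  (0 < n)%N -> bounded_measurable f -> (forall i, (0 < q i)%N) ->
  cvgn (series (fun i => (q i)%:R^-1 : R)) ->
  {ae P, forall w, (q i)%:R^-1 * \sum_(j < q i) f (window n (k i + (j * n)%N%:Z) w)
    @[i --> \oo] --> \int[P]_w f (window n 0 w)}.
Proof.
move=> n0 bf q0 cq; have /andP[b0 b1] := b01.
have frequency (D : set (n.-tuple Y)) : measurable D ->
    {ae P, forall w, (q i)%:R^-1 * \sum_(j < q i) (\1_D (window n (k i + (j * n)%N%:Z) w)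
      - fine (P (window n 0 @^-1` D))) @[i --> \oo] --> (0 : R)}.
  move=> mD; set p := fine _.
  pose s i w : R := \sum_(j < q i) (\1_D (window n (k i + (j * n)%N%:Z) w) - p).
  have bs i : bounded_measurable (s i).
    apply: bmeas_sum => j; apply: bmeasB; last exact: bmeas_cst.
    by apply: (@bmeas_comp _ _ _ _ _ \1_D); [exact: bmeas_indic|exact: measurable_window].
  have qn0 i : (q i)%:R != 0 :> R by rewrite pnatr_eq0 -lt0n.
  have [D' [mD' D'0 D'sub]] : {ae P, forall w, ((q i)%:R^-1 * s i w) ^+ 2 @[i --> \oo] --> 0}.
    apply: (@ae_cvg0_of_summable _ _ _ P _ (fun i => (2 / (1 - b)) *: (q i)%:R^-1)).
    - by move=> i; under eq_fun do rewrite expr2; apply: bmeasM; exact: bmeasZ.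
    - by move=> i x; exact: sqr_ge0.
    - move=> i; under eq_Rint do rewrite exprMn.
      rewrite bintegralZl; last by under eq_fun do rewrite expr2; exact: bmeasM.
      have := window_frequency_variance (k i) (q i) n0 mD.
      rewrite -(ler_pM2l (_ : 0 < (q i)%:R^-1 ^+ 2)); last first.
        by rewrite exprn_gt0// invr_gt0 ltr0n.
      move=> /le_trans; apply; rewrite expr2 -mulrA [_ * (_ * (_ / _))]mulrA.
      by rewrite mulVf// mul1r mulrC.
    - have -> : series (fun i => (2 / (1 - b)) *: (q i)%:R^-1 : R) =
         (2 / (1 - b)) *: series (fun i => (q i)%:R^-1 : R).
        by apply/funext => i; rewrite /series/= -scaler_sumr.
      exact: is_cvgZl_tmp.
  exists D'; split=> // w nw; apply: D'sub => /= h; apply: nw.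
  apply: (@norm_cvg0 _ R^o).
  have -> : (fun i => `|(q i)%:R^-1 * s i w|) =
      (fun i => Num.sqrt (((q i)%:R^-1 * s i w) ^+ 2)).
    by apply/funext => i; rewrite sqrtr_sqr.
  by rewrite -[X in _ --> X]sqrtr0; apply: (cvg_comp _ _ h); exact: sqrt_continuous.
have mwin i j : measurable_fun setT (window n (k i + (j * n)%N%:Z)) by exact: measurable_window.
(* A step function within e of f reduces the claim to finitely many frequencies. The three errors
   are the replacement of f in the average, its replacement in the mean, and the convergence of the
   frequencies. *)
have approx (e : R) : 0 < e -> {ae P, forall w, \forall i \near \oo,
   `|(q i)%:R^-1 * \sum_(j < q i) f (window n (k i + (j * n)%N%:Z) w) -
     \int[P]_w f (window n 0 w)| <= 3 * e}.
  move=> e0; have [r [c [D [mD fD]]]] := bmeas_quantize bf e0.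
  pose p l := fine (P (window n 0 @^-1` D l)).
  have aeall : {ae P, forall w, forall l, (q i)%:R^-1 *
     \sum_(j < q i) (\1_(D l) (window n (k i + (j * n)%N%:Z) w) - p l) @[i --> \oo] --> (0 : R)}.
    by apply/ae_foralln => l; exact: frequency.
  have [E [mE E0 Esub]] := aeall; exists E; split=> // w nw; apply: Esub => /= h; apply: nw.
  have lim0 : \sum_(l < r) c l * ((q i)%:R^-1 *
     \sum_(j < q i) (\1_(D l) (window n (k i + (j * n)%N%:Z) w) - p l)) @[i --> \oo] --> (0 : R).
    have s0 : \sum_(l < r) c l * 0 = 0 :> R by rewrite big1// => l _; rewrite mulr0.
    rewrite -[X in _ --> X]s0.
    by apply: (@cvg_big _ _ +%R 0 _ (@add_continuous R^o)) => l _; apply: cvgMl_tmp; exact: h.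
  have mean : `|\int[P]_w f (window n 0 w) - \sum_(l < r) c l * p l| <= e.
    have bfw : bounded_measurable (fun w => f (window n 0 w)).
      by apply: bmeas_comp => //; exact: measurable_window.
    have bDw l : bounded_measurable (fun w => c l * \1_(D l) (window n 0 w) : R).
      apply: bmeasZ; apply: (@bmeas_comp _ _ _ _ _ \1_(D l)); first exact: bmeas_indic.
      exact: measurable_window.
    have -> : \sum_(l < r) c l * p l = \int[P]_w (\sum_(l < r) c l * \1_(D l) (window n 0 w)).
      rewrite bintegral_sum//; apply: eq_bigr => l _; rewrite bintegralZl; last first.
        apply: (@bmeas_comp _ _ _ _ _ \1_(D l)); first exact: bmeas_indic.
        exact: measurable_window.
      congr (_ * _); rewrite /p /Rintegral.
      have mW : measurable (window n 0 @^-1` D l).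
        by rewrite -[X in measurable X]setTI; exact: measurable_window.
      by rewrite -[in LHS](setIT (_ @^-1` _)) -integral_indic.
    rewrite -bintegralB//; last exact: bmeas_sum.
    have bd : bounded_measurable (fun w => f (window n 0 w) -
        \sum_(l < r) c l * \1_(D l) (window n 0 w)) by apply: bmeasB => //; exact: bmeas_sum.
    have P1 : fine (P setT) = 1 by rewrite probability_setT.
    have e1 (s : R) : s = \int[P]_(x in setT) s by rewrite bintegral_cst P1 mulr1.
    rewrite ler_norml {1}(e1 (- e)) {2}(e1 e); apply/andP; split.
      apply: le_bintegral => // [|x]; first exact: bmeas_cst.
      by have := fD (window n 0 x); rewrite ler_norml => /andP[].
    apply: le_bintegral => // [|x]; first exact: bmeas_cst.
    by have := fD (window n 0 x); rewrite ler_norml => /andP[].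
  have /cvgrPdist_le /(_ _ e0) := lim0; apply: filterS => i; rewrite sub0r normrN => hi.
  have qn0 : (q i)%:R != 0 :> R by rewrite pnatr_eq0 -lt0n.
  have qg0 : 0 < (q i)%:R :> R by rewrite ltr0n.
  have h1 : `|(q i)%:R^-1 * \sum_(j < q i) f (window n (k i + (j * n)%N%:Z) w) -
     (q i)%:R^-1 * \sum_(j < q i) \sum_(l < r) c l * \1_(D l) (window n (k i + (j * n)%N%:Z) w)| <= e.
    rewrite -mulrBr -sumrB normrM ger0_norm ?invr_ge0 ?ler0n//.
    rewrite ler_pdivrMl//; apply: le_trans (ler_norm_sum _ _ _) _.
    apply: le_trans (ler_sum _ (fun j _ => fD _)) _.
    by rewrite sumr_const card_ord mulr_natl.
  have h2 : \sum_(l < r) c l * ((q i)%:R^-1 *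
     \sum_(j < q i) (\1_(D l) (window n (k i + (j * n)%N%:Z) w) - p l)) =
     (q i)%:R^-1 * (\sum_(j < q i) \sum_(l < r) c l * \1_(D l) (window n (k i + (j * n)%N%:Z) w))
     - \sum_(l < r) c l * p l.
    rewrite exchange_big/= mulr_sumr -sumrB; apply: eq_bigr => l _.
    rewrite -mulr_sumr sumrB sumr_const card_ord mulrBr -[p l *+ _]mulr_natl mulrA mulVf//.
    by ring.
  rewrite h2 in hi; move: hi h1 mean; rewrite !ler_norml; lra.
have [E [mE E0 Esub]] : {ae P, forall w, forall r : nat, \forall i \near \oo,
   `|(q i)%:R^-1 * \sum_(j < q i) f (window n (k i + (j * n)%N%:Z) w) -
     \int[P]_w f (window n 0 w)| <= 3 * r.+1%:R^-1}.
  by apply/ae_foralln => r; apply: approx; rewrite invr_gt0 ltr0n.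
exists E; split=> // w nw; apply: Esub => /= h; apply: nw.
apply/cvgrPdist_le => e e0.
have [r _ re] := near_infty_natSinv_lt (PosNum (divr_gt0 e0 (ltr0n _ 3))).
have {}re := re r (leqnn r).
apply: filterS (h r) => i; rewrite distrC => /le_trans; apply.
by move: re => /=; rewrite ltr_pdivlMr// mulrC => /ltW.
Qed.

End windows.

(** * Difference quotients of log masses *)

Lemma eq_fk_mass {R : realType} {dX} {X : measurableType dX}
    (lambda : {finite_measure set X -> \bar R}) n (K K' : nat -> X -> X -> R) x :
  (forall i y z, (i < n)%N -> K i y z = K' i y z) ->
  fk_mass lambda n K x = fk_mass lambda n K' x.
Proof.
elim: n K K' x => [//|n IH] K K' x KK /=.
apply: eq_Rint => z; rewrite KK//; congr (_ * _); apply: IH => i y z' ni.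
exact: KK.
Qed.

Section log_ratio.
Context {R : realType} {dX dY : measure_display}.
Context {X : measurableType dX} {Y : measurableType dY}.
Variable lambda : {finite_measure set X -> \bar R}.
Variable chi : probability X R.
Hypothesis lambda_gt0 : 0 < fine (lambda setT).
Variables (k1 k2 M : R).
Hypothesis k1_gt0 : 0 < k1.
Hypothesis k12 : k1 <= k2.
Hypothesis M_ge0 : 0 <= M.
Variables (Kf sf : X -> X -> Y -> R).
Hypothesis mKf : measurable_fun setT (fun z : X * X * Y => Kf z.1.1 z.1.2 z.2).
Hypothesis msf : measurable_fun setT (fun z : X * X * Y => sf z.1.1 z.1.2 z.2).
Hypothesis Kf_bound : forall x z y, k1 <= Kf x z y <= k2.
Hypothesis sf_bound : forall x z y, `|sf x z y| <= M.

Definition along {A B : Type} (f : A -> A -> B -> R) (v : nat -> B) : nat -> A -> A -> R :=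
  fun i x z => f x z (v i).

Local Lemma measurable_section (f : X -> X -> Y -> R) (y : Y) :
  measurable_fun setT (fun z : X * X * Y => f z.1.1 z.1.2 z.2) ->
  measurable_fun setT (fun z : X * X => f z.1 z.2 y).
Proof.
move=> mf; apply: (measurableT_comp mf (_ : measurable_fun _ (fun z : X * X => (z.1, z.2, y)))).
apply/measurable_fun_pairP; split; last exact: measurable_cst.
by apply/measurable_fun_pairP; split; [exact: measurable_fst|exact: measurable_snd].
Qed.

Lemma kernel_along v : kernel_between k1 k2 (along Kf v).
Proof. by move=> i; split; [exact: measurable_section|move=> x z; exact: Kf_bound]. Qed.

Lemma cost_along v : cost_bounded M (along sf v).
Proof. by move=> i; split; [exact: measurable_section|move=> x z; exact: sf_bound]. Qed.

Variable u : R.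
Hypothesis u_gt0 : 0 < u.

(** The difference quotient, with step u, of the log mass in the direction of the cost. Unlike the
    mean it approximates, it splits over disjoint windows with errors that do not grow with their
    lengths. *)
Definition log_ratio n (v : nat -> Y) : R :=
  (ln (fk_total lambda chi n (tilt (fun i x z => u * along sf v i x z) (along Kf v)))
   - ln (fk_total lambda chi n (along Kf v))) / u.

Let ucost v : cost_bounded (u * M) (fun i x z => u * along sf v i x z).
Proof.
move=> i; have [ms sM] := cost_along v i; split; first exact: measurable_funM.
by move=> x z; rewrite normrM gtr0_norm// ler_pM2l.
Qed.

Let x0 : X := point.

(** [fk_total_add] is used twice: tilting by u s widens the band of the kernel, whose log ratio
    becomes ln (k2 / k1) + 2 u M. *)
Lemma log_ratio_add n p v :
  `|log_ratio (n + p) v - log_ratio n v - log_ratio p (shift n v)|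
    <= (2 * ln (k2 / k1) + 2 * u * M) / u.
Proof.
have hT := tilt_between k1_gt0 k12 (kernel_along v) (ucost v).
have k1' : 0 < k1 * expR (- (u * M)) by rewrite mulr_gt0// expR_gt0.
have k2_gt0 : 0 < k2 by apply: lt_le_trans k12.
have H1 := fk_total_add chi lambda_gt0 k1_gt0 k12 n p (kernel_along v).
have H2 := fk_total_add chi lambda_gt0 k1' (tilt_le (along Kf v) k1_gt0 k12 (ucost v) x0) n p hT.
have e : ln (k2 * expR (u * M) / (k1 * expR (- (u * M)))) = ln (k2 / k1) + 2 * u * M.
  rewrite expRN invfM invrK mulrACA [LHS]lnM ?posrE ?divr_gt0 ?mulr_gt0 ?expR_gt0//.
  by rewrite -expRD expRK; ring.
rewrite e in H2; rewrite /log_ratio.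
have e2 : shift n (tilt (fun i x z => u * along sf v i x z) (along Kf v)) =
  tilt (fun i x z => u * along sf (shift n v) i x z) (along Kf (shift n v)) by [].
rewrite e2 in H2.
move: H1 H2; have -> : shift n (along Kf v) = along Kf (shift n v) by [].
rewrite -!mulrBl normrM [`|u^-1|]gtr0_norm ?invr_gt0// ler_pM2r ?invr_gt0//.
have aux (a0 a1 a2 b0 b1 b2 c1 c2 : R) : `|b0 - b1 - b2| <= c1 ->
    `|a0 - a1 - a2| <= c2 -> `|a0 - b0 - (a1 - b1) - (a2 - b2)| <= c2 + c1.
  by rewrite !ler_norml; lra.
move=> H1 H2; apply: le_trans (aux _ _ _ _ _ _ _ _ H1 H2) _.
by rewrite le_eqVlt; apply/orP; left; apply/eqP; ring.
Qed.

(** Excess of the quotient over the mean, per step: the second-order tilting error for the cost u s,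
    divided by u, hence proportional to u. *)
Definition log_ratio_defect : R := 2 * (4 * (u * M) / (k1 / k2)) ^+ 2 / u.

Hypothesis uM : 4 * (u * M) / (k1 / k2) <= 1.

Lemma log_ratio_expect n v :
  fk_expect lambda chi n (along Kf v) (along sf v) <= log_ratio n v <=
  fk_expect lambda chi n (along Kf v) (along sf v) + n.+1%:R * log_ratio_defect.
Proof.
have E := fk_expectZ chi lambda_gt0 k1_gt0 n u (kernel_along v) (cost_along v).
have H1 := fk_expect_tilt chi lambda_gt0 k1_gt0 k12 n (kernel_along v) (ucost v).
have H2 := fk_tilt_expect chi lambda_gt0 k1_gt0 k12 n (kernel_along v) (ucost v) uM.
rewrite E in H1 H2; rewrite /log_ratio ler_pdivlMr// mulrC H1/= ler_pdivrMr//.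
apply: le_trans H2 _; rewrite le_eqVlt; apply/orP; left; apply/eqP.
rewrite /log_ratio_defect; move: (_ ^+ 2) (fk_expect _ _ _ _ _) => D E'.
by field; rewrite gt_eqF.
Qed.

Definition log_ratio_max n : R := n%:R * M + n.+1%:R * log_ratio_defect.

Lemma log_ratio_defect_ge0 : 0 <= log_ratio_defect.
Proof. by rewrite divr_ge0 ?(ltW u_gt0)// mulr_ge0// sqr_ge0. Qed.

Lemma log_ratio_bound n v : `|log_ratio n v| <= log_ratio_max n.
Proof.
have := log_ratio_expect n v.
have := fk_expect_bound chi lambda_gt0 k1_gt0 n (kernel_along v) (cost_along v).
have : 0 <= n.+1%:R * log_ratio_defect by rewrite mulr_ge0 ?log_ratio_defect_ge0.
rewrite /log_ratio_max; move: (_ * log_ratio_defect) (_ * M) (fk_expect _ _ _ _ _).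
by move: (log_ratio n v) => A B C D; rewrite !ler_norml; lra.
Qed.

Lemma log_ratio_blocks q l r v :
  `|log_ratio (q * l + r) v - \sum_(j < q) log_ratio l (shift (j * l) v)
    - log_ratio r (shift (q * l) v)| <= q%:R * ((2 * ln (k2 / k1) + 2 * u * M) / u).
Proof.
elim: q r => [|q IH] r.
  by rewrite mul0n add0n big_ord0 mul0r subr0 subrr normr0.
have := IH (l + r)%N; have := log_ratio_add l r (shift (q * l) v).
rewrite big_ord_recr/=; move: (_ / u) => Dd.
have -> : q.+1%:R * Dd = q%:R * Dd + Dd by rewrite -natr1 mulrDl mul1r.
have -> : shift l (shift (q * l) v) = shift (q.+1 * l) v.
  by apply/funext => i; rewrite /shift mulSn addnA [(l + _)%N]addnC.
have -> : (q.+1 * l + r = q * l + (l + r))%N by rewrite mulSn addnA [(l + _)%N]addnC.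
set A := log_ratio _ _; set B := log_ratio _ _; set C := log_ratio _ _.
set D := log_ratio _ _; set F := \sum_(_ < _) _; move: A B C D F => A B C D F.
move: (_ * Dd) => E; by rewrite !ler_norml; lra.
Qed.

(** The last, incomplete window is replaced by a full one, hence the number of windows and twice
    [log_ratio_max l]. The additivity error is paid once per window, so a large l makes it small per
    observation, while the defect is paid at each step. *)
Lemma fk_expect_blocks l n v : (0 < l)%N ->
  `|fk_expect lambda chi n (along Kf v) (along sf v)
    - \sum_(j < (n %/ l).+1) log_ratio l (shift (j * l) v)| <=
  (n %/ l).+1%:R * ((2 * ln (k2 / k1) + 2 * u * M) / u)
  + (n%:R * log_ratio_defect + (log_ratio_defect + 2 * log_ratio_max l)).
Proof.
move=> l0; have := log_ratio_blocks (n %/ l) l (n %% l) v.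
rewrite -divn_eq; have := log_ratio_expect n v.
have := log_ratio_bound (n %% l) (shift (n %/ l * l) v).
have := log_ratio_bound l (shift (n %/ l * l) v).
have maxW : log_ratio_max (n %% l) <= log_ratio_max l.
  have rl : (n %% l <= l)%N by rewrite ltnW// ltn_mod.
  apply: lerD; first by rewrite ler_wpM2r// ler_nat.
  by rewrite ler_wpM2r ?log_ratio_defect_ge0// ler_nat.
rewrite big_ord_recr/= -[n.+1%:R]natr1 -[(n %/ l).+1%:R]natr1.
have d0 := log_ratio_defect_ge0.
have k12' : 1 <= k2 / k1 by rewrite ler_pdivlMr// mul1r.
have D0 : 0 <= (2 * ln (k2 / k1) + 2 * u * M) / u.
  apply: divr_ge0 (ltW u_gt0); apply: addr_ge0; apply: mulr_ge0 => //; first exact: ln_ge0.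
  by rewrite mulr_ge0// ltW.
move: D0; set D := (_ / u); move=> D0.
set A := log_ratio _ _; set B := log_ratio _ _; set C := log_ratio _ _.
set F := \sum_(_ < _) _.
have qD : 0 <= (n %/ l)%:R * D by exact: mulr_ge0.
have -> : (n%:R + 1) * log_ratio_defect = n%:R * log_ratio_defect + log_ratio_defect.
  by rewrite mulrDl mul1r.
have -> : ((n %/ l)%:R + 1) * D = (n %/ l)%:R * D + D by rewrite mulrDl mul1r.
move: qD; move: (_ * D) (n%:R * _) (log_ratio_max _) (log_ratio_max _) maxW.
move: (fk_expect _ _ _ _ _) (log_ratio n v) => G H qD nd m1 m2.
move: A B C F D D0 log_ratio_defect d0 => A B C F D D0 d d0.
by rewrite !ler_norml; lra.
Qed.

Lemma bmeas_log_ratio l (y0 : Y) :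
  bounded_measurable (fun v : l.-tuple Y => log_ratio l (nth y0 v)).
Proof.
have mnth i : measurable_fun setT (fun v : l.-tuple Y => nth y0 v i).
  have [il|li] := ltnP i l.
    have -> : (fun v : l.-tuple Y => nth y0 v i) = (fun v => tnth v (Ordinal il)).
      by apply/funext => v; rewrite (tnth_nth y0).
    exact: measurable_tnth.
  rewrite (_ : (fun v : l.-tuple Y => nth y0 v i) = cst y0); first exact: measurable_cst.
  by apply/funext => v; rewrite nth_default// size_tuple.
split; last by exists (log_ratio_max l) => v; exact: log_ratio_bound.
have mf (f : X -> X -> Y -> R) i :
    measurable_fun setT (fun z : X * X * Y => f z.1.1 z.1.2 z.2) ->
    measurable_fun setT (fun z : l.-tuple Y * X * X => along f (nth y0 z.1.1) i z.1.2 z.2).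
  move=> mf; apply: (measurableT_comp mf (_ : measurable_fun _
    (fun z : l.-tuple Y * X * X => (z.1.2, z.2, nth y0 z.1.1 i)))).
  apply/measurable_fun_pairP; split => /=.
    apply/measurable_fun_pairP; split => /=; last exact: measurable_snd.
    exact: (measurableT_comp measurable_snd measurable_fst).
  apply: (measurableT_comp (mnth i)).
  exact: (measurableT_comp measurable_fst measurable_fst).
apply: measurable_funM; last exact: measurable_cst.
have mtot (K : l.-tuple Y -> nat -> X -> X -> R) :
    (forall i, measurable_fun setT (fun z : l.-tuple Y * X * X => K z.1.1 i z.1.2 z.2)) ->
    measurable_fun setT (fun v => ln (fk_total lambda chi l (K v))).
  move=> mK; apply: measurableT_comp; first exact: measurable_ln.
  by apply: measurable_Rintegral_param; exact: measurable_fk_mass.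
apply: measurable_funB; apply: mtot => i; last exact: mf.
apply: measurable_funM; first exact: mf.
apply: measurableT_comp => //; apply: measurable_funM; first exact: measurable_cst.
exact: mf.
Qed.

Lemma eq_log_ratio l v v' : (forall i, (i < l)%N -> v i = v' i) ->
  log_ratio l v = log_ratio l v'.
Proof.
move=> vv; have total (K K' : nat -> X -> X -> R) :
    (forall i y z, (i < l)%N -> K i y z = K' i y z) ->
    fk_total lambda chi l K = fk_total lambda chi l K'.
  by move=> KK; apply: eq_Rint => x; exact: eq_fk_mass.
have e1 : fk_total lambda chi l (along Kf v) = fk_total lambda chi l (along Kf v').
  by apply: total => i y z il; rewrite /along vv.
rewrite /log_ratio e1.
rewrite (total _ (tilt (fun i x z => u * along sf v' i x z) (along Kf v'))) //.
by move=> i y z il; rewrite /tilt /along vv.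
Qed.

End log_ratio.

(** * Law of large numbers for block averages *)

Lemma ae_choose {R : realType} {d} {T : measurableType d} (P : probability T R)
    (A : T -> Prop) : {ae P, forall w, A w} -> exists w, A w.
Proof.
move=> [D [mD D0 Dsub]]; apply: contrapT => nA.
have : P setT = 0%E.
  apply/eqP; rewrite eq_le measure_ge0 andbT -D0; apply: le_measure; rewrite ?inE//.
  by move=> w _; apply: Dsub => Aw; apply: nA; exists w.
by rewrite probability_setT => /eqP; rewrite onee_eq0.
Qed.

Lemma natr_infty {R : realType} (e : R) : 0 < e -> exists n : nat, (0 < n)%N && (n%:R^-1 <= e).
Proof.
move=> e0; exists (Num.bound e^-1).+1 => //=; rewrite invf_ple ?posrE//.
by rewrite -natr1 (le_trans (ltW (archi_boundP _)))// ?invr_ge0 ?ltW// ltrDl.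
Qed.

Section block_lln.
Context {R : realType} {dO dX dY : measure_display}.
Context {Omega : measurableType dO} {X : measurableType dX} {Y : measurableType dY}.
Variables (P : probability Omega R) (Yt : int -> Omega -> Y).
Hypothesis mY : forall t, measurable_fun setT (Yt t).
Hypothesis Y_stationary : stationary P Yt.
Variables (C0 b : R).
Hypothesis C0_ge0 : 0 <= C0.
Hypothesis C0_lt1 : C0 < 1.
Hypothesis b01 : 0 < b < 1.
Hypothesis Y_mixing : forall n, (mixing_coef P Yt n <= (C0 * b ^+ n)%:E)%E.
Variable lambda : {finite_measure set X -> \bar R}.
Variable chi : probability X R.
Hypothesis lambda_gt0 : 0 < fine (lambda setT).
Variables (k1 k2 M : R).
Hypothesis k1_gt0 : 0 < k1.
Hypothesis k12 : k1 <= k2.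
Hypothesis M_ge0 : 0 <= M.
Variables (Kf sf : X -> X -> Y -> R).
Hypothesis mKf : measurable_fun setT (fun z : X * X * Y => Kf z.1.1 z.1.2 z.2).
Hypothesis msf : measurable_fun setT (fun z : X * X * Y => sf z.1.1 z.1.2 z.2).
Hypothesis Kf_bound : forall x z y, k1 <= Kf x z y <= k2.
Hypothesis sf_bound : forall x z y, `|sf x z y| <= M.

Definition observations (k : int) (w : Omega) : nat -> Y := fun j => Yt (j%:Z + k) w.

Definition block_average (n : nat) (k : int) (w : Omega) : R :=
  n%:R^-1 * fk_expect lambda chi n (along Kf (observations k w)) (along sf (observations k w)).

(** The constant c is chosen before the starts and lengths of the blocks; this is what later
    identifies limits taken along different blocks. *)
Lemma ae_block_average_near (e : R) : 0 < e -> exists c : R,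
  forall (k : nat -> int) (n : nat -> nat), (forall i, (0 < n i)%N) ->
  cvgn (series (fun i => (n i)%:R^-1 : R)) ->
  {ae P, forall w, \forall i \near \oo, `|block_average (n i) (k i) w - c| <= 5 * e}.
Proof.
move=> e0; pose a0 := 4 * M / (k1 / k2).
have k2_gt0 : 0 < k2 by apply: lt_le_trans k12.
have a0_ge0 : 0 <= a0 by apply: divr_ge0; [exact: mulr_ge0|apply: ltW; exact: divr_gt0].
(* The first bound makes the tilt small enough for the two-sided estimate, the second makes the
   defect 2 a0^2 u at most e. *)
pose u := Num.min (a0 + 1)^-1 (e / (2 * a0 ^+ 2 + 1)).
have sq0 : 0 <= a0 ^+ 2 by exact: sqr_ge0.
have u0 : 0 < u by rewrite lt_min invr_gt0 divr_gt0//; lra.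
have ua : u * a0 <= 1.
  have : u <= (a0 + 1)^-1 by rewrite ge_min lexx.
  move=> /(ler_wpM2r a0_ge0)/le_trans; apply; rewrite ler_pdivrMl; lra.
have uM : 4 * (u * M) / (k1 / k2) <= 1 by rewrite mulrCA -mulrA.
have ue : log_ratio_defect k1 k2 M u <= e.
  rewrite /log_ratio_defect.
  have -> : 4 * (u * M) / (k1 / k2) = u * a0 by rewrite mulrCA -mulrA.
  have -> : 2 * (u * a0) ^+ 2 / u = u * (2 * a0 ^+ 2) by field; rewrite gt_eqF.
  have : u <= e / (2 * a0 ^+ 2 + 1) by rewrite ge_min lexx orbT.
  move=> /ler_wpM2r => /(_ (2 * a0 ^+ 2)) /(_ _)/le_trans; apply; first lra.
  by rewrite mulrAC ler_pdivrMr; [nra|lra].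
set def := log_ratio_defect k1 k2 M u in ue.
have def0 : 0 <= def by exact: log_ratio_defect_ge0.
pose D := (2 * ln (k2 / k1) + 2 * u * M) / u.
have D0 : 0 <= D.
  have k12' : 1 <= k2 / k1 by rewrite ler_pdivlMr// mul1r.
  apply: divr_ge0 (ltW u0); apply: addr_ge0; apply: mulr_ge0 => //; first exact: ln_ge0.
  by rewrite mulr_ge0// ltW.
(* The window is chosen after u: the additivity error D contains 1 / u and must cost at most e per
   observation once divided by l. *)
have [l /andP[l0 lD]] : exists l : nat, (0 < l)%N && (l%:R^-1 * (D + e) <= e).
  have De : 0 < e / (D + e) by rewrite divr_gt0// ltr_wpDl.
  have [l /andP[l0 lD]] := natr_infty De; exists l; rewrite l0/=.
  by move: lD; rewrite ler_pdivlMr// ltr_wpDl.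
pose V v := log_ratio lambda chi Kf sf u l v.
pose B := log_ratio_max k1 k2 M u l.
have y0 : Y := point.
pose cbar := \int[P]_w V (nth y0 (window Yt l 0 w)).
have VB v : `|V v| <= B by exact: log_ratio_bound.
have bV : bounded_measurable (fun v : l.-tuple Y => V (nth y0 v)).
  exact: (bmeas_log_ratio _ lambda_gt0 k1_gt0 k12).
have B0 : 0 <= B by apply: le_trans (VB (fun=> y0)).
have cB : `|cbar| <= B.
  have bw : bounded_measurable (fun w => V (nth y0 (window Yt l 0 w))).
    by apply: (bmeas_comp bV); exact: measurable_window.
  have P1 : fine (P setT) = 1 by rewrite probability_setT.
  have e1 (s : R) : s = \int[P]_(x in setT) s by rewrite bintegral_cst P1 mulr1.
  rewrite ler_norml {1}(e1 (- B)) {2}(e1 B); apply/andP; split;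
    apply: le_bintegral => // [|w]; try exact: bmeas_cst;
    by have := VB (nth y0 (window Yt l 0 w)); rewrite ler_norml => /andP[].
exists (cbar / l%:R) => k n n0 cn.
pose q i := (n i %/ l).+1.
have ln0 : 0 < l%:R :> R by rewrite ltr0n.
have q_n i : (n i)%:R <= (q i)%:R * l%:R :> R.
  by rewrite -natrM ler_nat ltnW// ltn_ceil.
have n_q i : (q i)%:R * l%:R <= (n i)%:R + l%:R :> R.
  by rewrite -natrM -natrD ler_nat /q mulSn addnC leq_add2r leq_trunc_div.
have ng0 i : 0 < (n i)%:R :> R by rewrite ltr0n.
have cq : cvgn (series (fun i => (q i)%:R^-1 : R)).
  apply: (@series_le_cvg _ _ (fun i => l%:R *: (n i)%:R^-1 : R)).
  - by move=> i; rewrite invr_ge0.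
  - by move=> i; rewrite mulr_ge0// invr_ge0.
  - move=> i; rewrite -[leLHS]mul1r ler_pdivrMr ?ltr0n// mulrAC.
    by rewrite ler_pdivlMr// mul1r mulrC.
  - have -> : series (fun i => l%:R *: (n i)%:R^-1 : R) =
         l%:R *: series (fun i => (n i)%:R^-1 : R).
      by apply/funext => i; rewrite /series/= -scaler_sumr.
    exact: is_cvgZl_tmp.
have [E [mE E0 Esub]] := ae_window_average_cvg mY Y_stationary C0_ge0 C0_lt1 b01
  Y_mixing k l0 bV (fun i => ltn0Sn _) cq.
exists E; split=> // w nw; apply: Esub => /= h; apply: nw.
have /cvgrPdist_le /(_ _ e0) h1 := h.
have n_inv : (n i)%:R^-1 @[i --> \oo] --> (0 : R) by exact: cvg_series_cvg_0.
have small : 0 < e / (D + e + def + 3 * B + 1) by rewrite divr_gt0//; lra.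
have /cvgrPdist_le /(_ _ small) h2 := n_inv.
near=> i.
have := fk_expect_blocks chi lambda_gt0 k1_gt0 k12 M_ge0 mKf msf Kf_bound sf_bound u0 uM
  (n i) (observations (k i) w) l0.
have -> : \sum_(j < (n i %/ l).+1) log_ratio lambda chi Kf sf u l
     (shift (j * l) (observations (k i) w)) =
   \sum_(j < q i) V (nth y0 (window Yt l (k i + (j * l)%N%:Z) w)).
  apply: eq_bigr => j _; apply: eq_log_ratio => a' al.
  rewrite -(tnth_nth y0 _ (Ordinal al)) /window tnth_mktuple /shift /observations/=.
  by rewrite PoszD [k i + _]addrC addrA [_%:Z + a'%:Z]addrC.
rewrite -/(q i) -/D -/def -/B /block_average.
have : `|cbar - (q i)%:R^-1 * \sum_(j < q i) V (nth y0 (window Yt l (k i + (j * l)%N%:Z) w))| <= e.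
  by near: i.
have : `|0 - (n i)%:R^-1| <= e / (D + e + def + 3 * B + 1) by near: i.
have sum0 : 0 < D + e + def + 3 * B + 1 by lra.
rewrite sub0r normrN (ger0_norm (ltW (_ : 0 < (n i)%:R^-1))) ?invr_gt0// (ler_pdivlMr _ _ sum0).
set F := fk_expect _ _ _ _ _; set G := \sum_(j < _) _; set ni := (n i)%:R^-1.
have qg0 : 0 < (q i)%:R :> R by rewrite ltr0n.
move=> H2 H1 H3.
pose r := ni * (q i)%:R.
have nn : ni * (n i)%:R = 1 by rewrite mulVf// gt_eqF.
have ni0 : 0 < ni by rewrite invr_gt0.
have rl : r <= l%:R^-1 + ni.
  rewrite -(ler_pM2r ln0) mulrDl mulVf ?gt_eqF// /r -mulrA.
  by apply: le_trans (ler_wpM2l (ltW ni0) (n_q i)) _; rewrite mulrDr nn.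
have lr : l%:R^-1 <= r.
  rewrite -(ler_pM2r ln0) mulVf ?gt_eqF// /r -mulrA.
  by have := ler_wpM2l (ltW ni0) (q_n i); rewrite nn.
(* Three errors: the mean against the sum over windows, the empirical against the expected window
   value, and the number r of windows per observation against 1 / l. *)
have -> : ni * F - cbar / l%:R = ni * (F - G) + r * ((q i)%:R^-1 * G - cbar) + cbar * (r - l%:R^-1).
  rewrite /r; field; rewrite ?gt_eqF//.
have r0 : 0 <= r by rewrite mulr_ge0// ltW.
have t1 : `|ni * (F - G)| <= r * D + (def + ni * (def + 2 * B)).
  rewrite normrM gtr0_norm//; apply: le_trans (ler_wpM2l (ltW ni0) H3) _.
  rewrite /r le_eqVlt; apply/orP; left; apply/eqP.
  have aux (s x y z v' : R) : s * (x * D + (y * z + v')) = s * x * D + (s * y * z + s * v').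
    by ring.
  by rewrite aux nn mul1r.
have t2 : `|r * ((q i)%:R^-1 * G - cbar)| <= r * e.
  by rewrite normrM ger0_norm// ler_wpM2l// distrC.
have t3 : `|cbar * (r - l%:R^-1)| <= B * ni.
  by rewrite normrM ler_pM// ger0_norm ?subr_ge0// lerBlDl.
have t4 : r * (D + e) <= (l%:R^-1 + ni) * (D + e) by rewrite ler_wpM2r//; lra.
apply: le_trans (ler_normD _ _) _; apply: le_trans (lerD (ler_normD _ _) (lexx _)) _.
apply: le_trans (lerD (lerD t1 t2) t3) _.
have : r * (D + e) = r * D + r * e by rewrite mulrDr.
have : (l%:R^-1 + ni) * (D + e) = l%:R^-1 * (D + e) + ni * (D + e) by rewrite mulrDl.
have : ni * (D + e) = ni * D + ni * e by rewrite mulrDr.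
have : ni * (def + 2 * B) = ni * def + 2 * (ni * B) by rewrite mulrDr; ring.
have : ni * (D + e + def + 3 * B + 1) = ni * D + ni * e + ni * def + 3 * (ni * B) + ni.
  by ring.
rewrite [B * ni]mulrC; lra.
Unshelve. all: by end_near. Qed.

(** The given limit concerns one start k0 and consecutive lengths, whereas the blocks of the
    algorithm have moving starts. The lengths 2^i from k0 satisfy the summability condition, so they
    place the constant of [ae_block_average_near] close to L. *)
Lemma ae_block_average_cvg (k0 : int) (L : R) :
  {ae P, forall w, block_average n k0 w @[n --> \oo] --> L} ->
  forall (k : nat -> int) (n : nat -> nat), (forall i, (0 < n i)%N) ->
  cvgn (series (fun i => (n i)%:R^-1 : R)) ->
  {ae P, forall w, block_average (n i) (k i) w @[i --> \oo] --> L}.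
Proof.
move=> aeL k n n0 cn.
have c2 : cvgn (series (fun i => (2 ^ i)%:R^-1 : R)).
  have -> : (fun i => (2 ^ i)%:R^-1) = geometric 1 (2^-1 : R).
    by apply/funext => i /=; rewrite mul1r natrX exprVn.
  apply: is_cvg_geometric_series; rewrite ger0_norm ?invr_ge0//.
  by rewrite invf_lt1//; lra.
have n2 i : (0 < 2 ^ i)%N by rewrite expn_gt0.
have [E [mE E0 Esub]] : {ae P, forall w, forall r : nat, \forall i \near \oo,
    `|block_average (n i) (k i) w - L| <= r.+1%:R^-1}.
  apply/ae_foralln => r; set e : R := r.+1%:R^-1.
  have e0 : 0 < e by rewrite invr_gt0 ltr0n.
  have [c cP] := ae_block_average_near (divr_gt0 e0 (ltr0n _ 10)).
  have e5 : 5 * (e / 10) = e / 2 by field.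
  have cL : `|L - c| <= e / 2.
    have [w [h1 h2]] := ae_choose (filterI aeL (cP (fun=> k0) (fun i => 2 ^ i)%N n2 c2)).
    have h3 : block_average (2 ^ i) k0 w @[i --> \oo] --> L.
      apply: (cvg_comp (fun i => 2 ^ i)%N _ _ h1).
      apply/cvgnyPge => N; exists N => // i /= Ni.
      by apply: leq_trans Ni _; apply: ltnW; exact: ltn_expl.
    have h4 : `|block_average (2 ^ i)%N k0 w - c| @[i --> \oo] --> `|L - c|.
      by apply: cvg_norm; apply: cvgB => //; exact: cvg_cst.
    by rewrite -e5; exact: (cvgr_to_le h4 h2).
  have [D [mD D0 Dsub]] := cP k n n0 cn; exists D; split=> // w nw; apply: Dsub => /= h.
  apply: nw; apply: filterS h => i; rewrite e5 => hi.
  by move: hi cL; rewrite !ler_norml; lra.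
exists E; split=> // w nw; apply: Esub => /= h; apply: nw.
apply/cvgrPdist_le => e e0.
have [r _ re] := near_infty_natSinv_lt (PosNum e0).
have {}re := re r (leqnn r).
by apply: filterS (h r) => i; rewrite distrC => /le_trans; apply; exact: ltW.
Qed.

End block_lln.

(** * Essential boundedness of the observations *)

Section essential_bounds.
Context {R : realType} {dO dY : measure_display}.
Context {Omega : measurableType dO} {Y : measurableType dY}.
Variables (P : probability Omega R) (Yt : int -> Omega -> Y).
Hypothesis mY : forall t, measurable_fun setT (Yt t).

Lemma stationary_marginal t (A : set Y) : stationary P Yt -> measurable A ->
  P (Yt t @^-1` A) = P (Yt 0 @^-1` A).
Proof.
move=> st mA; pose D := [set v : 1.-tuple Y | A (tnth v ord0)].
have E k : window Yt 1 k @^-1` D = Yt k @^-1` A.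
  by apply/funext => w /=; rewrite /D/= /window tnth_mktuple/= add0r.
rewrite -!E; apply: (@window_law _ _ _ _ _ P Yt st).
by rewrite -[X in measurable X]setTI; exact: (measurable_tnth ord0).
Qed.

Lemma finite_Lp_norm_ae_lty (p : R) (f : Y -> \bar R) (Z : Omega -> Y) :
  0 < p -> measurable_fun setT Z -> finite_Lp_norm P p f Z ->
  {ae P, forall w, (f (Z w) < +oo)%E}.
Proof.
move=> p0 mZ [mf].
have mfZ : measurable_fun setT (fun w => (`|f (Z w)| `^ p)%E).
  apply: (measurableT_comp (measurable_poweR _)).
  by apply: measurableT_comp => //; exact: measurableT_comp.
rewrite unlock /= => h.
have int : P.-integrable setT (fun w => (`|f (Z w)| `^ p)%E).
  apply/integrableP; split=> //; under eq_integral do rewrite gee0_abs ?poweR_ge0//.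
  rewrite ltey; apply/eqP => E; move: h; rewrite E poweRyr ?ltxx//.
  by rewrite invr_neq0 // gt_eqF.
have [D [mD D0 Dsub]] := integrable_ae measurableT int; exists D; split=> // w nw.
apply: Dsub => /= /(_ I) fin; apply: nw.
by rewrite /= ltey; apply/eqP => E; move: fin; rewrite E poweRyr ?gt_eqF.
Qed.

(* The mixing coefficient at lag 0 is C0 < 1, so an event determined by a single
   observation has probability 0 or at least 1 - C0. *)
Lemma mixing_essentially_bounded (C0 : R) (f : Y -> \bar R) :
  stationary P Yt -> 0 <= C0 < 1 -> (mixing_coef P Yt 0 <= C0%:E)%E ->
  measurable_fun setT f -> {ae P, forall w, (f (Yt 0 w) < +oo)%E} ->
  exists K : nat, forall t, {ae P, forall w, (f (Yt t w) <= K%:R%:E)%E}.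
Proof.
move=> st /andP[C00 C01] mix mf flty.
pose A (n : nat) := [set y | (n%:R%:E < f y)%E].
have mA n : measurable (A n).
  by rewrite -[A n]setTI; exact: emeasurable_fun_o_infty.
pose E n := Yt 0 @^-1` A n.
have mE n : measurable (E n) by rewrite /E -[X in measurable X]setTI; exact: mY.
have E0 : P (E n) @[n --> \oo] --> 0%E.
  have -> : 0%E = P (\bigcap_n E n).
    have [D [mD D0 Dsub]] := flty; apply/esym/eqP; rewrite eq_le measure_ge0 andbT -D0.
    apply: le_measure; rewrite ?inE//; first exact: bigcap_measurable.
    move=> w Ew; apply: Dsub => /=; move: Ew; case fw : (f (Yt 0 w)) => [r| |].
    - move=> /(_ (Num.bound r) I); rewrite /E /A /= fw lte_fin => h.
      have := le_lt_trans (ler_norm r) (archi_boundP (normr_ge0 r)).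
      move=> h2; have := lt_trans h h2.
      by rewrite /Num.bound normr_id ltxx.
    - by move=> _; rewrite ltxx.
    - by move=> /(_ 0%N I); rewrite /E /A /= fw.
  apply: nonincreasing_cvg_mu => //.
  - by rewrite (le_lt_trans (probability_le1 _ _)) ?ltry.
  - exact: bigcap_measurable.
  - move=> a b ab; apply/subsetPset => w; rewrite /E /A /=.
    by apply: le_lt_trans; rewrite lee_fin ler_nat.
have [K /= PK] : exists K, fine (P (E K)) < 1 - C0.
  have h : fine (P (E n)) @[n --> \oo] --> (0 : R) by apply: (@fine_cvg _ _ _ _ _ 0).
  have /cvgrPdist_lt /(_ (1 - C0)) := h; rewrite subr_gt0 => /(_ C01) [K _ hK].
  exists K; have := hK K (leqnn K); rewrite /= sub0r normrN => /(le_lt_trans _); apply.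
  exact: ler_norm.
have PEK0 : P (E K) = 0%E.
  (* At lag 0 the event lies in both sigma-fields and is compared with itself: p - p^2 <= C0 p, so p
     < 1 - C0 forces p = 0. *)
  have sE D : D 0 -> sigma_process Yt D (E K).
    by move=> D0; apply: sub_sigma_algebra; exists 0 => //; exists (A K).
  have := mixing_events mY C00 mix (sE _ (lexx 0 : [set u : int | u <= 0] 0))
    (sE _ (lexx (0 + 0%:Z)%R : [set u : int | 0 + 0%:Z <= u] 0)).
  rewrite setIid => h; have finP : P (E K) \is a fin_num by exact: fin_num_measure.
  have p0 : 0 <= fine (P (E K)) by rewrite fine_ge0.
  rewrite -(fineK finP); congr (_%:E); move: h p0 PK; move: (fine _) => p.
  by rewrite ler_norml => /andP[_ h] p0 PK; nra.
exists K => t; exists (Yt t @^-1` A K); split.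
- by rewrite -[X in measurable X]setTI; exact: mY.
- by rewrite stationary_marginal.
- by move=> w /= /negP; rewrite -ltNge.
Qed.

End essential_bounds.

Section good_observations.
Context {R : realType} {dO dX dY : measure_display} {Par : Type} {d : nat}.
Context {Omega : measurableType dO} {X : measurableType dX} {Y : measurableType dY}.
Variables (P : probability Omega R) (Yt : int -> Omega -> Y).
Hypothesis mY : forall t, measurable_fun setT (Yt t).
Hypothesis Y_stationary : stationary P Yt.
Variable C0 : R.
Hypothesis C01 : 0 <= C0 < 1.
Hypothesis mix0 : (mixing_coef P Yt 0 <= C0%:E)%E.
Variables (Theta : set Par) (th0 : Par) (lambda : {finite_measure set X -> \bar R}).
Hypothesis lambda_gt0 : 0 < fine (lambda setT).
Hypothesis Theta0 : Theta th0.
Variables (m : Par -> X -> X -> R) (g : Par -> X -> Y -> R) (S : X -> X -> Y -> 'rV[R]_d).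
Variables (ups : nat -> nat -> X -> R) (q : nat -> nat -> X -> X -> R).
Hypothesis ups_gt0 : forall t n x, 0 < ups t n x.
Hypothesis q_ge0 : forall t n x z, 0 <= q t n x z.
Hypothesis mg : forall th y, Theta th -> measurable_fun setT (fun x => g th x y).
Variables (sm sp : R).
Hypothesis sm_gt0 : 0 < sm.
Hypothesis m_bound : forall th x z, Theta th -> sm <= m th x z <= sp.
Variables (kappa : R -> R * R).
Hypothesis kappa_gt0 : forall M, 0 < (kappa M).1.
Hypothesis mg_bound : forall th x z y M, Theta th -> enorm (S x z y) <= M ->
  (kappa M).1 <= m th x z * g th z y <= (kappa M).2.
Variables (p1 p2 : R).
Hypothesis p1_gt0 : 0 < p1.
Hypothesis p2_gt0 : 0 < p2.
Hypothesis S_Lp : finite_Lp_norm P p1 (sup_S S) (Yt 0).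
Hypothesis m_b_minus : measurable_fun setT (b_minus lambda g Theta).
Hypothesis omega_Lp : finite_Lp_norm P p2
  (fun y => omega_plus m g Theta ups q y / b_minus lambda g Theta y)%E (Yt 0).

(** Essential boundedness reaches [omega_plus] only through its quotient by [b_minus]. Where S is
    bounded, m g and m lie between positive constants, hence so does g; then [b_minus] is positive
    and bounded above on G, and the weights inherit a bound. *)
Lemma good_observations : exists (G : set Y) (M B : R), [/\ measurable G,
  forall t, {ae P, forall w, G (Yt t w)},
  forall y x z, G y -> enorm (S x z y) <= M
  & forall y th x z t n, G y -> Theta th ->
      0 < q t n x z /\ m th x z * g th z y / (ups t n x * q t n x z) <= B].
Proof.
have [mS _] := S_Lp; have [mom _] := omega_Lp.
have [K1 hK1] := mixing_essentially_bounded mY Y_stationary C01 mix0 mS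
  (finite_Lp_norm_ae_lty p1_gt0 (mY 0) S_Lp).
have [K2 hK2] := mixing_essentially_bounded mY Y_stationary C01 mix0 mom
  (finite_Lp_norm_ae_lty p2_gt0 (mY 0) omega_Lp).
set ratio := (fun y => _) in hK2 mom.
pose G := [set y | (sup_S S y <= K1%:R%:E)%E] `&` [set y | (ratio y <= K2%:R%:E)%E].
pose k1 := (kappa K1%:R).1; pose k2 := (kappa K1%:R).2.
pose x0 : X := point.
have GS y x z : G y -> enorm (S x z y) <= K1%:R.
  move=> [/= h _]; rewrite -lee_fin; apply: le_trans h.
  by apply: ereal_sup_ubound; exists (x, z).
have sp_gt0 : 0 < sp.
  by have /andP[h1 h2] := m_bound x0 x0 Theta0; apply: lt_le_trans sm_gt0 (le_trans h1 h2).
have g_bound y th z : G y -> Theta th -> k1 / sp <= g th z y <= k2 / sm.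
  move=> Gy Tth; have /andP[m1 m2] := m_bound x0 z Tth.
  have /andP[h1 h2] := mg_bound Tth (GS y x0 z Gy).
  have m0 : 0 < m th x0 z by apply: lt_le_trans m1.
  have g0 : 0 < g th z y.
    by rewrite -(pmulr_rgt0 _ m0); apply: lt_le_trans h1; exact: kappa_gt0.
  rewrite ler_pdivrMr// ler_pdivlMr//; apply/andP; split.
    by apply: le_trans h1 _; rewrite mulrC ler_pM2l.
  by apply: le_trans h2; rewrite mulrC ler_pM2r.
pose L := fine (lambda setT).
have LE : lambda setT = L%:E by rewrite /L fineK// fin_num_measure.
have b_bound y : G y -> ((k1 / sp * L)%:E <= b_minus lambda g Theta y <= (k2 / sm * L)%:E)%E.
  have int_bound th : G y -> Theta th ->
      ((k1 / sp * L)%:E <= \int[lambda]_x (g th x y)%:E <= (k2 / sm * L)%:E)%E.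
    move=> Gy Tth; have gb := fun z => g_bound y th z Gy Tth.
    have bg : bounded_measurable (fun x => g th x y) by exact: bmeas_between (mg y Tth) gb.
    rewrite bintegral_EFin// !lee_fin -!(bintegral_cst lambda); apply/andP; split;
      by apply: le_bintegral => // [|x]; [exact: bmeas_cst|case/andP: (gb x)].
  move=> Gy; apply/andP; split.
    by apply: le_ereal_inf_tmp => _ [th Tth <-]; case/andP: (int_bound th Gy Tth).
  apply: ge_ereal_inf; exists (\int[lambda]_x (g th0 x y)%:E)%E; first by exists th0.
  by case/andP: (int_bound th0 Gy Theta0).
exists G, K1%:R, (K2%:R * (k2 / sm * L)); split.
- apply: measurableI.
    by rewrite -[X in measurable X]setTI; exact: emeasurable_fun_infty_c.
  by rewrite -[X in measurable X]setTI; exact: emeasurable_fun_infty_c.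
- by move=> t; exact: filterI (hK1 t) (hK2 t).
- exact: GS.
- move=> y th x z t n Gy Tth.
  have /andP[b1 b2] := b_bound y Gy.
  have bfin : b_minus lambda g Theta y \is a fin_num.
    by rewrite fin_numE -!ltey -ltNye (lt_le_trans _ b1) ?ltNyr// (le_lt_trans b2) ?ltry.
  have b0 : 0 < fine (b_minus lambda g Theta y).
    rewrite -lte_fin fineK//; apply: lt_le_trans b1; rewrite lte_fin.
    by rewrite mulr_gt0// divr_gt0//; exact: kappa_gt0.
  have om : (omega_plus m g Theta ups q y <= (K2%:R * (k2 / sm * L))%:E)%E.
    have [_ /=] := Gy; rewrite /ratio -(fineK bfin) inver gt_eqF// lee_pdivrMr//.
    move=> /le_trans; apply; rewrite EFinM; apply: lee_wpmul2l; first by rewrite lee_fin.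
    by rewrite fineK.
  have k0 : 0 < m th x z * g th z y.
    by have /andP[h _] := mg_bound Tth (GS y x z Gy); apply: lt_le_trans h; exact: kappa_gt0.
  have le : ((m th x z * g th z y)%:E / (ups t n x * q t n x z)%:E <=
      (K2%:R * (k2 / sm * L))%:E)%E.
    apply: le_trans om; apply: ereal_sup_ubound; exists th, x, z, t, n; split=> //.
  (* A zero of the proposal density would make the quotient +oo, its numerator being positive;
     boundedness on G therefore gives q > 0. *)
  have [q0|qn0] := eqVneq (q t n x z) 0.
    by move: le; rewrite q0 mulr0 inver eqxx gt0_muley ?lte_fin// leye_eq.
  have qg0 : 0 < q t n x z by rewrite lt_neqAle eq_sym qn0 q_ge0.
  split=> //; move: le; rewrite inver mulf_eq0 (negbTE qn0) (gt_eqF (ups_gt0 _ _ _))/=.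
  by rewrite -EFinM lee_fin.
Qed.

End good_observations.

(** * Compactness and exponential-family kernels *)

Lemma compact_net {R : realType} {V : normedModType R} (A : set V) (Q : V -> V -> Prop) :
  compact A ->
  (forall x, A x -> exists2 r : R, 0 < r & forall y, A y -> `|x - y| < r -> Q x y) ->
  exists s : seq V, (forall x, x \in s -> A x) /\
    forall y, A y -> exists2 x, x \in s & Q x y.
Proof.
rewrite compact_cover => cA hQ.
have /choice[r rP] x : exists r : R, A x -> 0 < r /\ forall y, A y -> `|x - y| < r -> Q x y.
  have [Ax|nAx] := pselect (A x); last by exists 0 => /nAx.
  by have [r r0 h] := hQ x Ax; exists r.
have [||D DA AD] := cA V A (fun x => ball x (r x)).
- by move=> x Ax; apply: ball_open; exact: (rP x Ax).1.
- by move=> x Ax; exists x => //; apply: ballxx; exact: (rP x Ax).1.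
exists (finmap.enum_fset D); split=> [x xD|y Ay].
  by have := DA x xD; rewrite inE.
have [x /= xD] := AD y Ay; rewrite -ball_normE /= => xy; exists x => //.
by apply: (rP x _).2 => //; have := DA x xD; rewrite inE.
Qed.

Lemma compact_image_bound {R : realType} {V V' : normedModType R} (A : set V) (f : V -> V') :
  compact A -> continuous_on A f -> exists M : R, 0 < M /\ forall x, A x -> `|f x| <= M.
Proof.
move=> cA cf.
have [s [sA hs]] : exists s : seq V, (forall x, x \in s -> A x) /\
    forall y, A y -> exists2 x, x \in s & `|f x - f y| < 1.
  by apply: compact_net => // x Ax; have [r r0 h] := cf x Ax 1 ltr01; exists r.
exists (\sum_(x <- s) `|f x| + 1); split; first by rewrite ltr_wpDl// sumr_ge0.
move=> y Ay; have [x xs xy] := hs y Ay.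
have -> : f y = f x - (f x - f y) by rewrite subKr.
rewrite (le_trans (ler_normB _ _))// lerD ?(ltW xy)//.
by rewrite (big_rem x)//= lerDl sumr_ge0.
Qed.

Lemma norm_dotp_le {R : realType} {d : nat} (u v : 'rV[R]_d) (M : R) :
  (forall k, `|u 0 k| <= M) -> `|dotp u v| <= M * \sum_k `|v 0 k|.
Proof.
move=> uM; rewrite dotpE (le_trans (ler_norm_sum _ _ _))// mulr_sumr ler_sum// => k _.
by rewrite normrM ler_wpM2r.
Qed.

Lemma norm_coord_le {R : realType} {d : nat} (u : 'rV[R]_d) k : `|u 0 k| <= `|u|.
Proof.
rewrite [leRHS]/Num.norm/= mx_normrE.
by apply/bigmax_geP; right; exists (0, k).
Qed.

Lemma distr_le_of_le {R : realFieldType} (A B D : R) :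
  A <= B + D -> B <= A + D -> `|A - B| <= D.
Proof. by rewrite ler_norml; lra. Qed.

Lemma tilt_gap {R : realFieldType} (A B p1 p2 p3 p4 : R) :
  p1 <= p2 + A -> `|p3 - p4| <= A -> A <= B -> p1 - p3 <= p2 - p4 + 2 * B.
Proof. by rewrite ler_norml; lra. Qed.

Section exponential_family.
Context {R : realType} {dX dY : measure_display} {dth d : nat}.
Context {X : measurableType dX} {Y : measurableType dY}.
Variables (Theta : set 'rV[R]_dth) (phi : 'rV[R]_dth -> R) (psi : 'rV[R]_dth -> 'rV[R]_d).
Hypothesis compact_Theta : compact Theta.
Hypothesis phi_cont : continuous_on Theta (phi : 'rV[R]_dth -> R^o).
Hypothesis psi_cont : continuous_on Theta psi.
Variables (S : X -> X -> Y -> 'rV[R]_d) (M : R).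
Hypothesis mS : forall k, measurable_fun setT (fun z : X * X * Y => S z.1.1 z.1.2 z.2 0 k).
Hypothesis S_bound : forall x z y k, `|S x z y 0 k| <= M.

Definition exp_kernel th x z y : R := expR (phi th + dotp (S x z y) (psi th)).

Definition coord_cost k x z y : R := S x z y 0 k.

(** Bounds the variation of the log kernel over all states and observations. Parameters are compared
    only through it, so uniformity over [Theta] reduces to making it small. *)
Definition kernel_dist th th' : R :=
  `|phi th - phi th'| + M * \sum_k `|psi th 0 k - psi th' 0 k|.

Lemma measurable_dotp_cost (v : 'rV[R]_d) :
  measurable_fun setT (fun z : X * X * Y => dotp (S z.1.1 z.1.2 z.2) v).
Proof.
under eq_fun do rewrite dotpE.
apply: measurable_sum => k; apply: measurable_funM => //; exact: measurable_cst.
Qed.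

Lemma measurable_exp_kernel th :
  measurable_fun setT (fun z : X * X * Y => exp_kernel th z.1.1 z.1.2 z.2).
Proof.
apply: measurableT_comp => //; apply: measurable_funD; first exact: measurable_cst.
exact: measurable_dotp_cost.
Qed.

Lemma M_ge0 : (0 < d)%N -> 0 <= M.
Proof. by case: d S S_bound => // n s h _; exact: le_trans (h point point point ord0). Qed.

Lemma exp_exponent_bound (C C' : R) th x z y : `|phi th| <= C -> `|psi th| <= C' ->
  `|phi th + dotp (S x z y) (psi th)| <= C + `|M| * (d%:R * C').
Proof.
move=> hphi hpsi; rewrite (le_trans (ler_normD _ _))// lerD//.
apply: le_trans (norm_dotp_le (M := `|M|) _ _) _ => [k|].
  by rewrite (le_trans (S_bound _ _ _ _))// ler_norm.
rewrite ler_wpM2l// (le_trans (ler_sum _ (fun k _ => norm_coord_le _ k)))//.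
by rewrite sumr_const card_ord mulr_natl; exact: ler_wMn2r.
Qed.

Lemma exp_kernel_bound : exists k1 k2 : R, [/\ 0 < k1, k1 <= k2 &
  forall th x z y, Theta th -> k1 <= exp_kernel th x z y <= k2].
Proof.
have [C [C0 hC]] := compact_image_bound compact_Theta phi_cont.
have [C' [C'0 hC']] := compact_image_bound compact_Theta psi_cont.
pose c := C + `|M| * (d%:R * C').
have c0 : 0 <= c by rewrite addr_ge0 ?mulr_ge0// ltW.
exists (expR (- c)), (expR c); split; [exact: expR_gt0|by rewrite ler_expR; lra|].
move=> th x z y Tth; rewrite !ler_expR -ler_norml.
by apply: exp_exponent_bound; [exact: hC|exact: hC'].
Qed.

Lemma exp_kernel_le th th' x z y :
  exp_kernel th x z y <= expR (kernel_dist th th') * exp_kernel th' x z y.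
Proof.
rewrite -expRD ler_expR -lerBlDr /kernel_dist.
have -> : phi th + dotp (S x z y) (psi th) - (phi th' + dotp (S x z y) (psi th')) =
    (phi th - phi th') + dotp (S x z y) (psi th - psi th').
  by rewrite [dotp _ (_ - _)]dotpC dotpBl ![dotp (psi _) _]dotpC; ring.
apply: lerD; first exact: ler_norm.
apply: le_trans (ler_norm _) _; apply: le_trans (norm_dotp_le _ (S_bound x z y)) _.
by under eq_bigr do rewrite !mxE.
Qed.

Lemma kernel_distC th th' : kernel_dist th th' = kernel_dist th' th.
Proof.
rewrite /kernel_dist distrC; congr (_ + _ * _); apply: eq_bigr => k _.
by rewrite distrC.
Qed.

Lemma kernel_dist_small th (e : R) : Theta th -> 0 < e -> exists2 r : R, 0 < r &
  forall th', Theta th' -> `|th - th'| < r -> kernel_dist th th' <= e.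
Proof.
move=> Tth e0; have e2 : 0 < e / 2 by rewrite divr_gt0.
have [r1 r10 h1] := phi_cont Tth e2.
pose D : R := `|M| * d%:R + 1.
have D0 : 0 < D by rewrite ltr_wpDl// mulr_ge0.
have [r2 r20 h2] := psi_cont Tth (divr_gt0 e2 D0).
exists (Num.min r1 r2); first by rewrite lt_min r10.
move=> th' Tth'; rewrite lt_min => /andP[d1 d2].
have a1 := ltW (h1 th' Tth' d1); have a2 := ltW (h2 th' Tth' d2).
have -> : e = e / 2 + e / 2 by field.
apply: lerD => //.
apply: (@le_trans _ _ (`|M| * (d%:R * (e / 2 / D)))).
  apply: (@le_trans _ _ (`|M| * \sum_k `|psi th 0 k - psi th' 0 k|)).
    by rewrite ler_wpM2r ?ler_norm// sumr_ge0.
  rewrite ler_wpM2l//; apply: (@le_trans _ _ (\sum_(k < d) e / 2 / D)).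
    apply: ler_sum => k _; apply: le_trans a2.
    by have := norm_coord_le (psi th - psi th') k; rewrite !mxE.
  by rewrite sumr_const card_ord mulr_natl.
have aux (x y z v : R) : x * (y * (z * v)) = z * (x * y * v) by ring.
rewrite aux ler_piMr ?(ltW e2)//.
by rewrite ler_pdivrMr// mul1r /D lerDl.
Qed.

Section expectations.
Variable lambda : {finite_measure set X -> \bar R}.
Variable chi : probability X R.
Hypothesis lambda_gt0 : 0 < fine (lambda setT).
Variables (k1 k2 : R).
Hypothesis k1_gt0 : 0 < k1.
Hypothesis k12 : k1 <= k2.
Hypothesis k_bound : forall th x z y, Theta th -> k1 <= exp_kernel th x z y <= k2.

Let hK th v : Theta th -> kernel_between k1 k2 (along (exp_kernel th) v).
Proof. by move=> Tth; apply: kernel_along => // [|x z y]; [exact: measurable_exp_kernel|exact: k_bound]. Qed.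

Let hS k v : cost_bounded M (along (coord_cost k) v).
Proof. by apply: cost_along; [exact: mS|move=> x z y; exact: S_bound]. Qed.

Lemma ln_fk_total_close n (K K' : nat -> X -> X -> R) l1 l2 l1' l2' (e : R) :
  0 < l1 -> 0 < l1' -> kernel_between l1 l2 K -> kernel_between l1' l2' K' ->
  (forall i x z, K i x z <= expR e * K' i x z) ->
  ln (fk_total lambda chi n K) <= ln (fk_total lambda chi n K') + n%:R * e.
Proof.
move=> l10 l10' kK kK' KK'.
have t0 := fk_total_gt0 chi lambda_gt0 l10 n kK.
have t0' := fk_total_gt0 chi lambda_gt0 l10' n kK'.
rewrite -[X in _ + X]expRK -lnM ?posrE ?expR_gt0// ler_ln ?posrE ?mulr_gt0 ?expR_gt0//.
rewrite mulrC /fk_total -bintegralZl.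
  apply: le_bintegral.
  - exact: (fk_mass_weight lambda_gt0 l10 n kK).1.
  - by apply: bmeasZ; exact: (fk_mass_weight lambda_gt0 l10' n kK').1.
  - by move=> x; exact: le_fk_mass l10' kK kK' KK'.
exact: (fk_mass_weight lambda_gt0 l10' n kK').1.
Qed.

Lemma ln_exp_kernel_close n v th th' : Theta th -> Theta th' ->
  `|ln (fk_total lambda chi n (along (exp_kernel th) v)) -
    ln (fk_total lambda chi n (along (exp_kernel th') v))| <= n%:R * kernel_dist th th'.
Proof.
move=> Tth Tth'.
have H a b : Theta a -> Theta b -> ln (fk_total lambda chi n (along (exp_kernel a) v)) <=
    ln (fk_total lambda chi n (along (exp_kernel b) v)) + n%:R * kernel_dist a b.
  move=> Ta Tb; apply: (ln_fk_total_close n k1_gt0 k1_gt0 (hK v Ta) (hK v Tb)) => i x z.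
  exact: exp_kernel_le.
apply: distr_le_of_le; first exact: H.
by rewrite kernel_distC; exact: H.
Qed.

(** A change of parameter moves a log mass of n steps by at most n times [kernel_dist], hence the
    difference quotient by twice that over u, while the quotient is within n + 1 defects of the
    mean. After division by n nothing depends on n; u is fixed first, then eta = u e / 4. *)
Lemma fk_expect_equicontinuous (e : R) : 0 <= M -> 0 < e -> exists2 eta : R, 0 < eta &
  forall th th', Theta th -> Theta th' -> kernel_dist th th' <= eta ->
  forall n k v, (0 < n)%N ->
  `|n%:R^-1 * fk_expect lambda chi n (along (exp_kernel th) v) (along (coord_cost k) v) -
    n%:R^-1 * fk_expect lambda chi n (along (exp_kernel th') v) (along (coord_cost k) v)| <= e.
Proof.
move=> M0 e0; pose a0 := 4 * M / (k1 / k2).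
have k2_gt0 : 0 < k2 by apply: lt_le_trans k12.
have a0_ge0 : 0 <= a0 by apply: divr_ge0; [exact: mulr_ge0|apply: ltW; exact: divr_gt0].
(* The defect is made at most e / 4, because n + 1 <= 2 n defects have to fit into n e / 2. *)
pose u := Num.min (a0 + 1)^-1 (e / (4 * (2 * a0 ^+ 2 + 1))).
have sq0 : 0 <= a0 ^+ 2 by exact: sqr_ge0.
have u0 : 0 < u by rewrite lt_min invr_gt0 divr_gt0//; lra.
have ua : u * a0 <= 1.
  have : u <= (a0 + 1)^-1 by rewrite ge_min lexx.
  move=> /(ler_wpM2r a0_ge0)/le_trans; apply; rewrite ler_pdivrMl; lra.
have uM : 4 * (u * M) / (k1 / k2) <= 1 by rewrite mulrCA -mulrA.
have ue : log_ratio_defect k1 k2 M u <= e / 4.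
  rewrite /log_ratio_defect.
  have -> : 4 * (u * M) / (k1 / k2) = u * a0 by rewrite mulrCA -mulrA.
  have -> : 2 * (u * a0) ^+ 2 / u = u * (2 * a0 ^+ 2) by field; rewrite gt_eqF.
  have : u <= e / (4 * (2 * a0 ^+ 2 + 1)) by rewrite ge_min lexx orbT.
  move=> /ler_wpM2r => /(_ (2 * a0 ^+ 2)) /(_ _)/le_trans; apply; first lra.
  rewrite mulrAC ler_pdivrMr; [nra|lra].
set def := log_ratio_defect k1 k2 M u in ue.
have def0 : 0 <= def by exact: log_ratio_defect_ge0.
exists (u * (e / 4)); first by rewrite mulr_gt0// divr_gt0.
move=> th th' Tth Tth' dist n k v n0.
have half a b : Theta a -> Theta b -> kernel_dist a b <= u * (e / 4) ->
  fk_expect lambda chi n (along (exp_kernel b) v) (along (coord_cost k) v) <=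
  fk_expect lambda chi n (along (exp_kernel a) v) (along (coord_cost k) v) + n%:R * e.
  move=> Ta Tb dab.
  have la := log_ratio_expect chi lambda_gt0 k1_gt0 k12 (measurable_exp_kernel a) (mS k)
    (fun x z y => k_bound x z y Ta) (fun x z y => S_bound x z y k) u0 uM n v.
  have lb := log_ratio_expect chi lambda_gt0 k1_gt0 k12 (measurable_exp_kernel b) (mS k)
    (fun x z y => k_bound x z y Tb) (fun x z y => S_bound x z y k) u0 uM n v.
  have /andP[_ la2] := la; have /andP[lb1 _] := lb.
  apply: (le_trans lb1).
  have : log_ratio lambda chi (exp_kernel b) (coord_cost k) u n v <=
     log_ratio lambda chi (exp_kernel a) (coord_cost k) u n v + n%:R * (e / 2).
    rewrite /log_ratio ler_pdivrMr// mulrDl -mulrA mulVf ?gt_eqF// mulr1.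
    have ucost : cost_bounded (u * M) (fun i x z => u * along (coord_cost k) v i x z).
      move=> i; have [ms sM] := hS k v i; split; first exact: measurable_funM.
      by move=> x z; rewrite normrM gtr0_norm// ler_pM2l.
    have k1' : 0 < k1 * expR (- (u * M)) by rewrite mulr_gt0// expR_gt0.
    have t1 : ln (fk_total lambda chi n (tilt (fun i x z => u * along (coord_cost k) v i x z)
         (along (exp_kernel b) v))) <=
      ln (fk_total lambda chi n (tilt (fun i x z => u * along (coord_cost k) v i x z)
         (along (exp_kernel a) v))) + n%:R * kernel_dist b a.
      apply: (ln_fk_total_close n k1' k1' (tilt_between k1_gt0 k12 (hK v Tb) ucost)
        (tilt_between k1_gt0 k12 (hK v Ta) ucost)) => i x z.
      by rewrite /tilt mulrA ler_wpM2r ?expR_ge0//; exact: exp_kernel_le.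
    have t2 := ln_exp_kernel_close n v Tb Ta.
    have t3 : n%:R * kernel_dist b a <= n%:R * (u * (e / 4)).
      by rewrite ler_wpM2l// kernel_distC.
    have -> : n%:R * (e / 2) * u = 2 * (n%:R * (u * (e / 4))) by field.
    exact: tilt_gap t1 t2 t3.
  have : n.+1%:R * def <= n%:R * (e / 2).
    have n1 : n.+1%:R <= 2 * n%:R :> R by rewrite -natrM ler_nat mul2n -addnn -addn1 leq_add2l.
    apply: le_trans (ler_pM _ def0 n1 ue) _ => //.
    by rewrite le_eqVlt; apply/orP; left; apply/eqP; field.
  have -> : n%:R * e = n%:R * (e / 2) + n%:R * (e / 2) by field.
  by move=> h1 h2; apply: le_trans h2 _; rewrite addrA lerD2r (le_trans la2)// lerD2l.
have ng0 : 0 < n%:R :> R by rewrite ltr0n.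
have h1 := half _ _ Tth Tth' dist; rewrite kernel_distC in dist.
have h2 := half _ _ Tth' Tth dist.
rewrite -mulrBr normrM gtr0_norm ?invr_gt0// ler_pdivrMl//.
exact: distr_le_of_le h2 h1.
Qed.

Lemma fk_sum_cst n K (c : R) x : kernel_between k1 k2 K ->
  fk_sum lambda n K (fun _ _ _ => c) x = n%:R * c * fk_mass lambda n K x.
Proof.
elim: n K x => [|n IH] K x kK /=; first by rewrite !mul0r.
rewrite -bintegralZl; last first.
  exact: (step_weight lambda_gt0 k1_gt0 n x kK).1.
apply: eq_Rint => z; rewrite [shift 1 (fun=> _)]/shift IH; last exact: kernel_shift.
by rewrite -natr1; ring.
Qed.

Lemma fk_expect_cst n K (c : R) : kernel_between k1 k2 K ->
  fk_expect lambda chi n K (fun _ _ _ => c) = n%:R * c.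
Proof.
move=> kK; rewrite /fk_expect; under eq_Rint do rewrite fk_sum_cst//.
rewrite bintegralZl; last exact: (fk_mass_weight lambda_gt0 k1_gt0 n kK).1.
by rewrite -/(fk_total lambda chi n K) mulfK// gt_eqF//; exact: fk_total_gt0 kK.
Qed.

Lemma fk_expect_dotp n th v (w : 'rV[R]_d) : Theta th ->
  fk_expect lambda chi n (along (exp_kernel th) v)
    (along (fun x z y => dotp (S x z y) w) v) =
  \sum_k w 0 k * fk_expect lambda chi n (along (exp_kernel th) v) (along (coord_cost k) v).
Proof.
move=> Tth.
have H (s : seq 'I_d) : cost_bounded (\sum_(k <- s) `|w 0 k| * M)
     (fun i x z => \sum_(k <- s) w 0 k * along (coord_cost k) v i x z) /\
    fk_expect lambda chi n (along (exp_kernel th) v)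
      (fun i x z => \sum_(k <- s) w 0 k * along (coord_cost k) v i x z) =
    \sum_(k <- s) w 0 k * fk_expect lambda chi n (along (exp_kernel th) v) (along (coord_cost k) v).
  elim: s => [|k s [IHb IH]].
    split.
      move=> i; split=> [|x z]; last by rewrite !big_nil normr0.
      by under eq_fun do rewrite big_nil; exact: measurable_cst.
    rewrite big_nil -[RHS](fk_expect0 lambda chi n (along (exp_kernel th) v)).
    by congr fk_expect; apply/funext => i; apply/funext => x; apply/funext => z; rewrite big_nil.
  have E : (fun i x z => \sum_(k <- k :: s) w 0 k * along (coord_cost k) v i x z) =
    (fun i x z => w 0 k * along (coord_cost k) v i x z +
       \sum_(k <- s) w 0 k * along (coord_cost k) v i x z).
    by apply/funext => i; apply/funext => x; apply/funext => z; rewrite big_cons.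
  rewrite E !big_cons; split; first exact: cost_lin (hS k v) IHb.
  by rewrite (fk_expect_lin chi lambda_gt0 k1_gt0 n (w 0 k) (hK v Tth) (hS k v) IHb) IH.
rewrite -(H _).2; congr fk_expect; apply/funext => i; apply/funext => x; apply/funext => z.
by rewrite /along dotpE; apply: eq_bigr => k _; rewrite mulrC.
Qed.

(** The EM inequality: tilting the kernel at th by the log ratio of the two kernels yields the
    kernel at th', so the log-likelihood gain dominates the smoothed mean of that log ratio. *)
Lemma exp_kernel_jensen n v th th' : Theta th -> Theta th' ->
  n%:R * (phi th' - phi th) + \sum_k (psi th' - psi th) 0 k *
    fk_expect lambda chi n (along (exp_kernel th) v) (along (coord_cost k) v) <=
  ln (fk_total lambda chi n (along (exp_kernel th') v)) -
  ln (fk_total lambda chi n (along (exp_kernel th) v)).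
Proof.
move=> Tth Tth'; set w := psi th' - psi th.
rewrite -(fk_expect_dotp n v w Tth) -(fk_expect_cst n (phi th' - phi th) (hK v Tth)).
have hc : cost_bounded `|phi th' - phi th| (fun (_ : nat) (_ _ : X) => phi th' - phi th).
  by move=> i; split=> //; exact: measurable_cst.
have hd : cost_bounded (M * \sum_k `|w 0 k|) (along (fun x z y => dotp (S x z y) w) v).
  apply: cost_along => [|x z y]; first exact: measurable_dotp_cost.
  by apply: norm_dotp_le => k; exact: S_bound.
rewrite -[X in X + _]mul1r -(fk_expect_lin chi lambda_gt0 k1_gt0 n 1 (hK v Tth) hc hd).
have hcd := cost_lin 1 hc hd.
have := fk_expect_tilt chi lambda_gt0 k1_gt0 k12 n (hK v Tth) hcd.
congr (_ <= ln (fk_total lambda chi n _) - _).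
apply/funext => i; apply/funext => x; apply/funext => z.
rewrite /tilt /along /exp_kernel -expRD; congr expR.
by rewrite mul1r /w [dotp _ (_ - _)]dotpC dotpBl ![dotp (psi _) _]dotpC; ring.
Qed.

End expectations.
End exponential_family.

(** * Limits of block means: continuity, ascent, uniformity *)

Lemma distr_via {R : realFieldType} (a b a' b' e : R) :
  `|a - b| <= e / 3 -> `|a - a'| <= e / 3 -> `|b - b'| <= e / 3 -> `|a' - b'| <= e.
Proof. by rewrite !ler_norml; lra. Qed.

Section limits.
Context {R : realType} {dO dX dY : measure_display} {dth d : nat}.
Context {Omega : measurableType dO} {X : measurableType dX} {Y : measurableType dY}.
Variables (P : probability Omega R) (Yt : int -> Omega -> Y).
Hypothesis mY : forall t, measurable_fun setT (Yt t).
Hypothesis Y_stationary : stationary P Yt.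
Variables (C0 b : R).
Hypothesis C0_ge0 : 0 <= C0.
Hypothesis C0_lt1 : C0 < 1.
Hypothesis b01 : 0 < b < 1.
Hypothesis Y_mixing : forall n, (mixing_coef P Yt n <= (C0 * b ^+ n)%:E)%E.
Variables (Theta : set 'rV[R]_dth) (phi : 'rV[R]_dth -> R) (psi : 'rV[R]_dth -> 'rV[R]_d).
Hypothesis compact_Theta : compact Theta.
Hypothesis phi_cont : continuous_on Theta (phi : 'rV[R]_dth -> R^o).
Hypothesis psi_cont : continuous_on Theta psi.
Variables (S : X -> X -> Y -> 'rV[R]_d) (M : R).
Hypothesis M_ge0 : 0 <= M.
Hypothesis mS : forall k, measurable_fun setT (fun z : X * X * Y => S z.1.1 z.1.2 z.2 0 k).
Hypothesis S_bound : forall x z y k, `|S x z y 0 k| <= M.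
Variable lambda : {finite_measure set X -> \bar R}.
Variable chi : probability X R.
Hypothesis lambda_gt0 : 0 < fine (lambda setT).
Variables (k1 k2 : R).
Hypothesis k1_gt0 : 0 < k1.
Hypothesis k12 : k1 <= k2.
Hypothesis k_bound : forall th x z y, Theta th -> k1 <= exp_kernel phi psi S th x z y <= k2.
Variables (Sbar : 'rV[R]_dth -> 'rV[R]_d) (ell : 'rV[R]_dth -> R).

Definition block_mean th k n j w : R :=
  block_average Yt lambda chi (exp_kernel phi psi S th) (coord_cost S k) n j w.

Hypothesis Sbar_lim : forall th k, Theta th ->
  {ae P, forall w, block_mean th k n 2 w @[n --> \oo] --> Sbar th 0 k}.
Hypothesis ell_lim : forall th, Theta th -> {ae P, forall w,
  T%:R^-1 * ln (fk_total lambda chi T (along (exp_kernel phi psi S th) (observations Yt 1 w)))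
    @[T --> \oo] --> ell th}.

Lemma ae_block_mean_cvg th k (j : nat -> int) (n : nat -> nat) : Theta th ->
  (forall i, (0 < n i)%N) -> cvgn (series (fun i => (n i)%:R^-1 : R)) ->
  {ae P, forall w, block_mean th k (n i) (j i) w @[i --> \oo] --> Sbar th 0 k}.
Proof.
move=> Tth n0 cn; apply: (ae_block_average_cvg mY Y_stationary C0_ge0 C0_lt1 b01 Y_mixing
  lambda_gt0 k1_gt0 k12 M_ge0 (measurable_exp_kernel phi psi mS th) (mS k) _ _ (Sbar_lim k Tth)) => //.
- by move=> x z y; exact: k_bound.
- by move=> x z y; exact: S_bound.
Qed.

Lemma Sbar_equicontinuous (e : R) : 0 < e -> exists2 eta : R, 0 < eta &
  forall th th', Theta th -> Theta th' -> kernel_dist phi psi M th th' <= eta ->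
  (forall n k j w, (0 < n)%N -> `|block_mean th k n j w - block_mean th' k n j w| <= e) /\
  forall k, `|Sbar th 0 k - Sbar th' 0 k| <= e.
Proof.
move=> e0; have [eta eta0 H] := fk_expect_equicontinuous mS S_bound chi lambda_gt0 k1_gt0
  k12 k_bound M_ge0 e0.
exists eta => // th th' Tth Tth' dist; split=> [n k j w n0|k].
  exact: H.
have [w [h1 h2]] := ae_choose (filterI (Sbar_lim k Tth) (Sbar_lim k Tth')).
have h3 : `|block_mean th k n 2 w - block_mean th' k n 2 w| @[n --> \oo] -->
    `|Sbar th 0 k - Sbar th' 0 k| by apply: cvg_norm; exact: cvgB.
by apply: (cvgr_to_le h3); exists 1%N => // n n0; exact: H.
Qed.

Lemma Sbar_continuous : continuous_on Theta Sbar.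
Proof.
move=> th Tth e e0; have e2 : 0 < e / 2 by rewrite divr_gt0.
have [eta eta0 H] := Sbar_equicontinuous e2.
have [r r0 hr] := kernel_dist_small phi_cont psi_cont M Tth eta0.
exists r => // th' Tth' thth'; apply: norm_lt_coord => // k.
have [_ /(_ k)] := H th th' Tth Tth' (hr th' Tth' thth').
by move=> /le_lt_trans; apply; rewrite gtr_pMr// invf_lt1//; lra.
Qed.

Lemma ell_continuous : continuous_on Theta (ell : 'rV[R]_dth -> R^o).
Proof.
move=> th Tth e e0; have e2 : 0 < e / 2 by rewrite divr_gt0.
have [r r0 hr] := kernel_dist_small phi_cont psi_cont M Tth e2.
exists r => // th' Tth' thth'.
suff le : `|ell th - ell th'| <= e / 2.
  by apply: (le_lt_trans le); rewrite gtr_pMr// invf_lt1//; lra.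
have [w [h1 h2]] := ae_choose (filterI (ell_lim Tth) (ell_lim Tth')).
have h3 : `|n%:R^-1 * ln (fk_total lambda chi n (along (exp_kernel phi psi S th) (observations Yt 1 w)))
    - n%:R^-1 * ln (fk_total lambda chi n (along (exp_kernel phi psi S th') (observations Yt 1 w)))|
    @[n --> \oo] --> `|ell th - ell th'|.
  by apply: cvg_norm; exact: cvgB.
apply: (cvgr_to_le h3); exists 1%N => // n n0 /=.
rewrite -mulrBr normrM gtr0_norm ?invr_gt0 ?ltr0n// ler_pdivrMl ?ltr0n//.
apply: le_trans (ln_exp_kernel_close mS S_bound chi lambda_gt0 k1_gt0 k_bound n _ Tth Tth') _.
by rewrite ler_wpM2l//; exact: hr.
Qed.

Lemma summable_exp2 : cvgn (series (fun i => (2 ^ i)%N%:R^-1 : R)).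
Proof.
have -> : (fun i => (2 ^ i)%N%:R^-1) = geometric 1 (2^-1 : R).
  by apply/funext => i /=; rewrite mul1r natrX exprVn.
apply: is_cvg_geometric_series; rewrite ger0_norm ?invr_ge0//.
by rewrite invf_lt1//; lra.
Qed.

(** The limit defining [ell] reads observations from time 1, the one defining [Sbar] from time 2.
    Along the lengths 2^i the block means from time 1 also tend to [Sbar], so the EM inequality
    passes to the limit at a single sample point. *)
Lemma ell_jensen th th' : Theta th -> Theta th' ->
  phi th' - phi th + \sum_k (psi th' - psi th) 0 k * Sbar th 0 k <= ell th' - ell th.
Proof.
move=> Tth Tth'.
have n2 i : (0 < 2 ^ i)%N by rewrite expn_gt0.
have aeS : {ae P, forall w, forall k, block_mean th k (2 ^ i)%N 1 w @[i --> \oo] --> Sbar th 0 k}.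
  have H k : {ae P, forall w, block_mean th k (2 ^ i)%N 1 w @[i --> \oo] --> Sbar th 0 k}.
    exact: (ae_block_mean_cvg k (fun=> 1) Tth n2 summable_exp2).
  have : {ae P, forall w, forall l : nat, forall k : 'I_d, (k : nat) = l ->
      block_mean th k (2 ^ i)%N 1 w @[i --> \oo] --> Sbar th 0 k}.
    apply/ae_foralln => l; have [ld|dl] := ltnP l d; last first.
      by apply: filterE => w k kl; move: (ltn_ord k); rewrite kl ltnNge dl.
    have [D [mD D0 Ds]] := H (Ordinal ld); exists D; split=> // w nw; apply: Ds => h; apply: nw.
    by move=> k kl; have -> : k = Ordinal ld by exact: val_inj.
  by move=> [D [mD D0 Ds]]; exists D; split=> // w nw; apply: Ds => h; apply: nw => k; exact: h.
have [w [[h1 h2] h3]] := ae_choose (filterI (filterI (ell_lim Tth) (ell_lim Tth')) aeS).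
have c2 : (2 ^ i)%N @[i --> \oo] --> \oo.
  apply/cvgnyPge => N; exists N => // i /= Ni.
  by apply: leq_trans Ni _; apply: ltnW; exact: ltn_expl.
pose t a i := (2 ^ i)%N%:R^-1 * ln (fk_total lambda chi (2 ^ i)%N
  (along (exp_kernel phi psi S a) (observations Yt 1 w))).
have c3 : t th' i - t th i @[i --> \oo] --> ell th' - ell th.
  by apply: cvgB; [exact: (cvg_comp _ _ c2 h2)|exact: (cvg_comp _ _ c2 h1)].
have c4 : \sum_k (psi th' - psi th) 0 k * block_mean th k (2 ^ i)%N 1 w @[i --> \oo] -->
    \sum_k (psi th' - psi th) 0 k * Sbar th 0 k.
  by apply: (@cvg_big _ _ +%R 0 _ (@add_continuous R^o)) => k _; apply: cvgMl_tmp; exact: h3.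
have c5 : phi th' - phi th + \sum_k (psi th' - psi th) 0 k * block_mean th k (2 ^ i)%N 1 w
    @[i --> \oo] --> phi th' - phi th + \sum_k (psi th' - psi th) 0 k * Sbar th 0 k.
  by apply: cvgD => //; exact: cvg_cst.
apply: (ler_cvg_to c5 c3); apply: filterE => i.
have ng0 : 0 < (2 ^ i)%N%:R :> R by rewrite ltr0n.
have H := exp_kernel_jensen mS S_bound chi lambda_gt0 k1_gt0 k12 k_bound (2 ^ i)%N
  (observations Yt 1 w) Tth Tth'.
rewrite /t -mulrBr ler_pdivlMl//; apply: le_trans H.
rewrite [leLHS]mulrDr mulr_sumr lerD2l le_eqVlt; apply/orP; left; apply/eqP; apply: eq_bigr => k _.
by rewrite /block_mean /block_average mulrCA mulVKf ?gt_eqF.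
Qed.

(** The parameter of a block depends on the observations, so the exceptional null set must not
    depend on it. Convergence is taken on countably many finite nets, one for each precision 1 / (r
    + 1), and equicontinuity extends it to [Theta]. *)
Lemma ae_uniform_block_mean (j : nat -> int) (n : nat -> nat) :
  (forall i, (0 < n i)%N) -> cvgn (series (fun i => (n i)%:R^-1 : R)) ->
  {ae P, forall w, forall (k : 'I_d) (e : R), 0 < e -> \forall i \near \oo,
    forall th, Theta th -> `|block_mean th k (n i) (j i) w - Sbar th 0 k| <= e}.
Proof.
move=> n0 cn.
have netE r : exists s : seq 'rV[R]_dth, (forall x, x \in s -> Theta x) /\
    forall y, Theta y -> exists2 x, x \in s &
      (forall i k w, `|block_mean x k (n i) (j i) w - block_mean y k (n i) (j i) w| <= r.+1%:R^-1)
      /\ forall k, `|Sbar x 0 k - Sbar y 0 k| <= r.+1%:R^-1.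
  have r0 : 0 < r.+1%:R^-1 :> R by rewrite invr_gt0.
  have [eta eta0 H] := Sbar_equicontinuous r0.
  have [s [sT hs]] := compact_net compact_Theta
    (fun x Tx => kernel_dist_small phi_cont psi_cont M Tx eta0).
  exists s; split=> // y Ty; have [x xs xy] := hs y Ty; exists x => //.
  have [Ha Hb] := H x y (sT x xs) Ty xy.
  by split=> // i k w; exact: Ha.
have /choice[s hs] := netE.
have aeall : {ae P, forall w, forall (r l m : nat) (k : 'I_d), (k : nat) = m -> (l < size (s r))%N ->
    block_mean (nth 0 (s r) l) k (n i) (j i) w @[i --> \oo] --> Sbar (nth 0 (s r) l) 0 k}.
  apply/ae_foralln => r; apply/ae_foralln => l; apply/ae_foralln => m.
  have [md|dm] := ltnP m d; last first.
    by apply: filterE => w k kl; move: (ltn_ord k); rewrite kl ltnNge dm.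
  have [ls|sl] := ltnP l (size (s r)); last by apply: filterE.
  have [D [mD D0 Ds]] := ae_block_mean_cvg (Ordinal md) j ((hs r).1 _ (mem_nth 0 ls)) n0 cn.
  exists D; split=> // w nw; apply: Ds => h; apply: nw.
  by move=> k km _; have -> : k = Ordinal md by exact: val_inj.
have [D [mD D0 Ds]] := aeall; exists D; split=> // w nw; apply: Ds => h; apply: nw => k e e0.
have e3 : 0 < e / 3 by rewrite divr_gt0.
have [r _ re] := near_infty_natSinv_lt (PosNum e3).
have {}re := ltW (re r (leqnn r)); rewrite /= in re.
have : \forall i \near \oo, forall l : 'I_(size (s r)),
    `|block_mean (nth 0 (s r) l) k (n i) (j i) w - Sbar (nth 0 (s r) l) 0 k| <= e / 3.
  apply: filter_forall => l.
  have /cvgrPdist_le /(_ _ e3) := h r l k k erefl (ltn_ord l).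
  by apply: filterS => i; rewrite distrC.
apply: filterS => i hi th Tth.
have [x xs [Ha Hb]] := (hs r).2 th Tth.
have ix : (index x (s r) < size (s r))%N by rewrite index_mem.
have := hi (Ordinal ix); rewrite /= nth_index// => h1.
have h2 := le_trans (Ha i k w) re; have h3 := le_trans (Hb k) re.
exact: distr_via h1 h2 h3.
Qed.

End limits.

(** * Minorization of smoothed transitions by the reference measure *)

Lemma doeblin_lower {R : fieldType} (a b L m : R) : a != 0 -> b != 0 -> L != 0 ->
  a / b * (a / b) / L * (b / (a / b) * m * L) = a * m.
Proof. by move=> a0 b0 L0; field; rewrite a0 b0 L0. Qed.

Lemma doeblin_upper {R : fieldType} (a b L m : R) : a != 0 -> b != 0 -> L != 0 ->
  (a / b * (a / b) * L)^-1 * (a * (a / b) * m * L) = b * m.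
Proof. by move=> a0 b0 L0; field; rewrite a0 b0 L0. Qed.

Section minorization.
Context {R : realType} {dX : measure_display} {X : measurableType dX}.
Variable lambda : {finite_measure set X -> \bar R}.
Variable chi : probability X R.
Hypothesis lambda_gt0 : 0 < fine (lambda setT).
Variables (k1 k2 M : R).
Hypothesis k1_gt0 : 0 < k1.
Hypothesis k12 : k1 <= k2.
Implicit Types K s : nat -> X -> X -> R.

Local Notation rho := (k1 / k2).
Local Notation Lam := (fine (lambda setT)).

Let k2_gt0 : 0 < k2. Proof. by apply: lt_le_trans k12. Qed.
Let rho_gt0 : 0 < rho. Proof. exact: divr_gt0. Qed.

(** Kernel and look-ahead mass each vary by a factor at most 1 / rho, so the density of one smoothed
    step with respect to [lambda] is, up to rho^2 either way, the uniform one 1 / Lam. *)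
Let step_weight_bounds n K x z : kernel_between k1 k2 K ->
  rho * rho / Lam * (\int[lambda]_z (K 0%N x z * fk_mass lambda n (shift 1 K) z))
    <= K 0%N x z * fk_mass lambda n (shift 1 K) z <=
  (rho * rho * Lam)^-1 * (\int[lambda]_z (K 0%N x z * fk_mass lambda n (shift 1 K) z)).
Proof.
move=> hK; have hK1 := kernel_shift 1 hK.
have pm := fk_mass_weight lambda_gt0 k1_gt0 n hK1; have [bm _] := pm.
have [bw _] := step_weight lambda_gt0 k1_gt0 n x hK.
have m0 y := weight_gt0 y pm.
have ratio y y' := fk_mass_ratio lambda_gt0 k1_gt0 k12 n y y' hK1.
have kx y : k1 <= K 0%N x y <= k2 by have [_] := hK 0%N; apply.
have up : \int[lambda]_z (K 0%N x z * fk_mass lambda n (shift 1 K) z) <=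
    k2 / rho * fk_mass lambda n (shift 1 K) z * Lam.
  rewrite -bintegral_cst; apply: le_bintegral => // [|y]; first exact: bmeas_cst.
  have /andP[_ h] := kx y; apply: le_trans (ler_pM _ _ h (lexx _)) _.
  - by have /andP[h1 _] := kx y; apply: le_trans h1; exact: ltW.
  - exact: ltW.
  by rewrite -mulrA ler_wpM2l ?(ltW k2_gt0)// ler_pdivlMl.
have lo : k1 * rho * fk_mass lambda n (shift 1 K) z * Lam <=
    \int[lambda]_z (K 0%N x z * fk_mass lambda n (shift 1 K) z).
  rewrite -bintegral_cst; apply: le_bintegral => // [|y]; first exact: bmeas_cst.
  have /andP[h _] := kx y; rewrite -mulrA; apply: ler_pM => //; [exact: ltW|].
  by rewrite mulr_ge0// ltW.
have /andP[h1 h2] := kx z; apply/andP; split.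
  apply: (le_trans (ler_wpM2l _ up)); first by apply: divr_ge0; [apply: mulr_ge0|]; exact: ltW.
  apply: (@le_trans _ _ (k1 * fk_mass lambda n (shift 1 K) z)); last by rewrite ler_wpM2r// ltW.
  by rewrite doeblin_lower// gt_eqF.
apply: (@le_trans _ _ ((rho * rho * Lam)^-1 * (k1 * rho * fk_mass lambda n (shift 1 K) z * Lam))).
  apply: (@le_trans _ _ (k2 * fk_mass lambda n (shift 1 K) z)); first by rewrite ler_wpM2r// ltW.
  by rewrite doeblin_upper// gt_eqF.
apply: ler_wpM2l lo; rewrite invr_ge0; apply: mulr_ge0 (ltW lambda_gt0).
by apply: mulr_ge0; exact: ltW.
Qed.

Definition step_lower : R := rho * rho / Lam.
Definition step_upper : R := (rho * rho * Lam)^-1.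

Lemma step_lower_gt0 : 0 < step_lower.
Proof. by apply: divr_gt0 => //; exact: mulr_gt0. Qed.

Lemma step_upper_gt0 : 0 < step_upper.
Proof. by rewrite invr_gt0; apply: mulr_gt0 => //; exact: mulr_gt0. Qed.

Lemma step_mean_between n K x (Z : X -> R) : kernel_between k1 k2 K ->
  bounded_measurable Z -> (forall z, 0 <= Z z) ->
  step_lower * (\int[lambda]_z Z z)
    <= wmean lambda (fun z => K 0%N x z * fk_mass lambda n (shift 1 K) z) Z
    <= step_upper * (\int[lambda]_z Z z).
Proof.
move=> hK bZ Z0; have pw := step_weight lambda_gt0 k1_gt0 n x hK; have [bw _] := pw.
have W0 := weight_integral_gt0 lambda_gt0 pw.
have B z := step_weight_bounds n x z hK.
rewrite /wmean; apply/andP; split.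
  rewrite ler_pdivlMr// mulrAC -bintegralZl//; apply: le_bintegral.
  - exact: bmeasZ.
  - exact: bmeasM.
  - by move=> z; rewrite ler_wpM2r//; case/andP: (B z).
rewrite ler_pdivrMr// mulrAC -bintegralZl//; apply: le_bintegral.
- exact: bmeasM.
- exact: bmeasZ.
- by move=> z; rewrite ler_wpM2r//; case/andP: (B z).
Qed.

Let cost_section s i x : cost_bounded M s -> bounded_measurable (s i x).
Proof. exact: cost_bmeas. Qed.

Definition cost_mass s i : R := \int[lambda]_x (\int[lambda]_z s i x z).

Let bmeas_cost_inner s i : cost_bounded M s ->
  bounded_measurable (fun x => \int[lambda]_z s i x z).
Proof.
move=> hs; apply: bmeas_Rintegral_param; have [ms sM] := hs i; split=> //.
by exists M => z; exact: sM.
Qed.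

(* A single step only sees lambda through s i x; integrating over the law of x
   takes a second step, hence the pairs of steps. *)
Lemma fk_mean_minorization n K s x : kernel_between k1 k2 K -> cost_bounded M s ->
  (forall i x z, 0 <= s i x z) ->
  step_lower ^+ 2 * \sum_(i < n) cost_mass s (i.*2.+1) <= fk_mean lambda n.*2 K s x.
Proof.
elim: n K s x => [|n IH] K s x hK hs s0.
  by rewrite big_ord0 mulr0 /fk_mean/= mul0r.
have hK1 := kernel_shift 1 hK; have hs1 := cost_shift 1 hs.
have hK2 := kernel_shift 1 hK1; have hs2 := cost_shift 1 hs1.
rewrite doubleS (fk_meanS lambda_gt0 k1_gt0 _ _ _ hK).
have bF m (z : X) := bmeas_fk_mean lambda_gt0 k1_gt0 m hK1 hs1.
pose c := step_lower ^+ 2 * \sum_(i < n) cost_mass s (i.+1.*2.+1).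
have below z : step_lower * (\int[lambda]_z' s 1%N z z') + c <=
    fk_mean lambda n.*2.+1 (shift 1 K) (shift 1 s) z.
  rewrite (fk_meanS lambda_gt0 k1_gt0 _ _ _ hK1).
  have pw := step_weight lambda_gt0 k1_gt0 n.*2 z hK1.
  have bF2 := bmeas_fk_mean lambda_gt0 k1_gt0 n.*2 hK2 hs2.
  rewrite wmeanD//; last exact: (cost_section 0 z hs1).
  apply: lerD.
    by have /andP[] := step_mean_between n.*2 z hK1 (cost_section 0 z hs1) (s0 1%N z).
  have cF y : c <= fk_mean lambda n.*2 (shift 1 (shift 1 K)) (shift 1 (shift 1 s)) y.
    apply: le_trans (IH _ _ y hK2 hs2 _); last by move=> *; exact: s0.
    by rewrite /c; under eq_bigr do rewrite doubleS.
  rewrite -[leLHS](wmean_cst lambda_gt0 c pw); apply: wmean_le => //; exact: bmeas_cst.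
have pw := step_weight lambda_gt0 k1_gt0 n.*2.+1 x hK.
have bI : bounded_measurable (fun z => step_lower * (\int[lambda]_z' s 1%N z z')).
  by apply: bmeasZ; exact: bmeas_cost_inner.
apply: (@le_trans _ _ (wmean lambda
    (fun z => K 0%N x z * fk_mass lambda n.*2.+1 (shift 1 K) z)
    (fun z => step_lower * (\int[lambda]_z' s 1%N z z') + c))).
  rewrite wmeanD//; last exact: bmeas_cst.
  rewrite wmean_cst// big_ord_recl/= mulrDr /c; apply: lerD => //.
  have I0 z : 0 <= step_lower * (\int[lambda]_z' s 1%N z z').
    by rewrite mulr_ge0 ?(ltW step_lower_gt0)//; apply: Rintegral_ge0 => z' _; exact: s0.
  have /andP[h _] := step_mean_between n.*2.+1 x hK bI I0.
  apply: le_trans h; rewrite bintegralZl; last exact: bmeas_cost_inner.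
  by rewrite mulrA expr2.
apply: wmean_le => //.
- by apply: bmeasD => //; exact: bmeas_cst.
- by apply: bmeasD; [exact: (cost_section 0 x hs)|exact: bF].
- by move=> z; apply: le_trans (below z) _; rewrite lerDr.
Qed.

Lemma fk_mean_ge0 n K s x : kernel_between k1 k2 K -> (forall i x z, 0 <= s i x z) ->
  0 <= fk_mean lambda n K s x.
Proof.
move=> hK s0; apply: divr_ge0; last exact: ltW (fk_mass_gt0 lambda_gt0 k1_gt0 n x hK).
elim: n K s x hK s0 => [//|n IH] K s x hK s0 /=; have hK1 := kernel_shift 1 hK.
apply: Rintegral_ge0 => z _; apply: mulr_ge0.
  by have [_ /(_ x z)/andP[h _]] := hK 0%N; apply: le_trans h; exact: ltW.
apply: addr_ge0; last by apply: IH => // *; exact: s0.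
apply: mulr_ge0; first exact: s0.
exact: ltW (fk_mass_gt0 lambda_gt0 k1_gt0 n z hK1).
Qed.

(** Smoothed steps have bounded densities with respect to [lambda], so a cost that is null for the
    product of [lambda] with itself can be felt only at the first step, which leaves from the fixed
    point x. Hence M and not 0. *)
Lemma fk_mean_null n K s x : kernel_between k1 k2 K -> cost_bounded M s ->
  (forall i x z, 0 <= s i x z) -> (forall i, cost_mass s i <= 0) ->
  fk_mean lambda n K s x <= M.
Proof.
move=> hK hs s0 ms0.
have M0 : 0 <= M by apply: le_trans ((hs 0%N).2 x x).
have main m (K' s' : nat -> X -> X -> R) : kernel_between k1 k2 K' -> cost_bounded M s' ->
    (forall i x z, 0 <= s' i x z) -> (forall i, cost_mass s' i <= 0) ->
    \int[lambda]_y fk_mean lambda m K' s' y <= 0.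
  elim: m K' s' => [|m IH] K' s' hK' hs' s0' ms0'.
    have F0 y : fk_mean lambda 0 K' s' y = 0 by rewrite /fk_mean/= mul0r.
    by rewrite (eq_Rint lambda F0) bintegral_cst mul0r.
  have hK1 := kernel_shift 1 hK'; have hs1 := cost_shift 1 hs'.
  have bF := bmeas_fk_mean lambda_gt0 k1_gt0 m hK1 hs1.
  have F0 y : 0 <= fk_mean lambda m (shift 1 K') (shift 1 s') y.
    by apply: fk_mean_ge0 => // *; exact: s0'.
  have le1 y : fk_mean lambda m.+1 K' s' y <= step_upper * (\int[lambda]_z s' 0%N y z) +
      step_upper * (\int[lambda]_z fk_mean lambda m (shift 1 K') (shift 1 s') z).
    have pw := step_weight lambda_gt0 k1_gt0 m y hK'.
    have bs := cost_section 0%N y hs'.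
    rewrite (fk_meanS lambda_gt0 k1_gt0 _ _ _ hK') wmeanD//; apply: lerD.
      by have /andP[] := step_mean_between m y hK' bs (s0' 0%N y).
    by have /andP[] := step_mean_between m y hK' bF F0.
  have bI := bmeas_cost_inner 0%N hs'.
  apply: (@le_trans _ _ (\int[lambda]_y (step_upper * (\int[lambda]_z s' 0%N y z) +
      step_upper * (\int[lambda]_z fk_mean lambda m (shift 1 K') (shift 1 s') z)))).
    apply: le_bintegral le1.
      exact: (bmeas_fk_mean lambda_gt0 k1_gt0 m.+1 hK' hs').
    by apply: bmeasD; [exact: bmeasZ|exact: bmeas_cst].
  rewrite bintegralD; [|exact: bmeasZ|exact: bmeas_cst].
  rewrite bintegralZl// bintegral_cst -[leRHS]addr0; apply: lerD.
    by rewrite pmulr_rle0 ?step_upper_gt0//; exact: ms0'.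
  rewrite pmulr_lle0// pmulr_rle0 ?step_upper_gt0//.
  by apply: IH => // *; [exact: s0'|exact: ms0'].
case: n => [|n]; first by rewrite /fk_mean/= mul0r.
have hK1 := kernel_shift 1 hK; have hs1 := cost_shift 1 hs.
have bF := bmeas_fk_mean lambda_gt0 k1_gt0 n hK1 hs1.
have pw := step_weight lambda_gt0 k1_gt0 n x hK.
have bs := cost_section 0%N x hs.
rewrite (fk_meanS lambda_gt0 k1_gt0 _ _ _ hK) wmeanD// -[leRHS]addr0; apply: lerD.
  rewrite -[leRHS](wmean_cst lambda_gt0 M pw); apply: wmean_le => //; first exact: bmeas_cst.
  by move=> z; apply: le_trans (ler_norm _) _; exact: (hs 0%N).2.
have F0 y : 0 <= fk_mean lambda n (shift 1 K) (shift 1 s) y.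
  by apply: fk_mean_ge0 => // *; exact: s0.
have /andP[_ h] := step_mean_between n x hK bF F0.
apply: le_trans h _; rewrite pmulr_rle0 ?step_upper_gt0//.
by apply: main => // *; [exact: s0|exact: ms0].
Qed.

End minorization.

(** * Supports of measures and convex hulls *)

Lemma ae_eq0_of_integral {R : realType} {d} {T : measurableType d}
    (mu : {measure set T -> \bar R}) (f : T -> R) :
  measurable_fun setT f -> (forall x, 0 <= f x) ->
  (\int[mu]_x (f x)%:E = 0)%E <-> {ae mu, forall x, f x = 0}.
Proof.
move=> mf f0.
have E : (\int[mu]_x (f x)%:E = \int[mu]_x `|(f x)%:E|)%E.
  by apply: eq_integral => x _; rewrite gee0_abs// lee_fin.
rewrite E; have [h1 h2] := @ae_eq_integral_abs _ _ _ mu _ measurableT (EFin \o f)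
  ((measurable_EFinP _ _).2 mf).
split=> [/h1 [D [mD D0 Ds]]|[D [mD D0 Ds]]].
  exists D; split=> // x nx; apply: Ds => /= fx; apply: nx.
  by case: (fx I).
apply: h2; exists D; split=> // x nx; apply: Ds => /= fx; apply: nx => _ /=.
by rewrite fx.
Qed.

Section hull_support.
Context {R : realType} {dE : measure_display} {E : measurableType dE} {d : nat}.
Variable mu : {measure set E -> \bar R}.
Hypothesis mu_neq0 : mu setT <> 0%E.
Variables (C : set 'rV[R]_d) (F : E -> 'rV[R]_d) (z : 'rV[R]_d).
Hypothesis C_convex : forall a b t, 0 <= t <= 1 -> C a -> C b -> C (t *: b + (1 - t) *: a).
Hypothesis CF : forall e, C (F e).
Hypothesis support : forall v, {ae mu, forall e, 0 <= dotp v (F e - z)} ->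
  {ae mu, forall e, dotp v (F e - z) = 0}.

(** Otherwise cut C - z down to the vectors orthogonal to all directions v for which the pairing
    with F - z vanishes almost everywhere; almost every F - z stays in the cut. A proper separation
    of it from 0 yields one more such direction, which would have to vanish on the cut and be
    positive somewhere on it. *)
Lemma hull_support : C z.
Proof.
apply: contrapT => nCz.
pose V := [set v | {ae mu, forall e, dotp v (F e - z) = 0}].
have [r [B [BV _ Bspan]]] := row_basis V.
pose K := [set k | C (k + z) /\ forall i : 'I_r, dotp (row i B) k = 0].
have dotpDr (u a b : 'rV[R]_d) : dotp u (a + b) = dotp u a + dotp u b.
  by rewrite dotpC dotpDl ![dotp _ u]dotpC.
have dotpZr (u a : 'rV[R]_d) (t : R) : dotp u (t *: a) = t * dotp u a.
  by rewrite dotpC dotpZl [dotp _ u]dotpC.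
have aeK : {ae mu, forall e, K (F e - z)}.
  have : {ae mu, forall e, forall l : nat, forall i : 'I_r, (i : nat) = l ->
      dotp (row i B) (F e - z) = 0}.
    apply/ae_foralln => l; have [lr|rl] := ltnP l r; last first.
      by apply: filterE => w k kl; move: (ltn_ord k); rewrite kl ltnNge rl.
    have [D [mD D0 Ds]] := BV (Ordinal lr); exists D; split=> // w nw; apply: Ds => h; apply: nw.
    by move=> k kl; have -> : k = Ordinal lr by exact: val_inj.
  move=> [D [mD D0 Ds]]; exists D; split=> // w nw; apply: Ds => h; apply: nw.
  by split=> [|i]; [rewrite subrK|exact: h].
have [e Ke] : exists e, K (F e - z).
  have [D [mD D0 Ds]] := aeK; apply: contrapT => nA; apply: mu_neq0.
  apply/eqP; rewrite eq_le measure_ge0 andbT -D0; apply: le_measure; rewrite ?inE//.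
  by move=> w _; apply: Ds => Aw; apply: nA; exists w.
have Kconv a b t : 0 <= t <= 1 -> K a -> K b -> K (t *: b + (1 - t) *: a).
  move=> t01 [Ca Va] [Cb Vb]; split=> [|i].
    have -> : t *: b + (1 - t) *: a + z = t *: (b + z) + (1 - t) *: (a + z).
      by rewrite !scalerDr addrACA -[t *: z + _]scalerDl [t + _]addrC subrK scale1r.
    exact: C_convex.
  by rewrite dotpDr !dotpZr Va Vb !mulr0 addr0.
have K0 : ~ K 0 by move=> [C0 _]; apply: nCz; rewrite add0r in C0.
have [v [vK [k Kk vk]]] := proper_separation Kconv (ex_intro _ _ Ke) K0.
have Vv : V v.
  apply: support; have [D [mD D0 Ds]] := aeK; exists D; split=> // w nw.
  by apply: Ds => h; apply: nw; exact: vK.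
have /submxP[D vD] := Bspan v Vv.
suff v0 : dotp v k = 0 by rewrite v0 ltxx in vk.
have [_ Bk] := Kk.
rewrite vD mulmx_sum_row dotpC dotpE.
under eq_bigr do rewrite summxE mulr_sumr.
rewrite exchange_big/= big1// => i _.
transitivity (D 0 i * dotp (row i B) k); last by rewrite Bk mulr0.
by rewrite dotpE mulr_sumr; apply: eq_bigr => l _; rewrite !mxE; ring.
Qed.

End hull_support.

(** * Null costs and membership of the limit in the hull *)

Section finite_product.
Context {R : realType} {d1 d2 : measure_display}.
Context {T1 : measurableType d1} {T2 : measurableType d2}.
Variables (mu1 : {finite_measure set T1 -> \bar R}) (mu2 : {finite_measure set T2 -> \bar R}).

Definition finite_product : set (T1 * T2)%type -> \bar R := (mu1 \x mu2)%E.

HB.instance Definition _ := Measure.on finite_product.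

Let finite_productT : finite_product setT = (mu1 setT * mu2 setT)%E.
Proof. by rewrite /finite_product -setXTT product_measure1E. Qed.

Let finite_product_finite : fin_num_fun finite_product.
Proof.
move=> A mA; rewrite ge0_fin_numE ?measure_ge0//.
apply: (@le_lt_trans _ _ (finite_product setT)); first by apply: le_measure; rewrite ?inE.
by rewrite finite_productT lte_mul_pinfty// ?fin_num_measure// ltey_eq fin_num_measure.
Qed.

HB.instance Definition _ := Measure_isFinite.Build _ _ _ finite_product
  finite_product_finite.

End finite_product.

Lemma finite_measure_product {R : realType} {d1 d2} {T1 : measurableType d1}
    {T2 : measurableType d2} (mu1 : {finite_measure set T1 -> \bar R})
    (mu2 : {finite_measure set T2 -> \bar R}) :
  exists mu : {finite_measure set (T1 * T2)%type -> \bar R},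
    forall f : T1 * T2 -> R, bounded_measurable f -> (forall z, 0 <= f z) ->
      \int[mu]_z f z = \int[mu1]_x \int[mu2]_y f (x, y).
Proof.
exists (finite_product mu1 mu2) => f bf f0; have [mf [M fM]] := bf.
rewrite /Rintegral; congr fine.
have mf' : measurable_fun setT (EFin \o f) by apply/measurable_EFinP.
have f0' z : (0 <= (EFin \o f) z)%E by rewrite lee_fin.
rewrite -[LHS]/(\int[mu1 \x mu2]_z (EFin \o f) z)%E (fubini_tonelli1 _ mf' f0').
apply: eq_integral => x _; rewrite /fubini_F /= fineK//.
apply: integrable_fin_num => //; apply: bmeas_integrable; split; last by exists M.
exact: (measurableT_comp mf (measurable_pair1 x)).
Qed.

Lemma finite_measure_product3 {R : realType} {d1 d2 d3} {T1 : measurableType d1}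
    {T2 : measurableType d2} {T3 : measurableType d3}
    (mu1 : {finite_measure set T1 -> \bar R}) (mu2 : {finite_measure set T2 -> \bar R})
    (mu3 : {finite_measure set T3 -> \bar R}) :
  exists mu : {finite_measure set (T1 * T2 * T3)%type -> \bar R},
    forall f : T1 * T2 * T3 -> R, bounded_measurable f -> (forall z, 0 <= f z) ->
      \int[mu]_z f z = \int[mu1]_x \int[mu2]_y \int[mu3]_z f (x, y, z).
Proof.
have [nu hnu] := finite_measure_product mu1 mu2.
have [mu hmu] := finite_measure_product nu mu3.
exists mu => f bf f0; rewrite hmu// hnu//.
  apply: (@bmeas_Rintegral_param _ _ _ _ _ mu3 (fun a z => f (a, z))).
  by rewrite (_ : (fun _ => _) = f)//; apply/funext => -[a c].
by move=> a; apply: Rintegral_ge0 => z _.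
Qed.

Lemma second_observation (J : nat) : (1%N%:Z + (2%:Z + J%:Z) = J.+1%:Z + 2%:Z)%R.
Proof. by rewrite intS; ring. Qed.

Lemma half_gap {R : realFieldType} (p D G M A C : R) : 0 <= p -> C <= M -> D * G <= A ->
  D / 2 * (p * G) - M / 2 * p <= 2^-1 * p * (- 1 * C + A).
Proof.
move=> p0 CM DGA; rewrite -subr_ge0.
have -> : 2^-1 * p * (- 1 * C + A) - (D / 2 * (p * G) - M / 2 * p) =
  p / 2 * ((A - D * G) + (M - C)) by field.
by apply: mulr_ge0; [apply: divr_ge0|apply: addr_ge0; rewrite subr_ge0].
Qed.

Section null_cost.
Context {R : realType} {dO dX dY : measure_display}.
Context {Omega : measurableType dO} {X : measurableType dX} {Y : measurableType dY}.
Variables (P : probability Omega R) (Yt : int -> Omega -> Y).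
Hypothesis mY : forall t, measurable_fun setT (Yt t).
Hypothesis Y_stationary : stationary P Yt.
Variables (C0 b : R).
Hypothesis C0_ge0 : 0 <= C0.
Hypothesis C0_lt1 : C0 < 1.
Hypothesis b01 : 0 < b < 1.
Hypothesis Y_mixing : forall n, (mixing_coef P Yt n <= (C0 * b ^+ n)%:E)%E.
Variable lambda : {finite_measure set X -> \bar R}.
Variable chi : probability X R.
Hypothesis lambda_gt0 : 0 < fine (lambda setT).
Variables (k1 k2 M : R).
Hypothesis k1_gt0 : 0 < k1.
Hypothesis k12 : k1 <= k2.
Variables (Kf sf : X -> X -> Y -> R).
Hypothesis mKf : measurable_fun setT (fun z : X * X * Y => Kf z.1.1 z.1.2 z.2).
Hypothesis msf : measurable_fun setT (fun z : X * X * Y => sf z.1.1 z.1.2 z.2).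
Hypothesis Kf_bound : forall x z y, k1 <= Kf x z y <= k2.
Hypothesis sf_bound : forall x z y, `|sf x z y| <= M.

Lemma stationary_ae (A : set Y) (s t : int) : measurable A ->
  {ae P, forall w, A (Yt s w)} -> {ae P, forall w, A (Yt t w)}.
Proof.
move=> mA [D [mD D0 Ds]]; have mC := measurableC mA.
have mYC u : measurable (Yt u @^-1` (~` A)).
  by rewrite -[X in measurable X]setTI; exact: mY.
exists (Yt t @^-1` (~` A)); split=> //.
rewrite (stationary_marginal t Y_stationary mC) -(stationary_marginal s Y_stationary mC).
apply/eqP; rewrite eq_le measure_ge0 andbT -D0; apply: le_measure; rewrite ?inE//.
Qed.

Definition double_mass (f : X -> X -> Y -> R) (y : Y) : R :=
  \int[lambda]_x \int[lambda]_z f x z y.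

Lemma bmeas_double_mass (f : X -> X -> Y -> R) (C : R) :
  measurable_fun setT (fun z : X * X * Y => f z.1.1 z.1.2 z.2) ->
  (forall x z y, `|f x z y| <= C) -> bounded_measurable (double_mass f).
Proof.
move=> mf fC; apply: (@bmeas_Rintegral_param _ _ _ _ _ lambda
  (fun y x => \int[lambda]_z f x z y)).
apply: (@bmeas_Rintegral_param _ _ _ _ _ lambda
  (fun (a : Y * X) z => f a.2 z a.1)).
split; last by exists C => e; exact: fC.
apply: (measurableT_comp mf (_ : measurable_fun _ (fun e : Y * X * X => (e.1.2, e.2, e.1.1)))).
apply/measurable_fun_pairP; split => /=.
  apply/measurable_fun_pairP; split => /=; last exact: measurable_snd.
  exact: (measurableT_comp measurable_snd measurable_fst).
exact: (measurableT_comp measurable_fst measurable_fst).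
Qed.

Let sp x z y := Num.max (sf x z y) 0.
Let sn x z y := Num.max (- sf x z y) 0.

Let M_ge0 : 0 <= M.
Proof. exact: le_trans (normr_ge0 _) (sf_bound point point point). Qed.

Let msp : measurable_fun setT (fun z : X * X * Y => sp z.1.1 z.1.2 z.2).
Proof. by apply: measurable_maxr => //; exact: measurable_cst. Qed.

Let msn : measurable_fun setT (fun z : X * X * Y => sn z.1.1 z.1.2 z.2).
Proof.
apply: measurable_maxr; last exact: measurable_cst.
exact: measurableT_comp.
Qed.

Let sp_ge0 x z y : 0 <= sp x z y. Proof. by rewrite le_max lexx orbT. Qed.
Let sn_ge0 x z y : 0 <= sn x z y. Proof. by rewrite le_max lexx orbT. Qed.

Let sp_bound x z y : `|sp x z y| <= M.
Proof. by rewrite ger0_norm// ge_max M_ge0 andbT (le_trans (ler_norm _)). Qed.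

Let sn_bound x z y : `|sn x z y| <= M.
Proof. by rewrite ger0_norm// ge_max M_ge0 andbT (le_trans (ler_norm _))// normrN. Qed.

Lemma fk_expect_le_cst n (K s : nat -> X -> X -> R) (C c : R) :
  kernel_between k1 k2 K -> cost_bounded C s -> (forall x, fk_mean lambda n K s x <= c) ->
  fk_expect lambda chi n K s <= c.
Proof.
move=> hK hs h; rewrite (fk_expectE chi lambda_gt0 k1_gt0 n s hK).
have pw := fk_mass_weight lambda_gt0 k1_gt0 n hK.
rewrite -[leRHS](wmean_cst (chi_gt0 chi) c pw); apply: wmean_le h => //; last exact: bmeas_cst.
  exact: chi_gt0.
exact: (bmeas_fk_mean lambda_gt0 k1_gt0 n hK hs).
Qed.

Lemma fk_expect_ge_cst n (K s : nat -> X -> X -> R) (C c : R) :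
  kernel_between k1 k2 K -> cost_bounded C s -> (forall x, c <= fk_mean lambda n K s x) ->
  c <= fk_expect lambda chi n K s.
Proof.
move=> hK hs h; rewrite (fk_expectE chi lambda_gt0 k1_gt0 n s hK).
have pw := fk_mass_weight lambda_gt0 k1_gt0 n hK.
rewrite -[leLHS](wmean_cst (chi_gt0 chi) c pw); apply: wmean_le h => //; first exact: chi_gt0.
  exact: bmeas_cst.
exact: (bmeas_fk_mean lambda_gt0 k1_gt0 n hK hs).
Qed.

(** The negative part costs at most M over a whole block, so the averages of the positive part tend
    to 0 too. By minorization they dominate a multiple of the averages of its double integral over
    every second observation, which converge to the expectation; hence the expectation is 0. *)
Lemma null_cost :
  {ae P, forall w, block_average Yt lambda chi Kf sf n 2 w @[n --> \oo] --> 0} ->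
  {ae P, forall w, double_mass sn (Yt 0 w) = 0} ->
  {ae P, forall w, double_mass sp (Yt 0 w) = 0}.
Proof.
move=> lim0 sn0.
have bsp : bounded_measurable (double_mass sp) := bmeas_double_mass msp sp_bound.
have bsn : bounded_measurable (double_mass sn) := bmeas_double_mass msn sn_bound.
have m0 (f : Y -> R) : measurable_fun setT f -> measurable [set y | f y = 0].
  move=> mf; have -> : [set y | f y = 0] = f @^-1` [set 0] by [].
  by rewrite -[X in measurable X]setTI; exact: mf.
have sn0t : {ae P, forall w, forall t : nat, double_mass sn (Yt (t%:Z + 2) w) = 0}.
  by apply/ae_foralln => t; exact: stationary_ae (m0 _ bsn.1) sn0.
(* The second entry of a window of length 2, because the minorization retains the cost of the second
   step of each pair. *)
pose f (v : 2.-tuple Y) := double_mass sp (tnth v (lift ord0 ord0)).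
have bf : bounded_measurable f by apply: (bmeas_comp bsp); exact: measurable_tnth.
have q0 i : (0 < 2 ^ i)%N by rewrite expn_gt0.
have lln := ae_window_average_cvg mY Y_stationary C0_ge0 C0_lt1 b01 Y_mixing
  (fun=> 2) (isT : (0 < 2)%N) bf q0 summable_exp2.
have [w [[h1 h2] h3]] := ae_choose (filterI (filterI lim0 sn0t) lln).
have mass0 : \int[P]_w f (window Yt 2 0 w) <= 0.
  (* Halved because a block of twice 2^i observations contains 2^i pairs. *)
  pose dl := step_lower lambda k1 k2 ^+ 2 / 2.
  have dl0 : 0 < dl by rewrite divr_gt0// exprn_gt0//; exact: step_lower_gt0.
  have c2 : (2 ^ i).*2 @[i --> \oo] --> \oo.
    apply/cvgnyPge => N; exists N => // i /= Ni.
    apply: leq_trans Ni _; apply: leq_trans (ltnW (ltn_expl i (isT : 1 < 2)%N)) _.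
    by rewrite -addnn leq_addr.
  have l1 := cvg_comp _ _ c2 h1.
  have inv0 : (2 ^ i)%N%:R^-1 @[i --> \oo] --> (0 : R).
    exact: cvg_series_cvg_0 summable_exp2.
  have l2 : dl * ((2 ^ i)%N%:R^-1 * \sum_(j < 2 ^ i) f (window Yt 2 (2 + (j * 2)%N%:Z) w))
     - M / 2 * (2 ^ i)%N%:R^-1 @[i --> \oo] -->
     dl * (\int[P]_w f (window Yt 2 0 w)) - M / 2 * 0.
    by apply: cvgB; apply: cvgMl_tmp.
  rewrite mulr0 subr0 in l2.
  rewrite -(pmulr_rle0 _ dl0); apply: (ler_cvg_to l2 l1); apply: filterE => i /=.
  rewrite /block_average.
  have hK := kernel_along mKf Kf_bound (observations Yt 2 w).
  have hsp := cost_along msp sp_bound (observations Yt 2 w).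
  have hsn := cost_along msn sn_bound (observations Yt 2 w).
  have -> : along sf (observations Yt 2 w) = (fun i x z => -1 * along sn (observations Yt 2 w) i x z
      + along sp (observations Yt 2 w) i x z).
    apply/funext => j; apply/funext => x; apply/funext => z; rewrite /along /sn /sp.
    move: (sf _ _ _) => a; rewrite mulN1r /Num.max.
    by case: ltP => h; case: ltP => h'; lra.
  rewrite (fk_expect_lin chi lambda_gt0 k1_gt0 _ _ hK hsn hsp).
  have u1 : fk_expect lambda chi (2 ^ i).*2 (along Kf (observations Yt 2 w))
      (along sn (observations Yt 2 w)) <= M.
    apply: (fk_expect_le_cst hK hsn) => x; apply: fk_mean_null hK hsn _ _ => //.
      by move=> *; exact: sn_ge0.
    move=> j; have := h2 j; rewrite /cost_mass /double_mass /along /observations => ->.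
    exact: lexx.
  have u2 : step_lower lambda k1 k2 ^+ 2 * \sum_(j < 2 ^ i) f (window Yt 2 (2 + (j * 2)%N%:Z) w) <=
      fk_expect lambda chi (2 ^ i).*2 (along Kf (observations Yt 2 w))
      (along sp (observations Yt 2 w)).
    apply: (fk_expect_ge_cst hK hsp) => x.
    apply: le_trans (fk_mean_minorization lambda_gt0 k1_gt0 k12 (2 ^ i) x hK hsp _); last first.
      by move=> *; exact: sp_ge0.
    rewrite le_eqVlt; apply/orP; left; apply/eqP; congr (_ * _).
    apply: eq_bigr => j _; rewrite /f /window tnth_mktuple /cost_mass /double_mass /along.
    rewrite /observations /=; congr (\int[lambda]_x _); apply/funext => x'.
    apply: eq_Rint => z; congr (sp _ _ (Yt _ w)).
    by rewrite muln2; exact: (second_observation j.*2).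
  have e2 : (2 ^ i).*2%:R^-1 = 2^-1 * (2 ^ i)%N%:R^-1 :> R by rewrite -mul2n natrM invfM.
  by rewrite e2; apply: half_gap u1 u2; rewrite invr_ge0.
have : {ae P, forall w, double_mass sp (Yt 1 w) = 0}.
  have Ew w' : f (window Yt 2 0 w') = double_mass sp (Yt 1 w').
    by rewrite /f /window tnth_mktuple addr0.
  have ge0 y : 0 <= double_mass sp y.
    by apply: Rintegral_ge0 => x _; apply: Rintegral_ge0 => z _; exact: sp_ge0.
  have bw : bounded_measurable (fun w' => double_mass sp (Yt 1 w')) by exact: bmeas_comp.
  apply/ae_eq0_of_integral; [by have [] := bw|by []|].
  rewrite bintegral_EFin//; congr (_%:E); apply/eqP; rewrite eq_le; apply/andP; split.
    by apply: le_trans mass0; rewrite le_eqVlt; apply/orP; left; apply/eqP; apply: eq_Rint.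
  by apply: Rintegral_ge0 => x _.
exact: stationary_ae (m0 _ bsp.1).
Qed.

End null_cost.

Section limit_in_hull.
Context {R : realType} {dO dX dY : measure_display} {dth d : nat}.
Context {Omega : measurableType dO} {X : measurableType dX} {Y : measurableType dY}.
Variables (P : probability Omega R) (Yt : int -> Omega -> Y).
Hypothesis mY : forall t, measurable_fun setT (Yt t).
Hypothesis Y_stationary : stationary P Yt.
Variables (C0 b : R).
Hypothesis C0_ge0 : 0 <= C0.
Hypothesis C0_lt1 : C0 < 1.
Hypothesis b01 : 0 < b < 1.
Hypothesis Y_mixing : forall n, (mixing_coef P Yt n <= (C0 * b ^+ n)%:E)%E.
Variables (Theta : set 'rV[R]_dth) (phi : 'rV[R]_dth -> R) (psi : 'rV[R]_dth -> 'rV[R]_d).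
Variables (S : X -> X -> Y -> 'rV[R]_d) (M : R).
Hypothesis mS : forall k, measurable_fun setT (fun z : X * X * Y => S z.1.1 z.1.2 z.2 0 k).
Hypothesis S_bound : forall x z y k, `|S x z y 0 k| <= M.
Variable lambda : {finite_measure set X -> \bar R}.
Variable chi : probability X R.
Hypothesis lambda_gt0 : 0 < fine (lambda setT).
Variables (k1 k2 : R).
Hypothesis k1_gt0 : 0 < k1.
Hypothesis k12 : k1 <= k2.
Hypothesis k_bound : forall th x z y, Theta th -> k1 <= exp_kernel phi psi S th x z y <= k2.
Variables (th : 'rV[R]_dth) (z : 'rV[R]_d).
Hypothesis Theta_th : Theta th.
Hypothesis z_lim : {ae P, forall w, forall k,
  block_mean Yt phi psi S lambda chi th k n 2 w @[n --> \oo] --> z 0 k}.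
Variable C : set 'rV[R]_d.
Hypothesis C_convex : forall a b t, 0 <= t <= 1 -> C a -> C b -> C (t *: b + (1 - t) *: a).
Hypothesis C_S : forall x x' y, C (S x x' y).

Lemma block_mean_dotp (v : 'rV[R]_d) n w : (0 < n)%N ->
  block_average Yt lambda chi (exp_kernel phi psi S th) (fun x x' y => dotp v (S x x' y - z)) n 2 w =
  \sum_k v 0 k * block_mean Yt phi psi S lambda chi th k n 2 w - dotp v z.
Proof.
move=> n0; set obs := observations Yt 2 w.
have hK : kernel_between k1 k2 (along (exp_kernel phi psi S th) obs).
  by apply: kernel_along => [|x x' y]; [exact: measurable_exp_kernel|exact: k_bound].
have hd : cost_bounded (M * \sum_k `|v 0 k|) (along (fun x x' y => dotp (S x x' y) v) obs).
  apply: cost_along => [|x x' y]; first exact: measurable_dotp_cost.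
  by apply: norm_dotp_le => k; exact: S_bound.
have hc : cost_bounded `|- dotp v z| (fun (_ : nat) (_ _ : X) => - dotp v z).
  by move=> i; split=> //; exact: measurable_cst.
rewrite /block_average -/obs.
have -> : along (fun x x' y => dotp v (S x x' y - z)) obs =
  (fun i x x' => 1 * along (fun x x' y => dotp (S x x' y) v) obs i x x' + - dotp v z).
  apply/funext => i; apply/funext => x; apply/funext => x'.
  by rewrite /along mul1r [LHS]dotpC dotpBl [dotp z v]dotpC.
rewrite (fk_expect_lin chi lambda_gt0 k1_gt0 n 1 hK hd hc) mul1r.
rewrite (fk_expect_cst chi lambda_gt0 k1_gt0 n _ hK) mulrDr mulKf ?pnatr_eq0 -?lt0n//.
rewrite (fk_expect_dotp mS S_bound chi lambda_gt0 k1_gt0 k_bound n obs v Theta_th).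
by rewrite mulr_sumr; congr (_ + _); apply: eq_bigr => k _; rewrite mulrCA.
Qed.

(** [hull_support] is applied to the product of P, [lambda] and [lambda], and to S at the
    observation of time 0. If the pairing of v with S - z is nonnegative almost everywhere, its
    negative part is null; its block averages tend to 0 because z is the limit of the block means,
    and [null_cost] makes it vanish. *)
Lemma limit_in_hull : C z.
Proof.
have [mu hmu] := finite_measure_product3 P lambda lambda.
pose F (e : Omega * X * X) := S e.1.2 e.2 (Yt 0 e.1.1).
have mproj : measurable_fun setT (fun e : Omega * X * X => (e.1.2, e.2, Yt 0 e.1.1)).
  apply/measurable_fun_pairP; split => /=.
    apply/measurable_fun_pairP; split => /=; last exact: measurable_snd.
    exact: (measurableT_comp measurable_snd measurable_fst).
  apply: (measurableT_comp (mY 0)).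
  exact: (measurableT_comp measurable_fst measurable_fst).
apply: (@hull_support R _ _ _ mu _ C F z C_convex) => [mu0|e|v nonneg].
- have := hmu (fun=> 1) (bmeas_cst 1) (fun=> ler01).
  have e0 : fine (mu setT) = 0 := congr1 fine mu0.
  have e1 : \int[mu]_e (1 : R) = 0 by rewrite (bintegral_cst mu 1) (e0 : fine (mu _) = 0) mulr0.
  rewrite e1.
  rewrite (eq_Rint P (g := fun=> fine (lambda setT) * fine (lambda setT))); last first.
    move=> w; rewrite (eq_Rint lambda (g := fun=> fine (lambda setT))).
      by rewrite bintegral_cst.
    by move=> x; rewrite bintegral_cst mul1r.
  have P1 : fine (P setT) = 1 by rewrite probability_setT.
  rewrite (bintegral_cst P) P1 mulr1 => /esym/eqP.
  by rewrite mulf_eq0 gt_eqF.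
- exact: C_S.
pose sf x x' y := dotp v (S x x' y - z).
have sfE x x' y : sf x x' y = dotp (S x x' y) v - dotp v z.
  by rewrite /sf dotpC dotpBl [dotp z v]dotpC.
have msf : measurable_fun setT (fun e : X * X * Y => sf e.1.1 e.1.2 e.2).
  under eq_fun do rewrite sfE.
  by apply: measurable_funB; [exact: measurable_dotp_cost|exact: measurable_cst].
pose B := M * \sum_k `|v 0 k| + `|dotp v z|.
have sfB x x' y : `|sf x x' y| <= B.
  rewrite sfE (le_trans (ler_normB _ _))// lerD//.
  by apply: norm_dotp_le => k; exact: S_bound.
have lim0 : {ae P, forall w, block_average Yt lambda chi (exp_kernel phi psi S th) sf n 2 w
    @[n --> \oo] --> 0}.
  have [D [mD D0 Ds]] := z_lim; exists D; split=> // w nw; apply: Ds => h; apply: nw => /=.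
  have h2 : \sum_k v 0 k * block_mean Yt phi psi S lambda chi th k n 2 w - dotp v z
      @[n --> \oo] --> dotp v z - dotp v z.
    apply: cvgB; last exact: cvg_cst.
    rewrite [in X in _ --> X]dotpE.
    by apply: (@cvg_big _ _ +%R 0 _ (@add_continuous R^o)) => k _; apply: cvgMl_tmp; exact: h.
  rewrite subrr in h2; apply: cvg_trans h2; apply: near_eq_cvg.
  by exists 1%N => // n n0 /=; rewrite block_mean_dotp.
have M0 : 0 <= B by exact: le_trans (normr_ge0 _) (sfB point point point).
pose sn x x' y := Num.max (- sf x x' y) 0.
pose sp x x' y := Num.max (sf x x' y) 0.
have part (f : X -> X -> Y -> R) : measurable_fun setT (fun e : X * X * Y => f e.1.1 e.1.2 e.2) ->
    (forall x x' y, 0 <= f x x' y <= B) ->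
    {ae mu, forall e, f e.1.2 e.2 (Yt 0 e.1.1) = 0} <->
    {ae P, forall w, double_mass lambda f (Yt 0 w) = 0}.
  move=> mf fB.
  have f0 x x' y : 0 <= f x x' y by case/andP: (fB x x' y).
  have fN x x' y : `|f x x' y| <= B by rewrite ger0_norm//; case/andP: (fB x x' y).
  have mfe : measurable_fun setT (fun e : Omega * X * X => f e.1.2 e.2 (Yt 0 e.1.1)).
    exact: (measurableT_comp mf mproj).
  have bm := bmeas_double_mass lambda mf fN.
  have bmY := bmeas_comp bm (mY 0).
  have dm0 w : 0 <= double_mass lambda f (Yt 0 w).
    by apply: Rintegral_ge0 => x _; apply: Rintegral_ge0 => x' _.
  have bfe : bounded_measurable (fun e : Omega * X * X => f e.1.2 e.2 (Yt 0 e.1.1)).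
    by split=> //; exists B => e; exact: fN.
  rewrite -(ae_eq0_of_integral _ mfe (fun e => f0 _ _ _)).
  rewrite -(ae_eq0_of_integral P bmY.1 dm0) !bintegral_EFin//.
  by rewrite hmu.
have msn : measurable_fun setT (fun e : X * X * Y => sn e.1.1 e.1.2 e.2).
  by apply: measurable_maxr; [exact: measurableT_comp|exact: measurable_cst].
have msp : measurable_fun setT (fun e : X * X * Y => sp e.1.1 e.1.2 e.2).
  by apply: measurable_maxr => //; exact: measurable_cst.
have snB x x' y : 0 <= sn x x' y <= B.
  by rewrite le_max lexx orbT ge_max M0 andbT (le_trans (ler_norm _))// normrN.
have spB x x' y : 0 <= sp x x' y <= B.
  by rewrite le_max lexx orbT ge_max M0 andbT (le_trans (ler_norm _)).
have aesn : {ae mu, forall e, sn e.1.2 e.2 (Yt 0 e.1.1) = 0}.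
  have [D [mD D0 Ds]] := nonneg; exists D; split=> // e ne; apply: Ds => h; apply: ne.
  by rewrite /= /sn max_r// oppr_le0; exact: h.
have /(part _ msn snB) nul := aesn.
have := null_cost mY Y_stationary C0_ge0 C0_lt1 b01 Y_mixing lambda_gt0 k1_gt0 k12
  (measurable_exp_kernel phi psi mS th) msf (fun x x' y => k_bound x x' y Theta_th) sfB lim0 nul.
move=> /(part _ msp spB) aesp.
have [D [mD D0 Ds]] := filterI aesp nonneg; exists D; split=> // e ne; apply: Ds => -[h1 h2].
by apply: ne; move: h1; rewrite /= /sp max_l.
Qed.

End limit_in_hull.

(** * Measurability on a subset, convexity, and the statistic of the algorithm *)

Lemma measurable_continuous_on {R : realType} {dT} {T : measurableType dT} {d : nat}
    (D : set 'rV[R]_d) (f : 'rV[R]_d -> R) (s : T -> 'rV[R]_d) :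
  continuous_on D (f : 'rV[R]_d -> R^o) -> (forall w, D (s w)) ->
  (forall k, measurable_fun setT (fun w => s w 0 k)) ->
  measurable_fun setT (fun w => f (s w)).
Proof.
move=> cf Ds ms.
apply: (measurability _ (RGenOInfty.measurableE R)) => _ [_ [r ->] <-].
rewrite setTI.
(* D is arbitrary and f is continuous on D only, so a superlevel set is described by the countably
   many rational boxes on whose trace in D the function exceeds r. *)
pose box (c : 'rV[rat]_d) (n : nat) := [set y : 'rV[R]_d | forall k, `|y 0 k - ratr (c 0 k)| < n.+1%:R^-1].
pose good c n := `[< forall y, D y -> box c n y -> r < f y >].
pose A (i : nat) : set T := if unpickle i is Some (c, n) then
  (if good c n then s @^-1` box c n else set0) else set0.
have -> : (fun w => f (s w)) @^-1` `]r, +oo[ = \bigcup_i A i.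
  apply/seteqP; split => w /=; last first.
    move=> [i _]; rewrite /A; case: unpickle => // -[c n].
    case: ifP => // /asboolP g bx.
    by rewrite in_itv/= andbT; exact: g.
  rewrite in_itv/= andbT => rf.
  have [e e0 he] := cf (s w) (Ds w) _ (eqbRL (subr_gt0 _ _) rf).
  have e2 : 0 < e / 2 by rewrite divr_gt0.
  have [n _ ne] := near_infty_natSinv_lt (PosNum e2).
  have {}ne : n.+1%:R^-1 < e / 2 := ne n (leqnn n).
  have n0 : 0 < n.+1%:R^-1 :> R by rewrite invr_gt0.
  have /choice[c hc] k : exists c : rat, `|s w 0 k - ratr c| < n.+1%:R^-1.
    have [c] : exists c : rat, ratr c \in `](s w 0 k - n.+1%:R^-1), (s w 0 k + n.+1%:R^-1)[.
      by apply: rat_in_itvoo; rewrite ltrD2l (lt_trans _ n0)// oppr_lt0.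
    rewrite in_itv/= => /andP[h1 h2]; exists c; move: h1 h2.
    by move: (ratr c : R) (s w 0 k) (n.+1%:R^-1 : R) => p1 p2 p3 h1 h2; rewrite ltr_norml; lra.
  exists (pickle (\row_k c k, n)) => //; rewrite /A pickleK ifT; last first.
    apply/asboolP => y Dy bx.
    have : `|s w - y| < e.
      apply: norm_lt_coord => // k; have := bx k; have := hc k; rewrite mxE => h1 h2.
      have -> : e = e / 2 + e / 2 by field.
      apply: le_lt_trans (ler_distD (ratr (c k)) _ _) _.
      by apply: ltrD; [exact: lt_trans ne|rewrite distrC; exact: lt_trans ne].
    by move=> /(he y Dy); rewrite ltr_norml; lra.
  by move=> k; rewrite mxE; exact: hc.
apply: bigcup_measurable => i _; rewrite /A; case: unpickle => // -[c n].
case: ifP => // _.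
have -> : s @^-1` box c n = \bigcap_(k in [set: 'I_d])
    ((fun w => `|s w 0 k - ratr (c 0 k)|) @^-1` `]-oo, n.+1%:R^-1[).
  apply/seteqP; split => w /= h k; first by move=> _ /=; rewrite in_itv/=; exact: h.
  by have := h k I; rewrite /= in_itv.
apply: fin_bigcap_measurable => [|k _]; first exact: finite_finset.
rewrite -[X in measurable X]setTI.
have mk : measurable_fun setT (fun w => `|s w 0 k - ratr (c 0 k)|).
  by apply: measurableT_comp => //; apply: measurable_funB => //; exact: measurable_cst.
by apply: mk => //; exact: measurable_itv.
Qed.

Section convex_combinations.
Context {R : realType} {d : nat}.
Variable C : set 'rV[R]_d.
Hypothesis C_convex : forall a b t, 0 <= t <= 1 -> C a -> C b -> C (t *: b + (1 - t) *: a).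

Lemma convex_combination n (a : 'I_n.+1 -> R) (v : 'I_n.+1 -> 'rV[R]_d) :
  (forall i, 0 < a i) -> (forall i, C (v i)) ->
  C ((\sum_i a i)^-1 *: \sum_i a i *: v i).
Proof.
elim: n a v => [|n IH] a v a0 Cv.
  by rewrite !big_ord1 scalerA mulVf ?scale1r// gt_eqF.
rewrite [X in X^-1]big_ord_recl [X in _ *: X]big_ord_recl /=.
set A := \sum_(i < n.+1) _; set V := \sum_(i < n.+1) _.
have A0 : 0 < A.
  rewrite /A big_ord_recl; apply: ltr_wpDr => //.
  by apply: sumr_ge0 => i _; exact: ltW.
have CV := IH (fun i => a (lift ord0 i)) (fun i => v (lift ord0 i)) (fun i => a0 _) (fun i => Cv _).
have sn0 : a ord0 + A != 0 by rewrite gt_eqF// addr_gt0.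
have := C_convex (a := A^-1 *: V) (b := v ord0) (t := a ord0 / (a ord0 + A)).
have -> : 1 - a ord0 / (a ord0 + A) = A / (a ord0 + A) by field.
rewrite scalerA -mulrAC divff ?gt_eqF// mul1r scalerDr scalerA [_^-1 * _]mulrC.
apply=> //; apply/andP; split; first by rewrite divr_ge0 ?ltW ?addr_gt0.
by rewrite ler_pdivrMr ?addr_gt0// mul1r lerDl ltW.
Qed.

End convex_combinations.

Lemma sum_ord_gt0 {R : numDomainType} n (F : 'I_n -> R) : (0 < n)%N ->
  (forall i, 0 < F i) -> 0 < \sum_i F i.
Proof.
case: n F => // n F _ F0; rewrite big_ord_recl; apply: ltr_wpDr => //.
by apply: sumr_ge0 => i _; exact: ltW.
Qed.

Section block_link.
Context {R : realType} {dX dY : measure_display} {Par : Type} {d : nat}.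
Context {X : measurableType dX} {Y : measurableType dY}.
Variable lambda : {finite_measure set X -> \bar R}.
Variables (m : Par -> X -> X -> R) (g : Par -> X -> Y -> R) (S : X -> X -> Y -> 'rV[R]_d).
Variables (N : nat) (th : Par) (x : nat -> nat -> X) (y : nat -> Y).
Variables (ups : nat -> X -> R) (q : nat -> X -> X -> R) (K : nat -> X -> X -> R).
Hypothesis N_gt0 : (0 < N)%N.
Hypothesis m_gt0 : forall z z', 0 < m th z z'.
Hypothesis g_gt0 : forall z y, 0 < g th z y.
Hypothesis ups_gt0 : forall t z, 0 < ups t z.
Hypothesis q_gt0 : forall t z z', 0 < q t z z'.
Hypothesis mgK : forall t z z', m th z z' * g th z' (y t.+1) = K t z z'.

Lemma weightE j t l : weight m g N th x j y ups q t l = pweight N K ups q x j t l.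
Proof. by case: t => [//|t]; rewrite /weight /pweight mgK. Qed.

Lemma block_weight_gt0 j t l : 0 < weight m g N th x j y ups q t l.
Proof.
case: t => [|t] /=; first by rewrite invr_gt0 ltr0n.
apply: divr_gt0; apply: mulr_gt0; [exact: m_gt0|exact: g_gt0|exact: ups_gt0|exact: q_gt0].
Qed.

(** The observation density at the new particle is common to numerator and denominator and cancels,
    which permits the product kernel; the time factors of the recursion are absorbed in [psum]. *)
Lemma smoothed_statE j t l k : smoothed_stat m g S N th x j y ups q t l 0 k =
  t%:R^-1 * psum N K (fun i z z' => S z z' (y i.+1) 0 k) ups q x j t l.
Proof.
elim: t l => [|t IH] l; first by rewrite /= mxE mulr0.
rewrite [smoothed_stat _ _ _ _ _ _ _ _ _ _ _ _]/= mxE; congr (_ * _).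
rewrite summxE /= mulr_suml.
have G0 : g th (x t.+1 l) (y t.+1) != 0 by rewrite gt_eqF.
set D := \sum_(k0 < N) weight m g N th x j y ups q t k0 * m th (x t k0) (x t.+1 l).
have -> : \sum_(i < N) pweight N K ups q x j t i * K t (x t i) (x t.+1 l) =
    D * g th (x t.+1 l) (y t.+1).
  rewrite /D mulr_suml; apply: eq_bigr => i _.
  by rewrite weightE -mgK mulrA.
have D0 : D != 0.
  rewrite gt_eqF//; apply: sum_ord_gt0 => // i.
  by apply: mulr_gt0 => //; exact: block_weight_gt0.
apply: eq_bigr => i _; rewrite !mxE IH weightE -mgK.
have -> : t%:R * (t%:R^-1 * psum N K (fun i z z' => S z z' (y i.+1) 0 k) ups q x j t i) =
    psum N K (fun i z z' => S z z' (y i.+1) 0 k) ups q x j t i.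
  by case: (t) => [|t']; [rewrite mul0r|rewrite mulVKf// pnatr_eq0].
move: (psum _ _ _ _ _ _ _ _ _) (pweight _ _ _ _ _ _ _ _) (S _ _ _ _ _) G0 D0 => a b c.
move: (g _ _ _) D (m _ _ _) => G {}D e G0 D0.
by field; rewrite G0 D0.
Qed.

Lemma particle_statE j tau k : particle_stat m g S N th x j y ups q tau 0 k =
  tau%:R^-1 * ((\sum_(l < N) pweight N K ups q x j tau l *
       psum N K (fun i z z' => S z z' (y i.+1) 0 k) ups q x j tau l)
     / \sum_(l < N) pweight N K ups q x j tau l).
Proof.
rewrite /particle_stat mxE summxE.
rewrite (eq_bigr (fun l : 'I_N => pweight N K ups q x j tau l)); last first.
  by move=> l _; rewrite weightE.
set D := \sum_(l < N) pweight _ _ _ _ _ _ _ _; set A := \sum_(l < N) pweight _ _ _ _ _ _ _ _ * _.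
have -> : \sum_(l < N) (weight m g N th x j y ups q tau l *:
    smoothed_stat m g S N th x j y ups q tau l) 0 k = tau%:R^-1 * A.
  by rewrite mulr_sumr; apply: eq_bigr => l _; rewrite mxE weightE smoothed_statE mulrCA.
by rewrite mulrCA [A / D]mulrC.
Qed.

(** Only indices of actual particles at positive times up to t are read, so ancestor indices may be
    altered anywhere else. *)
Lemma eq_smoothed_stat j j' t l : (l < N)%N ->
  (forall s i, (0 < s <= t)%N -> (i < N)%N -> j s i = j' s i) ->
  weight m g N th x j y ups q t l = weight m g N th x j' y ups q t l /\
  smoothed_stat m g S N th x j y ups q t l = smoothed_stat m g S N th x j' y ups q t l.
Proof.
elim: t l => [//|t IH] l lN jj.
have H i (iN : (i < N)%N) := IH i iN (fun s i' st => jj s i'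
  (let: conj h1 h2 := andP st in introT andP (conj h1 (leqW h2)))).
split; first by rewrite /weight jj// ltnS leqnn.
rewrite /=; congr (_ *: _); apply: eq_bigr => i _.
have [h1 h2] := H i (ltn_ord i); rewrite h1 h2; congr (_ / _ *: _).
by apply: eq_bigr => i' _; have [-> _] := H i' (ltn_ord i').
Qed.

Lemma eq_particle_stat j j' tau :
  (forall s i, (0 < s <= tau)%N -> (i < N)%N -> j s i = j' s i) ->
  particle_stat m g S N th x j y ups q tau = particle_stat m g S N th x j' y ups q tau.
Proof.
move=> jj; rewrite /particle_stat; congr (_^-1 *: _); apply: eq_bigr => l _;
  by have [h1 h2] := eq_smoothed_stat (ltn_ord l) jj; rewrite ?h1 ?h2.
Qed.

(** Positive weights make every stage a convex combination. At the first time the previous statistic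
    has coefficient 0, so its conventional value 0 does not have to lie in C. *)
Lemma particle_stat_convex (C : set 'rV[R]_d) j tau :
  (forall a b t, 0 <= t <= 1 -> C a -> C b -> C (t *: b + (1 - t) *: a)) ->
  (forall z z' v, C (S z z' v)) -> (0 < tau)%N ->
  C (particle_stat m g S N th x j y ups q tau).
Proof.
move=> Cc CS; case: tau => [//|tau] _.
have comb (a : 'I_N -> R) (v : 'I_N -> 'rV[R]_d) : (forall i, 0 < a i) -> (forall i, C (v i)) ->
    C ((\sum_i a i)^-1 *: \sum_i a i *: v i).
  by case: (N) a v N_gt0 => // n a v _; exact: convex_combination.
have CSm t l : C (smoothed_stat m g S N th x j y ups q t.+1 l).
  elim: t l => [|t IH] l; rewrite [smoothed_stat _ _ _ _ _ _ _ _ _ _ _ _]/=.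
    have := comb (fun i => weight m g N th x j y ups q 0 i * m th (x 0%N i) (x 1%N l))
      (fun i => S (x 0%N i) (x 1%N l) (y 1%N)) (fun i => mulr_gt0 (block_weight_gt0 _ _ _) (m_gt0 _ _))
      (fun i => CS _ _ _).
    congr C; rewrite invr1 scale1r scaler_sumr; apply: eq_bigr => i _.
    by rewrite scaler0 addr0 scalerA [_^-1 * _]mulrC.
  have tn0 : t.+2%:R != 0 :> R by rewrite pnatr_eq0.
  have CT (i : 'I_N) : C (t.+2%:R^-1 *: (S (x t.+1 i) (x t.+2 l) (y t.+2) +
         t.+1%:R *: smoothed_stat m g S N th x j y ups q t.+1 i)).
    have := Cc (smoothed_stat m g S N th x j y ups q t.+1 i) (S (x t.+1 i) (x t.+2 l) (y t.+2))
      (t.+2%:R^-1) _ (IH i) (CS _ _ _).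
    have -> : 1 - t.+2%:R^-1 = t.+2%:R^-1 * t.+1%:R :> R.
      by rewrite -{1}(mulVf tn0) -[X in _ * X - _]natr1 mulrDr mulr1 addrK.
    rewrite -scalerA -scalerDr; apply.
    by rewrite invr_ge0 ler0n/= invf_le1 ?ltr0n// ler1n.
  have := comb (fun i => weight m g N th x j y ups q t.+1 i * m th (x t.+1 i) (x t.+2 l))
      (fun i => t.+2%:R^-1 *: (S (x t.+1 i) (x t.+2 l) (y t.+2) +
         t.+1%:R *: smoothed_stat m g S N th x j y ups q t.+1 i))
      (fun i => mulr_gt0 (block_weight_gt0 _ _ _) (m_gt0 _ _)) CT.
  congr C; rewrite !scaler_sumr; apply: eq_bigr => i _.
  by rewrite !scalerA; congr (_ *: _); rewrite mulrC; congr (_ * _); exact: mulrC.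
exact: comb (fun l => block_weight_gt0 _ _ _) (fun l => CSm _ _).
Qed.

Hypothesis mq : forall t, measurable_fun setT (fun z : X * X => q t z.1 z.2).
Hypothesis q_total : forall t z, (\int[lambda]_z' (q t z z')%:E = 1)%E.

Lemma proposal_lawE j t (B : set (nat * X)) : measurable B ->
  proposal_law lambda m g N th x j y ups q t.+1 B =
  (\sum_(i < N) \int[lambda]_z
    ((pweight N K ups q x j t i * ups t.+1 (x t i) * q t.+1 (x t i) z
      / \sum_(k < N) pweight N K ups q x j t k * ups t.+1 (x t k)) * \1_B (i : nat, z)))%:E.
Proof.
move=> mB; pose a (i : nat) := pweight N K ups q x j t i * ups t.+1 (x t i).
have a0 i : 0 < a i.
  by rewrite /a -weightE; apply: mulr_gt0 => //; exact: block_weight_gt0.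
pose A := \sum_(k < N) a k.
have A0 : 0 < A by apply: sum_ord_gt0.
have mqs i : measurable_fun setT (q t.+1 (x t i)) by exact: (measurableT_comp (mq t.+1) (measurable_pair1 _)).
have mBi (i : nat) : measurable [set z | B (i, z)].
  have -> : [set z | B (i, z)] = (fun z => (i, z)) @^-1` B by [].
  by rewrite -[X in measurable X]setTI; exact: (measurable_pair1 i).
have iq i : lambda.-integrable setT (EFin \o q t.+1 (x t i)).
  apply/integrableP; split; first exact/measurable_EFinP.
  rewrite (eq_integral (fun z => (q t.+1 (x t i) z)%:E)) ?q_total ?ltry// => z _.
  by rewrite /= ger0_norm// ltW.
have iqB i (D : set X) : measurable D -> lambda.-integrable D (EFin \o q t.+1 (x t i)).
  by move=> mD; exact: integrableS (iq i).
pose r (D : nat -> set X) i := \int[lambda]_(z in D i) q t.+1 (x t i) z.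
have massE D : measurable D -> proposal_mass lambda m g N th x j y ups q t.+1 D =
    (\sum_(i < N) a i * r (fun i => [set z | D (i, z)]) i)%:E.
  move=> mD; rewrite /proposal_mass -sumEFin; apply: eq_bigr => i _ /=.
  have mDi : measurable [set z | D (i : nat, z)].
    have -> : [set z | D (i : nat, z)] = (fun z => (i : nat, z)) @^-1` D by [].
    by rewrite -[X in measurable X]setTI; exact: (measurable_pair1 (i : nat)).
  rewrite weightE [RHS]EFinM; congr (_ * _)%E.
  by rewrite /r /Rintegral fineK//; apply: integrable_fin_num => //; exact: iqB.
have totE : proposal_mass lambda m g N th x j y ups q t.+1 setT = A%:E.
  rewrite massE//; congr (_%:E); apply: eq_bigr => i _.
  rewrite /r (_ : [set z | [set: nat * X] (i : nat, z)] = setT)//.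
  by rewrite /Rintegral q_total/= mulr1.
rewrite /proposal_law totE massE// inver gt_eqF// -EFinM; congr (_%:E).
rewrite mulr_suml; apply: eq_bigr => i _; rewrite -/A -/(a i).
rewrite (eq_Rint lambda (g := fun z => a i / A * (q t.+1 (x t i) z * \1_[set z | B (i : nat, z)] z))); last first.
  move=> z; rewrite [in LHS]mulrAC -/(a i) -!mulrA.
  have -> : \1_[set z | B (i : nat, z)] z = \1_B (i : nat, z) :> R.
    by rewrite !indicE; congr ((nat_of_bool _)%:R); apply/idP/idP; rewrite !inE.
  by rewrite -/(a i) /a -/A; ring.
have iqi : lambda.-integrable setT
    (EFin \o (fun z => q t.+1 (x t i) z * \1_[set z | B (i : nat, z)] z)).
  apply: (@le_integrable _ _ _ lambda setT measurableT _ (EFin \o q t.+1 (x t i))) => //.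
    by apply/measurable_EFinP; apply: measurable_funM => //; exact: measurable_indic.
  move=> z _; rewrite /= lee_fin indicE normrM; case: (_ \in _); rewrite ?normr1 ?normr0 ?mulr1 ?mulr0//.
rewrite RintegralZl// [LHS]mulrAC; congr (_ * _).
rewrite /r /Rintegral; congr fine; rewrite integral_mkcond; apply: eq_integral => z _.
by rewrite patchE/= indicE; case: ifP; rewrite ?mulr1 ?mulr0.
Qed.

End block_link.

(** * Changes on null sets and the surrogate run *)

Import HBNNSimple.

(** Measurability of the integrands is not supposed: the proposal laws of the given run are compared
    with those of the surrogate before they are known to be measurable. Simple functions below f are
    cut to E, where f = g. *)
Lemma ge0_integral_le_ae {R : realType} {d} {T : measurableType d}
    (mu : {measure set T -> \bar R}) (A E : set T) (f g : T -> \bar R) :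
  measurable E -> mu (~` E) = 0%E -> (forall x, 0 <= f x)%E -> (forall x, 0 <= g x)%E ->
  (forall x, E x -> f x = g x) -> (\int[mu]_(x in A) f x <= \int[mu]_(x in A) g x)%E.
Proof.
move=> mE E0 f0 g0 fg; rewrite !ge0_integralE//.
apply: ge_ereal_sup => _ [h /= hf <-].
pose h' := proj_nnsfun h mE.
have h'E x : h' x = h x * \1_E x by [].
have -> : sintegral mu h = sintegral mu h'.
  have H (k : {nnsfun T >-> R}) : sintegral mu k = (\int[mu]_x (k x)%:E)%E.
    by rewrite integral_nnsfun// patch_setT.
  rewrite !H; apply: ae_eq_integral => //.
  - by apply/measurable_EFinP; exact: measurable_funP.
  - by apply/measurable_EFinP; exact: measurable_funP.
  - exists (~` E); split=> //; first exact: measurableC.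
    move=> x nx Ex; apply: nx => _; apply: (congr1 EFin); apply/esym/(etrans (h'E x)).
    by rewrite indicE mem_set// mulr1.
apply: ereal_sup_ubound; exists h' => // x.
suff : ((h x * \1_E x)%:E <= (g \_ A) x)%E by [].
rewrite indicE; have [Ex|nEx] := boolP (x \in E).
  rewrite mulr1; apply: (le_trans (hf x)); rewrite !patchE; case: ifP => // _.
  by rewrite fg//; exact: set_mem.
by rewrite mulr0 patchE; case: ifP.
Qed.

Lemma ge0_integral_eq_ae {R : realType} {d} {T : measurableType d}
    (mu : {measure set T -> \bar R}) (A E : set T) (f g : T -> \bar R) :
  measurable E -> mu (~` E) = 0%E -> (forall x, 0 <= f x)%E -> (forall x, 0 <= g x)%E ->
  (forall x, E x -> f x = g x) -> (\int[mu]_(x in A) f x = \int[mu]_(x in A) g x)%E.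
Proof.
move=> mE E0 f0 g0 fg; apply/eqP; rewrite eq_le (ge0_integral_le_ae _ mE)//=.
by apply: (ge0_integral_le_ae _ mE) => // x /fg.
Qed.

Lemma ae_measure_eq {R : realType} {d} {T : measurableType d}
    (mu : {measure set T -> \bar R}) (A B E : set T) :
  measurable A -> measurable B -> measurable E ->
  mu (~` E) = 0%E -> (forall x, E x -> A x <-> B x) -> mu A = mu B.
Proof.
move=> mA mB mE E0 AB.
have H (C : set T) : measurable C -> mu C = mu (C `&` E).
  move=> mC; have mCE : measurable (C `&` E) by exact: measurableI.
  have mE' := measurableC mE.
  apply/eqP; rewrite eq_le; apply/andP; split; last by apply: le_measure; rewrite ?inE.
  apply: (@le_trans _ _ (mu ((C `&` E) `|` ~` E))).
    apply: le_measure; rewrite ?inE//; first exact: measurableU.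
    by move=> x Cx; have [Ex|nEx] := pselect (E x); [left|right].
  by rewrite -[leRHS]adde0 -E0; exact: measureU2.
rewrite (H A mA) (H B mB); congr (mu _); apply/seteqP; split => x [Cx Ex]; split=> //.
  exact: (AB x Ex).1.
exact: (AB x Ex).2.
Qed.

Lemma inv_natr_ratio {R : realFieldType} (t : nat) (E D : R) : (0 < t)%N -> 0 <= D ->
  E <= t.+1%:R ^+ 2 * D -> t%:R^-1 ^+ 2 * E <= 4 * D.
Proof.
move=> t0 D0 ED; have tg : 0 < t%:R :> R by rewrite ltr0n.
rewrite exprVn ler_pdivrMl ?exprn_gt0//; apply: le_trans ED _.
rewrite mulrA; apply: ler_wpM2r => //.
have : t.+1%:R <= 2 * t%:R :> R by rewrite -natrM ler_nat mul2n -addnn -addn1 leq_add2l.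
by move=> h; rewrite !expr2; have : 0 <= t.+1%:R :> R by []; nra.
Qed.

Section run.
Context {R : realType} {dO dX dY : measure_display} {dth d : nat}.
Context {Omega : measurableType dO} {X : measurableType dX} {Y : measurableType dY}.
Variables (P : probability Omega R) (lambda : {finite_measure set X -> \bar R}).
Variable chi : probability X R.
Variables (m : 'rV[R]_dth -> X -> X -> R) (g : 'rV[R]_dth -> X -> Y -> R).
Variables (S : X -> X -> Y -> 'rV[R]_d) (thbar : 'rV[R]_d -> 'rV[R]_dth).
Variables (tau N : nat -> nat) (ups : nat -> nat -> X -> R) (q : nat -> nat -> X -> X -> R).
Variables (Yt : int -> Omega -> Y) (th0 : 'rV[R]_dth).
Variables (xi : nat -> nat -> nat -> Omega -> X) (J : nat -> nat -> nat -> Omega -> nat).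
Variable theta : nat -> Omega -> 'rV[R]_dth.
Hypothesis run : pboem P lambda chi m g S thbar tau N ups q Yt th0 xi J theta.
Hypothesis mY : forall t, measurable_fun setT (Yt t).
Hypothesis tau_gt0 : forall n, (0 < tau n.+1)%N.
Hypothesis N_gt0 : forall n, (0 < N n.+1)%N.
Variables (Theta : set 'rV[R]_dth) (phi : 'rV[R]_dth -> R) (psi : 'rV[R]_dth -> 'rV[R]_d).
Hypothesis phi_cont : continuous_on Theta (phi : 'rV[R]_dth -> R^o).
Hypothesis psi_cont : continuous_on Theta psi.
Hypothesis Theta_th0 : Theta th0.
Hypothesis m_gt0 : forall th x z, Theta th -> 0 < m th x z.
Hypothesis g_gt0 : forall th x y, Theta th -> 0 < g th x y.
Hypothesis mgE : forall th x z y, Theta th -> m th x z * g th z y = exp_kernel phi psi S th x z y.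
Variables (clip : Y -> Y) (M U B k1 k2 : R).
Let Sc x z y := S x z (clip y).
Hypothesis mclip : measurable_fun setT clip.
Hypothesis clipE : {ae P, forall w, forall t, clip (Yt t w) = Yt t w}.
Hypothesis mSc : forall k, measurable_fun setT (fun z : X * X * Y => Sc z.1.1 z.1.2 z.2 0 k).
Hypothesis Sc_bound : forall x z y k, `|Sc x z y 0 k| <= M.
Hypothesis lambda_gt0 : 0 < fine (lambda setT).
Hypothesis k1_gt0 : 0 < k1.
Hypothesis k12 : k1 <= k2.
Hypothesis k_bound : forall th x z y, Theta th -> k1 <= exp_kernel phi psi Sc th x z y <= k2.
Hypothesis m_ups : forall t n, measurable_fun setT (ups t n).
Hypothesis ups_bound : forall t n x, 0 < ups t n x <= U.
Hypothesis mq : forall t n, measurable_fun setT (fun z : X * X => q t n z.1 z.2).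
Hypothesis q_gt0 : forall t n x z, 0 < q t n x z.
Hypothesis q_total : forall t n x, (\int[lambda]_z (q t n x z)%:E = 1)%E.
Hypothesis weight_bound : forall th x z y t n, Theta th ->
  exp_kernel phi psi Sc th x z y / (ups t n x * q t n x z) <= B.
Variables (Sset : set 'rV[R]_d) (C : set 'rV[R]_d).
Hypothesis thbar_cont : continuous_on Sset thbar.
Hypothesis thbar_Theta : forall s, Sset s -> Theta (thbar s).
Hypothesis C_convex : forall a b t, 0 <= t <= 1 -> C a -> C b -> C (t *: b + (1 - t) *: a).
Hypothesis C_S : forall x z y, C (S x z y).
Hypothesis C_Sset : C `<=` Sset.

Let ups_gt0 t n x : 0 < ups t n x. Proof. by case/andP: (ups_bound t n x). Qed.

(** Ancestor indices are known to be below the number of particles almost surely only; the default 0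
    makes them valid everywhere. *)
Definition clip_index n t l w : nat := if (J n t l w < N n.+1)%N then J n t l w else 0%N.

(** Parameters of a surrogate run with clipped observations and indices and the same particles. It
    agrees almost surely with the given run, and its kernels are bounded and its parameters
    measurable without exceptional set. *)
Fixpoint clip_theta (n : nat) (w : Omega) : 'rV[R]_dth :=
  if n is n'.+1 then
    thbar (particle_stat m g S (N n) (clip_theta n' w) (fun s l => xi n' s l w)
      (fun s l => clip_index n' s l w) (fun t => clip (block_obs tau Yt n' w t))
      (ups^~ n') (q^~ n') (tau n))
  else th0.

Let stat n w := particle_stat m g S (N n.+1) (clip_theta n w) (fun s l => xi n s l w)
      (fun s l => clip_index n s l w) (fun t => clip (block_obs tau Yt n w t))
      (ups^~ n) (q^~ n) (tau n.+1).

Let stat_C th n w j (y : nat -> Y) : Theta th ->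
  C (particle_stat m g S (N n.+1) th (fun s l => xi n s l w) j y (ups^~ n) (q^~ n) (tau n.+1)).
Proof.
move=> Tth; apply: particle_stat_convex => //.
- by move=> z z'; exact: m_gt0.
- by move=> z y'; exact: g_gt0.
Qed.

Lemma clip_theta_Theta n w : Theta (clip_theta n w).
Proof. by elim: n => [//|n IH] /=; apply: thbar_Theta; apply: C_Sset; exact: stat_C. Qed.

Lemma theta_Theta n w : Theta (theta n w).
Proof.
elim: n => [|n IH]; first by rewrite (pboem_theta0 run).
by rewrite (pboem_update run); apply: thbar_Theta; apply: C_Sset; exact: stat_C.
Qed.

Let obs n w := observations Yt (block_end tau n).+1%:Z w.
Let K w n := along (exp_kernel phi psi Sc (clip_theta n w)) (obs n w).
Let sc k w n := along (coord_cost Sc k) (obs n w).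

Let obsE n w t : block_obs tau Yt n w t.+1 = obs n w t.
Proof. by rewrite /block_obs /obs /observations addnS -addSn PoszD addrC. Qed.

(** The generating family of [history], isolated so that sub-sigma-fields can be compared by
    inclusion of generators. *)
Definition generators (n t : nat) : set (set Omega) :=
  [set A | exists u B, measurable B /\ A = Yt u @^-1` B] `|`
  [set A | exists k s l B, [/\ before tau k s n t, (l < N k.+1)%N,
             measurable B & A = xi k s l @^-1` B]] `|`
  [set A | exists k s l B, [/\ before tau k s.+1 n t, (l < N k.+1)%N,
             measurable B & A = J k s.+1 l @^-1` B]].

Let historyE n t : history tau N Yt xi J n t = <<s generators n t >>.
Proof. by []. Qed.

Let generators_mono n t t' : (t <= t')%N -> generators n t `<=` generators n t'.
Proof.
move=> tt A [[|]|]; first by left; left.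
  move=> [k [s [l [D [h1 h2 h3 h4]]]]]; left; right; exists k, s, l, D; split=> //.
  move: h1; rewrite /before => /orP[->//|/andP[-> h]].
  by rewrite (leq_trans h tt) orbT.
move=> [k [s [l [D [h1 h2 h3 h4]]]]]; right; exists k, s, l, D; split=> //.
move: h1; rewrite /before => /orP[->//|/andP[-> h]].
by rewrite (leq_trans h tt) orbT.
Qed.

(** All that a block draws up to its last time is available at time 0 of the next block, which makes
    the next parameter measurable there. *)
Let generators_next n : generators n (tau n.+1).+1 `<=` generators n.+1 0.
Proof.
have H k s : before tau k s n (tau n.+1).+1 -> before tau k s n.+1 0.
  rewrite /before => /orP[/andP[kn st]|/andP[/eqP -> st]]; apply/orP; left; apply/andP; split=> //.
  exact: ltnW.
move=> A [[|]|]; first by left; left.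
  by move=> [k [s [l [D [h1 h2 h3 h4]]]]]; left; right; exists k, s, l, D; split=> //; exact: H.
by move=> [k [s [l [D [h1 h2 h3 h4]]]]]; right; exists k, s, l, D; split=> //; exact: H.
Qed.

Let generators_measurable n t : (t <= (tau n.+1).+1)%N -> generators n t `<=` measurable.
Proof.
have H k s : (t <= (tau n.+1).+1)%N -> before tau k s n t -> (s <= tau k.+1)%N.
  by move=> tt /orP[/andP[]//|/andP[/eqP -> st]]; rewrite -ltnS; exact: leq_trans tt.
move=> tt A [[|]|].
- by move=> [u [D [mD ->]]]; rewrite -[X in measurable X]setTI; exact: mY.
- move=> [k [s [l [D [h1 h2 h3 ->]]]]]; rewrite -[X in measurable X]setTI.
  by apply: (pboem_xi_measurable run) => //; exact: H h1.
- move=> [k [s [l [D [h1 h2 h3 ->]]]]]; rewrite -[X in measurable X]setTI.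
  by apply: (pboem_J_measurable run) => //; exact: H h1.
Qed.

Let HG n t := g_sigma_algebraType (generators n t).

Let mYG n t u : measurable_fun setT (Yt u : HG n t -> Y).
Proof. by move=> _ D mD; rewrite setTI; apply: sub_sigma_algebra; left; left; exists u, D. Qed.

Let mxiG n t l : (l < N n.+1)%N -> sub_measurable (generators n t.+1) (xi n t l).
Proof.
move=> lN _ D mD; rewrite setTI; apply: sub_sigma_algebra; left; right.
by exists n, t, l, D; split=> //; rewrite /before eqxx leqnn orbT.
Qed.

Let mclip_index : forall n, measurable_fun setT (fun j : nat => if (j < N n.+1)%N then j else 0%N).
Proof. by []. Qed.

Let mJG n t l : (l < N n.+1)%N -> sub_measurable (generators n t.+2) (clip_index n t.+1 l).
Proof.
move=> lN; apply: (measurableT_comp (@mclip_index n)).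
move=> _ D mD; rewrite setTI; apply: sub_sigma_algebra; right.
by exists n, t, l, D; split=> //; rewrite /before eqxx ltnSn orbT.
Qed.

Let clip_index_lt n t l w : (clip_index n t l w < N n.+1)%N.
Proof. by rewrite /clip_index; case: ifP. Qed.

Definition theta_measurable n := forall k,
  sub_measurable (generators n 0) (fun w => clip_theta n w 0 k).

Let measurable_block_kernel n i : theta_measurable n ->
  measurable_fun setT (fun z : HG n 0 * X * X => K z.1.1 n i z.1.2 z.2).
Proof.
move=> mth; rewrite /K /along /exp_kernel.
have m1 : measurable_fun setT (fun z : HG n 0 * X * X => z.1.1).
  exact: (measurableT_comp measurable_fst measurable_fst).
have mphi : measurable_fun setT (fun w : HG n 0 => phi (clip_theta n w)).
  exact: (@measurable_continuous_on R _ (HG n 0) dth Theta phi (clip_theta n) phi_cont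
    (clip_theta_Theta n) mth).
have psik k : continuous_on Theta ((fun th => psi th 0 k) : 'rV[R]_dth -> R^o).
  move=> th Tth e e0; have [r r0 h] := psi_cont Tth e0; exists r => // th' Tth' /(h _ Tth').
  by move=> /(le_lt_trans _); apply; have := norm_coord_le (psi th - psi th') k; rewrite !mxE.
have mpsi k : measurable_fun setT (fun w : HG n 0 => psi (clip_theta n w) 0 k).
  exact: (@measurable_continuous_on R _ (HG n 0) dth Theta _ (clip_theta n) (psik k)
    (clip_theta_Theta n) mth).
apply: measurableT_comp => //; apply: measurable_funD; first exact: (measurableT_comp mphi m1).
under eq_fun do rewrite dotpE.
apply: measurable_sum => k; apply: measurable_funM; last exact: (measurableT_comp (mpsi k) m1).
apply: (measurableT_comp (mSc k) (g := fun z : HG n 0 * X * X => (z.1.2, z.2, obs n z.1.1 i))).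
apply: measurable_fun_pair; last exact: (measurableT_comp (@mYG n 0 _) m1).
apply: measurable_fun_pair; last exact: measurable_snd.
exact: (measurableT_comp measurable_snd measurable_fst).
Qed.

Let measurable_block_cost k n i :
  measurable_fun setT (fun z : HG n 0 * X * X => sc k z.1.1 n i z.1.2 z.2).
Proof.
apply: (measurableT_comp (mSc k) (g := fun z : HG n 0 * X * X => (z.1.2, z.2, obs n z.1.1 i))).
apply: measurable_fun_pair.
  apply: measurable_fun_pair; last exact: measurable_snd.
  exact: (measurableT_comp measurable_snd measurable_fst).
apply: (measurableT_comp (@mYG n 0 _)).
exact: (measurableT_comp measurable_fst measurable_fst).
Qed.

Let mgKc n w t z z' : m (clip_theta n w) z z' * g (clip_theta n w) z' (clip (block_obs tau Yt n w t.+1))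
   = K w n t z z'.
Proof. by rewrite mgE ?obsE//; exact: clip_theta_Theta. Qed.

Let ratio k n w := (\sum_(l < N n.+1)
    pweight (N n.+1) (K w n) (ups^~ n) (q^~ n) (fun s l => xi n s l w) (fun s l => clip_index n s l w) (tau n.+1) l *
    psum (N n.+1) (K w n) (sc k w n) (ups^~ n) (q^~ n) (fun s l => xi n s l w) (fun s l => clip_index n s l w) (tau n.+1) l)
  / \sum_(l < N n.+1)
    pweight (N n.+1) (K w n) (ups^~ n) (q^~ n) (fun s l => xi n s l w) (fun s l => clip_index n s l w) (tau n.+1) l.

Let statE n w k : stat n w 0 k = (tau n.+1)%:R^-1 * ratio k n w.
Proof.
have Tc := clip_theta_Theta n w.
have -> := @particle_statE R dX dY _ d X Y m g S (N n.+1) (clip_theta n w)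
  (fun s l => xi n s l w) (fun t => clip (block_obs tau Yt n w t)) (ups^~ n) (q^~ n) (K w n)
  (N_gt0 n) (fun z z' => m_gt0 z z' Tc) (fun z y => g_gt0 z y Tc) (fun t z => ups_gt0 t n z)
  (fun t z z' => q_gt0 t n z z') (mgKc n w) (fun s l => clip_index n s l w) (tau n.+1) k.
congr (_ * (_ / _)); apply: eq_bigr => l _; congr (_ * psum _ _ _ _ _ _ _ _ _).
by apply/funext => i; apply/funext => z; apply/funext => z'; rewrite obsE.
Qed.

(** Induction over blocks: the parameter makes the kernels measurable at the start of a block, hence
    the statistic at its end, and continuity of [thbar] on [Sset] passes this on to the next
    parameter. *)
Lemma clip_theta_measurable n : theta_measurable n.
Proof.
elim: n => [|n IH] k; first exact: measurable_cst.
have mratio l : sub_measurable (generators n.+1 0) (fun w => stat n w 0 l).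
  apply: (sub_measurableW (@generators_next n)).
  rewrite (_ : (fun w => _) = (fun w => (tau n.+1)%:R^-1 * ratio l n w)); last first.
    by apply/funext => w; exact: statE.
  apply: measurable_funM; first exact: measurable_cst.
  apply: (measurable_particle_ratio lambda (tau := tau n.+1) (N := N n.+1) (G := generators n)
    (K := fun w => K w n) (s := fun w => sc l w n) (u := ups^~ n) (q := q^~ n) (xi := xi n)
    (J := clip_index n) (@generators_mono n)).
  - by move=> i; exact: measurable_block_kernel.
  - by move=> i; exact: measurable_block_cost.
  - by move=> t; exact: m_ups.
  - by move=> t; exact: mq.
  - by move=> t i _ iN; exact: mxiG.
  - by move=> t i _ iN; exact: mJG.
  - by move=> t i w; exact: clip_index_lt.
have tk : continuous_on Sset ((fun s => thbar s 0 k) : 'rV[R]_d -> R^o).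
  move=> s Ss e e0; have [r r0 h] := thbar_cont Ss e0; exists r => // s' Ss' /(h _ Ss').
  by move=> /(le_lt_trans _); apply; have := norm_coord_le (thbar s - thbar s') k; rewrite !mxE.
apply: (@measurable_continuous_on R _ (HG n.+1 0) d Sset _ (stat n) tk) => // w.
by apply: C_Sset; apply: stat_C; exact: clip_theta_Theta.
Qed.

Lemma measurable_clip_theta n k : measurable_fun setT (fun w => clip_theta n w 0 k).
Proof. exact: (sub_measurableT (generators_measurable (leq0n _)) (@clip_theta_measurable n k)). Qed.

Let good (w : Omega) : Prop := (forall t : nat, clip (Yt t w) = Yt t w) /\
  forall n t l, (0 < t <= tau n.+1)%N -> (l < N n.+1)%N -> (J n t l w < N n.+1)%N.

Let indices_lt n t : (0 < t <= tau n.+1)%N ->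
  {ae P, forall w, forall l, (l < N n.+1)%N -> (J n t l w < N n.+1)%N}.
Proof.
move=> tt; have step := pboem_step run tt.
pose D : set (nat * X) := [set p | (p.1 < N n.+1)%N].
have mD : measurable D.
  rewrite (_ : D = [set i | (i < N n.+1)%N] `*` setT); first exact: measurableX.
  by apply/seteqP; split => -[i z] /=; [|move=> []].
have histT : history tau N Yt xi J n t setT by exact: (@measurableT _ (HG n t)).
have E1 := step setT (fun=> D) histT (fun=> mD).
have E2 := step setT (fun=> setT) histT (fun=> measurableT).
set X1 := (_ `&` _) in E1; set X2 := (_ `&` _) in E2.
have X2T : X2 = setT by apply/seteqP; split => w //= _; split.
(* The proposal mass is carried by indices below the number of particles, so the product rule
   assigns this event the same value as the whole space, which has probability 1. *)
have PX1 : P X1 = 1%E.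
  transitivity (P X2); last by rewrite X2T probability_setT.
  rewrite E1 E2; apply: eq_integral => w _.
  apply: eq_bigr => l _; rewrite /proposal_law; congr (_ * _)%E.
  rewrite /proposal_mass; apply: eq_bigr => i _; congr (_ * _)%E.
  by congr (integral _ _ _); apply/seteqP; split => z // _; exact: ltn_ord.
have mX1 : measurable X1.
  rewrite /X1 setTI (_ : [set w | _] = \bigcap_(l in [set l | (l < N n.+1)%N])
     (J n t l @^-1` [set i | (i < N n.+1)%N])); last by [].
  apply: bigcap_measurable => [|l lN]; first by exists 0%N; exact: N_gt0.
  by rewrite -[X in measurable X]setTI; apply: (pboem_J_measurable run).
exists (~` X1); split; first exact: measurableC.
  by rewrite probability_setC// PX1 subee.
by move=> w nw [_ Xw]; apply: nw => l lN; exact: Xw.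
Qed.

Let ae_good : {ae P, forall w, good w}.
Proof.
have ae2 : {ae P, forall w, forall n t, (0 < t <= tau n.+1)%N -> forall l, (l < N n.+1)%N ->
    (J n t l w < N n.+1)%N}.
  apply/ae_foralln => n; apply/ae_foralln => t.
  have [tt|nt] := boolP (0 < t <= tau n.+1)%N; last by apply: filterE.
  have [D [mD D0 Ds]] := indices_lt tt; exists D; split=> // w nw; apply: Ds => h.
  by apply: nw => _; exact: h.
have [D [mD D0 Ds]] := filterI clipE ae2; exists D; split=> // w nw; apply: Ds => -[h1 h2].
by apply: nw; split=> [t|n t l tt lN]; [exact: h1|exact: h2].
Qed.

Let good_clip_obs w n : good w ->
  (fun t => clip (block_obs tau Yt n w t)) = block_obs tau Yt n w.
Proof. by move=> [h _]; apply/funext => t; exact: h. Qed.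

Let good_index w n t l : good w -> (0 < t <= tau n.+1)%N -> (l < N n.+1)%N ->
  J n t l w = clip_index n t l w.
Proof. by move=> [_ h] tt lN; rewrite /clip_index h. Qed.

Lemma good_theta w n : good w -> theta n w = clip_theta n w.
Proof.
move=> gw; elim: n => [|n IH]; first by rewrite (pboem_theta0 run).
rewrite (pboem_update run) /= IH good_clip_obs//; congr thbar.
by apply: eq_particle_stat => s i st iN; exact: good_index.
Qed.

Lemma ae_clip_theta : {ae P, forall w, forall n, theta n w = clip_theta n w}.
Proof.
have [D [mD D0 Ds]] := ae_good; exists D; split=> // w nw; apply: Ds => h; apply: nw => n.
exact: good_theta.
Qed.

(** The product rule of the given run is transferred to the surrogate: events and integrands change
    on a null set only, and the proposal law of the surrogate is the mixture of
    [proposal_density]. *)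
Let block_iid n t : (t < tau n.+1)%N ->
  cond_iid P <<s generators n t.+1 >> (N n.+1) (fun l w => (clip_index n t.+1 l w, xi n t.+1 l w))
    (fun w D => (mixture lambda (N n.+1) pair (fun w => proposal_density (N n.+1) (fun w => K w n)
        (ups^~ n) (q^~ n) (xi n) (clip_index n) w t) w \1_D)%:E).
Proof.
move=> tt A D GA mD.
have [D0 [mD0 PD0 Ds]] := ae_good.
have mE : measurable (~` D0) by exact: measurableC.
have E0 : P (~` ~` D0) = 0%E by rewrite setCK.
have gE w : (~` D0) w -> good w by move=> nw; apply: contrapT => ng; apply: nw; exact: Ds.
have tt' : (0 < t.+1 <= tau n.+1)%N by [].
have mA : measurable A := sub_sigma_measurable (generators_measurable (leqW tt)) GA.
have mev (Z : nat -> Omega -> nat) : (forall l, (l < N n.+1)%N -> measurable_fun setT (Z l)) ->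
    measurable (A `&` [set w | forall l, (l < N n.+1)%N -> D l (Z l w, xi n t.+1 l w)]).
  move=> mZ; apply: measurableI => //.
  rewrite (_ : [set w | _] = \bigcap_(l in [set l | (l < N n.+1)%N])
     ((fun w => (Z l w, xi n t.+1 l w)) @^-1` D l)); last by [].
  apply: bigcap_measurable => [|l lN]; first by exists 0%N; exact: N_gt0.
  rewrite -[X in measurable X]setTI; apply: measurable_fun_pair => //; first exact: mZ.
  exact: (pboem_xi_measurable run).
have mJl l : (l < N n.+1)%N -> measurable_fun setT (J n t.+1 l).
  by move=> lN; exact: (pboem_J_measurable run).
have mJcl l : (l < N n.+1)%N -> measurable_fun setT (clip_index n t.+1 l).
  by move=> lN; apply: (measurableT_comp (@mclip_index n)); exact: mJl.
rewrite (ae_measure_eq (mev _ mJcl) (mev _ mJl) mE E0); last first.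
  move=> w /gE gw; split=> -[Aw h]; split=> // l lN.
    by rewrite (good_index gw tt' lN); exact: h.
  by rewrite -(good_index gw tt' lN); exact: h.
apply: (etrans (pboem_step run tt' GA mD)).
have law w (Dl : set (nat * X)) : measurable Dl ->
    proposal_law lambda m g (N n.+1) (clip_theta n w) (fun s l => xi n s l w)
      (fun s l => clip_index n s l w) (fun t => clip (block_obs tau Yt n w t)) (ups^~ n) (q^~ n) t.+1 Dl =
    (mixture lambda (N n.+1) pair (fun w => proposal_density (N n.+1) (fun w => K w n)
        (ups^~ n) (q^~ n) (xi n) (clip_index n) w t) w \1_Dl)%:E.
  move=> mDl; have Tc := clip_theta_Theta n w.
  rewrite (@proposal_lawE R dX dY _ X Y lambda m g (N n.+1) (clip_theta n w)
    (fun s l => xi n s l w) (fun t => clip (block_obs tau Yt n w t)) (ups^~ n) (q^~ n) (K w n)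
    (N_gt0 n) (fun z z' => m_gt0 z z' Tc) (fun z y => g_gt0 z y Tc) (fun t z => ups_gt0 t n z)
    (fun t z z' => q_gt0 t n z z') (mgKc n w) (fun t => @mq t n) (fun t z => q_total t n z))//.
  congr (_%:E); apply: eq_bigr => i _; apply: eq_Rint => z.
  by rewrite /proposal_density ltn_ord.
have eq_law w (Dl : set (nat * X)) : good w ->
    proposal_law lambda m g (N n.+1) (theta n w) (fun s l => xi n s l w)
      (fun s l => J n s l w) (block_obs tau Yt n w) (ups^~ n) (q^~ n) t.+1 Dl =
    proposal_law lambda m g (N n.+1) (clip_theta n w) (fun s l => xi n s l w)
      (fun s l => clip_index n s l w) (fun t => clip (block_obs tau Yt n w t)) (ups^~ n) (q^~ n) t.+1 Dl.
  move=> gw; rewrite good_theta// good_clip_obs//.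
  have H Dl' : proposal_mass lambda m g (N n.+1) (clip_theta n w) (fun s l => xi n s l w)
      (fun s l => J n s l w) (block_obs tau Yt n w) (ups^~ n) (q^~ n) t.+1 Dl' =
     proposal_mass lambda m g (N n.+1) (clip_theta n w) (fun s l => xi n s l w)
      (fun s l => clip_index n s l w) (block_obs tau Yt n w) (ups^~ n) (q^~ n) t.+1 Dl'.
    apply: eq_bigr => i _; congr ((_ * _)%:E * _)%E.
    have := @eq_smoothed_stat R dX dY _ d X Y m g S (N n.+1) (clip_theta n w)
      (fun s l => xi n s l w) (block_obs tau Yt n w) (ups^~ n) (q^~ n)
      (fun s l => J n s l w) (fun s l => clip_index n s l w) t i (ltn_ord i).
    case=> // s j /andP[s0 st] jN; apply: good_index => //; rewrite s0/=.
    by apply: leq_trans st _; exact: ltnW.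
  by rewrite /proposal_law !H.
have law_ge0 th w j y (Dl : set (nat * X)) : Theta th ->
    (0 <= proposal_law lambda m g (N n.+1) th (fun s l => xi n s l w) j y (ups^~ n) (q^~ n) t.+1 Dl)%E.
  move=> Tth; have H Dl' : (0 <= proposal_mass lambda m g (N n.+1) th (fun s l => xi n s l w) j y
     (ups^~ n) (q^~ n) t.+1 Dl')%E.
    apply: sume_ge0 => i _; apply: mule_ge0.
      rewrite lee_fin; apply: mulr_ge0; apply: ltW => //.
      apply: (@block_weight_gt0 R dX dY _ X Y m g (N n.+1) th _ _ (ups^~ n) (q^~ n)) => //.
        by move=> z z'; exact: m_gt0.
      by move=> z y'; exact: g_gt0.
    by apply: integral_ge0 => z _; rewrite lee_fin; apply: ltW.
  by apply: mule_ge0 => //; rewrite inve_ge0.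
apply: (ge0_integral_eq_ae A mE E0).
- by move=> w; apply: prode_ge0 => l _; apply: law_ge0; exact: theta_Theta.
- by move=> w; apply: prode_ge0 => l _; rewrite -law//; apply: law_ge0; exact: clip_theta_Theta.
- by move=> w /gE gw; apply: eq_bigr => l _; rewrite eq_law// law.
Qed.

(** Once averaged over the block, the mean square error is at most a constant over the number of
    particles, so summable inverses give almost sure convergence. Block n reads observations from
    [block_end tau n] plus one on. *)
Lemma ae_block_error_cvg k : cvgn (series (fun n => (N n.+1)%:R^-1 : R)) ->
  {ae P, forall w, particle_stat m g S (N n.+1) (clip_theta n w) (fun s l => xi n s l w)
      (fun s l => clip_index n s l w) (fun t => clip (block_obs tau Yt n w t))
      (ups^~ n) (q^~ n) (tau n.+1) 0 k -
    block_mean Yt phi psi Sc lambda chi (clip_theta n w) k (tau n.+1) (block_end tau n).+1%:Z w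
    @[n --> \oo] --> 0}.
Proof.
move=> cN; pose F n w := ratio k n w - fk_expect lambda chi (tau n.+1) (K w n) (sc k w n).
pose D := 8 * ((k1 / k2)^-1 * (4 * M / (k1 / k2))) ^+ 2 / (k1 / k2) ^+ 2 +
     8 * (B / (k1 / k2) * (4 * M / (k1 / k2))) ^+ 2 /
       (k1 * (k1 / k2) * fine (lambda setT) / U) ^+ 2.
have D0 : 0 <= D.
  by apply: addr_ge0; apply: divr_ge0; rewrite ?sqr_ge0//; apply: mulr_ge0; rewrite ?sqr_ge0.
have Kb n w i x z : k1 <= K w n i x z <= k2 by apply: k_bound; exact: clip_theta_Theta.
have bF n : bounded_measurable (F n).
  apply: (bmeas_particle_error chi lambda_gt0 k1_gt0 (tau := tau n.+1) (N := N n.+1) (M := M)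
    (U := U) (k2 := k2) (G := generators n)
    (K := fun w => K w n) (s := fun w => sc k w n) (u := ups^~ n) (q := q^~ n) (xi := xi n)
    (J := clip_index n) (N_gt0 n) (@generators_measurable n) (@generators_mono n)).
  - by move=> i; apply: measurable_block_kernel; exact: clip_theta_measurable.
  - by move=> i; exact: measurable_block_cost.
  - exact: Kb.
  - by move=> w i x z; exact: Sc_bound.
  - by move=> t; exact: m_ups.
  - by move=> t x; exact: ups_bound.
  - by move=> t; exact: mq.
  - by move=> t x z; exact: q_gt0.
  - by move=> t i _ iN; exact: mxiG.
  - by move=> t i _ iN; exact: mJG.
  - by move=> t i w; exact: clip_index_lt.
have intF n : \int[P]_w (F n w ^+ 2) <= (tau n.+1).+1%:R ^+ 2 * D / (N n.+1)%:R.
  apply: (particle_block_error lambda_gt0 k1_gt0 k12 (tau := tau n.+1) (N := N n.+1)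
    (G := generators n)
    (K := fun w => K w n) (s := fun w => sc k w n) (u := ups^~ n) (q := q^~ n) (xi := xi n)
    (J := clip_index n) (N_gt0 n) (@generators_measurable n) (@generators_mono n)).
  - by move=> i; apply: measurable_block_kernel; exact: clip_theta_measurable.
  - by move=> i; exact: measurable_block_cost.
  - exact: Kb.
  - by move=> w i x z; exact: Sc_bound.
  - by move=> t; exact: m_ups.
  - by move=> t x; exact: ups_bound.
  - by move=> t; exact: mq.
  - by move=> t x z; exact: q_gt0.
  - by move=> t x; exact: q_total.
  - by move=> w i x z; apply: weight_bound; exact: clip_theta_Theta.
  - by move=> t i _ iN; exact: mxiG.
  - by move=> t i tt iN; exact: (pboem_xi_measurable run).
  - by move=> t i _ iN; exact: mJG.
  - move=> t i tt iN; apply: (measurableT_comp (@mclip_index n)).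
    exact: (pboem_J_measurable run).
  - by move=> t i w; exact: clip_index_lt.
  - by move=> A D1 GA mD1; exact: (pboem_initial run GA mD1).
  - by move=> t tt; exact: block_iid.
have bF2 n : bounded_measurable (fun w => F n w ^+ 2).
  by under eq_fun do rewrite expr2; exact: bmeasM.
have [E [mE E0 Es]] : {ae P, forall w, (tau n.+1)%:R^-1 ^+ 2 * F n w ^+ 2 @[n --> \oo] --> 0}.
  apply: (@ae_cvg0_of_summable _ _ _ P _ (fun n => (4 * D) *: (N n.+1)%:R^-1)).
  - by move=> n; exact: bmeasZ.
  - by move=> n w; apply: mulr_ge0; exact: sqr_ge0.
  - move=> n; rewrite bintegralZl//.
    have h := intF n; rewrite -mulrA in h.
    have D1 : 0 <= D / (N n.+1)%:R by apply: divr_ge0.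
    by have := inv_natr_ratio (tau_gt0 n) D1 h; rewrite mulrA.
  - have -> : series (fun n => (4 * D) *: (N n.+1)%:R^-1 : R) =
       (4 * D) *: series (fun n => (N n.+1)%:R^-1 : R).
      by apply/funext => i; rewrite /series/= -scaler_sumr.
    exact: is_cvgZl_tmp.
exists E; split=> // w nw; apply: Es => /= h; apply: nw; apply: (@norm_cvg0 _ R^o).
have -> : (fun n => `|particle_stat m g S (N n.+1) (clip_theta n w) (fun s l => xi n s l w)
      (fun s l => clip_index n s l w) (fun t => clip (block_obs tau Yt n w t))
      (ups^~ n) (q^~ n) (tau n.+1) 0 k -
    block_mean Yt phi psi Sc lambda chi (clip_theta n w) k (tau n.+1) (block_end tau n).+1%:Z w|) =
   (fun n => Num.sqrt ((tau n.+1)%:R^-1 ^+ 2 * F n w ^+ 2)).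
  apply/funext => n; rewrite -exprMn sqrtr_sqr /F mulrBr.
  by rewrite -/(stat n w) statE.
by rewrite -[X in _ --> X]sqrtr0; apply: (cvg_comp _ _ h); exact: sqrt_continuous.
Qed.

End run.

(** * Summability of inverse block sizes and particle numbers *)

Section summable_powers.
Context {R : realType}.

(** The comparison of the series with the integral of x^(-a), in telescoping form. With y = x + 1 it
    follows from (y / x)^(a - 1) >= 1 + (a - 1) ln (y / x) and ln (y / x) >= 1 / y. *)
Lemma powR_telescope (a : R) (n : nat) : 1 < a ->
  (n.+2%:R `^ a)^-1 <= (a - 1)^-1 * ((n.+1%:R `^ (a - 1))^-1 - (n.+2%:R `^ (a - 1))^-1).
Proof.
move=> a1; have s0 : 0 < a - 1 by rewrite subr_gt0.
have x0 : 0 < n.+1%:R :> R by rewrite ltr0n.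
have y0 : 0 < n.+2%:R :> R by rewrite ltr0n.
have -> : n.+2%:R `^ a = n.+2%:R * n.+2%:R `^ (a - 1).
  have y1 : (1 + (a - 1) == 0) ==> (n.+2%:R != 0 :> R) by rewrite pnatr_eq0 implybT.
  have -> : n.+2%:R * n.+2%:R `^ (a - 1) = n.+2%:R `^ 1 * n.+2%:R `^ (a - 1).
    by rewrite powRr1// ltW.
  by rewrite -(powRD y1); congr (_ `^ _); ring.
set p := n.+2%:R `^ (a - 1); have p0 : 0 < p by exact: powR_gt0.
set r := n.+1%:R `^ (a - 1); have r0 : 0 < r by exact: powR_gt0.
rewrite ler_pdivlMl// invfM.
have h : 1 + (a - 1) * n.+2%:R^-1 <= p / r.
  have -> : p / r = expR ((a - 1) * (ln n.+2%:R - ln n.+1%:R)).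
    by rewrite /p /r /powR !gt_eqF// mulrBr expRB.
  apply: le_trans (expR_ge1Dx _); rewrite lerD2l ler_wpM2l ?(ltW s0)//.
  rewrite -ln_div ?posrE// -[X in X <= _]opprK lerNl -lnV ?posrE ?divr_gt0// invf_div.
  have -> : n.+1%:R / n.+2%:R = 1 + (- n.+2%:R^-1) :> R.
    by rewrite -[n.+1%:R](addrK 1) natr1 mulrBl divff ?gt_eqF// mul1r.
  apply: le_ln1Dx; rewrite ltrN2 invf_lt1// ltr1n//.
have -> : (a - 1) * (n.+2%:R^-1 * p^-1) = ((1 + (a - 1) * n.+2%:R^-1) - 1) / p.
  by rewrite addrAC subrr add0r mulrA.
have -> : r^-1 - p^-1 = (p / r - 1) / p by field; rewrite !gt_eqF.
by rewrite ler_wpM2r ?invr_ge0 ?(ltW p0)// lerD2r.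
Qed.

Lemma summable_powR (a : R) : 1 < a -> cvgn (series (fun n => (n.+1%:R `^ a)^-1 : R)).
Proof.
move=> a1; have s0 : 0 < a - 1 by rewrite subr_gt0.
apply: nondecreasing_is_cvgn.
  by apply/nondecreasing_seqP => n; rewrite -subr_ge0 seriesSB invr_ge0 powR_ge0.
have H n : series (fun n => (n.+1%:R `^ a)^-1 : R) n.+1 <=
    1 + (a - 1)^-1 * (1 - (n.+1%:R `^ (a - 1))^-1).
  elim: n => [|n IH].
    by rewrite /series/= big_nat1 !powR1 invr1 subrr mulr0 addr0.
  rewrite /series/= big_nat_recr//=; apply: le_trans (lerD IH (powR_telescope n a1)) _.
  by rewrite -addrA -mulrDr addrA subrK.
exists (1 + (a - 1)^-1) => _ [n _ <-].
apply: (@le_trans _ _ (series (fun n => (n.+1%:R `^ a)^-1 : R) n.+1)).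
  by rewrite -subr_ge0 seriesSB invr_ge0 powR_ge0.
by apply: (le_trans (H n)); rewrite lerD2l ler_piMr ?invr_ge0 ?(ltW s0)// gerBl invr_ge0 powR_ge0.
Qed.

Lemma summableZ (c : R) (u : R^nat) : cvgn (series u) -> cvgn (series (fun n => c * u n)).
Proof.
move=> cu; have -> : series (fun n => c * u n) = c *: series u.
  by apply/funext => n; rewrite /series/= -mulr_sumr.
exact: is_cvgZl_tmp.
Qed.

(** A positive integer part k satisfies x < k + 1 <= 2 k. *)
Lemma inv_le_floor (k : nat) (x : R) : (0 < k)%N -> k%:Z = Num.floor x -> x / 2 <= k%:R.
Proof.
move=> k0 kx; have : x < k%:R + 1.
  have := floorD1_gt x; rewrite -kx rmorphD /= => /lt_le_trans; apply.
  by rewrite -pmulrn.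
have : 1 <= k%:R :> R by rewrite ler1n.
lra.
Qed.

Lemma summable_block_sizes (c a : R) (tau : nat -> nat) : 0 < c -> 1 < a ->
  (forall n, (0 < n)%N -> (0 < tau n)%N) ->
  (forall n, (0 < n)%N -> (tau n)%:Z = Num.floor (c * n%:R `^ a)) ->
  cvgn (series (fun n => (tau n.+1)%:R^-1 : R)).
Proof.
move=> c0 a1 t0 tE.
apply: (@series_le_cvg _ _ (fun n => 2 / c * (n.+1%:R `^ a)^-1 : R)).
- by move=> n; rewrite invr_ge0.
- by move=> n; apply: mulr_ge0; [apply: divr_ge0 => //; exact: ltW|rewrite invr_ge0 powR_ge0].
- move=> n; have h := inv_le_floor (t0 n.+1 isT) (tE n.+1 isT).
  have p0 : 0 < n.+1%:R `^ a :> R by apply: powR_gt0; rewrite ltr0n.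
  have x0 : 0 < c * n.+1%:R `^ a / 2 by apply: divr_gt0 => //; exact: mulr_gt0.
  apply: le_trans (_ : (c * n.+1%:R `^ a / 2)^-1 <= _).
    by rewrite lef_pV2 ?posrE ?ltr0n ?t0.
  by rewrite invf_div invfM mulrA.
- by apply: summableZ; exact: summable_powR.
Qed.

(** The particle numbers are of order n^(a d'), and the lower bound on d' makes the exponent at
    least (a + 1) / 2, which exceeds 1 because a does. *)
Lemma summable_particle_numbers (c a c' d' : R) (tau N : nat -> nat) : 0 < c -> 1 < a -> 0 < c' ->
  (a + 1) / (2 * a) <= d' ->
  (forall n, (0 < n)%N -> (0 < tau n)%N) -> (forall n, (0 < n)%N -> (0 < N n)%N) ->
  (forall n, (0 < n)%N -> (tau n)%:Z = Num.floor (c * n%:R `^ a)) ->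
  (forall n, (0 < n)%N -> (N n)%:Z = Num.floor (c' * (tau n)%:R `^ d')) ->
  cvgn (series (fun n => (N n.+1)%:R^-1 : R)).
Proof.
move=> c0 a1 c'0 hd t0 N0 tE NE; have a0 : 0 < a by apply: lt_trans a1.
have d0 : 0 < d' by apply: lt_le_trans hd; rewrite divr_gt0// ?addr_gt0// mulr_gt0.
have ad : (a + 1) / 2 <= a * d'.
  by move: hd; rewrite ler_pdivrMr ?mulr_gt0//; lra.
have cd0 : 0 < (c / 2) `^ d' by apply: powR_gt0; rewrite divr_gt0.
pose K := c' * (c / 2) `^ d' / 2.
have K0 : 0 < K by apply: divr_gt0 => //; exact: mulr_gt0.
apply: (@series_le_cvg _ _ (fun n => K^-1 * (n.+1%:R `^ ((a + 1) / 2))^-1 : R)).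
- by move=> n; rewrite invr_ge0.
- by move=> n; apply: mulr_ge0; rewrite invr_ge0 ?powR_ge0// ltW.
- move=> n; have n0 : 0 <= n.+1%:R :> R by [].
  have p0 : 0 < n.+1%:R `^ ((a + 1) / 2) :> R by apply: powR_gt0; rewrite ltr0n.
  have h := inv_le_floor (t0 n.+1 isT) (tE n.+1 isT).
  have h' := inv_le_floor (N0 n.+1 isT) (NE n.+1 isT).
  rewrite -invfM lef_pV2 ?posrE ?mulr_gt0 ?ltr0n ?N0//.
  apply: le_trans h'; rewrite /K mulrAC ler_pM2r ?invr_gt0// -mulrA ler_pM2l//.
  apply: (@le_trans _ _ ((c / 2 * n.+1%:R `^ a) `^ d')).
    rewrite [leRHS]powRM ?powR_ge0 ?divr_ge0 ?(ltW c0)// ler_wpM2l ?powR_ge0//.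
    by rewrite -powRrM ler_powR// ler1n.
  apply: ge0_ler_powR; rewrite ?nnegrE ?(ltW d0)//.
    by rewrite mulr_ge0 ?powR_ge0// divr_ge0// ltW.
  by rewrite mulrAC.
- by apply: summableZ; apply: summable_powR; rewrite ltr_pdivlMr//; lra.
Qed.

End summable_powers.

(** * Hulls, clipping, and closeness under continuous maps *)

Lemma convex_hull_segment {R : realType} {d : nat} (A : set 'rV[R]_d) a b t :
  0 <= t <= 1 -> convex_hull A a -> convex_hull A b ->
  convex_hull A (t *: b + (1 - t) *: a).
Proof.
move=> /andP[t0 t1] Ca Cb V [cV AV].
pose l : {i01 R} := Itv01 t0 t1.
have := cV b a l; rewrite !inE => H.
exact: (H (Cb V (conj cV AV)) (Ca V (conj cV AV))).
Qed.

Lemma coord_le_enorm {R : realType} {d : nat} (u : 'rV[R]_d) k : `|u 0 k| <= enorm u.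
Proof.
rewrite /enorm -sqrtr_sqr ler_wsqrtr// dotpE (bigD1 k)//= -expr2 lerDl.
by apply: sumr_ge0 => i _; rewrite -expr2 sqr_ge0.
Qed.

Lemma measurable_clip {R : realType} {d} {Y : measurableType d} (G : set Y) (y0 : Y) :
  measurable G -> measurable_fun setT (fun y => if y \in G then y else y0).
Proof.
move=> mG _ A mA; rewrite setTI.
have [Ay|nAy] := pselect (A y0).
  have -> : (fun y => if y \in G then y else y0) @^-1` A = (G `&` A) `|` ~` G.
    apply/seteqP; split => y /=; case: ifPn => [/set_mem Gy|/negP nG].
    - by left.
    - by right => Gy; apply: nG; exact: mem_set.
    - by case=> [[]|].
    - by [].
  by apply: measurableU; [exact: measurableI|exact: measurableC].
have -> : (fun y => if y \in G then y else y0) @^-1` A = G `&` A.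
  apply/seteqP; split => y /=; case: ifPn => [/set_mem Gy|/negP nG].
  - by move=> Ay; split.
  - by [].
  - by case.
  - by move=> [Gy _]; case: nG; exact: mem_set.
exact: measurableI.
Qed.

Lemma exists_random_variable {R : realType} {d} {T : measurableType d} (P : probability T R)
    (f : T -> R) : measurable_fun setT f -> exists Z : {RV P >-> R}, forall w, Z w = f w.
Proof. by move=> mf; exists (mfun_Sub (mem_set mf)). Qed.

Lemma ae_forall_ord {R : realType} {d} {T : measurableType d} (mu : {measure set T -> \bar R})
    n (A : 'I_n -> T -> Prop) : (forall k, {ae mu, forall w, A k w}) ->
  {ae mu, forall w, forall k, A k w}.
Proof.
move=> h; have : {ae mu, forall w, forall l : nat, forall k : 'I_n, (k : nat) = l -> A k w}.
  apply/ae_foralln => l; have [ln|nl] := ltnP l n; last first.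
    by apply: filterE => w k kl; move: (ltn_ord k); rewrite kl ltnNge nl.
  have [D [mD D0 Ds]] := h (Ordinal ln); exists D; split=> // w nw; apply: Ds => hw; apply: nw.
  by move=> k kl; have -> : k = Ordinal ln by exact: val_inj.
move=> [D [mD D0 Ds]]; exists D; split=> // w nw; apply: Ds => hw; apply: nw => k.
exact: hw.
Qed.

(** The set D on which h is continuous may fail to be compact. Uniformity comes from the compact
    image of A under f, which the points s n approach. *)
Lemma continuous_on_close {R : realType} {V V' V'' : normedModType R}
    (A : set V) (D : set V') (f : V -> V') (h : V' -> V'') (x : nat -> V) (s : nat -> V') :
  compact A -> continuous_on A f -> (forall a, A a -> D (f a)) -> continuous_on D h ->
  (forall n, A (x n)) -> (forall n, D (s n)) ->
  (forall e : R, 0 < e -> exists N, forall n, (N <= n)%N -> `|s n - f (x n)| < e) ->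
  forall e : R, 0 < e -> exists N, forall n, (N <= n)%N -> `|h (s n) - h (f (x n))| < e.
Proof.
move=> cA cf fD ch Ax Ds sf e e0; apply: contrapT => nh.
pose Bad := [set n | e <= `|h (s n) - h (f (x n))|].
have inf N : exists2 n, (N <= n)%N & Bad n.
  apply: contrapT => hN; apply: nh; exists N => n Nn; rewrite ltNge.
  by apply/negP => Sn; apply: hN; exists n.
have [a Aa cl] := infinitely_often_cluster cA Ax inf.
have e2 : 0 < e / 2 by rewrite divr_gt0.
have [r r0 hr] := ch _ (fD a Aa) _ e2.
have r2 : 0 < r / 2 by rewrite divr_gt0.
have [r' r'0 hr'] := cf a Aa _ r2.
have [N hN] := sf _ r2.
have [n [Nn Bn axn]] := cl r' N r'0.
have h1 := hr' _ (Ax n) axn.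
have h1' : `|f a - f (x n)| < r by apply: lt_trans h1 _; rewrite gtr_pMr// invf_lt1// ltr1n.
have h2 : `|f a - s n| < r.
  rewrite (splitr r); apply: le_lt_trans (ler_distD (f (x n)) _ _) _.
  by apply: ltrD => //; rewrite distrC; exact: hN.
have := Bn; rewrite /Bad /= leNgt => /negP; apply.
rewrite (splitr e); apply: le_lt_trans (ler_distD (h (f a)) _ _) _.
apply: ltrD; first by rewrite distrC; apply: hr.
by apply: hr => //; exact: fD.
Qed.

(** * Convergence of the particle block EM sequence *)

Theorem theorem4p3 (R : realType) (dO dX dY : measure_display)
  (Omega : measurableType dO) (P : probability Omega R)
  (X : topMeasurableType dX) (Y : topMeasurableType dY) (dth d : nat)
  (* model *)
  (Theta : set 'rV[R]_dth)
  (lambda : {finite_measure set X -> \bar R}) (nu : {measure set Y -> \bar R})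
  (chi : probability X R)
  (m : 'rV[R]_dth -> X -> X -> R) (g : 'rV[R]_dth -> X -> Y -> R)
  (Yt : int -> Omega -> Y)
  (compact_Theta : compact Theta)
  (cgX : countably_generated X) (cgY : countably_generated Y)
  (m_density : forall th, Theta th -> markov_density lambda (m th))
  (g_density : forall th, Theta th -> markov_density nu (g th))
  (mY : forall t, measurable_fun setT (Yt t))
  (* algorithm *)
  (phi : 'rV[R]_dth -> R) (psi : 'rV[R]_dth -> 'rV[R]_d)
  (S : X -> X -> Y -> 'rV[R]_d)
  (Sset : set 'rV[R]_d) (thbar : 'rV[R]_d -> 'rV[R]_dth)
  (mS : forall k, measurable_fun setT
    (fun z : X * X * Y => S z.1.1 z.1.2 z.2 0 k))
  (tau N : nat -> nat)
  (tau_gt0 : forall n, (0 < n)%N -> (0 < tau n)%N)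
  (N_gt0 : forall n, (0 < n)%N -> (0 < N n)%N)
  (ups : nat -> nat -> X -> R) (q : nat -> nat -> X -> X -> R)
  (ups_gt0 : forall t n x, 0 < ups t n x)
  (m_ups : forall t n, measurable_fun setT (ups t n))
  (q_density : forall t n, markov_density lambda (q t n))
  (th0 : 'rV[R]_dth) (Theta_th0 : Theta th0)
  (xi : nat -> nat -> nat -> Omega -> X) (J : nat -> nat -> nat -> Omega -> nat)
  (theta : nat -> Omega -> 'rV[R]_dth)
  (run : pboem P lambda chi m g S thbar tau N ups q Yt th0 xi J theta)
  (* limiting EM map and contrast function *)
  (Sbar : 'rV[R]_dth -> 'rV[R]_d) (ell : 'rV[R]_dth -> R)
  (Sbar_lim : forall th T, Theta th -> (0 < T)%N ->
    {ae P, forall w,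
      block_stat lambda chi m g S th T k (fun i => Yt i w) @[k --> \oo]
        --> Sbar th})
  (ell_lim : forall th, Theta th ->
    {ae P, forall w,
      T%:R^-1 * ln (likelihood lambda chi m g th 0 T (fun i => Yt i w))
        @[T --> \oo] --> ell th})
  (pbar p : R) (pbar_gt2 : 2 < pbar) (p_range : 2 < p < pbar)
  (phi_cont : {within Theta, continuous phi})
  (psi_cont : {within Theta, continuous psi})
  (S_cont : continuous (fun z : X * X * Y => S z.1.1 z.1.2 z.2))
  (exp_family : forall th x x' y, Theta th ->
    [/\ 0 < m th x x', 0 < g th x' y
      & ln (m th x x') + ln (g th x' y) =
        phi th + dotp (S x x' y) (psi th)])
  (Sset_open : open Sset)
  (Sset_hull : convex_hull
    (range (fun z : X * X * Y => S z.1.1 z.1.2 z.2)) `<=` Sset)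
  (thbar_cont : {within Sset, continuous thbar})
  (thbar_argmax : forall s, Sset s ->
    argmax_on Theta (fun th => phi th + dotp s (psi th)) = [set thbar s])
  (m_bounded : exists sm sp : R, 0 < sm /\
    forall th x x', Theta th -> sm <= m th x x' <= sp)
  (S_Lp : finite_Lp_norm P pbar (sup_S S) (Yt 0))
  (Y_stationary : stationary P Yt)
  (Y_mixing : exists C0 b : R, [/\ 0 <= C0 < 1, 0 < b < 1
    & forall n, (mixing_coef P Yt n <= (C0 * b ^+ n)%:E)%E])
  (m_b_minus : measurable_fun setT (b_minus lambda g Theta))
  (m_b_plus : measurable_fun setT (b_plus lambda g Theta))
  (log_b_int : (\int[P]_w (`|lne (b_minus lambda g Theta (Yt 0%:Z w))|
                         + `|lne (b_plus lambda g Theta (Yt 0%:Z w))|) < +oo)%E)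
  (c a : R) (c_gt0 : 0 < c) (a_gt1 : 1 < a)
  (tauE : forall n, (0 < n)%N -> (tau n)%:Z = Num.floor (c * n%:R `^ a))
  (ups_bounded : exists M : R, forall t n x, `|ups t n x| <= M)
  (omega_Lp : finite_Lp_norm P (2 * pbar * p / (pbar - p))
    (fun y => omega_plus m g Theta ups q y / b_minus lambda g Theta y)%E
    (Yt 0))
  (c' d' : R) (c'_gt0 : 0 < c') (d'_ge : (a + 1) / (2 * a) <= d')
  (NE : forall n, (0 < n)%N -> (N n)%:Z = Num.floor (c' * (tau n)%:R `^ d')) :
  let Rmap := fun th => thbar (Sbar th) in
  let L := [set th | Theta th /\ Rmap th = th] in
  let W := fun th => expR (ell th) in
  (W @` L)° = set0 ->
  exists wstar : {RV P >-> R},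
    {ae P, forall w,
      W (theta n w) @[n --> \oo] --> wstar w /\
      edist_inf [set th | L th /\ W th = wstar w] (theta n w) @[n --> \oo]
        --> 0%E}.
Proof.
have thbar_co : continuous_on Sset thbar := within_continuous_on thbar_cont.
have phi_co := within_continuous_on (phi_cont : {within Theta, continuous (phi : 'rV[R]_dth -> R^o)}).
have psi_co := within_continuous_on psi_cont.
have [C0 [b [/andP[C00 C01] b01 mix]]] := Y_mixing.
have [sm [sp [sm0 mb]]] := m_bounded.
have [Um hUm] := ups_bounded.
have /andP[p2 ppbar] := p_range.
have m_gt0 th x z : Theta th -> 0 < m th x z.
  by move=> Tth; have [h _ _] := exp_family th x z point Tth.
have g_gt0 th z y : Theta th -> 0 < g th z y.
  by move=> Tth; have [_ h _] := exp_family th point z y Tth.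
have mgE th x z y : Theta th -> m th x z * g th z y = exp_kernel phi psi S th x z y.
  move=> Tth; have [m0 g0 h] := exp_family th x z y Tth.
  by rewrite /exp_kernel -h expRD !lnK ?posrE.
(* A transition density integrates to 1 and is at most sp, so [lambda] has positive mass. *)
have lambda_gt0 : 0 < fine (lambda setT).
  pose x0 : X := point; have [mm _ tot] := m_density _ Theta_th0.
  have bm : bounded_measurable (m th0 x0).
    apply: (@bmeas_between _ _ _ _ sm sp) => [|z]; last exact: mb.
    exact: (measurableT_comp mm (measurable_pair1 x0)).
  have one : \int[lambda]_z m th0 x0 z = 1 by rewrite /Rintegral tot.
  have le : 1 <= sp * fine (lambda setT).
    rewrite -one -bintegral_cst; apply: le_bintegral => // [|z]; first exact: bmeas_cst.
    by have /andP[] := mb th0 x0 z Theta_th0.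
  rewrite lt_neqAle fine_ge0// andbT; apply/negP => /eqP L0.
  by move: le; rewrite -L0 mulr0 ler10.
have [Cphi [Cphi0 hCphi]] := compact_image_bound compact_Theta phi_co.
have [Cpsi [Cpsi0 hCpsi]] := compact_image_bound compact_Theta psi_co.
pose kap (M : R) := Cphi + `|M| * (d%:R * Cpsi).
have kappa_bound th x z y M : Theta th -> enorm (S x z y) <= M ->
    expR (- kap M) <= m th x z * g th z y <= expR (kap M).
  move=> Tth hM; rewrite mgE// /exp_kernel !ler_expR -ler_norml.
  apply: (@exp_exponent_bound R dX dY dth d X Y phi psi (fun _ _ _ => S x z y) M
    (fun _ _ _ k => le_trans (coord_le_enorm _ k) hM) Cphi Cpsi th x z y).
    exact: hCphi.
  exact: hCpsi.
have mg th y : Theta th -> measurable_fun setT (fun x => g th x y).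
  move=> Tth; have [mgth _ _] := g_density _ Tth.
  exact: (measurableT_comp mgth (measurable_pair2 y)).
have q_ge0 t n x z : 0 <= q t n x z by have [_ h _] := q_density t n.
have mix0 : (mixing_coef P Yt 0 <= C0%:E)%E by have := mix 0%N; rewrite expr0 mulr1.
have dp0 : 0 < 2 * pbar * p / (pbar - p).
  by apply: divr_gt0; [apply: mulr_gt0; [apply: mulr_gt0|]; lra|lra].
have pb0 : 0 < pbar by lra.
have C0b : 0 <= C0 < 1 by rewrite C00.
have [G [M [B [mG aeG GS GB]]]] := good_observations (kappa := fun M => (expR (- kap M), expR (kap M)))
  mY Y_stationary C0b mix0 lambda_gt0 Theta_th0 ups_gt0 q_ge0 mg sm0 mb
  (fun M => expR_gt0 _) kappa_bound pb0 dp0 S_Lp omega_Lp.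
have [w0 Gw0] := ae_choose (aeG 0).
(* Observations outside G are replaced by a good one, so every clipped value satisfies the bounds
   that come with G. *)
pose y0 := Yt 0 w0; pose clip y := if y \in G then y else y0.
have clipG y : G (clip y) by rewrite /clip; case: ifPn => [/set_mem|].
have mclip : measurable_fun setT clip by exact: measurable_clip.
have clip1 (t : int) : {ae P, forall w, clip (Yt t w) = Yt t w}.
  have [D [mD D0 Ds]] := aeG t; exists D; split=> // w nw.
  by apply: Ds => h; apply: nw; rewrite /= /clip mem_set.
(* Integer times are split into two copies of the natural numbers, over which null sets can be
   collected. *)
have clipE : {ae P, forall w, forall t : int, clip (Yt t w) = Yt t w}.
  have ae1 : {ae P, forall w, forall t : nat, clip (Yt (Posz t) w) = Yt (Posz t) w}.
    by apply/ae_foralln => t; exact: clip1.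
  have ae2 : {ae P, forall w, forall t : nat, clip (Yt (Negz t) w) = Yt (Negz t) w}.
    by apply/ae_foralln => t; exact: clip1.
  have [D [mD D0 Ds]] := filterI ae1 ae2; exists D; split=> // w nw; apply: Ds => -[h1 h2].
  by apply: nw => -[t|t]; [exact: h1|exact: h2].
pose Sc x z y := S x z (clip y).
have Sc_bound x z y k : `|Sc x z y 0 k| <= M.
  by apply: le_trans (coord_le_enorm _ k) (GS _ _ _ (clipG y)).
have mSc k : measurable_fun setT (fun z : X * X * Y => Sc z.1.1 z.1.2 z.2 0 k).
  apply: (measurableT_comp (mS k) (g := fun z : X * X * Y => (z.1.1, z.1.2, clip z.2))).
  apply: measurable_fun_pair; last exact: (measurableT_comp mclip measurable_snd).
  apply: measurable_fun_pair; first exact: (measurableT_comp measurable_fst measurable_fst).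
  exact: (measurableT_comp measurable_snd measurable_fst).
have M0 : 0 <= M by apply: le_trans (sqrtr_ge0 _) (GS y0 point point Gw0).
have [k1 [k2 [k10 k12 kb]]] := exp_kernel_bound compact_Theta phi_co psi_co Sc_bound.
have q_gt0 t n x z : 0 < q t n x z by have [] := GB y0 th0 x z t n Gw0 Theta_th0.
have mgcE th x z y : Theta th -> m th x z * g th z (clip y) = exp_kernel phi psi Sc th x z y.
  by move=> Tth; rewrite mgE.
have weight_bound th x z y t n : Theta th ->
    exp_kernel phi psi Sc th x z y / (ups t n x * q t n x z) <= B.
  by move=> Tth; rewrite -mgcE//; have [] := GB (clip y) th x z t n (clipG y) Tth.
have ups_bound t n x : 0 < ups t n x <= Um.
  by rewrite ups_gt0 (le_trans (ler_norm _)).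
have mq t n : measurable_fun setT (fun z : X * X => q t n z.1 z.2) by have [] := q_density t n.
have q_total t n x : (\int[lambda]_z (q t n x z)%:E = 1)%E by have [_ _] := q_density t n.
pose C := convex_hull (range (fun z : X * X * Y => S z.1.1 z.1.2 z.2)).
have C_convex a' b' t : 0 <= t <= 1 -> C a' -> C b' -> C (t *: b' + (1 - t) *: a').
  exact: convex_hull_segment.
have C_S x z y : C (S x z y) by move=> V [_ AV]; apply: AV; exists (x, z, y).
have thbar_max s : Sset s -> argmax_on Theta (fun th => phi th + dotp s (psi th)) (thbar s).
  by move=> Ss; rewrite thbar_argmax.
have thbar_Theta s : Sset s -> Theta (thbar s) by move=> /thbar_max[].
(* The limit is given for T > 0. The case T = 1 is used, whose observations start at time 2, hence
   the start 2 in the block means. *)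
have good_lim th k : Theta th ->
    {ae P, forall w, block_mean Yt phi psi Sc lambda chi th k n 2 w @[n --> \oo] --> Sbar th 0 k}.
  move=> Tth; have [D [mD D0 Ds]] := filterI clipE (Sbar_lim th 1%N Tth isT).
  exists D; split=> // w nw; apply: Ds => -[h1 h2]; apply: nw => /=.
  have EK : (fun i x z => m th x z * g th z (Yt (1 + i.+1)%N w)) =
      along (exp_kernel phi psi Sc th) (observations Yt 2 w).
    apply/funext => i; apply/funext => x; apply/funext => z.
    rewrite /along -mgcE//; congr (_ * g _ _ _); rewrite -[LHS]h1 /observations; congr (clip (Yt _ _)).
    by rewrite add1n -addn2 PoszD.
  have ES l : (fun i x z => S x z (Yt (1 + i.+1)%N w) 0 l) =
      along (coord_cost Sc l) (observations Yt 2 w).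
    apply/funext => i; apply/funext => x; apply/funext => z.
    rewrite /along /coord_cost /Sc; congr (S _ _ _ _ _); rewrite -[LHS]h1 /observations.
    by congr (clip (Yt _ _)); rewrite add1n -addn2 PoszD.
  have hK : kernel_between k1 k2 (fun i x z => m th x z * g th z (Yt (1 + i.+1)%N w)).
    rewrite EK; apply: kernel_along => [|x z y]; first exact: measurable_exp_kernel.
    exact: kb.
  have hs l : cost_bounded M (fun i x z => S x z (Yt (1 + i.+1)%N w) 0 l).
    by rewrite ES; apply: cost_along; [exact: mSc|move=> x z y; exact: Sc_bound].
  have h3 := cvg_comp _ _ h2 (@coord_continuous R 1 d 0 k (Sbar th)).
  apply: cvg_trans h3; apply: near_eq_cvg; apply: filterE => n.
  rewrite /= (block_stat_fk chi lambda_gt0 k10 (y := fun i => Yt i w) (T := 1%N) hK hs) EK ES.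
  by [].
(* The likelihood has T = 0, so its observations start at time 1. *)
have good_ell th : Theta th -> {ae P, forall w,
  T%:R^-1 * ln (fk_total lambda chi T (along (exp_kernel phi psi Sc th) (observations Yt 1 w)))
    @[T --> \oo] --> ell th}.
  move=> Tth; have [D [mD D0 Ds]] := filterI clipE (ell_lim th Tth).
  exists D; split=> // w nw; apply: Ds => -[h1 h2]; apply: nw => /=.
  have EK : (fun i x z => m th x z * g th z (Yt (0 + i.+1)%N w)) =
      along (exp_kernel phi psi Sc th) (observations Yt 1 w).
    apply/funext => i; apply/funext => x; apply/funext => z.
    rewrite /along -mgcE//; congr (_ * g _ _ _); rewrite -[LHS]h1 /observations; congr (clip (Yt _ _)).
    by rewrite add0n -addn1 PoszD.
  have hK : kernel_between k1 k2 (fun i x z => m th x z * g th z (Yt (0 + i.+1)%N w)).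
    rewrite EK; apply: kernel_along => [|x z y]; first exact: measurable_exp_kernel.
    exact: kb.
  apply: cvg_trans h2; apply: near_eq_cvg; apply: filterE => n.
  by rewrite /= (likelihood_fk chi lambda_gt0 k10 (y := fun i => Yt i w) (T := 0%N) hK) EK.
have Sbar_co := Sbar_continuous phi_co psi_co M0 mSc Sc_bound lambda_gt0 k10 k12 kb good_lim.
have ell_co := ell_continuous phi_co psi_co mSc Sc_bound lambda_gt0 k10 kb good_ell.
have jensen := ell_jensen mY Y_stationary C00 C01 b01 mix M0 mSc Sc_bound lambda_gt0 k10 k12 kb
  good_lim good_ell.
(* Places the limit in the set where [thbar] is the maximizer and is continuous; monotonicity and
   continuity of the limiting map depend on it. *)
have Sbar_Sset th : Theta th -> Sset (Sbar th).
  move=> Tth; apply: Sset_hull.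
  apply: (limit_in_hull mY Y_stationary C00 C01 b01 mix mSc Sc_bound lambda_gt0 k10 k12 kb Tth
    _ C_convex) => [|x x' y]; last exact: C_S.
  by apply: ae_forall_ord => k; exact: good_lim.
move=> Rmap L W WL_interior.
(* [ell_jensen] between th and its image: the contrast gains at least as much as the objective that
   [thbar] maximizes. *)
have gain th : Theta th -> phi (Rmap th) + dotp (Sbar th) (psi (Rmap th)) -
    (phi th + dotp (Sbar th) (psi th)) <= ell (Rmap th) - ell th.
  move=> Tth; have TR : Theta (Rmap th) by apply: thbar_Theta; exact: Sbar_Sset.
  apply: le_trans (jensen _ _ Tth TR); rewrite le_eqVlt; apply/orP; left; apply/eqP.
  have -> : \sum_k (psi (Rmap th) - psi th) 0 k * Sbar th 0 k =
      dotp (Sbar th) (psi (Rmap th)) - dotp (Sbar th) (psi th).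
    by rewrite -dotpE dotpBl ![dotp (psi _) _]dotpC.
  by rewrite opprD addrACA.
have R_Theta th : Theta th -> Theta (Rmap th).
  by move=> Tth; apply: thbar_Theta; exact: Sbar_Sset.
have W_le th : Theta th -> W th <= W (Rmap th).
  move=> Tth; rewrite /W ler_expR -subr_ge0; apply: le_trans (gain th Tth) => /=.
  by rewrite subr_ge0; have [_ h] := thbar_max _ (Sbar_Sset _ Tth); exact: h.
(* Without a gain of contrast th already maximizes the objective, and uniqueness of the maximizer
   identifies it with its image. *)
have W_fix th : Theta th -> W (Rmap th) <= W th -> Rmap th = th.
  move=> Tth; rewrite /W ler_expR -subr_le0 => /(le_trans (gain th Tth)); rewrite subr_le0 => h.
  have : argmax_on Theta (fun u => phi u + dotp (Sbar th) (psi u)) th.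
    split=> // u Tu; apply: le_trans h.
    by have [_ h'] := thbar_max _ (Sbar_Sset _ Tth); exact: h'.
  by rewrite (thbar_argmax _ (Sbar_Sset _ Tth)) => /esym.
have W_co : continuous_on Theta (W : 'rV[R]_dth -> R^o).
  move=> th Tth e e0; have /cvgrPdist_lt /(_ e e0) := @continuous_expR R (ell th).
  move=> /nbhs_normP[r /= r0 hr]; have [r' r'0 hr'] := ell_co th Tth r r0.
  by exists r' => // th' Tth' dth'; apply: hr; exact: hr'.
have R_co : continuous_on Theta Rmap.
  move=> th Tth e e0; have [r r0 hr] := thbar_co _ (Sbar_Sset _ Tth) e e0.
  have [r' r'0 hr'] := Sbar_co th Tth r r0; exists r' => // th' Tth' dth'.
  by apply: hr; [exact: Sbar_Sset|exact: hr'].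
pose that := clip_theta m g S thbar tau N ups q Yt th0 xi J clip.
have t0 n : (0 < tau n.+1)%N by exact: tau_gt0.
have N0 n : (0 < N n.+1)%N by exact: N_gt0.
have that_Theta n w : Theta (that n w).
  exact: (clip_theta_Theta Yt xi J t0 N0 Theta_th0 m_gt0 g_gt0 clip ups_bound q_gt0 thbar_Theta
    C_convex C_S Sset_hull n w).
have that_stat_Sset n w : Sset (particle_stat m g S (N n.+1) (that n w) (fun s l => xi n s l w)
      (fun s l => clip_index N J n s l w) (fun t => clip (block_obs tau Yt n w t))
      (ups^~ n) (q^~ n) (tau n.+1)).
  apply: Sset_hull; apply: particle_stat_convex => //.
  - by move=> z z'; exact: m_gt0.
  - by move=> z y; exact: g_gt0.
have that_measurable n k : measurable_fun setT (fun w => that n w 0 k).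
  by apply: (measurable_clip_theta run mY t0 N0 phi_co psi_co Theta_th0 m_gt0 g_gt0 mgE mSc m_ups
    ups_bound mq q_gt0 thbar_co thbar_Theta C_convex C_S Sset_hull).
have ae_that := ae_clip_theta run N0 clipE.
have cN := summable_particle_numbers c_gt0 a_gt1 c'_gt0 d'_ge tau_gt0 N_gt0 tauE NE.
have ctau := summable_block_sizes c_gt0 a_gt1 tau_gt0 tauE.
have ae_particles : {ae P, forall w, forall k, particle_stat m g S (N n.+1) (that n w)
      (fun s l => xi n s l w) (fun s l => clip_index N J n s l w)
      (fun t => clip (block_obs tau Yt n w t)) (ups^~ n) (q^~ n) (tau n.+1) 0 k -
    block_mean Yt phi psi Sc lambda chi (that n w) k (tau n.+1) (block_end tau n).+1%:Z w
    @[n --> \oo] --> 0}.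
  apply: ae_forall_ord => k.
  by apply: (ae_block_error_cvg run mY t0 N0 phi_co psi_co Theta_th0 m_gt0 g_gt0 mgE clipE mSc Sc_bound
    lambda_gt0 k10 k12 kb m_ups ups_bound mq q_gt0 q_total weight_bound thbar_co thbar_Theta
    C_convex C_S Sset_hull).
have ae_lln := ae_uniform_block_mean mY Y_stationary C00 C01 b01 mix compact_Theta phi_co psi_co M0
  mSc Sc_bound lambda_gt0 k10 k12 kb good_lim (fun n => (block_end tau n).+1%:Z) t0 ctau.
have ae_cvg : {ae P, forall w, exists ws : R, W (that n w) @[n --> \oo] --> ws /\
    edist_inf [set th | L th /\ W th = ws] (that n w) @[n --> \oo] --> 0%E}.
  have [D [mD D0 Ds]] := filterI ae_particles ae_lln; exists D; split=> // w nw.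
  apply: Ds => -[h1 h2]; apply: nw.
  (* The updates are close to the limiting map as soon as the particle statistics are close to
     [Sbar] along the run. *)
  have H := continuous_on_close compact_Theta Sbar_co Sbar_Sset thbar_co
    (fun n => that_Theta n w) (fun n => that_stat_Sset n w).
  suff close : forall e : R, 0 < e -> exists N', forall n, (N' <= n)%N ->
      `|particle_stat m g S (N n.+1) (that n w)
      (fun s l => xi n s l w) (fun s l => clip_index N J n s l w)
      (fun t => clip (block_obs tau Yt n w t)) (ups^~ n) (q^~ n) (tau n.+1) - Sbar (that n w)| < e.
    exact: (perturbed_iteration_cvg compact_Theta W_co R_co R_Theta W_le W_fix
      (fun n => that_Theta n w) (H close) WL_interior).
  move=> e e0; have e2 : 0 < e / 2 by rewrite divr_gt0.
  have e4 : 0 < e / 4 by rewrite divr_gt0.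
  have : \forall n \near \oo, forall k : 'I_d, `|particle_stat m g S (N n.+1) (that n w)
      (fun s l => xi n s l w) (fun s l => clip_index N J n s l w)
      (fun t => clip (block_obs tau Yt n w t)) (ups^~ n) (q^~ n) (tau n.+1) 0 k -
      Sbar (that n w) 0 k| <= e / 4 + e / 4.
    apply: filter_forall => k; have /cvgrPdist_le /(_ _ e4) := h1 k.
    move=> f1; have f2 := h2 k _ e4.
    have f1' : \forall n \near \oo, `|particle_stat m g S (N n.+1) (that n w)
      (fun s l => xi n s l w) (fun s l => clip_index N J n s l w)
      (fun t => clip (block_obs tau Yt n w t)) (ups^~ n) (q^~ n) (tau n.+1) 0 k -
      block_mean Yt phi psi Sc lambda chi (that n w) k (tau n.+1) (block_end tau n).+1%:Z w| <= e / 4.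
      by apply: filterS f1 => n; rewrite sub0r normrN.
    near=> n.
    apply: le_trans (ler_distD (block_mean Yt phi psi Sc lambda chi (that n w) k (tau n.+1)
      (block_end tau n).+1%:Z w) _ _) _; apply: lerD.
      by near: n.
    have f3 : forall th, Theta th -> `|block_mean Yt phi psi Sc lambda chi th k (tau n.+1)
      (block_end tau n).+1%:Z w - Sbar th 0 k| <= e / 4 by near: n.
    exact: f3.
  move=> [N1 _ hN1]; exists N1 => n Nn; apply: norm_lt_coord => // k.
  apply: le_lt_trans (hN1 n Nn k) _.
  have -> : e / 4 + e / 4 = e / 2 by field.
  by rewrite gtr_pMr// invf_lt1// ltr1n.
have Wbound : exists K : R, forall n w, `|W (that n w)| <= K.
  have [K [_ hK]] := compact_image_bound compact_Theta W_co.
  by exists K => n w; exact: hK.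
have [K hK] := Wbound.
(* The limit is only known to exist off a null set. The upper limit is measurable on the whole
   space, by the uniform bound K, and equals the limit where it exists. *)
have mWs : measurable_fun setT (fun w => limn_sup (fun n => W (that n w))).
  apply: (@measurable_fun_limn_sup _ _ _ _ (fun n w => W (that n w))) => [w _|w _|n].
  - by exists K => _ [n _ <-]; exact: le_trans (ler_norm _) (hK n w).
  - by exists (- K) => _ [n _ <-]; have := hK n w; rewrite ler_norml => /andP[].
  - exact: (@measurable_continuous_on R _ Omega dth Theta W (that n) W_co (that_Theta n)
      (that_measurable n)).
have [wstar wstarE] := exists_random_variable P mWs; exists wstar.
have [D [mD D0 Ds]] := filterI ae_cvg ae_that; exists D; split=> // w nw.
apply: Ds => -[[ws [h1 h2]] h3]; apply: nw => /=.
have -> : wstar w = ws by rewrite wstarE; exact: (cvg_limn_inf_sup h1).2.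
have -> : (fun n => W (theta n w)) = (fun n => W (that n w)).
  by apply/funext => n; rewrite h3.
have -> : (fun n => edist_inf [set th | L th /\ W th = ws] (theta n w)) =
    (fun n => edist_inf [set th | L th /\ W th = ws] (that n w)).
  by apply/funext => n; rewrite h3.
by [].
Unshelve. all: by end_near. Qed.
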